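(* Let $f,g$ be piecewise Möbius interval maps on $\mathbb I_f,\mathbb I_g$, with associated two-dimensional maps $\mathcal F,\mathcal G$ and planar domains of bijectivity $\Omega_f,\Omega_g$, such that $\Omega_g$ can be (countably) quilted from $\Omega_f$, and assume $\mu(\Omega_f)<\infty$. Then: (a) if $\mathcal F:\Omega_f\to\Omega_f$ is ergodic with respect to $\mu$, then $\mathcal G:\Omega_g\to\Omega_g$ is ergodic with respect to $\mu$; (b) if the system of $\mathcal F$ on $\Omega_f$ is the natural extension of the system of $f$, then the system of $\mathcal G$ on $\Omega_g$ is the natural extension of the system of $g$; (c) if the system of $\mathcal F$ on $\Omega_f$ is the natural extension of the system of $f$, then the entropy of $g$ is given explicitly in terms of that of $f$ by $$h(g)=\Big(1+\sum_{i}(a_i-d_i)\,\nu(\Delta_i)\Big)^{-1}h(f),$$ where $\mathcal C_i,a_i,d_i$ are the quilting data, $\mathcal C_i$ projects to $\Delta_i\subset\mathbb I_f$ (that is, $\mathcal C_i$ is the part of $\Omega_f$ lying above $\Delta_i$), and $\nu$ is the marginal probability measure on $\mathbb I_f$ induced from the normalization of $\mu$ on $\Omega_f$.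
   Context: Matrices $M=\begin{pmatrix}a&b\\c&d\end{pmatrix}$ with $\det M=\pm1$, taken up to sign, act by $M\cdot x=\frac{ax+b}{cx+d}$. A piecewise Möbius interval map $T:\mathbb I\to\mathbb I$ is given on the intervals $K_\beta$ of a partition of $\mathbb I$ (each as large as possible; the cylinders) by $T(x)=M_\beta\cdot x$. With $R=\begin{pmatrix}0&-1\\1&0\end{pmatrix}$, put $\mathcal T_M(x,y)=(M\cdot x,RMR^{-1}\cdot y)$ and $\mathcal T(x,y)=\mathcal T_{M_\beta}(x,y)$ for $x\in K_\beta$. The measure $\mu$ on $\mathbb R^2$, $d\mu=\frac{dx\,dy}{(1+xy)^2}$, is locally $\mathcal T_M$-invariant. A planar domain of bijectivity for $T$ is a set $\Omega\subset\mathbb R^2$ projecting onto $\mathbb I$ on which $\mathcal T$ is bijective up to $\mu$-measure zero. The system of $\mathcal T$ uses (normalized) $\mu$ on $\Omega$, and the system of $T$ uses the marginal measure $\nu(E)=\mu(\Omega\cap(E\times\mathbb R))/\mu(\Omega)$. Entropy $h$ is Kolmogorov–Sinai entropy with respect to these probability measures. The natural extension of a system is its minimal invertible extension, up to isomorphism. Setting for quilting: $f,g$ are piecewise Möbius interval maps on $\mathbb I_f,\mathbb I_g$, each with at most countably many cylinders and with planar domains of bijectivity $\Omega_f,\Omega_g$ of finite nonzero $\mu$-measure for the corresponding two-dimensional maps $\mathcal F,\mathcal G$. For $x\in\mathbb I_f$ let $b_f(x)$ be the $f$-digit of $x$, i.e. the Möbius transformation applied by $f$ at $x$; similarly $b_g(x)$.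 Let $\Delta=\{x\in\mathbb I_f\cap\mathbb I_g\mid b_f(x)\ne b_g(x)\}$ and $\mathcal C=\{(x,y)\in\Omega_f\mid x\in\Delta\}$. Extend $\mathcal G$ to $\mathbb I_g\times\mathbb R$ by $\mathcal G(x,y)=\mathcal T_M(x,y)$ where $g(x)=M\cdot x$. $\Omega_g$ can be (countably) quilted from $\Omega_f$ if $\mathcal C$ has positive measure and: (i) there is an at most countable partition of $\mathcal C$ by sets $\mathcal C_i$ and integers $d_i,a_i$ with $\mathcal F^{1+d_i}|_{\mathcal C_i}=\mathcal G^{1+a_i}|_{\mathcal C_i}$; (ii) the sets $\mathcal F^j(\mathcal C_i)$, over all $i$ and $1\le j\le d_i$, are pairwise disjoint with union of strictly less than full measure in $\Omega_f$, and similarly the sets $\mathcal G^j(\mathcal C_i)$ ($1\le j\le a_i$) are pairwise disjoint with union of finite measure; (iii) $\Omega_g=\big(\Omega_f\setminus\coprod_i\coprod_{j=1}^{d_i}\mathcal F^j(\mathcal C_i)\big)\amalg\coprod_i\coprod_{j=1}^{a_i}\mathcal G^j(\mathcal C_i)$. Disjointness, equality and bijectivity are up to measure zero.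
   Formalization: ''Projecting onto I'' is also required in the sense of measure: no subset of I of positive length has a μ-null part of Ω above it; otherwise a null set added to Ω_g could make it project onto I_g and the entropy formula (c) would fail. *)

(* Defs.v *)
From HB Require Import structures.
From mathcomp Require Import all_boot all_order all_algebra.
From mathcomp Require Import all_classical all_reals all_analysis.
From mathcomp Require Import measurable_realfun.

Set Implicit Arguments.
Unset Strict Implicit.
Unset Printing Implicit Defensive.

Import Order.TTheory GRing.Theory Num.Theory.
Import numFieldNormedType.Exports.

Local Open Scope classical_set_scope.
Local Open Scope ring_scope.

Section Mod0.
Context d (T : measurableType d) (R : realType) (m : set T -> \bar R).

Definition eq_mod0 (A B : set T) := m.-negligible (A `+` B).

Definition disjoint_mod0 (A B : set T) := m.-negligible (A `&` B).

Definition trivIset_mod0 (I : Type) (D : set I) (A : I -> set T) :=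
  forall i j, D i -> D j -> i <> j -> disjoint_mod0 (A i) (A j).

Definition bijective_mod0 (S : T -> T) (Om : set T) :=
  exists A B : set T,
    [/\ A `<=` Om, B `<=` Om, m.-negligible (Om `\` A),
        m.-negligible (Om `\` B) & set_bij A B S].

End Mod0.

Section Systems.
Context (R : realType).

Section OneSystem.
Context d (X : measurableType d) (P : probability X R) (T : X -> X).

Definition measure_preserving :=
  measurable_fun [set: X] T /\
  forall A, measurable A -> P (T @^-1` A) = P A.

Definition ergodic :=
  measure_preserving /\
  forall A, measurable A -> eq_mod0 P (T @^-1` A) A -> P A = 0%E \/ P A = 1%E.

Definition negxlnx (t : R) : R := - (t * ln t).

(* A finite measurable partition is given by its labelling [xi : X -> 'I_k].
   The atoms of its join with its first [n - 1] preimages under [T] are indexed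
   by the words of length [n]. *)
Definition join_entropy k (xi : X -> 'I_k) (n : nat) : R :=
  \sum_(w : {ffun 'I_n -> 'I_k})
    negxlnx (fine (P [set x | forall j : 'I_n, xi (iter j T x) = w j])).

Definition partition_entropy k (xi : X -> 'I_k) : R :=
  limn (fun n => join_entropy xi n / n%:R).

Definition ks_entropy : \bar R :=
  ereal_sup [set e | exists k (xi : X -> 'I_k),
    (forall i, measurable (xi @^-1` [set i])) /\ e = (partition_entropy xi)%:E].

End OneSystem.

(* [phi] exhibits the system (Y, Q, S) as a factor of (X, P, T), that is
   (X, P, T) as an extension of (Y, Q, S). *)
Definition factor_map
    d (X : measurableType d) (P : probability X R) (T : X -> X)
    d' (Y : measurableType d') (Q : probability Y R) (S : Y -> Y)
    (phi : X -> Y) :=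
  [/\ measurable_fun [set: X] phi,
      forall B, measurable B -> P (phi @^-1` B) = Q B
    & {ae P, forall x, phi (T x) = S (phi x)}].

(* Isomorphism mod 0: a factor map inducing an isomorphism of measure algebras.
   On standard Borel spaces this is the same as having a measurable a.e.
   inverse; on arbitrary spaces only the measure algebra is meaningful. *)
Definition system_iso
    d (X : measurableType d) (P : probability X R) (T : X -> X)
    d' (Y : measurableType d') (Q : probability Y R) (S : Y -> Y)
    (phi : X -> Y) :=
  factor_map P T Q S phi /\
  forall A, measurable A ->
    exists2 B, measurable B & eq_mod0 P (phi @^-1` B) A.

Definition invertible_system
    d (X : measurableType d) (P : probability X R) (T : X -> X) :=
  measure_preserving P T /\ system_iso P T P T T.

(* (X, P, T) is, through [phi], the minimal invertible extension of (Y, Q, S):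
   any invertible system through which [phi] factors is isomorphic to
   (X, P, T). *)
Definition natural_extension
    d (X : measurableType d) (P : probability X R) (T : X -> X)
    d' (Y : measurableType d') (Q : probability Y R) (S : Y -> Y)
    (phi : X -> Y) :=
  [/\ measure_preserving Q S,
      invertible_system P T,
      factor_map P T Q S phi
    & forall d0 (Z : measurableType d0) (P0 : probability Z R) (T0 : Z -> Z)
        (al : X -> Z) (be : Z -> Y),
        invertible_system P0 T0 ->
        factor_map P T P0 T0 al ->
        factor_map P0 T0 Q S be ->
        {ae P, forall x, be (al x) = phi x} ->
        system_iso P T P0 T0 al].

End Systems.

Section Mobius.
Context (R : realType).

Definition mobius_den (M : 'M[R]_2) (x : R) : R := M 1 0 * x + M 1 1.

(* x / 0 = 0: the value is a convention where [mobius_den M x = 0]. *)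
Definition mobius (M : 'M[R]_2) (x : R) : R :=
  (M 0 0 * x + M 0 1) / mobius_den M x.

(* equality of the Möbius transformations of matrices of determinant +-1 *)
Definition eq_mobius (M N : 'M[R]_2) := M = N \/ M = - N.

(* the matrix [0, -1; 1, 0] *)
Definition rotmx : 'M[R]_2 :=
  \matrix_(i < 2, j < 2)
    (((i == 1) && (j == 0))%:R - ((i == 0) && (j == 1))%:R).

Definition planar_mobius (M : 'M[R]_2) (z : R * R) : R * R :=
  (mobius M z.1, mobius (rotmx *m M *m invmx rotmx) z.2).

(* The density takes the value 0 on the hyperbola 1 + xy = 0, which is null. *)
Definition mu_density (z : R * R) : R := (1 + z.1 * z.2) ^- 2.

Definition mu (A : set (R * R)) : \bar R :=
  (\int[lebesgue_measure \x lebesgue_measure]_(z in A) (mu_density z)%:E)%E.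

Lemma mu_density_ge0 z : 0 <= mu_density z.
Proof. by rewrite /mu_density invr_ge0 sqr_ge0. Qed.

Lemma measurable_mu_density : measurable_fun [set: R * R] mu_density.
Proof.
have mV : measurable_fun [set: R] (fun t : R => t^-1).
  have -> : [set: R] = [set 0] `|` ~` [set 0] by rewrite setUv.
  apply/measurable_funU => //; first exact: measurableC.
  split; first exact: measurable_fun_set1.
  apply: open_continuous_measurable_fun.
    by rewrite openC; exact: closed_eq.
  move=> x /set_mem x0.
  by apply: inv_continuous; apply/eqP.
apply: (measurableT_comp mV); apply: measurable_funX.
by apply: measurable_funD => //; exact: measurable_funM.
Qed.

Let mu0 : mu set0 = 0%E.
Proof. by rewrite /mu integral_set0. Qed.

Let mu_ge0 A : (0 <= mu A)%E.
Proof. by apply: integral_ge0 => z _; rewrite lee_fin mu_density_ge0. Qed.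

Let mu_sigma_additive : semi_sigma_additive mu.
Proof.
apply: (@semi_sigma_additive_nng_induced _ _ R
  (lebesgue_measure \x lebesgue_measure)%E (EFin \o mu_density)) => [|z].
  by apply/measurable_EFinP; exact: measurable_mu_density.
by rewrite /= lee_fin mu_density_ge0.
Qed.

HB.instance Definition _ :=
  isMeasure.Build _ _ _ mu mu0 mu_ge0 mu_sigma_additive.

End Mobius.

(* The cylinders are indexed by [nat]; some may be empty, so that there are at
   most countably many nonempty ones. *)
Record pwMobius (R : realType) := PwMobius {
  pw_dom : set R;
  pw_cyl : nat -> set R;
  pw_mat : nat -> 'M[R]_2;
  pw_dom_itv : is_interval pw_dom;
  pw_cyl_itv : forall n, is_interval (pw_cyl n);
  pw_cyl_triv : trivIset [set: nat] pw_cyl;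
  pw_cyl_cover : \bigcup_n pw_cyl n = pw_dom;
  pw_det : forall n, \det (pw_mat n) = 1 \/ \det (pw_mat n) = -1;
  pw_den : forall n x, pw_cyl n x -> mobius_den (pw_mat n) x != 0;
  pw_stable : forall n x, pw_cyl n x -> pw_dom (mobius (pw_mat n) x);
  (* each cylinder is as large as possible *)
  pw_max : forall n (J : set R), is_interval J ->
    pw_cyl n !=set0 -> pw_cyl n `<=` J -> J `<=` pw_dom ->
    (forall m x, J x -> pw_cyl m x -> eq_mobius (pw_mat m) (pw_mat n)) ->
    J = pw_cyl n
}.

Section PiecewiseMobius.
Context (R : realType).
Implicit Types (T f g : pwMobius R) (Om : set (R * R)).

(* Meaningful on [pw_dom T] only; [pw_dom T] is stable under [pw_map T] and
   [pw_dom T `*` setT] under [pw_planar T]. *)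
Definition pw_digit T (x : R) : 'M[R]_2 :=
  pw_mat T (xget 0%N [set n | pw_cyl T n x]).

Definition pw_map T (x : R) : R := mobius (pw_digit T x) x.

Definition pw_planar T (z : R * R) : R * R := planar_mobius (pw_digit T z.1) z.

(* [Om] matters up to null sets only, and so does its projection: besides
   having image [I], it must be onto [I] in the sense of measure, i.e. no
   non-null set of points of [I] may have a null part of [Om] above it. *)
Definition projects_onto Om (I : set R) :=
  fst @` Om = I /\
  forall E : set R, measurable E -> E `<=` I ->
    mu (Om `&` (E `*` setT)) = 0%E -> lebesgue_measure E = 0%E.

Definition bijectivity_domain T Om :=
  projects_onto Om (pw_dom T) /\ bijective_mod0 (@mu R) (pw_planar T) Om.

(* [mu] restricted to [Om] and normalized. The second argument of [mnormalize]
   is its value when the measure of [Om] is zero or infinite. *)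
Definition planar_prob Om (mOm : measurable Om) : probability (R * R)%type R :=
  mnormalize (mrestr (@mu R) mOm) (dirac ((0, 0) : R * R)).

Definition proj_x (z : R * R) : R := z.1.

HB.instance Definition _ :=
  isMeasurableFun.Build _ _ _ _ proj_x measurable_fst.

Definition marginal_prob Om (mOm : measurable Om) : probability R R :=
  distribution (planar_prob mOm) proj_x.

End PiecewiseMobius.

Section Quilting.
Context (R : realType).
Implicit Types (f g : pwMobius R) (Omf Omg : set (R * R)).

Definition altered_base f g : set R :=
  [set x | [/\ pw_dom f x, pw_dom g x
             & ~ eq_mobius (pw_digit f x) (pw_digit g x)]].

Definition altered f g Omf : set (R * R) :=
  [set z | Omf z /\ altered_base f g z.1].

(* the levels of the towers over the [C i]: indices (i, j), 1 <= j <= h i *)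
Definition levels (h : nat -> nat) : set (nat * nat) :=
  [set p | (0 < p.2 <= h p.1)%N].

Definition level (S : R * R -> R * R) (C : nat -> set (R * R)) (p : nat * nat) :=
  iter p.2 S @` C p.1.

Definition tower S C h : set (R * R) := \bigcup_(p in levels h) level S C p.

(* The pieces are indexed by [nat]; some may be empty or null, so that the
   partition is at most countable. *)
Record quilting f g Omf Omg (C : nat -> set (R * R)) (d a : nat -> nat) : Prop :=
  Quilting {
  quilt_pos : (0 < mu (altered f g Omf))%E;
  quilt_measurable : forall i, measurable (C i);
  quilt_triv : trivIset_mod0 (@mu R) [set: nat] C;
  quilt_cover : eq_mod0 (@mu R) (\bigcup_i C i) (altered f g Omf);
  quilt_orbit : forall i,
    (@mu R).-negligible
      (C i `&` [set z | iter (d i).+1 (pw_planar f) z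
                        <> iter (a i).+1 (pw_planar g) z]);
  quilt_removed_triv :
    trivIset_mod0 (@mu R) (levels d) (level (pw_planar f) C);
  quilt_removed_lt : (mu (tower (pw_planar f) C d) < mu Omf)%E;
  quilt_added_triv :
    trivIset_mod0 (@mu R) (levels a) (level (pw_planar g) C);
  quilt_added_fin : (mu (tower (pw_planar g) C a) < +oo)%E;
  quilt_disj : disjoint_mod0 (@mu R) (Omf `\` tower (pw_planar f) C d)
                                     (tower (pw_planar g) C a);
  quilt_eq : eq_mod0 (@mu R) Omg
    ((Omf `\` tower (pw_planar f) C d) `|` tower (pw_planar g) C a)
}.

End Quilting.

(* Main.v *)
(* Write U and V for the removed and the added towers, so that
   Om_g = (Om_f \ U) + V. For z in Om_f, let s z be F z off the C_i and
   F^(1+d_i) z = G^(1+a_i) z on C_i: the orbit of z under s is contained both in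
   its F-orbit and in its G-orbit, and it skips only points of U, respectively
   of V. Hence the first return maps of F and of G to Om_f \ U agree.

   (a) An invariant set of G, restricted to Om_f \ U, meets almost all or almost
   no orbits of F; as every orbit of G enters Om_f, almost all of Om_g follows.

   (b) The system of F is the natural extension of that of f if and only if
   every measurable set has preimages F^-n(A) arbitrarily close to sets which
   are unions of vertical fibres. In the coordinate zeta = y / (1 + x y) the
   measure mu is the Lebesgue measure, F is affine on fibres with slope
   1 / |f'|, and it maps fibres into fibres. The criterion fails when the
   fibres are mapped onto fibres along a non-null set of orbits, since then the
   preimages of the lower half-fibres keep halving the fibres. Otherwise, by
   recurrence, the images of a fibre occupy smaller and smaller proportions of
   the fibres of Om, and the criterion holds for the sets {q < zeta}. Which of
   the two cases occurs can be read off the orbits of s, hence is the same for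
   F and G.

   (c) For a natural extension, the entropies of the planar map and of the
   interval map agree, by the criterion in (b) and Fano's inequality. The
   unnormalised entropy is invariant under inducing (Abramov), and F and G induce
   the same map on Om_f \ U; the points of Om_f whose orbits never leave U are
   treated by inducing s, once it is known that they belong to Om_g. This
   holds because they form a union of fibres and C_i is the part of Om_f
   above Delta_i. So the entropies are in the inverse ratio of the measures of
   Om_f and Om_g, which is computed from the sizes of the towers. *)

From HB Require Import structures.
Require Import Defs.
From mathcomp Require Import all_boot all_order all_algebra.
From mathcomp Require Import all_classical all_reals all_analysis.
From mathcomp Require Import measurable_realfun lra ring zify.

Set Implicit Arguments.
Unset Strict Implicit.
Unset Printing Implicit Defensive.

Import Order.TTheory GRing.Theory Num.Theory.
Import numFieldNormedType.Exports.

Local Open Scope classical_set_scope.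
Local Open Scope ring_scope.

(** * Entropy of finite partitions *)

Section Klog.
Context (R : realType).
Implicit Types p q : R.

(** The relations of a quilting hold up to null sets only. A null set invariant under images and
    preimages of both planar maps is discarded, after which orbits, towers and injectivity are
    exact. The real obstacle is in the entropy formula: points whose orbit never leaves the removed
    towers have no return to the common part through which [F] and [G] could be compared. For them
    the towers are forced into chains, the top of each one being a base point of the next, so that
    the strand climbs one tower and jumps over the following one. Its return map to the first levels
    is therefore the square of the return map of [F], and by the same argument the square of that of
    [G]. This is why the entropies are compared through their doubles, both being the entropy of the
    single map [two_step]. That these points lie in [Omg] rests on the measure part of
    [projects_onto]: when a fibre of them is missing, almost nothing of [Omg] lies above the same
    base point, so the missing fibres have a null base in [pw_dom g]. *)

Definition klog p q := p * (ln q - ln p).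

Lemma klog0 q : klog 0 q = 0. Proof. by rewrite /klog mul0r. Qed.

Lemma klogxx p : klog p p = 0. Proof. by rewrite /klog subrr mulr0. Qed.

Lemma klog_ge0 p q : 0 <= p -> p <= q -> 0 <= klog p q.
Proof.
rewrite le_eqVlt => /predU1P[<- _|p0 pq]; first by rewrite klog0.
by rewrite mulr_ge0 ?(ltW p0)// subr_ge0 ler_ln ?posrE ?(lt_le_trans p0 pq).
Qed.

(* The log-sum inequality, term by term: a consequence of [ln x <= x - 1]. *)
Lemma klog_tangent p q P Q : 0 <= p -> p <= q -> 0 < P -> 0 < Q ->
  klog p q <= p * (ln Q - ln P) + (q * P / Q - p).
Proof.
move=> p0 pq P0 Q0.
move: p0; rewrite le_eqVlt => /predU1P[p0|p0].
  by rewrite -p0 klog0 mul0r add0r subr0 divr_ge0 ?mulr_ge0 ?(ltW P0) ?(ltW Q0) // p0.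
have q0 : 0 < q by exact: lt_le_trans pq.
have x0 : 0 < (q * P) / (p * Q) by rewrite divr_gt0 ?mulr_gt0.
have : ln (q * P / (p * Q)) <= q * P / (p * Q) - 1.
  have := @le_ln1Dx R (q * P / (p * Q) - 1); rewrite [1 + _]addrC subrK; apply.
  by rewrite ltrBrDr addNr.
rewrite ln_div ?posrE ?mulr_gt0 // !lnM ?posrE // => /(ler_wpM2l (ltW p0)) H.
have E : p * (q * P / (p * Q) - 1) = q * P / Q - p.
  by field; rewrite ?gt_eqF.
rewrite /klog -E; rewrite -lerBlDl -mulrBr; apply: le_trans H.
by apply: ler_wpM2l; [exact: ltW | lra].
Qed.

(** Sum the tangent bounds at the totals [P] and [Q]: the corrections [q i * P / Q - p i] add up to
    zero. *)
Lemma klog_sum (I : finType) (D : pred I) (p q : I -> R) :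
  (forall i, D i -> 0 <= p i <= q i) ->
  \sum_(i | D i) klog (p i) (q i) <= klog (\sum_(i | D i) p i) (\sum_(i | D i) q i).
Proof.
move=> pq.
set P := \sum_(i | D i) p i; set Q := \sum_(i | D i) q i.
have P0 : 0 <= P by apply: sumr_ge0 => i /pq /andP[].
move: P0; rewrite le_eqVlt => /predU1P[P0|P0].
  have p0 i : D i -> p i = 0.
    move=> Di; apply/eqP; have /eqP := esym P0.
    rewrite psumr_eq0; last by move=> j /pq /andP[].
    by move=> /allP /(_ i); rewrite mem_index_enum Di; exact.
  by rewrite -P0 klog0 big1 // => i Di; rewrite p0 // klog0.
have Q0 : 0 < Q.
  by apply: lt_le_trans P0 _; apply: ler_sum => i /pq /andP[].
apply: le_trans (_ : \sum_(i | D i) (p i * (ln Q - ln P) + (q i * P / Q - p i)) <= _).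
  by apply: ler_sum => i Di; have /andP[? ?] := pq _ Di; exact: klog_tangent.
rewrite big_split /= -mulr_suml sumrB -/P.
under eq_bigr do rewrite -mulrA.
rewrite -mulr_suml -/Q /klog.
by rewrite mulrCA divff ?gt_eqF // mulr1 subrr addr0.
Qed.

End Klog.

Lemma sum_pair (V : nmodType) (A B : finType) (P : pred A) (Q : pred B) (F : A * B -> V) :
  \sum_(k | P k.1 && Q k.2) F k = \sum_(i | P i) \sum_(j | Q j) F (i, j).
Proof. by rewrite pair_big; apply: eq_bigr => -[]. Qed.

Section Entropy.
Context d (X : measurableType d) (R : realType).
Context (m : {measure set X -> \bar R}).
Local Notation w D := (fine (m D)).

Lemma fine_measureU D1 D2 : measurable D1 -> measurable D2 -> D1 `&` D2 = set0 ->
  (m (D1 `|` D2) < +oo)%E -> w (D1 `|` D2) = w D1 + w D2.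
Proof.
move=> m1 m2 D0 fin; rewrite measureU // fineD // ge0_fin_numE //.
all: apply: le_lt_trans fin; apply: le_measure; rewrite ?inE //.
- exact: measurableU.
- exact: measurableU.
Qed.

Lemma fine_measure_le D1 D2 : measurable D1 -> measurable D2 -> D1 `<=` D2 ->
  (m D2 < +oo)%E -> w D1 <= w D2.
Proof.
move=> m1 m2 D12 fin; apply: fine_le; rewrite ?ge0_fin_numE //.
  by apply: le_lt_trans fin; apply: le_measure; rewrite ?inE.
by apply: le_measure; rewrite ?inE.
Qed.

Definition labelling (A : finType) (a : X -> A) := forall i, measurable (a @^-1` [set i]).

Lemma labelling_preimage (A : finType) (a : X -> A) (P : set A) :
  labelling a -> measurable (a @^-1` P).
Proof.
move=> ma; rewrite -[P]image_id -bigcup_imset1 preimage_bigcup.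
by apply: fin_bigcup_measurable => //; exact: finite_finset.
Qed.

Lemma labelling_comp (A B : finType) (a : X -> A) (f : A -> B) :
  labelling a -> labelling (f \o a).
Proof. by move=> ma i; rewrite comp_preimage; exact: labelling_preimage. Qed.

Definition pair_label (A B : Type) (a : X -> A) (b : X -> B) z := (a z, b z).

Lemma preimage_pair_label (A B : eqType) (a : X -> A) (b : X -> B) i j :
  pair_label a b @^-1` [set (i, j)] = a @^-1` [set i] `&` b @^-1` [set j].
Proof.
by apply/seteqP; split=> z; rewrite /pair_label /= => -[<- <-].
Qed.

Lemma labelling_pair (A B : finType) (a : X -> A) (b : X -> B) :
  labelling a -> labelling b -> labelling (pair_label a b).
Proof.
by move=> ma mb [i j]; rewrite preimage_pair_label; exact: measurableI.
Qed.

Lemma measurable_atom (A : finType) (a : X -> A) D i :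
  labelling a -> measurable D -> measurable (D `&` a @^-1` [set i]).
Proof. by move=> ma mD; exact: measurableI. Qed.

Definition pmass (A : finType) (D : set X) (a : X -> A) (i : A) : R :=
  w (D `&` a @^-1` [set i]).

Lemma pmass_ge0 (A : finType) D (a : X -> A) i : 0 <= pmass D a i.
Proof. exact: fine_ge0. Qed.

Lemma pmass_seq (A : finType) D (a : X -> A) (s : seq A) : labelling a ->
  measurable D -> (m D < +oo)%E -> uniq s ->
  w (D `&` [set z | a z \in s]) = \sum_(i <- s) pmass D a i.
Proof.
move=> ma mD fD; elim: s => [_|i s IH /= /andP[nis us]].
  by rewrite big_nil (_ : _ `&` _ = set0) ?measure0 // -subset0 => z [].
rewrite big_cons -IH //.
have -> : D `&` [set z | a z \in i :: s] =
    (D `&` a @^-1` [set i]) `|` (D `&` [set z | a z \in s]).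
  rewrite -setIUr; congr (_ `&` _); apply/seteqP; split=> z /=.
    by rewrite inE => /predU1P.
  by rewrite inE => -[->|->]; rewrite ?eqxx ?orbT.
have ms : measurable (D `&` [set z | a z \in s]).
  by apply: measurableI => //; exact: (labelling_preimage [set i | i \in s] ma).
rewrite fine_measureU //; first exact: measurable_atom.
  rewrite -subset0 => z [[_ /= azi] [_ /=]]; rewrite azi => si.
  by rewrite si in nis.
rewrite -setIUr; apply: le_lt_trans fD; apply: le_measure; rewrite ?inE //.
by rewrite setIUr; apply: measurableU => //; exact: measurable_atom.
Qed.

Lemma pmass_marginal (A B : finType) D (a : X -> A) (b : X -> B) (f : A -> B) j :
  labelling a -> measurable D -> (m D < +oo)%E ->
  (forall z, D z -> b z = f (a z)) ->
  pmass D b j = \sum_(i | f i == j) pmass D a i.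
Proof.
move=> ma mD fD bf.
rewrite -big_filter -pmass_seq ?filter_uniq ?index_enum_uniq //.
congr (w _); apply/seteqP; split=> z /= [Dz]; rewrite mem_filter mem_index_enum andbT.
  by move=> <-; rewrite -bf.
by rewrite -bf // => /eqP.
Qed.

Lemma pmass_total (A : finType) D (a : X -> A) : labelling a -> measurable D ->
  (m D < +oo)%E -> \sum_i pmass D a i = w D.
Proof.
move=> ma mD fD; rewrite -pmass_seq ?index_enum_uniq //; congr (w _).
by apply/seteqP; split=> [z []//|z Dz]; split=> //=; rewrite mem_index_enum.
Qed.

(* Entropies are not normalised: they are homogeneous of degree one in the
   measure, so that restricting the measure to a set makes sense. *)
Definition ent (A : finType) (D : set X) (a : X -> A) : R :=
  \sum_i negxlnx (pmass D a i).

(** Conditional entropy of [a] given [b]: each term is [p * ln (q / p)] for a joint atom of mass [p]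
    inside an atom of [b] of mass [q]. Like [ent], it is not divided by the mass of [D]. *)
Definition cent (A B : finType) (D : set X) (a : X -> A) (b : X -> B) : R :=
  \sum_j \sum_i klog (pmass D (pair_label a b) (i, j)) (pmass D b j).

Definition determines (A B : Type) (D : set X) (b : X -> B) (a : X -> A) :=
  forall z z', D z -> D z' -> b z = b z' -> a z = a z'.

(** The function picks a representative in each fibre of [b]; its values on labels not taken on [D]
    are arbitrary. *)
Lemma determinesP (A B : Type) (D : set X) (b : X -> B) (a : X -> A) :
  determines D b a -> exists f, forall z, D z -> a z = f (b z).
Proof.
move=> ba; exists (fun j => a (xget point [set z | D z /\ b z = j])) => z Dz.
case: xgetP => [y -> [Dy byz]|/(_ z) []//].
by apply: ba.
Qed.

Lemma determines_sub (A B : Type) (D D' : set X) (b : X -> B) (a : X -> A) :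
  D' `<=` D -> determines D b a -> determines D' b a.
Proof. by move=> s ba z z' /s ? /s ?; exact: ba. Qed.

Section Finite.
Context (D : set X) (mD : measurable D) (fD : (m D < +oo)%E).

Lemma pmass_pair_sum (A B : finType) (a : X -> A) (b : X -> B) j :
  labelling a -> labelling b ->
  \sum_i pmass D (pair_label a b) (i, j) = pmass D b j.
Proof.
move=> ma mb; have mab := labelling_pair ma mb.
rewrite (pmass_marginal j mab mD fD (f := snd)) //.
rewrite (eq_bigl (fun k : A * B => xpredT k.1 && (k.2 == j))); last by case.
by rewrite (sum_pair xpredT (pred1 j)); apply: eq_bigr => i _; rewrite big_pred1_eq.
Qed.

Lemma pmass_pair_le (A B : finType) (a : X -> A) (b : X -> B) i j :
  labelling a -> labelling b ->
  0 <= pmass D (pair_label a b) (i, j) <= pmass D b j.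
Proof.
move=> ma mb; rewrite pmass_ge0 -(pmass_pair_sum j ma mb) (bigD1 i) //= lerDl.
by apply: sumr_ge0 => ? _; exact: pmass_ge0.
Qed.

Lemma cent_ge0 (A B : finType) (a : X -> A) (b : X -> B) :
  labelling a -> labelling b -> 0 <= cent D a b.
Proof.
move=> ma mb; apply: sumr_ge0 => j _; apply: sumr_ge0 => i _.
by have /andP[] := pmass_pair_le i j ma mb; exact: klog_ge0.
Qed.

Lemma ent_chain (A B : finType) (a : X -> A) (b : X -> B) :
  labelling a -> labelling b ->
  ent D (pair_label a b) = ent D b + cent D a b.
Proof.
move=> ma mb; rewrite /ent /cent -big_split /=.
rewrite (sum_pair xpredT xpredT) exchange_big /=.
apply: eq_bigr => j _; rewrite /klog.
under [X in _ = _ + X]eq_bigr do rewrite mulrBr.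
rewrite sumrB -mulr_suml (pmass_pair_sum j ma mb) /negxlnx sumrN; lra.
Qed.

(** Inside an atom of [b'] the masses of the finer atoms of [b], and of their traces on an atom of
    [a], add up: this is the log-sum inequality for each pair of labels. *)
Lemma cent_refine (A B B' : finType) (a : X -> A) (b : X -> B) (b' : X -> B') :
  labelling a -> labelling b -> labelling b' -> determines D b b' ->
  cent D a b <= cent D a b'.
Proof.
move=> ma mb mb' /determinesP[f bf].
rewrite /cent [leLHS](partition_big f xpredT) //=.
apply: ler_sum => j' _; rewrite exchange_big /=; apply: ler_sum => i _.
rewrite (pmass_marginal j' mb mD fD bf).
rewrite (pmass_marginal (i, j') (labelling_pair ma mb) mD fD (f := fun k => (k.1, f k.2))); last first.
  by move=> z Dz; rewrite /pair_label /= bf.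
rewrite (eq_bigl (fun k : A * B => pred1 i k.1 && (f k.2 == j'))); last by case.
rewrite (sum_pair (pred1 i) (fun k => f k == j')) big_pred1_eq; apply: klog_sum => j _; exact: pmass_pair_le.
Qed.

Lemma cent_det (A B : finType) (a : X -> A) (b : X -> B) :
  labelling a -> labelling b -> determines D b a -> cent D a b = 0.
Proof.
move=> ma mb /determinesP[f bf]; apply: big1 => j _; apply: big1 => i _.
have [->|/eqP ij] := eqVneq i (f j).
  suff -> : pmass D (pair_label a b) (f j, j) = pmass D b j by rewrite klogxx.
  congr (w _); apply/seteqP; split=> z /= [Dz]; first by case.
  by rewrite /pair_label => e; rewrite bf // e.
suff -> : pmass D (pair_label a b) (i, j) = 0 by rewrite klog0.
rewrite /pmass (_ : _ `&` _ = set0) ?measure0 // -subset0 => z [Dz /= [ai bj]].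
by apply: ij; rewrite -ai -bj -bf.
Qed.

Lemma ent_det (A B : finType) (a : X -> A) (b : X -> B) :
  labelling a -> labelling b -> determines D b a -> ent D a <= ent D b.
Proof.
move=> ma mb ba.
have := ent_chain ma mb; rewrite (cent_det ma mb ba) addr0 => <-.
have swap : ent D (pair_label a b) = ent D (pair_label b a).
  rewrite /ent (reindex (fun k : B * A => (k.2, k.1))) /=; last first.
    by exists (fun k : A * B => (k.2, k.1)) => -[].
  apply: eq_bigr => -[j i] _; congr (negxlnx (w (_ `&` _))).
  by rewrite !preimage_pair_label setIC.
by rewrite swap ent_chain // lerDl cent_ge0.
Qed.

(** Apply the log-sum inequality over the labels of [a]: the total on the right is [#|A|] times the
    mass of the atom of [b]. *)
Lemma cent_bound (A B : finType) (a : X -> A) (b : X -> B) :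
  labelling a -> labelling b -> cent D a b <= w D * ln #|A|%:R.
Proof.
move=> ma mb; rewrite -(pmass_total mb mD fD) mulr_suml; apply: ler_sum => j _.
apply: le_trans (klog_sum _) _; first by move=> i _; exact: pmass_pair_le.
rewrite pmass_pair_sum // sumr_const -[_ *+ _]mulr_natr.
set q := pmass _ _ _; have q0 : 0 <= q by exact: pmass_ge0.
move: q0; rewrite le_eqVlt => /predU1P[<-|q0]; first by rewrite klog0 mul0r.
have A0 : 0 < #|A|%:R :> R by rewrite ltr0n; apply/card_gt0P; exists (a point).
by rewrite /klog lnM ?posrE //; lra.
Qed.

Lemma ent_eq (A B : finType) (a : X -> A) (b : X -> B) :
  labelling a -> labelling b -> determines D b a -> determines D a b ->
  ent D a = ent D b.
Proof. by move=> ma mb ba ab; apply/eqP; rewrite eq_le !ent_det. Qed.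

Lemma cent_eq (A B B' : finType) (a : X -> A) (b : X -> B) (b' : X -> B') :
  labelling a -> labelling b -> labelling b' ->
  determines D b b' -> determines D b' b -> cent D a b = cent D a b'.
Proof. by move=> ma mb mb' bb' b'b; apply/eqP; rewrite eq_le !cent_refine. Qed.

Lemma cent_pair (A A' B : finType) (a : X -> A) (a' : X -> A') (b : X -> B) :
  labelling a -> labelling a' -> labelling b ->
  cent D (pair_label a a') b = cent D a b + cent D a' (pair_label a b).
Proof.
move=> ma ma' mb.
have maa' := labelling_pair ma ma'; have mab := labelling_pair ma mb.
have E : ent D (pair_label (pair_label a a') b) = ent D (pair_label a' (pair_label a b)).
  apply: ent_eq; try exact: labelling_pair.
    by move=> z z' _ _; rewrite /pair_label => -[-> -> ->].
  by move=> z z' _ _; rewrite /pair_label => -[-> -> ->].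
have := ent_chain maa' mb; rewrite E ent_chain // ent_chain //; lra.
Qed.

Lemma cent_pair_le (A A' B : finType) (a : X -> A) (a' : X -> A') (b : X -> B) :
  labelling a -> labelling a' -> labelling b ->
  cent D (pair_label a a') b <= cent D a b + cent D a' b.
Proof.
move=> ma ma' mb; rewrite cent_pair // lerD2l cent_refine //.
  exact: labelling_pair.
by move=> z z' _ _ [_ ->].
Qed.

Lemma cent_det_left (A A' B : finType) (a : X -> A) (a' : X -> A') (b : X -> B) :
  labelling a -> labelling a' -> labelling b -> determines D a' a ->
  cent D a b <= cent D a' b.
Proof.
move=> ma ma' mb a'a; have mb' := labelling_pair ma mb; have mc := labelling_pair ma' mb.
rewrite -(lerD2l (ent D b)) -!ent_chain //; apply: ent_det => //.
by move=> z z' Dz Dz' [e1 e2]; rewrite /pair_label e2 (a'a z z').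
Qed.

(** Without normalisation the equality holds term by term, as an atom of the pair in [D] is an atom
    of [b] in a piece of [D]. It allows entropies to be estimated piece by piece. *)
Lemma cent_label (A B E : finType) (a : X -> A) (b : X -> B) (e : X -> E) :
  cent D a (pair_label b e) = \sum_k cent (D `&` e @^-1` [set k]) a b.
Proof.
rewrite /cent (sum_pair xpredT xpredT) exchange_big /=.
apply: eq_bigr => k _; apply: eq_bigr => j _; apply: eq_bigr => i _; congr klog.
  by congr (w _); rewrite !preimage_pair_label; apply/seteqP; split=> z /=; tauto.
by congr (w _); rewrite !preimage_pair_label; apply/seteqP; split=> z /=; tauto.
Qed.

Lemma sum_cent_label_le (A B E : finType) (a : X -> A) (b : X -> B) (e : X -> E) :
  labelling a -> labelling b -> labelling e ->
  \sum_k cent (D `&` e @^-1` [set k]) a b <= cent D a b.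
Proof.
move=> ma mb me; rewrite -cent_label cent_refine //; first exact: labelling_pair.
by move=> z z' _ _ [].
Qed.

Lemma cent_label_det (A B E : finType) (a : X -> A) (b : X -> B) (e : X -> E) :
  labelling a -> labelling b -> labelling e -> determines D b e ->
  cent D a b = \sum_k cent (D `&` e @^-1` [set k]) a b.
Proof.
move=> ma mb me be; rewrite -cent_label; apply: cent_eq => //.
- exact: labelling_pair.
- by move=> z z' Dz Dz' bzz'; rewrite /pair_label bzz' (be z z').
- by move=> z z' _ _ [].
Qed.

End Finite.

Lemma pmass_set0 (A : finType) (a : X -> A) i : pmass set0 a i = 0.
Proof. by rewrite /pmass set0I measure0. Qed.

End Entropy.

(** * Entropy rate of a measure-preserving map *)

Section Words.
Context d (X : measurableType d) (R : realType).
Context (m : {measure set X -> \bar R}).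
Context (Om : set X) (mOm : measurable Om) (fOm : (m Om < +oo)%E).
Context (T : X -> X) (mT : measurable_fun [set: X] T).
Context (presT : forall E, measurable E -> m (Om `&` T @^-1` E) = m (Om `&` E)).

Lemma measurable_fun_iter n : measurable_fun [set: X] (iter n T).
Proof.
elim: n => [|n IH]; first exact: measurable_id.
by rewrite (_ : iter n.+1 T = T \o iter n T) //; exact: measurableT_comp.
Qed.

Lemma measurable_iter_preimage n E : measurable E -> measurable (iter n T @^-1` E).
Proof. by move=> mE; rewrite -[X in measurable X]setTI; exact: measurable_fun_iter. Qed.

Lemma preserve_iter n E : measurable E -> m (Om `&` iter n T @^-1` E) = m (Om `&` E).
Proof.
move=> mE; elim: n => [//|n IH].
rewrite -IH -[RHS]presT; last exact: measurable_iter_preimage.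
by congr (m (_ `&` _)); apply/seteqP; split=> z; rewrite /preimage /= -iterSr.
Qed.

Lemma labelling_iter (A : finType) (a : X -> A) n : labelling a -> labelling (a \o iter n T).
Proof. by move=> ma i; rewrite comp_preimage; exact: measurable_iter_preimage. Qed.

(** The set [D] is arbitrary, so that separate pieces of [Om] can be shifted to a common time and
    their entropies added there. *)
Lemma cent_shift (A B : finType) n D (a : X -> A) (b : X -> B) :
  measurable D -> labelling a -> labelling b ->
  cent m (Om `&` iter n T @^-1` D) (a \o iter n T) (b \o iter n T) = cent m (Om `&` D) a b.
Proof.
move=> mD ma mb; apply: eq_bigr => j _; apply: eq_bigr => i _; congr klog.
  have mE : measurable (D `&` pair_label a b @^-1` [set (i, j)]).
    by apply: measurableI => //; exact: labelling_pair.
  congr fine; rewrite -!setIA -(preserve_iter n mE).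
  by congr (m _); apply/seteqP; split=> z /=.
have mE : measurable (D `&` b @^-1` [set j]) by exact: measurableI.
congr fine; rewrite -!setIA -(preserve_iter n mE).
by congr (m _); apply/seteqP; split=> z /=.
Qed.

Definition word (A : Type) (a : X -> A) n z : {ffun 'I_n -> A} :=
  [ffun j : 'I_n => a (iter j T z)].

Lemma word_nth (A : Type) (a : X -> A) n z z' : word a n z = word a n z' ->
  forall j, (j < n)%N -> a (iter j T z) = a (iter j T z').
Proof. by move=> e j jn; have /ffunP/(_ (Ordinal jn)) := e; rewrite !ffunE. Qed.

Lemma eq_word (A : Type) (a : X -> A) n z z' :
  (forall j, (j < n)%N -> a (iter j T z) = a (iter j T z')) -> word a n z = word a n z'.
Proof. by move=> e; apply/ffunP => j; rewrite !ffunE; exact: e. Qed.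

Lemma labelling_word (A : finType) (a : X -> A) n : labelling a -> labelling (word a n).
Proof.
move=> ma w.
rewrite (_ : _ @^-1` _ = \bigcap_(j in [set: 'I_n]) (a \o iter j T) @^-1` [set w j]).
  by apply: fin_bigcap_measurable => [|j _]; [exact: finite_finset|exact: labelling_iter].
apply/seteqP; split=> z /=; first by move=> <- j _ /=; rewrite ffunE.
by move=> e; apply/ffunP => j; rewrite ffunE; exact: (e j).
Qed.

Arguments labelling_word {A a} n _.

(** Entropy of the letter at time [n] given the preceding ones. The rate is defined as the limit of
    these decreasing increments; the usual quotient by the length is recovered from Cesaro means. *)
Definition entropy_step (A : finType) (a : X -> A) n : R :=
  cent m Om (a \o iter n T) (word a n).

Lemma ent_wordS (A : finType) (a : X -> A) n : labelling a ->
  ent m Om (word a n.+1) = ent m Om (word a n) + entropy_step a n.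
Proof.
move=> ma; have ma' := labelling_iter n ma; have mw k := labelling_word k ma.
rewrite -(ent_chain mOm fOm) //; apply: ent_eq => //; first exact: labelling_pair.
  move=> z z' _ _ [e1 e2]; apply: eq_word => j; rewrite ltnS leq_eqVlt.
  by move=> /predU1P[->//|]; exact: word_nth.
move=> z z' _ _ e; congr pair; first exact: (word_nth e).
by apply: eq_word => j jn; apply: (word_nth e); exact: ltnW.
Qed.

Lemma ent_word (A : finType) (a : X -> A) n : labelling a ->
  ent m Om (word a n) = ent m Om (word a 0) + \sum_(k < n) entropy_step a k.
Proof.
move=> ma; elim: n => [|n IH]; first by rewrite big_ord0 addr0.
by rewrite ent_wordS // IH big_ord_recr /= addrA.
Qed.

Lemma entropy_step_ge0 (A : finType) (a : X -> A) n : labelling a -> 0 <= entropy_step a n.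
Proof. by move=> ma; apply: cent_ge0 => //; [exact: labelling_iter|exact: labelling_word]. Qed.

Lemma entropy_step_noninc (A : finType) (a : X -> A) : labelling a ->
  nonincreasing_seq (entropy_step a).
Proof.
move=> ma; apply/nonincreasing_seqP => n.
have ma' k := labelling_iter k ma; have mw k := labelling_word k ma.
have -> : entropy_step a n = cent m Om (a \o iter n.+1 T) (word a n \o T).
  have := @cent_shift _ _ 1 setT _ _ measurableT (ma' n) (mw n).
  rewrite preimage_setT !setIT /entropy_step => <-.
  by congr (cent _ _ _ _); apply/funext => z /=; rewrite -iterSr.
apply: cent_refine => //; first exact: (labelling_iter 1 (mw n)).
move=> z z' _ _ e; apply: eq_word => j jn /=; rewrite -!iterSr.
by apply: (word_nth e).
Qed.

Definition entropy_rate (A : finType) (a : X -> A) : R := limn (entropy_step a).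

Lemma cvg_entropy_step (A : finType) (a : X -> A) : labelling a ->
  entropy_step a n @[n --> \oo] --> entropy_rate a.
Proof.
move=> ma; apply: nonincreasing_is_cvgn; first exact: entropy_step_noninc.
by exists 0 => _ [n _ <-]; exact: entropy_step_ge0.
Qed.

Lemma entropy_rate_le_step (A : finType) (a : X -> A) n : labelling a ->
  entropy_rate a <= entropy_step a n.
Proof.
move=> ma; apply: (nonincreasing_cvgn_ge (entropy_step_noninc ma)).
by apply/cvg_ex; eexists; exact: cvg_entropy_step.
Qed.

Lemma cvg_ent_word (A : finType) (a : X -> A) : labelling a ->
  ent m Om (word a n) / n%:R @[n --> \oo] --> entropy_rate a.
Proof.
move=> ma; rewrite -(cvg_shiftn 1) /=.
(* The empty word contributes a constant, which need not vanish as the mass of [Om] need not be 1;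
   it disappears after division by the length. *)
have -> : (fun n => ent m Om (word a (n + 1)) / (n + 1)%:R) =
    (fun n => ent m Om (word a 0) / n.+1%:R + arithmetic_mean (entropy_step a) n).
  apply/funext => n; rewrite addn1 ent_word // mulrDl; congr (_ + _).
  by rewrite /arithmetic_mean /series /= big_mkord mulrC.
rewrite -[entropy_rate a]add0r; apply: cvgD.
  rewrite -(mulr0 (ent m Om (word a 0))); apply: cvgMr; exact: cvg_harmonic.
exact/cesaro/cvg_entropy_step.
Qed.

Lemma cent_word_le (A B : finType) (a : X -> A) (b : X -> B) D n :
  measurable D -> (m D < +oo)%E -> labelling a -> labelling b ->
  cent m D (word a n) b <= \sum_(j < n) cent m D (a \o iter j T) b.
Proof.
move=> mD fD ma mb.
have ma' k := labelling_iter k ma; have mw k := labelling_word k ma.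
elim: n => [|n IH].
  rewrite big_ord0 cent_det //.
  by move=> z z' _ _ _; apply: eq_word.
rewrite big_ord_recr /=.
apply: le_trans (lerD IH (lexx _)); apply: le_trans (cent_pair_le mD fD _ _ _) => //.
apply: cent_det_left => //; first exact: labelling_pair.
move=> z z' _ _ [e1 e2]; apply: eq_word => j; rewrite ltnS leq_eqVlt.
by move=> /predU1P[->//|]; exact: word_nth.
Qed.

(** Given the word of [b], each letter of the word of [a] costs at most [cent m Om a b], by
    invariance. *)
Lemma entropy_rate_cent (A B : finType) (a : X -> A) (b : X -> B) :
  labelling a -> labelling b ->
  entropy_rate a <= entropy_rate b + cent m Om a b.
Proof.
move=> ma mb.
have H n : ent m Om (word a n.+1) / n.+1%:R <= ent m Om (word b n.+1) / n.+1%:R + cent m Om a b.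
  have mwa := labelling_word n.+1 ma; have mwb := labelling_word n.+1 mb.
  rewrite ler_pdivrMr ?ltr0n // mulrDl divfK ?pnatr_eq0 //.
  apply: le_trans (ent_det mOm fOm mwa (labelling_pair mwa mwb) _) _.
    by move=> z z' _ _ [].
  rewrite (ent_chain mOm fOm) // lerD2l.
  apply: le_trans (cent_word_le _ _ _ _ _) _ => //.
  rewrite mulr_natr -[leRHS]/(_ *+ n.+1) -[n.+1 in leRHS]card_ord -sumr_const.
  apply: ler_sum => j _.
  have := @cent_shift _ _ j setT _ _ measurableT ma mb.
  rewrite preimage_setT !setIT => <-.
  apply: cent_refine => //; try exact: labelling_iter.
  by move=> z z' _ _ e; exact: (word_nth e).
have c2 : ent m Om (word b n) / n%:R + cent m Om a b @[n --> \oo] --> entropy_rate b + cent m Om a b.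
  by apply: cvgD; [exact: cvg_ent_word|exact: cvg_cst].
apply: (ler_cvg_to (cvg_ent_word ma) c2); near=> n.
have := H n.-1; rewrite prednK //; near: n; exact: nbhs_infty_gt.
Unshelve. all: by end_near. Qed.

Lemma entropy_rate_det (A B : finType) (a : X -> A) (b : X -> B) :
  labelling a -> labelling b -> determines Om b a -> entropy_rate a <= entropy_rate b.
Proof.
by move=> ma mb ba; have := entropy_rate_cent ma mb; rewrite cent_det // addr0.
Qed.

Lemma entropy_rate_shift (A : finType) (a : X -> A) n : labelling a ->
  entropy_rate (a \o iter n T) = entropy_rate a.
Proof.
move=> ma; congr (limn _); apply/funext => k.
have := @cent_shift _ _ n setT _ _ measurableT (labelling_iter k ma) (labelling_word k ma).
rewrite preimage_setT !setIT /entropy_step => <-; congr (cent _ _ _ _).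
  by apply/funext => z /=; rewrite -!iterD addnC.
by apply/funext => z; apply/ffunP => j; rewrite !ffunE /= -!iterD addnC.
Qed.

End Words.

Arguments labelling_word {d X T} mT {A a} n _.

(** * Entropy of induced maps *)

Section SmallTail.
Context d (X : measurableType d) (R : realType) (m : {measure set X -> \bar R}).

Lemma measure_tail_small (F : nat -> set X) : (forall n, measurable (F n)) ->
  (m (F 0%N) < +oo)%E -> (forall n, F n.+1 `<=` F n) -> m (\bigcap_n F n) = 0%E ->
  forall e : R, 0 < e -> exists N, forall n, (N <= n)%N -> fine (m (F n)) < e.
Proof.
move=> mF f0 dF m0 e e0.
have ni : nonincreasing_seq F by apply/nonincreasing_seqP => n; exact/subsetPset.
have := nonincreasing_cvg_mu f0 mF (bigcapT_measurable mF) ni.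
rewrite m0 => /fine_cvg /cvgr_lt /(_ e e0) [N _ HN]; exists N => n Nn; exact: HN.
Qed.

Lemma null_sub D D' : measurable D -> measurable D' -> D `<=` D' -> m D' = 0%E -> m D = 0%E.
Proof. by move=> mD mD' s e; apply/eqP; rewrite -measure_le0 -e le_measure ?inE. Qed.

Lemma null_bigcup (F : nat -> set X) : (forall n, measurable (F n)) ->
  (forall n, m (F n) = 0%E) -> m (\bigcup_n F n) = 0%E.
Proof.
move=> mF F0; apply/(@negligibleP _ _ _ m); first exact: bigcupT_measurable.
by apply: negligible_bigcup => n; apply/(@negligibleP _ _ _ m) => //; exact: F0.
Qed.

Lemma trivIset_label n (F : nat -> set X) : (forall j, measurable (F j)) ->
  trivIset setT F -> exists e : X -> 'I_n.+1, [/\ labelling e,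
    forall (j : 'I_n) z, e z = widen_ord (leqnSn n) j <-> F j z &
    forall z, e z = ord_max <-> forall j, (j < n)%N -> ~ F j z].
Proof.
move=> mF tF.
pose e z : 'I_n.+1 := if [pick j : 'I_n | z \in F j] is Some j then widen_ord (leqnSn n) j else ord_max.
have eE (j : 'I_n) z : e z = widen_ord (leqnSn n) j <-> F j z.
  rewrite /e; case: pickP => [k /set_mem zk|/(_ j) zj]; last first.
    by split=> [/(congr1 val) /= jn|/mem_set]; [have := ltn_ord j; rewrite -jn ltnn|rewrite zj].
  split=> [/(congr1 val) /= /val_inj <- //|zj]; apply: val_inj => /=.
  by apply: (tF _ _ I I); exists z.
have eM z : e z = ord_max <-> forall j, (j < n)%N -> ~ F j z.
  split=> [ez j jn /(eE (Ordinal jn))|nF].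
    by rewrite ez => /(congr1 val) /= nj; rewrite -nj ltnn in jn.
  by rewrite /e; case: pickP => // j /set_mem; move: (ltn_ord j) => /nF.
exists e; split=> // i; case: (unliftP ord_max i) => [j ->|->].
  rewrite (_ : lift _ j = widen_ord (leqnSn n) j); last first.
    by apply: val_inj; rewrite /= /bump leqNgt ltn_ord.
  by rewrite (_ : _ @^-1` _ = F j) //; apply/seteqP; split=> z /eE.
rewrite (_ : _ @^-1` _ = ~` \bigcup_(j in [set j | (j < n)%N]) F j).
  by apply: measurableC; exact: bigcup_measurable.
apply/seteqP; split=> z /=; first by move=> /eM nF [j /= jn]; exact: nF.
by move=> nF; apply/eM => j jn Fj; apply: nF; exists j.
Qed.

(** Disjoint pieces of [D] are atoms of one labelling, and conditioning on it as well can only lower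
    the entropy. *)
Lemma sum_cent_trivIset (A B : finType) n D (F : nat -> set X) (a : X -> A) (b : X -> B) :
  measurable D -> (m D < +oo)%E -> labelling a -> labelling b ->
  (forall j, measurable (F j)) -> (forall j, F j `<=` D) -> trivIset setT F ->
  \sum_(j < n) cent m (F j) a b <= cent m D a b.
Proof.
move=> mD fD ma mb mF sF tF; have [e [me eE _]] := trivIset_label n mF tF.
apply: le_trans (sum_cent_label_le mD fD ma mb me).
rewrite big_ord_recr /= -[leLHS]addr0; apply: lerD.
  apply: ler_sum => j _; rewrite [in leRHS](_ : D `&` _ = F j) //.
  apply/seteqP; split=> [z [_ /eE]//|z Fz]; split; first exact: sF Fz.
  exact/eE.
apply: cent_ge0 => //; first exact: measurable_atom.
by apply: le_lt_trans fD; apply: le_measure; rewrite ?inE //; exact: measurable_atom.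
Qed.

Lemma cent_set0 (A B : finType) (a : X -> A) (b : X -> B) : cent m set0 a b = 0.
Proof. by apply: big1 => j _; apply: big1 => i _; rewrite !pmass_set0 klog0. Qed.

(** Unlike in [word], the letters are arbitrary functions of the point: this accommodates a process
    stopped at a time that depends on the point. *)
Definition sequence_word (A : Type) (v : nat -> X -> A) n z : {ffun 'I_n -> A} :=
  [ffun j : 'I_n => v j z].

Lemma sequence_word_nth (A : Type) (v : nat -> X -> A) n z z' :
  sequence_word v n z = sequence_word v n z' -> forall j, (j < n)%N -> v j z = v j z'.
Proof. by move=> e j jn; have /ffunP/(_ (Ordinal jn)) := e; rewrite !ffunE. Qed.

Lemma eq_sequence_word (A : Type) (v : nat -> X -> A) n z z' :
  (forall j, (j < n)%N -> v j z = v j z') -> sequence_word v n z = sequence_word v n z'.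
Proof. by move=> e; apply/ffunP => j; rewrite !ffunE; exact: e. Qed.

Lemma labelling_sequence_word (A : finType) (v : nat -> X -> A) n :
  (forall j, labelling (v j)) -> labelling (sequence_word v n).
Proof.
move=> mv w.
rewrite (_ : _ @^-1` _ = \bigcap_(j in [set: 'I_n]) v j @^-1` [set w j]).
  by apply: fin_bigcap_measurable => [|j _]; [exact: finite_finset|exact: mv].
apply/seteqP; split=> z /=; first by move=> <- j _ /=; rewrite ffunE.
by move=> e; apply/ffunP => j; rewrite ffunE; exact: (e j).
Qed.

Lemma ent_sequence_word (A : finType) (v : nat -> X -> A) D n :
  measurable D -> (m D < +oo)%E -> (forall j, labelling (v j)) ->
  ent m D (sequence_word v n) =
  ent m D (sequence_word v 0) + \sum_(j < n) cent m D (v j) (sequence_word v j).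
Proof.
move=> mD fD mv; have mw k : labelling (sequence_word v k) by exact: labelling_sequence_word.
elim: n => [|n IH]; first by rewrite big_ord0 addr0.
rewrite big_ord_recr /= addrA -IH -(ent_chain mD fD) //.
apply: ent_eq => //; first exact: labelling_pair.
  move=> z z' _ _ [e1 e2]; apply: eq_sequence_word => j; rewrite ltnS leq_eqVlt.
  by move=> /predU1P[->//|]; exact: sequence_word_nth.
move=> z z' _ _ e; congr pair; first exact: (sequence_word_nth e).
by apply: eq_sequence_word => j jn; apply: (sequence_word_nth e); exact: ltnW.
Qed.

End SmallTail.

Arguments labelling_sequence_word {d X A v} n _.

(** * First returns and visits *)

Section FirstReturn.
Context d (X : measurableType d).
Implicit Types (T : X -> X) (B : set X).

(** The value 0 stands for no return, in which case [first_return] is the identity; genuine return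
    times are positive. *)
Definition return_time T B z : nat :=
  if pselect (exists n, iter n.+1 T z \in B) is left e then (ex_minn e).+1 else 0%N.

Definition first_return T B z : X := iter (return_time T B z) T z.

Lemma return_timeP T B z n : B (iter n.+1 T z) ->
  [/\ (0 < return_time T B z <= n.+1)%N, B (first_return T B z)
    & forall i, (0 < i < return_time T B z)%N -> ~ B (iter i T z)].
Proof.
move=> Bn; rewrite /first_return /return_time; case: pselect => [e|]; last first.
  by case; exists n; exact: mem_set.
case: ex_minnP => k Bk min; split; first by rewrite /= ltnS min ?mem_set.
  exact: set_mem.
by case=> // i ik /mem_set /min; rewrite leqNgt => /negP; apply; move: ik; rewrite /= ltnS.
Qed.

Lemma return_time_eqS T B z n : B (iter n.+1 T z) ->
  (forall i, (0 < i <= n)%N -> ~ B (iter i T z)) -> return_time T B z = n.+1.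
Proof.
move=> Bn nB; have [/andP[r0 rn] Br _] := return_timeP Bn.
apply/eqP; rewrite eqn_leq rn ltnNge; apply/negP => rn'.
by apply: (nB (return_time T B z)) => //; rewrite r0.
Qed.

Lemma return_time_gt0 T B z : (0 < return_time T B z)%N -> exists n, B (iter n.+1 T z).
Proof.
by rewrite /return_time; case: pselect => // -[n /set_mem Bn] _; exists n.
Qed.

Definition visits T B n z : nat := \sum_(i < n) (iter i T z \in B).

Lemma visits0 T B z : visits T B 0 z = 0%N. Proof. by rewrite /visits big_ord0. Qed.

Lemma visitsS T B n z : visits T B n.+1 z = (visits T B n z + (iter n T z \in B))%N.
Proof. by rewrite /visits big_ord_recr. Qed.

Lemma visits1 T B z : visits T B 1 z = (z \in B). Proof. by rewrite visitsS visits0. Qed.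

Lemma visitsD T B k n z :
  visits T B (k + n) z = (visits T B k z + visits T B n (iter k T z))%N.
Proof.
by rewrite /visits big_split_ord; congr addn; apply: eq_bigr => i _; rewrite /= addnC iterD.
Qed.

Lemma visits_le T B n z : (visits T B n z <= n)%N.
Proof. by elim: n => [|n IH]; rewrite ?visits0// visitsS -addn1 leq_add ?leq_b1. Qed.

Lemma leq_visits T B k n z : (k <= n)%N -> (visits T B k z <= visits T B n z)%N.
Proof. by move=> kn; rewrite -(subnKC kn) visitsD leq_addr. Qed.

Lemma visits_eq0 T B n z : visits T B n z = 0%N <-> forall i, (i < n)%N -> ~ B (iter i T z).
Proof.
elim: n => [|n [IH1 IH2]]; first by rewrite visits0.
rewrite visitsS; split=> [/eqP|nB]; last first.
  rewrite IH2 => [|i ik]; last by apply: nB; exact: ltnW.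
  by rewrite add0n; case: (boolP (_ \in B)) => // /set_mem /nB -/(_ (ltnSn _)).
rewrite addn_eq0 => /andP[/eqP/IH1 nB]; case: (boolP (_ \in B)) => // /negP nBn _ i.
rewrite ltnS leq_eqVlt => /predU1P[->|/nB//]; by move/mem_set.
Qed.

(** Each visit before time [j] accounts for one application of the return map; induction after
    removing the first excursion. *)
Lemma iter_first_return T B j : forall z, B z -> B (iter j T z) ->
  iter (visits T B j z) (first_return T B) z = iter j T z.
Proof.
elim/ltn_ind: j => -[|j] IH z Bz Bj; first by rewrite visits0.
have [/andP[r0 rj] Br nB] := return_timeP Bj.
set r := return_time T B z in r0 rj nB *.
have vr : visits T B r z = 1%N.
  rewrite -(prednK r0) -add1n visitsD visits1 mem_set //.
  rewrite (_ : visits _ _ _ _ = 0%N) //; apply/visits_eq0 => i ir.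
  rewrite -iterD; apply: nB; rewrite addn1 /= -ltn_predRL //.
rewrite -(subnKC rj) visitsD vr add1n iterSr -/(first_return T B z).
rewrite IH ?ltn_subrL ?r0 //.
  by rewrite /first_return -iterD addnC.
by rewrite /first_return -iterD subnK.
Qed.

Lemma visits_reached T B M n z : (M < visits T B n z)%N ->
  exists j, [/\ (j < n)%N, visits T B j z = M & B (iter j T z)].
Proof.
elim: n => [|n IH]; rewrite ?visits0 // visitsS => Mn.
have [/IH[j [jn jM Bj]]|nM] := ltnP M (visits T B n z).
  by exists j; rewrite ltnW.
move: Mn; case: (boolP (iter n T z \in B)) => [/set_mem Bn|_]; last by rewrite addn0 ltnNge nM.
by rewrite addn1 ltnS => Mn; exists n; split=> //; apply/eqP; rewrite eqn_leq nM.
Qed.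

End FirstReturn.

(** * Entropy of a first return map, partition by partition *)

Section Induction.
Context d (X : measurableType d) (R : realType) (m : {measure set X -> \bar R}).
Context (Om : set X) (mOm : measurable Om) (fOm : (m Om < +oo)%E).
Context (T : X -> X) (mT : measurable_fun [set: X] T).
Context (presT : forall E, measurable E -> m (Om `&` T @^-1` E) = m (Om `&` E)).
Context (B : set X) (mB : measurable B) (BOm : B `<=` Om).
Local Notation S := (first_return T B).
Local Notation w D := (fine (m D)).

Lemma fin_sub D : measurable D -> D `<=` Om -> (m D < +oo)%E.
Proof. by move=> mD DO; apply: le_lt_trans fOm; apply: le_measure; rewrite ?inE. Qed.

Lemma labelling_mem (D : set X) : measurable D -> labelling (fun z => z \in D).
Proof.
move=> mD; case.
  by rewrite (_ : _ @^-1` _ = D) //; apply/seteqP; split=> z /= => [/set_mem|/mem_set].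
rewrite (_ : _ @^-1` _ = ~` D); first exact: measurableC.
apply/seteqP; split=> z /=; first by move=> + /mem_set => ->.
by move=> ?; apply/negbTE/negP => /set_mem.
Qed.

Lemma visits_word n z z' :
  word T (fun z => z \in B) n z = word T (fun z => z \in B) n z' ->
  visits T B n z = visits T B n z'.
Proof. by move=> e; apply: eq_bigr => i _; rewrite (word_nth e). Qed.

Lemma measurable_visits n (P : set nat) : measurable (visits T B n @^-1` P).
Proof.
have [f fE] := determinesP (D := setT) (fun z z' _ _ => @visits_word n z z').
rewrite (_ : _ @^-1` _ = word T (fun z => z \in B) n @^-1` (f @^-1` P)).
  by apply: labelling_preimage; apply: labelling_word => //; exact: labelling_mem.
by apply/seteqP; split=> z /=; rewrite fE.
Qed.

Lemma measurable_return_time n : measurable (return_time T B @^-1` [set n]).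
Proof.
have mp n' : measurable (return_time T B @^-1` [set n'.+1]).
  rewrite (_ : _ @^-1` _ = iter n'.+1 T @^-1` B `&` T @^-1` (visits T B n' @^-1` [set 0%N])).
    apply: measurableI; first exact: measurable_iter_preimage.
    by apply: (measurable_iter_preimage mT 1); exact: measurable_visits.
  apply/seteqP; split=> z /=.
    move=> rn; have [k Bk] : exists n, B (iter n.+1 T z).
      by apply: return_time_gt0; rewrite rn.
    have [_] := return_timeP Bk; rewrite /first_return rn => Bn nB; split=> //.
    apply/visits_eq0 => i ik; rewrite -iterSr; apply: nB; by rewrite /= ltnS.
  move=> [Bn /visits_eq0 nB]; apply: return_time_eqS => // -[//|i] /= ik.
  by rewrite -iterS iterSr; exact: nB.
case: n => [|//]; rewrite (_ : _ @^-1` _ = ~` \bigcup_n return_time T B @^-1` [set n.+1]).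
  by apply: measurableC; exact: bigcupT_measurable.
apply/seteqP; split=> z /=; first by move=> r0 [n _ /=]; rewrite r0.
move=> nr; apply: contrapT => r; apply: nr; exists (return_time T B z).-1 => //=.
by rewrite prednK // lt0n; exact/eqP.
Qed.

Lemma measurable_first_return : measurable_fun [set: X] S.
Proof.
move=> _ E mE; rewrite setTI.
rewrite (_ : _ @^-1` _ = \bigcup_n (return_time T B @^-1` [set n] `&` iter n T @^-1` E)).
  apply: bigcupT_measurable => n; apply: measurableI; first exact: measurable_return_time.
  exact: measurable_iter_preimage.
apply/seteqP; split=> z /=; first by move=> Ez; exists (return_time T B z).
by case=> n _ /= [<-].
Qed.

Context (hitB : m (Om `&` [set z | forall n, ~ B (iter n T z)]) = 0%E).

Definition unvisited n : set X := Om `&` visits T B n @^-1` [set 0%N].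

Lemma measurable_unvisited n : measurable (unvisited n).
Proof. by apply: measurableI => //; exact: measurable_visits. Qed.

Lemma fine_unvisited_small (e : R) : 0 < e ->
  exists N, forall n, (N <= n)%N -> w (unvisited n) < e.
Proof.
apply: measure_tail_small.
- exact: measurable_unvisited.
- by apply: fin_sub; [exact: measurable_unvisited|move=> z []].
- by move=> n z [Oz /visits_eq0 nB]; split=> //; apply/visits_eq0 => i /ltnW; exact: nB.
- rewrite -hitB; congr (m _); apply/seteqP; split=> z /=.
    move=> H; have [Oz _] := H 0%N I; split=> // n Bn.
    by have [_ /visits_eq0 /(_ n (ltnSn n))] := H n.+1 I.
  by move=> [Oz nB] n _; split=> //; apply/visits_eq0 => i _; exact: nB.
Qed.

(** The part of [E] in [B] is pulled back one step at a time: what falls in [B] has return time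
    exactly [n.+1], and the rest is pulled back further. After [n] steps the remainder lies in
    [unvisited n], whose measure tends to zero. *)
Lemma first_return_preserve E : measurable E -> m (B `&` S @^-1` E) = m (B `&` E).
Proof.
move=> mE.
pose V n := visits T B n @^-1` [set 0%N].
have mV n : measurable (V n) by exact: measurable_visits.
pose E' n := iter n T @^-1` (B `&` E).
have mE' n : measurable (E' n) by apply: measurable_iter_preimage => //; exact: measurableI.
have mS : measurable (S @^-1` E).
  by rewrite -[X in measurable X]setTI; exact: measurable_first_return.
pose r n := [set z | (0 < return_time T B z <= n)%N].
have mr n : measurable (r n).
  rewrite (_ : r n = \bigcup_(k in [set k | (0 < k <= n)%N]) return_time T B @^-1` [set k]).
    by apply: bigcup_measurable => k _; exact: measurable_return_time.
  by apply/seteqP; split=> z /=; [move=> rz; exists (return_time T B z)|case=> k /= ? rk; rewrite /r /= rk].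
have fs := fin_sub.
have step n : w (Om `&` (V n `&` E' n)) =
    w (B `&` (return_time T B @^-1` [set n.+1] `&` S @^-1` E)) + w (Om `&` (V n.+1 `&` E' n.+1)).
  rewrite -presT; last exact: measurableI.
  rewrite -fine_measureU //.
  - congr (w _); apply/seteqP; split=> z /=.
      move=> [Oz [/= Vz Ez]]; have [Bz|nBz] := pselect (B z); [left|right].
        have rz : return_time T B z = n.+1.
          apply: return_time_eqS; first by have [] := Ez; rewrite -iterSr.
          by case=> // i /= ik; rewrite -iterS iterSr; move/visits_eq0: Vz; apply.
        split=> //; split=> //=; rewrite /first_return rz iterSr; by have [] := Ez.
      split=> //; split; last by rewrite /E' /= -iterS iterSr.
      rewrite /V /= -add1n visitsD visits1 Vz memNset //.
    move=> [[Bz [/= rz Sz]]|[Oz [/= Vz Ez]]].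
      split; first exact: BOm.
      have [k Bk] : exists n, B (iter n.+1 T z) by apply: return_time_gt0; rewrite rz.
      have [_ Br nB] := return_timeP Bk; rewrite rz in nB.
      split; first by apply/visits_eq0 => i ik; rewrite -iterSr; apply: nB.
      by move: Sz Br; rewrite /E' /first_return rz iterSr /=.
    split=> //; split; last by move: Ez; rewrite /E' /= -iterS iterSr.
    by move: Vz; rewrite /V /= -add1n visitsD => /eqP; rewrite addn_eq0 => /andP[_ /eqP].
  - by apply: measurableI => //; apply: measurableI => //; exact: measurable_return_time.
  - by apply: measurableI => //; apply: measurableI.
  - rewrite -subset0 => z [[Bz _] [_ [+ _]]].
    by rewrite /V /= -add1n visitsD visits1 mem_set.
  - apply: fs; last by rewrite subUset; split=> z [] //; move=> /BOm.
    apply: measurableU; apply: measurableI => //; apply: measurableI => //.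
    exact: measurable_return_time.
have sum n : w (B `&` E) = w (B `&` (r n `&` S @^-1` E)) + w (Om `&` (V n `&` E' n)).
  elim: n => [|n IH].
    rewrite (_ : B `&` (r 0%N `&` _) = set0) ?measure0 ?add0r.
      congr (w _); apply/seteqP; split=> z /=; last by move=> [_ []].
      by move=> [Bz Ez]; split; [exact: BOm|rewrite /V /= visits0].
    by rewrite -subset0 => z [_ [/andP[r0 r1] _]]; have := leq_trans r0 r1.
  rewrite IH step addrA; congr (_ + _); rewrite -fine_measureU //.
  - congr (w _); apply/seteqP; split=> z /=.
      move=> [[Bz [/andP[r0 rn] Sz]]|[Bz [/= rz Sz]]]; split=> //; split=> //.
        by rewrite /r /= r0 (leq_trans rn).
      by rewrite /r /= rz leqnn.
    move=> [Bz [/andP[r0]]]; rewrite leq_eqVlt => /predU1P[rz|rn] Sz; first by right.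
    by left; split=> //; split=> //; rewrite /r /= r0.
  - by apply: measurableI => //; apply: measurableI.
  - by apply: measurableI => //; apply: measurableI => //; exact: measurable_return_time.
  - rewrite -subset0 => z [[_ [/andP[_ rn] _]] [_ [rz _]]].
    by have := rn; rewrite (rz : return_time T B z = n.+1) ltnn.
  - apply: fs; last by rewrite subUset; split=> z [] /BOm.
    apply: measurableU; apply: measurableI => //; apply: measurableI => //.
    exact: measurable_return_time.
have sum' n : w (B `&` S @^-1` E) = w (B `&` (r n `&` S @^-1` E)) + w (B `&` (~` r n `&` S @^-1` E)).
  rewrite -fine_measureU //.
  - congr (w _); rewrite -setIUr -setIUl setUv setTI //.
  - by apply: measurableI => //; apply: measurableI.
  - by apply: measurableI => //; apply: measurableI => //; exact: measurableC.
  - by rewrite -subset0 => z [[_ [? _]] [_ [? _]]].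
  - apply: fs; last by rewrite subUset; split=> z [] /BOm.
    apply: measurableU; apply: measurableI => //; apply: measurableI => //.
    exact: measurableC.
have b1 n : 0 <= w (Om `&` (V n `&` E' n)) <= w (unvisited n).
  rewrite fine_ge0 // fine_measure_le //.
  - by apply: measurableI => //; exact: measurableI.
  - exact: measurable_unvisited.
  - by move=> z [Oz [Vz _]].
  - by apply: fs => [|z []//]; exact: measurable_unvisited.
have b2 n : 0 <= w (B `&` (~` r n `&` S @^-1` E)) <= w (unvisited n).
  (* A point of [B] without return up to time [n] has an image that avoids [B] for a time [n]. *)
  have mU : m (unvisited n) = m (Om `&` T @^-1` (V n)) by rewrite presT.
  rewrite fine_ge0 // mU.
  have mTV : measurable (Om `&` T @^-1` V n).
    by apply: measurableI => //; apply: (measurable_iter_preimage mT 1).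
  rewrite fine_measure_le //.
  - by apply: measurableI => //; apply: measurableI => //; exact: measurableC.
  - move=> z [Bz [nr _]]; split; first exact: BOm.
    apply/visits_eq0 => i ik; rewrite -iterSr => /return_timeP[/andP[r0 rk] _ _].
    by apply: nr; rewrite /r /= r0 (leq_trans rk).
  - by apply: fs => // z [].
have mBE : measurable (B `&` E) by exact: measurableI.
have mBS : measurable (B `&` S @^-1` E) by exact: measurableI.
rewrite -[LHS]fineK ?ge0_fin_numE ?fs //; last by move=> z [/BOm].
rewrite -[RHS]fineK ?ge0_fin_numE ?fs //; last by move=> z [/BOm].
congr (_%:E); apply/eqP; rewrite eq_le; apply/andP; split; apply/ler_addgt0Pr => e e0.
all: have [N /(_ N (leqnn N))] := fine_unvisited_small e0.
all: have := b1 N; have := b2 N; rewrite (sum N) (sum' N); lra.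
Qed.

Lemma visits_slot_triv M i j z : B z -> B (iter i T z) -> B (iter j T z) ->
  visits T B i z = M -> visits T B j z = M -> i = j.
Proof.
move=> Bz; wlog ij : i j / (i <= j)%N => [H|] Bi Bj vi vj.
  by have [/H|/ltnW /H e] := leqP i j; [exact|apply/esym; exact: e].
apply/eqP; rewrite eqn_leq ij leqNgt; apply/negP => lij.
suff : (visits T B i z < visits T B j z)%N by rewrite vi vj ltnn.
by apply: leq_trans (leq_visits T B z lij); rewrite visitsS mem_set // addn1.
Qed.

(** Seen from a fixed time [k], at most one visit has exactly [M] visits from it, itself included,
    until just before [k]. *)
Lemma back_slot_triv k M i j z : (i <= k)%N -> (j <= k)%N ->
  B (iter (k - i) T z) -> B (iter (k - j) T z) ->
  visits T B i (iter (k - i) T z) = M -> visits T B j (iter (k - j) T z) = M -> i = j.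
Proof.
move=> ik jk; wlog ij : i j ik jk / (i <= j)%N => [H|] Bi Bj vi vj.
  by have [/H|/ltnW /H e] := leqP i j; [apply|apply/esym/e].
apply/eqP; rewrite eqn_leq ij leqNgt; apply/negP => lt.
have e : (k - i = (j - i) + (k - j))%N by lia.
have : visits T B ((j - i) + i) (iter (k - j) T z) = M by rewrite subnK.
rewrite visitsD -iterD -e vi -[RHS]add0n => /eqP; rewrite eqn_add2r.
have p : (0 < j - i)%N by rewrite subn_gt0.
by rewrite -(prednK p) -add1n visitsD visits1 mem_set.
Qed.

Lemma measurable_visits_slot M j :
  measurable (B `&` (iter j T @^-1` B `&` visits T B j @^-1` [set M])).
Proof.
apply: measurableI => //; apply: measurableI; first exact: measurable_iter_preimage.
exact: measurable_visits.
Qed.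

(** Carries a label of the induced system to the whole space. The value [None] reveals that the
    point is outside [B], so that a marked word also records the times of the visits. *)
Definition marked (A : Type) (eta : X -> A) z : option A :=
  if z \in B then Some (eta z) else None.

Lemma labelling_marked (A : finType) (eta : X -> A) : labelling eta -> labelling (marked eta).
Proof.
move=> meta.
have [f fE] := determinesP (D := setT) (b := pair_label (fun z => z \in B) eta) (a := marked eta)
  (fun z z' _ _ => ltac:(by rewrite /pair_label /marked => -[-> ->])).
rewrite (_ : marked eta = f \o pair_label (fun z => z \in B) eta); last by apply/funext => z; exact: fE.
by apply: labelling_comp; apply: labelling_pair => //; exact: labelling_mem.
Qed.

Lemma marked_eqP (A : Type) (eta : X -> A) z z' : marked eta z = marked eta z' ->
  (B z <-> B z') /\ (B z -> eta z = eta z').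
Proof.
rewrite /marked; case: (boolP (z \in B)) => [/set_mem Bz|/negP nBz].
  by case: (boolP (z' \in B)) => // /set_mem Bz' [->].
case: (boolP (z' \in B)) => // /negP nBz' _.
by split; [split=> /mem_set|move=> /mem_set].
Qed.

Lemma marked_visits (A : Type) (eta : X -> A) n z z' :
  word T (marked eta) n z = word T (marked eta) n z' -> visits T B n z = visits T B n z'.
Proof.
move=> e; apply: eq_bigr => i _; have [h _] := marked_eqP (word_nth e (ltn_ord i)).
by congr nat_of_bool; apply/idP/idP => /set_mem /h /mem_set.
Qed.

Definition few_visits M n : set X := Om `&` visits T B n @^-1` [set k | (k < M)%N].

Lemma measurable_few_visits M n : measurable (few_visits M n).
Proof. by apply: measurableI => //; exact: measurable_visits. Qed.

(** A point whose number of visits stays below [M] has an iterate whose orbit never meets [B]; such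
    points are null by [hitB] and invariance. *)
Lemma fine_few_visits_small M (e : R) : 0 < e ->
  exists N, forall n, (N <= n)%N -> w (few_visits M n) < e.
Proof.
apply: measure_tail_small.
- exact: measurable_few_visits.
- by apply: fin_sub; [exact: measurable_few_visits|move=> z []].
- by move=> n z [Oz /= vz]; split=> //=; apply: leq_ltn_trans vz; exact: leq_visits.
pose H := [set z | forall n, ~ B (iter n T z)].
have mH : measurable H.
  rewrite (_ : H = \bigcap_n iter n T @^-1` (~` B)).
    by apply: bigcapT_measurable => n; apply: measurable_iter_preimage => //; exact: measurableC.
  by apply/seteqP; split=> z h n; [move=> _; exact: h|exact: (h n I)].
apply: (@null_sub _ _ _ m _ (\bigcup_n (Om `&` iter n T @^-1` H))).
- by apply: bigcapT_measurable => n; exact: measurable_few_visits.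
- by apply: bigcupT_measurable => n; apply: measurableI => //; exact: measurable_iter_preimage.
- move=> z h; have Oz : Om z by have [] := h 0%N I.
  have bnd n : (visits T B n z <= M)%N by have [_ /= /ltnW] := h n I.
  have ex : exists n, visits T B n z == visits T B n z by exists 0%N.
  have [k kmax] : exists k, forall n, (visits T B n z <= visits T B k z)%N.
    apply: contrapT => nk.
    suff : forall j, exists n, (j <= visits T B n z)%N.
      by move=> /(_ M.+1)[n]; rewrite leqNgt ltnS bnd.
    elim=> [|j [n jn]]; first by exists 0%N.
    have /existsNP[n' /negP] : ~ forall n', (visits T B n' z <= visits T B n z)%N.
      by move=> h'; apply: nk; exists n.
    by rewrite -ltnNge => lt; exists n'; apply: leq_ltn_trans lt.
  exists k => //; split=> // n /= Bn; have := kmax (k + n).+1.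
  by rewrite visitsS visitsD [iter (k + n) T z](_ : _ = iter n T (iter k T z)) ?mem_set //;
    [rewrite addn1 ltnNge leq_addr|rewrite addnC iterD].
- apply: null_bigcup => n; first by apply: measurableI => //; exact: measurable_iter_preimage.
  by rewrite preserve_iter.
Qed.

(** * The induced entropy is at most the entropy of the map *)

Section Lower.
Context (A : finType) (eta : X -> A) (meta : labelling eta).
Local Notation xi := (marked eta).

Let mxi : labelling xi. Proof. exact: labelling_marked. Qed.

Let mw n : labelling (word T xi n). Proof. exact: labelling_word. Qed.

Section Stopped.
Variables (M n : nat).
(** The marked process is stopped after its [M]-th visit. With [M] visits before time [n], the
    stopped word determines [M] letters of the induced process, and yet the increments of its
    entropy add up to no more than those of [M] letters of the marked process. *)
Let v j z : option (option A) :=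
  if (visits T B j z < M)%N then Some (xi (iter j T z)) else None.

Let mv j : labelling (v j).
Proof.
move=> [c|].
  rewrite (_ : _ @^-1` _ = visits T B j @^-1` [set k | (k < M)%N] `&` (xi \o iter j T) @^-1` [set c]).
    by apply: measurableI; [exact: measurable_visits|exact: labelling_iter].
  apply/seteqP; split=> z /=; first by rewrite /v; case: ifP => // ? [].
  by rewrite /v => -[-> ->].
rewrite (_ : _ @^-1` _ = visits T B j @^-1` [set k | ~~ (k < M)%N]); first exact: measurable_visits.
by apply/seteqP; split=> z /=; rewrite /v; case: ifP.
Qed.

Lemma labelling_stopped j : labelling (v j). Proof. exact: mv. Qed.

Let sv := sequence_word v.
Let msv k : labelling (sv k). Proof. exact: (labelling_sequence_word k mv). Qed.

Let sv_visits k z z' : sv k z = sv k z' ->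
  forall j, (j <= k)%N -> minn M (visits T B j z) = minn M (visits T B j z').
Proof.
move=> e; elim=> [|j IH] jk; first by rewrite !visits0.
have := IH (ltnW jk) => {}IH; have := sequence_word_nth e jk.
rewrite /v !visitsS; case: ltnP => jM; case: ltnP => jM' //.
  move: IH; rewrite (minn_idPr (ltnW jM)) (minn_idPr (ltnW jM')) => -> [].
  by rewrite /marked; case: (boolP (iter j T z \in B)); case: (boolP (iter j T z' \in B)).
by move=> _; rewrite (minn_idPl (leq_trans jM (leq_addr _ _))) (minn_idPl (leq_trans jM' (leq_addr _ _))).
Qed.

Let sv_slot k z z' j : sv k z = sv k z' -> (j < k)%N -> (visits T B j z < M)%N ->
  B (iter j T z) -> [/\ visits T B j z' = visits T B j z, B (iter j T z')
    & eta (iter j T z) = eta (iter j T z')].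
Proof.
move=> e jk jM Bj; have := sv_visits e (ltnW jk); have := sequence_word_nth e jk.
rewrite /v jM; case: ltnP => // jM' -[]; rewrite /marked mem_set //.
case: (boolP (iter j T z' \in B)) => // /set_mem Bj' [->].
by move=> h; have -> : visits T B j z' = visits T B j z by lia.
Qed.

Let stopped_word : cent m B (word S eta M) (sv n) <=
  w (B `&` visits T B n @^-1` [set k | (k < M)%N]) * ln #|{ffun 'I_M -> A}|%:R.
Proof.
have mS : measurable_fun [set: X] S := measurable_first_return.
have fB : (m B < +oo)%E by exact: fin_sub.
have mws : labelling (word S eta M) by exact: labelling_word.
pose e z := (visits T B n z < M)%N.
have me b : e @^-1` [set b] = visits T B n @^-1` [set k | (k < M)%N = b] by [].
have le : labelling e by move=> b; rewrite me; exact: measurable_visits.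
rewrite (cent_label_det mB fB mws (@msv n) le); last first.
  by move=> z z' _ _ /sv_visits /(_ n (leqnn n)); rewrite /e; lia.
rewrite big_bool /= [X in _ + X](_ : _ = 0) ?addr0.
  rewrite me; apply: cent_bound => //.
    by apply: measurableI => //; exact: measurable_visits.
  by apply: fin_sub => [|z [/BOm]//]; apply: measurableI => //; exact: measurable_visits.
apply: cent_det => // z z' [Bz /= /negbT]; rewrite -leqNgt => nz [Bz' _] ezz'.
apply: eq_word => i iM; have [j [jn vj Bj]] := visits_reached (leq_trans iM nz).
have [vj' Bj' eE] : [/\ visits T B j z' = visits T B j z, B (iter j T z')
    & eta (iter j T z) = eta (iter j T z')] by apply: sv_slot ezz' _ _ _; rewrite ?vj.
by rewrite -vj iter_first_return // eE vj -vj -vj' iter_first_return.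
Qed.

Let D i j := B `&` visits T B j @^-1` [set i].
Let mD i j : measurable (D i j).
Proof. by apply: measurableI => //; exact: measurable_visits. Qed.
Let fD i j : (m (D i j) < +oo)%E. Proof. by apply: fin_sub => // z [/BOm]. Qed.

(** The number [i] of earlier visits is read off the stopped word. As long as it is below [M], the
    stopped word carries the same information as the marked word. *)
Let step_le j : cent m B (v j) (sv j) <=
  \sum_(i < M) cent m (D i j) (xi \o iter j T) (word T xi j).
Proof.
have fB : (m B < +oo)%E by exact: fin_sub.
pose e z : 'I_M.+1 := inord (minn M (visits T B j z)).
have eP (i : 'I_M.+1) z : e z = i <-> minn M (visits T B j z) = i.
  rewrite /e; split=> [<-|->]; last by rewrite inord_val.
  by rewrite inordK // ltnS geq_minl.
have mxj : labelling (xi \o iter j T) by exact: labelling_iter.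
rewrite (cent_label_det mB fB (@mv j) (@msv j) (e := e)); last first.
- by move=> z z' _ _ /sv_visits /(_ j (leqnn j)); rewrite /e => ->.
- move=> i; rewrite (_ : _ @^-1` _ = visits T B j @^-1` [set k | minn M k = i]).
    exact: measurable_visits.
  by apply/seteqP; split=> z /eP.
rewrite big_ord_recr /= [X in _ + X](_ : _ = 0) ?addr0; last first.
  apply: cent_det => // z z' [_ /eP /= ez] [_ /eP /= ez'] _.
  rewrite /v (_ : (visits T B j z < M)%N = false); last by lia.
  by rewrite (_ : (visits T B j z' < M)%N = false) //; lia.
apply: ler_sum => i _; set D' := _ `&` _.
have DE : D' = D i j.
  apply/seteqP; split=> z [Bz] /=.
    move=> /eP /=; rewrite /minn; case: ltnP => _ ei; split=> //.
    by have := ltn_ord i; rewrite -ei ltnn.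
  move=> /= vi; split=> //; apply/eP; rewrite /= vi; apply/minn_idPr; exact/ltnW/ltn_ord.
rewrite DE.
have dv : determines (D i j) (xi \o iter j T) (v j).
  by move=> z z' [_ /= vz] [_ /= vz'] /= ezz'; rewrite /v vz vz' ezz'.
apply: le_trans (cent_det_left (mD i j) (fD i j) (@mv j) mxj (@msv j) dv) _.
apply: cent_refine => // z z' [_ /= vz] [_ /= vz'] ezz'; apply: eq_word => k kj.
have := sequence_word_nth ezz' kj; rewrite /v.
rewrite (leq_ltn_trans (leq_visits T B z (ltnW kj))) ?vz //.
by rewrite (leq_ltn_trans (leq_visits T B z' (ltnW kj))) ?vz' // => -[].
Qed.

(** Shift every piece so that its current letter comes at time [n]. Pieces with the same number [i]
    of earlier visits become disjoint, and at least [i] letters of the past are known, so the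
    conditioning may be weakened to the last [i] of them. The sum is then bounded by a single
    increment. *)
Let slot_le (i : 'I_M) : (M <= n)%N ->
  \sum_(j < n) cent m (D i j) (xi \o iter j T) (word T xi j) <= entropy_step m Om T xi i.
Proof.
move=> Mn; have in' : (i <= n)%N by rewrite (leq_trans _ Mn) // ltnW.
pose a := xi \o iter n T; pose b := word T xi i \o iter (n - i) T.
have ma : labelling a by exact: labelling_iter.
have mb : labelling b by exact: labelling_iter.
pose E j := if (i <= j < n)%N then Om `&` iter (n - j) T @^-1` D i j else set0.
have mE j : measurable (E j).
  by rewrite /E; case: ifP => // _; apply: measurableI => //; exact: measurable_iter_preimage.
have sE j : E j `<=` Om by rewrite /E; case: ifP => // _ z [].
have step j : (j < n)%N ->
    cent m (D i j) (xi \o iter j T) (word T xi j) <= cent m (E j) a b.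
  move=> jn; rewrite /E jn andbT; case: ifPn => ij; last first.
    suff -> : D i j = set0 by rewrite !cent_set0.
    rewrite -subset0 => z [_ /= vi]; move: ij; rewrite -vi; move/negP; apply; exact: visits_le.
  rewrite -[D i j in leLHS](setIidr (A := Om)); last by move=> z [/BOm].
  rewrite -(cent_shift mT presT (n - j)) //; last exact: labelling_iter.
  rewrite (_ : (xi \o iter j T) \o _ = a); last first.
    by apply/funext => z; rewrite /a /= -iterD subnKC // ltnW.
  apply: cent_refine => //; first by apply: measurableI => //; exact: measurable_iter_preimage.
  - apply: fin_sub => [|z []//]; apply: measurableI => //; exact: measurable_iter_preimage.
  - exact: labelling_iter.
  - move=> z z' _ _ /= ezz'; apply: eq_word => k ki; rewrite -!iterD.
    have e : (k + (n - i) = (k + (j - i)) + (n - j))%N by lia.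
    rewrite e !(iterD (k + (j - i)) (n - j)); apply: (word_nth ezz'); lia.
apply: le_trans (ler_sum _ (fun (j : 'I_n) _ => step j (ltn_ord j))) _.
have -> : entropy_step m Om T xi i = cent m Om a b.
  have := cent_shift mT presT (n - i) measurableT (labelling_iter mT i mxi) (@mw i).
  rewrite preimage_setT !setIT /entropy_step => <-; congr (cent _ _ _ _).
  by apply/funext => z; rewrite /a /= -iterD subnKC.
apply: sum_cent_trivIset => //.
move=> j j' _ _ [z []]; rewrite /E; case: ifP => // /andP[ij jn] [Oz [/= Bj vj]].
case: ifP => // /andP[ij' jn'] [_ [/= Bj' vj']].
exact: back_slot_triv (ltnW jn) (ltnW jn') Bj Bj' vj vj'.
Qed.

(** The slot bounds for [i < M] add up to the entropy gained by the first [M] letters of the marked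
    process. Letting [n] grow removes the last term, since few points have fewer than [M] visits. *)
Lemma stopped_bound : (M <= n)%N ->
  ent m B (word S eta M) - ent m B (sv 0) <=
  ent m Om (word T xi M) - ent m Om (word T xi 0) +
  w (B `&` visits T B n @^-1` [set k | (k < M)%N]) * ln #|{ffun 'I_M -> A}|%:R.
Proof.
move=> Mn; have fB : (m B < +oo)%E by exact: fin_sub.
have mS : measurable_fun [set: X] S := measurable_first_return.
have mws : labelling (word S eta M) by exact: labelling_word.
have H1 : ent m B (word S eta M) <= ent m B (sv n) + cent m B (word S eta M) (sv n).
  rewrite -(ent_chain mB fB) //; apply: ent_det => //; first exact: labelling_pair.
  by move=> z z' _ _ [].
have H2 : ent m B (sv n) <= ent m B (sv 0) + \sum_(i < M) entropy_step m Om T xi i.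
  rewrite ent_sequence_word // lerD2l.
  apply: le_trans (ler_sum _ (fun (j : 'I_n) _ => step_le j)) _.
  by rewrite exchange_big /=; apply: ler_sum => i _; exact: slot_le.
have := ent_word mOm fOm mT M mxi; have := stopped_word; lra.
Qed.

End Stopped.

Lemma entropy_rate_first_return_le : entropy_rate m B S eta <= entropy_rate m Om T xi.
Proof.
have fB : (m B < +oo)%E by exact: fin_sub.
have mS : measurable_fun [set: X] S := measurable_first_return.
have presS : forall E, measurable E -> m (B `&` S @^-1` E) = m (B `&` E).
  by move=> E; exact: first_return_preserve.
pose K := ent m B (word S eta 0) - ent m Om (word T xi 0).
have H M : ent m B (word S eta M) <= ent m Om (word T xi M) + K.
  rewrite -lerBlDl; apply/ler_addgt0Pr => e e0.
  pose c := ln #|{ffun 'I_M -> A}|%:R : R.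
  have c0 : 0 <= c.
    by apply: ln_ge0; rewrite ler1n; apply/card_gt0P; exists [ffun=> eta point].
  have [N HN] := fine_few_visits_small M (divr_gt0 e0 (ltr_pwDr ltr01 c0)).
  pose n := maxn N M; have := HN n (leq_maxl _ _); have := @stopped_bound M n (leq_maxr _ _).
  set s0 := ent m B (sequence_word _ 0).
  have -> : s0 = ent m B (word S eta 0).
    apply: ent_eq => //; try by move=> ? ? _ _ _; apply/ffunP => -[].
    - by apply: labelling_sequence_word => j; exact: labelling_stopped.
    - exact: labelling_word.
  have : w (B `&` visits T B n @^-1` [set k | (k < M)%N]) <= w (few_visits M n).
    apply: fine_measure_le.
    - by apply: measurableI => //; exact: measurable_visits.
    - exact: measurable_few_visits.
    - by move=> z [/BOm].
    - by apply: fin_sub; [exact: measurable_few_visits|move=> z []].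
  rewrite /K -/c; set x := w _; set y := w _ => xy h yc.
  have : x * c <= e.
    apply: le_trans (_ : y * (c + 1) <= e); last by rewrite -ler_pdivlMr ?ltW // ltr_pwDr.
    apply: ler_pM => //; [exact: fine_ge0|lra].
  by lra.
have c1 := cvg_ent_word mB fB mS presS meta.
have c2 : ent m Om (word T xi n) / n%:R + K / n%:R @[n --> \oo] --> entropy_rate m Om T xi.
  rewrite -[entropy_rate _ _ _ _]addr0; apply: cvgD; first exact: cvg_ent_word.
  rewrite -(mulr0 K); apply: cvgMr; rewrite -(cvg_shiftn 1) /=.
  by under eq_fun do rewrite addn1; exact: cvg_harmonic.
apply: (ler_cvg_to c1 c2); near=> n.
by rewrite -mulrDl ler_wpM2r // H.
Unshelve. all: by end_near. Qed.

End Lower.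

(** * The entropy of the map is at most the induced entropy *)

Section Upper.
Context (A : finType) (xi : X -> A) (mxi : labelling xi) (l : nat).
Let L := l.+1.

(* The first return time, truncated, and the name of the excursion up to time
   [L]: away from the few points not visiting [B] for a time [L], the orbit of
   [eta] under the first return map determines the orbit of [xi] under [T]. *)
Let eta z : 'I_L.+2 * {ffun 'I_L -> A} :=
  (inord (minn (return_time T B z) L.+1), word T xi L z).

Let meta : labelling eta.
Proof.
have := labelling_pair (a := fun z => inord (minn (return_time T B z) L.+1) : 'I_L.+2)
  (b := word T xi L); apply; last exact: labelling_word.
move=> i; rewrite (_ : _ @^-1` _ = \bigcup_(n in [set n | inord (minn n L.+1) = i])
    return_time T B @^-1` [set n]).
  by apply: bigcup_measurable => n _; exact: measurable_return_time.
by apply/seteqP; split=> z /=; [exists (return_time T B z)|case=> n /= + ->].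
Qed.

Let eta_return z z' : eta z = eta z' -> forall i, (i <= L)%N ->
  (return_time T B z == i) = (return_time T B z' == i).
Proof.
move=> [/(congr1 val) /=]; rewrite !inordK ?ltnS ?geq_minr // => e _ i iL.
by lia.
Qed.

Let eta_xi z z' : eta z = eta z' -> forall i, (i < L)%N -> xi (iter i T z) = xi (iter i T z').
Proof. by move=> [_ e]; exact: (word_nth e). Qed.

Local Notation xi' := (marked eta).
Let mxi' : labelling xi'. Proof. exact: labelling_marked. Qed.
Let mw n : labelling (word T xi' n). Proof. exact: labelling_word. Qed.

Let unvis := fun z => visits T B L z == 0%N.
Let mun : labelling unvis.
Proof.
move=> b; rewrite (_ : _ @^-1` _ = visits T B L @^-1` [set k | (k == 0%N) = b]) //.
exact: measurable_visits.
Qed.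

Let fu : (m (unvisited L) < +oo)%E.
Proof. by apply: fin_sub => [|z []//]; exact: measurable_unvisited. Qed.

Let visited_bound (C : finType) (c : X -> C) : labelling c ->
  determines (Om `&` visits T B L @^-1` [set k | (0 < k)%N]) (word T xi' L) c ->
  cent m Om c (word T xi' L) <= w (unvisited L) * ln #|C|%:R.
Proof.
move=> mc det.
rewrite (cent_label_det mOm fOm mc (@mw L) mun); last first.
  by move=> z z' _ _ /marked_visits e; rewrite /unvis e.
rewrite big_bool /= [X in _ + X](_ : _ = 0) ?addr0; last first.
  apply: cent_det => //; apply: determines_sub det => z [Oz /=].
  by rewrite /unvis => /negbT; rewrite -lt0n.
rewrite (_ : _ `&` _ = unvisited L).
  exact: (cent_bound (measurable_unvisited L) fu mc (@mw L)).
by apply/seteqP; split=> z [Oz] /=; rewrite /unvis => /eqP.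
Qed.

Let last_visit n z : (0 < visits T B n z)%N -> exists i, [/\ (i < n)%N, B (iter i T z) &
  forall j, (i < j < n)%N -> ~ B (iter j T z)].
Proof.
elim: n => [|n IH]; first by rewrite visits0.
have [Bn _|nBn] := pselect (B (iter n T z)).
  by exists n; split=> // j /andP[nj]; rewrite ltnS leqNgt nj.
rewrite visitsS memNset // addn0 => /IH[i [iln Bi nB]].
exists i; split=> //; first exact: ltnW.
move=> j /andP[ij]; rewrite ltnS leq_eqVlt => /predU1P[->//|jn]; apply: nB; by rewrite ij.
Qed.

(** The last visit before time [L] is at some time [i <= l], and the excursion recorded there
    contains the letter at time [l]. *)
Let xi_determined : determines (Om `&` visits T B L @^-1` [set k | (0 < k)%N])
  (word T xi' L) (xi \o iter l T).
Proof.
move=> z z' [_ /= /last_visit[i [iL Bi _]]] _ e.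
have [_ /(_ Bi) ei] := marked_eqP (word_nth e iL).
have il : (l - i < L)%N by rewrite ltnS leq_subr.
by have := eta_xi ei il; rewrite -!iterD subnK.
Qed.

(** The return time recorded at the last visit before time [L] tells whether the next visit is at
    time [L]; values up to [L] are not affected by the truncation at [L.+1]. *)
Let mem_determined : determines (Om `&` visits T B L @^-1` [set k | (0 < k)%N])
  (word T xi' L) (fun z => iter L T z \in B).
Proof.
suff H z z' : (0 < visits T B L z)%N -> word T xi' L z = word T xi' L z' ->
    B (iter L T z) -> B (iter L T z').
  move=> z z' [_ /= vz] [_ /= vz'] e.
  by apply/idP/idP => /set_mem h; apply/mem_set; [apply: H e h|apply: H (esym e) h].
move=> /last_visit[i [iL Bi nB]] e BL.
have [Bi' /(_ Bi) ei] := marked_eqP (word_nth e iL); have {}Bi' := Bi'.1 Bi.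
have rz : return_time T B (iter i T z) = (L - i)%N.
  have p : (0 < L - i)%N by rewrite subn_gt0.
  rewrite -(prednK p); apply: return_time_eqS; first by rewrite prednK // -iterD subnK // ltnW.
  move=> j /andP[j0 jp]; rewrite -iterD; apply: nB.
  by move: jp; rewrite /L; lia.
have /eqP rz' : return_time T B (iter i T z') == (L - i)%N.
  by rewrite -(eta_return ei) ?leq_subr // rz.
have p : (0 < return_time T B (iter i T z'))%N by rewrite rz' subn_gt0.
have [k Bk] := return_time_gt0 p; have [_] := return_timeP Bk.
by rewrite /first_return rz' -iterD subnK // ltnW.
Qed.

(** The letter at time [l] is read off a block of [L] marked letters except on [unvisited L]. Blocks
    have no larger rate than single letters, since consecutive blocks share all but one letter. *)
Let rate_marked : entropy_rate m Om T xi <=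
  entropy_rate m Om T xi' + w (unvisited L) * ln #|A|%:R.
Proof.
have mxl : labelling (xi \o iter l T) by exact: labelling_iter.
rewrite -(entropy_rate_shift mT presT l mxi).
apply: le_trans (entropy_rate_cent mOm fOm mT presT mxl (@mw L)) _.
apply: lerD; last exact: visited_bound.
have step n : entropy_step m Om T (word T xi' L) n.+1 <= entropy_step m Om T xi' (n.+1 + l).
  pose b := word T xi' (n.+1 + l).
  have mb : labelling b by exact: mw.
  have mwL : labelling (word T xi' L \o iter n.+1 T) by exact: labelling_iter.
  have mww : labelling (word T (word T xi' L) n.+1) by exact: labelling_word.
  have mx : labelling (xi' \o iter (n.+1 + l) T) by exact: labelling_iter.
  apply: le_trans (cent_refine mOm fOm mwL mww mb _) _.
    move=> z z' _ _ e; apply: eq_word => j jn.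
    have [jl|lj] := ltnP j L.
      by apply: (word_nth (word_nth e (ltn0Sn n)) jl).
    have jln : (j - l < n.+1)%N by lia.
    have := word_nth (word_nth e jln) (ltnSn l).
    by rewrite -!iterD subnKC //; lia.
  have mp : labelling (pair_label (xi' \o iter (n.+1 + l) T) b) by exact: labelling_pair.
  apply: le_trans (cent_det_left mOm fOm mwL mp mb _) _.
    move=> z z' _ _ [e1 e2]; apply: eq_word => j; rewrite ltnS leq_eqVlt.
    case/predU1P => [->|jl]; first by rewrite -!iterD addnC.
    by rewrite -!iterD; apply: (word_nth e2); lia.
  rewrite (cent_pair mOm fOm) // [X in _ + X](_ : _ = 0) ?addr0 //.
  by apply: cent_det => // z z' _ _ [].
apply: limr_ge; first by apply/cvg_ex; eexists; exact: cvg_entropy_step.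
near=> n; have nl : (l < n)%N by near: n; exact: nbhs_infty_gt.
apply: le_trans (entropy_rate_le_step mOm fOm mT presT (n - l) (@mw L)) _.
have p : (0 < n - l)%N by rewrite subn_gt0.
by rewrite -(prednK p); apply: le_trans (step _) _; rewrite prednK // subnK // ltnW.
Unshelve. all: by end_near. Qed.

Section Slots.
Variables M k : nat.
Let D j := B `&` (iter j T @^-1` B `&` visits T B j @^-1` [set M]).
Let mD j : measurable (D j). Proof. exact: measurable_visits_slot. Qed.
Let fD j : (m (D j) < +oo)%E. Proof. by apply: fin_sub => // z [/BOm]. Qed.
Let F j := if (j <= k)%N then iter (k - j) T @^-1` (B `&` visits T B j @^-1` [set M]) else set0.
Let mF j : measurable (F j).
Proof.
rewrite /F; case: ifP => // _; apply: measurable_iter_preimage => //.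
by apply: measurableI => //; exact: measurable_visits.
Qed.
Let tF : trivIset setT F.
Proof.
move=> i j _ _ [z []]; rewrite /F; case: ifP => // ik [Bi vi]; case: ifP => // jk [Bj vj].
exact: back_slot_triv ik jk Bi Bj vi vj.
Qed.

Let D0 := Om `&` iter k T @^-1` B.
Let mD0 : measurable D0.
Proof. by apply: measurableI => //; exact: measurable_iter_preimage. Qed.
Let fD0 : (m D0 < +oo)%E. Proof. by apply: fin_sub => // z []. Qed.

(** On [F j] the [M]-th visit counted back from time [k] is at time [k - j]. From there on, the
    marked letters determine [M] letters of the induced process, and time [k] is reached by [M]
    steps of the return map. *)
Let slot_cent j : (j <= k)%N ->
  cent m (D0 `&` F j) (xi' \o iter k T) (word T xi' k) <=
  cent m (D j) (eta \o iter M S) (word S eta M).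
Proof.
move=> jk; have mS : measurable_fun [set: X] S := measurable_first_return.
have DE : D0 `&` F j = Om `&` iter (k - j) T @^-1` (D j).
  rewrite /F jk /D /D0; apply/seteqP; split=> z /=.
    by move=> [[Oz Bk] [Bj vj]]; split=> //; split=> //; split=> //; rewrite -iterD subnKC.
  by move=> [Oz [Bj [Bk vj]]]; split=> //; split=> //; move: Bk; rewrite -iterD subnKC.
have m0 : measurable (D0 `&` F j) by exact: measurableI.
have f0 : (m (D0 `&` F j) < +oo)%E by apply: fin_sub => // z [[]].
have m1 : labelling (xi' \o iter k T) by exact: labelling_iter.
have m2 : labelling (eta \o iter k T) by exact: labelling_iter.
have m3 : labelling (word T xi' j \o iter (k - j) T) by exact: labelling_iter.
apply: le_trans (cent_det_left m0 f0 m1 m2 (@mw k) _) _.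
  move=> z z' [[_ Bz] _] [[_ Bz'] _] /= e.
  by rewrite /marked !mem_set // e.
apply: le_trans (cent_refine m0 f0 m2 (@mw k) m3 _) _.
  move=> z z' _ _ e; apply: eq_word => i ij; rewrite -!iterD.
  by apply: (word_nth e); lia.
have m4 : labelling (eta \o iter j T) by exact: labelling_iter.
have m5 : labelling (eta \o iter M S) by exact: labelling_iter.
have m6 : labelling (word S eta M) by exact: labelling_word.
rewrite DE (_ : eta \o iter k T = (eta \o iter j T) \o iter (k - j) T); last first.
  by apply/funext => z /=; rewrite -iterD subnKC.
rewrite (cent_shift mT presT) // setIidr; last by move=> z [/BOm].
have SE z : D j z -> iter M S z = iter j T z.
  by move=> [Bz [Bj vj]]; rewrite -(iter_first_return Bz Bj) (vj : _ = M).
apply: le_trans (cent_det_left (mD j) (fD j) m4 m5 (@mw j) _) _.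
  by move=> z z' Dz Dz' /=; rewrite !SE.
apply: cent_refine => // z z' [Bz [Bj vj]] [Bz' [Bj' vj']] e.
apply: eq_word => i iM.
have : (i < visits T B j z)%N by rewrite (vj : _ = M).
move=> /visits_reached[i' [i'j vi Bi]].
have [h ei] := marked_eqP (word_nth e i'j); rewrite -vi iter_first_return // ei //.
suff -> : visits T B i' z = visits T B i' z' by rewrite iter_first_return //; exact/h.
apply: (marked_visits (eta := eta)); apply: eq_word => i0 i0i; apply: (word_nth e).
exact: ltn_trans i'j.
Qed.

(** The sets [F j] are recognised from the marked past. Shifted, they become disjoint pieces of [B],
    so their contributions add up to at most one increment of the induced process. Outside them
    there are fewer than [M] visits before time [k]. *)
Let returned_bound : cent m D0 (xi' \o iter k T) (word T xi' k) <=
  entropy_step m B S eta M +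
  w (few_visits M k) * ln #|{: option ('I_L.+2 * {ffun 'I_L -> A})}|%:R.
Proof.
have mS : measurable_fun [set: X] S := measurable_first_return.
have m1 : labelling (xi' \o iter k T) by exact: labelling_iter.
have [e [me eE eM]] := trivIset_label k.+1 mF tF.
rewrite (cent_label_det mD0 fD0 m1 (@mw k) me); last first.
  suff H z z' : D0 z -> D0 z' -> word T xi' k z = word T xi' k z' ->
      forall j, (j <= k)%N -> F j z -> F j z'.
    move=> z z' Dz Dz' ezz'; case: (unliftP ord_max (e z)) => [j|] ez.
      have ewj : lift ord_max j = widen_ord (leqnSn k.+1) j.
        by apply: val_inj; rewrite /= /bump leqNgt ltn_ord.
      rewrite ez ewj; apply/esym/eE; apply: H Dz Dz' ezz' _ _ _.
        by have := ltn_ord j; rewrite ltnS.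
      by apply/eE; rewrite ez.
    rewrite ez; apply/esym/eM => j; rewrite ltnS => jk Fj.
    by apply: ((eM z).1 ez j jk); apply: H (esym ezz') _ jk Fj.
  move=> [Oz Bz] [Oz' Bz'] ezz' j jk; rewrite /F jk => -[/= Bj vj]; split=> /=.
    have [j0|jp] := posnP j; first by rewrite j0 subn0.
    have kj : (k - j < k)%N by lia.
    by have [h _] := marked_eqP (word_nth ezz' kj); apply/h.
  rewrite -vj; apply/esym; apply: (marked_visits (eta := eta)); apply: eq_word => i ij.
  by rewrite -!iterD; apply: (word_nth ezz'); lia.
rewrite big_ord_recr /=; apply: lerD.
  apply: le_trans (_ : \sum_(j < k.+1) cent m (D j) (eta \o iter M S) (word S eta M) <= _).
    apply: ler_sum => j _; have := slot_cent (_ : (j <= k)%N); rewrite -ltnS ltn_ord => /(_ isT).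
    rewrite (_ : e @^-1` _ = F j) //; by apply/seteqP; split=> z /eE.
  apply: sum_cent_trivIset => //.
  - by apply: fin_sub.
  - exact: labelling_iter.
  - exact: labelling_word.
  - by move=> j z [].
  - by move=> i j _ _ [z [[Bz [Bi vi]] [_ [Bj vj]]]]; exact: visits_slot_triv Bz Bi Bj vi vj.
have mR : measurable (D0 `&` e @^-1` [set ord_max]) by exact: measurable_atom.
apply: le_trans (cent_bound mR _ m1 (@mw k)) _; first by apply: fin_sub => // z [[]].
apply: ler_wpM2r.
  by apply: ln_ge0; rewrite ler1n; apply/card_gt0P; exists None.
apply: fine_measure_le => //; first exact: measurable_few_visits.
  move=> z [[Oz Bz] /eM nF]; split=> //=; rewrite ltnNge; apply/negP => Mv.
  have [M0|Mp] := posnP M.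
    by apply: (nF 0%N) => //; rewrite /F leq0n subn0; split=> //=; rewrite visits0 M0.
  have lt : (visits T B k z - M < visits T B k z)%N by lia.
  have [i [ik vi Bi]] := visits_reached lt.
  apply: (nF (k - i)%N); first by rewrite ltnS leq_subr.
  rewrite /F leq_subr (subKn (ltnW ik)); split; first exact: Bi.
  suff : visits T B (k - i) (iter i T z) = M by [].
  by have := visitsD T B i (k - i) z; rewrite (subnKC (ltnW ik)) vi; lia.
by apply: fin_sub; [exact: measurable_few_visits|move=> z []].
Qed.

(** A marked letter is revealed in two stages: membership in [B], which is known from the last [L]
    letters unless these contain no visit, and then the induced letter. *)
Lemma marked_step_le : (L <= k)%N -> entropy_step m Om T xi' k <=
  w (unvisited L) * ln 2 + (entropy_step m B S eta M +
  w (few_visits M k) * ln #|{: option ('I_L.+2 * {ffun 'I_L -> A})}|%:R).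
Proof.
move=> Lk; pose be z := z \in B; have mbe : labelling be by exact: labelling_mem.
have m0 n : labelling (be \o iter n T) by exact: labelling_iter.
have m1 : labelling (xi' \o iter k T) by exact: labelling_iter.
have m2 : labelling (word T xi' L \o iter (k - L) T) by exact: labelling_iter.
have mp : labelling (pair_label (be \o iter k T) (xi' \o iter k T)) by exact: labelling_pair.
apply: le_trans (cent_det_left mOm fOm m1 mp (@mw k) _) _; first by move=> z z' _ _ [].
rewrite (cent_pair mOm fOm) //; apply: lerD.
  apply: le_trans (cent_refine mOm fOm (m0 k) (@mw k) m2 _) _.
    by move=> z z' _ _ e; apply: eq_word => i iL; rewrite -!iterD; apply: (word_nth e); lia.
  have := cent_shift mT presT (k - L) measurableT (m0 L) (@mw L).
  rewrite preimage_setT !setIT (_ : (be \o iter L T) \o _ = be \o iter k T); last first.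
    by apply/funext => z; rewrite /comp -iterD subnKC.
  by move=> ->; have := visited_bound (m0 L) mem_determined; rewrite card_bool.
have mq : labelling (pair_label (be \o iter k T) (word T xi' k)) by exact: labelling_pair.
have mq' : labelling (pair_label (word T xi' k) (be \o iter k T)) by exact: labelling_pair.
apply: le_trans (cent_refine mOm fOm m1 mq mq' _) _; first by move=> z z' _ _ [] /= e1 e2; congr pair.
rewrite cent_label big_bool /= [X in _ + X](_ : _ = 0) ?addr0; last first.
  by apply: cent_det => // z z' [_ /= nz] [_ /= nz'] _; rewrite /marked -/(be _) nz -/(be _) nz'.
rewrite [X in cent _ X](_ : _ = D0); first exact: returned_bound.
by apply/seteqP; split=> z [Oz] /=; [move=> /set_mem|move=> /mem_set].
Qed.

End Slots.

Lemma entropy_rate_le_first_return : entropy_rate m Om T xi <=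
  entropy_rate m B S eta + w (unvisited L) * (ln #|A|%:R + ln 2).
Proof.
have fB : (m B < +oo)%E by exact: fin_sub.
have mS : measurable_fun [set: X] S := measurable_first_return.
have presS : forall E, measurable E -> m (B `&` S @^-1` E) = m (B `&` E).
  by move=> E; exact: first_return_preserve.
rewrite mulrDr addrCA -lerBlDl; apply: le_trans (_ : entropy_rate m Om T xi' <= _).
  by rewrite lerBlDl; have := rate_marked; lra.
rewrite -lerBlDr.
apply: limr_ge; first by apply/cvg_ex; eexists; exact: cvg_entropy_step.
near=> M; rewrite lerBlDr; apply/ler_addgt0Pr => e e0.
pose c := ln #|{: option ('I_L.+2 * {ffun 'I_L -> A})}|%:R : R.
have c0 : 0 <= c by apply: ln_ge0; rewrite ler1n; apply/card_gt0P; exists None.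
have [N HN] := fine_few_visits_small M (divr_gt0 e0 (ltr_pwDr ltr01 c0)).
pose k := maxn N L; have fk := HN k (leq_maxl _ _).
have := entropy_rate_le_step mOm fOm mT presT k mxi'.
have := marked_step_le M (leq_maxr N L); rewrite -/k -/c.
have : w (few_visits M k) * c <= e.
  apply: le_trans (_ : w (few_visits M k) * (c + 1) <= e); last first.
    by rewrite -ler_pdivlMr ?ltW // ltr_pwDr.
  by apply: ler_wpM2l; [exact: fine_ge0|lra].
by lra.
Unshelve. all: by end_near. Qed.

Lemma labelling_excursion : labelling eta. Proof. exact: meta. Qed.

End Upper.

End Induction.

(** * Entropy as a supremum over partitions *)

Section TotalEntropy.
Context d (X : measurableType d) (R : realType) (m : {measure set X -> \bar R}).

Definition total_entropy (D : set X) (T : X -> X) : \bar R :=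
  ereal_sup [set e | exists k (xi : X -> 'I_k),
    labelling xi /\ e = (entropy_rate m D T xi)%:E].

Lemma entropy_rate_le_total (D : set X) (T : X -> X) (A : finType) (a : X -> A) :
  measurable D -> (m D < +oo)%E -> measurable_fun [set: X] T ->
  (forall E, measurable E -> m (D `&` T @^-1` E) = m (D `&` E)) -> labelling a ->
  ((entropy_rate m D T a)%:E <= total_entropy D T)%E.
Proof.
move=> mD fD mT presT ma; have mr : labelling (enum_rank \o a) by exact: labelling_comp.
apply: le_trans (_ : ((entropy_rate m D T (enum_rank \o a))%:E <= _)%E).
  rewrite lee_fin; apply: entropy_rate_det => //.
  by move=> z z' _ _ /= /enum_rank_inj.
by apply: ereal_sup_ubound; exists #|A|, (enum_rank \o a).
Qed.

Lemma total_entropy_le (D : set X) (T : X -> X) (x : \bar R) :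
  (forall k (xi : X -> 'I_k), labelling xi -> ((entropy_rate m D T xi)%:E <= x)%E) ->
  (total_entropy D T <= x)%E.
Proof. by move=> h; apply: ge_ereal_sup => _ [k [xi [mxi ->]]]; exact: h. Qed.

Context (Om : set X) (mOm : measurable Om) (fOm : (m Om < +oo)%E).
Local Notation preserves T := (forall E, measurable E -> m (Om `&` T @^-1` E) = m (Om `&` E)).

Section Induced.
Context (T : X -> X) (mT : measurable_fun [set: X] T) (presT : preserves T).

(* Abramov's formula, which has no factor as the entropy is not normalised. *)
Lemma total_entropy_first_return (B : set X) : measurable B -> B `<=` Om ->
  m (Om `&` [set z | forall n, ~ B (iter n T z)]) = 0%E ->
  total_entropy B (first_return T B) = total_entropy Om T.
Proof.
move=> mB BOm hit; apply/eqP; rewrite eq_le; apply/andP; split.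
  apply: ge_ereal_sup => _ [k [eta [meta ->]]].
  apply: le_trans (_ : ((entropy_rate m Om T (marked B eta))%:E <= _)%E).
    by rewrite lee_fin; exact: entropy_rate_first_return_le.
  by apply: entropy_rate_le_total => //; exact: labelling_marked.
apply: total_entropy_le => k xi mxi; apply/lee_addgt0Pr => e e0.
pose c := ln #|'I_k|%:R + ln 2 : R.
have c0 : 0 <= c.
  rewrite addr_ge0 ?ln_ge0 ?ler1n //; apply/card_gt0P; exists (xi point) => //.
have [N HN] := fine_unvisited_small mOm fOm mT mB hit (divr_gt0 e0 (ltr_pwDr ltr01 c0)).
have := HN N.+1 (leqnSn N); have := entropy_rate_le_first_return mOm fOm mT presT mB BOm hit mxi N.
set r := entropy_rate m B _ _ => h1 h2.
apply: le_trans (_ : (r%:E + e%:E <= _)%E).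
  rewrite -EFinD lee_fin; apply: le_trans h1 _; rewrite lerD2l -/c.
  apply: le_trans (_ : fine (m (unvisited Om T B N.+1)) * (c + 1) <= e); last first.
    by rewrite -ler_pdivlMr ?ltW // ltr_pwDr.
  by apply: ler_wpM2l; [exact: fine_ge0|rewrite lerDl].
rewrite leeD2r //.
have mS : measurable_fun [set: X] (first_return T B) by exact: measurable_first_return.
have presS : forall E, measurable E -> m (B `&` first_return T B @^-1` E) = m (B `&` E).
  by move=> E; exact: (first_return_preserve mOm).
have fB : (m B < +oo)%E by exact: fin_sub BOm.
pose eta z : 'I_N.+3 * {ffun 'I_N.+1 -> 'I_k} :=
  (inord (minn (return_time T B z) N.+2), word T xi N.+1 z).
have meta : labelling eta by exact: labelling_excursion.
exact: (entropy_rate_le_total mB fB mS presS meta).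
Qed.

(** A word of [n] pairs under the square of [T] and a word of [n.*2] letters under [T] determine
    each other. *)
Lemma entropy_rate_square (A : finType) (a : X -> A) : labelling a ->
  entropy_rate m Om (T \o T) (pair_label a (a \o T)) = 2 * entropy_rate m Om T a.
Proof.
move=> ma; have mTT : measurable_fun [set: X] (T \o T) by exact: measurableT_comp.
have presTT : preserves (T \o T).
  move=> E mE; rewrite comp_preimage presT; first exact: presT.
  by apply: (measurable_iter_preimage mT 1).
have mp : labelling (pair_label a (a \o T)).
  by apply: labelling_pair => //; exact: (labelling_iter mT 1).
have itE n z : iter n (T \o T) z = iter n.*2 T z by elim: n => //= n ->.
have c1 := cvg_ent_word mOm fOm mTT presTT mp.
have c2 : ent m Om (word T a n.*2) / n%:R @[n --> \oo] --> 2 * entropy_rate m Om T a.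
  have E : (fun n => ent m Om (word T a n.*2) / n%:R) =
      (fun n => 2 * (ent m Om (word T a n.*2) / (n.*2)%:R)).
    by apply/funext => n; rewrite -muln2 natrM invfM; lra.
  rewrite E; apply: cvgMr.
  apply: (cvg_comp _ _ _ (cvg_ent_word mOm fOm mT presT ma)).
  by move=> P [N _ HN]; exists N => // n /= Nn; apply: HN => /=; rewrite -addnn; lia.
apply: (cvg_unique _ c1) => //; apply: cvg_trans c2; apply: near_eq_cvg; near=> n.
congr (_ / _); apply: ent_eq => //; try exact: labelling_word.
  move=> z z' _ _ e; apply: eq_word => j jn.
  have jn' : (j./2 < n)%N by lia.
  have := word_nth e jn'; rewrite /pair_label /= !itE -!iterS => -[e1 e2].
  by rewrite -(odd_double_half j); case: (odd j).
move=> z z' _ _ e; apply: eq_word => j jn.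
have j0 : (j.*2 < n.*2)%N by lia.
have j1 : (j.*2.+1 < n.*2)%N by lia.
by rewrite /pair_label /= !itE -!iterS (word_nth e j0) (word_nth e j1).
Unshelve. all: by end_near. Qed.

Lemma total_entropy_square : total_entropy Om (T \o T) = (2%:E * total_entropy Om T)%E.
Proof.
have mTT : measurable_fun [set: X] (T \o T) by exact: measurableT_comp.
have presTT : preserves (T \o T).
  move=> E mE; rewrite comp_preimage presT; first exact: presT.
  by apply: (measurable_iter_preimage mT 1).
have mp (A : finType) (a : X -> A) : labelling a -> labelling (pair_label a (a \o T)).
  by move=> ma; apply: labelling_pair => //; exact: (labelling_iter mT 1).
apply/eqP; rewrite eq_le; apply/andP; split.
  apply: ge_ereal_sup => _ [k [xi [mxi ->]]].
  apply: le_trans (_ : ((2 * entropy_rate m Om T xi)%:E <= _)%E).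
    rewrite lee_fin -entropy_rate_square //; apply: entropy_rate_det => //; first exact: mp.
    by move=> z z' _ _ [].
  by rewrite EFinM lee_pmul2l //; exact: (entropy_rate_le_total mOm fOm).
rewrite -lee_pdivlMl //; apply: total_entropy_le => k xi mxi.
rewrite lee_pdivlMl // -EFinM -entropy_rate_square //.
exact: (entropy_rate_le_total mOm fOm mTT presTT (mp _ _ mxi)).
Qed.

End Induced.

Lemma measure_eq_mod0 (A B N : set X) : measurable A -> measurable B -> measurable N ->
  m N = 0%E -> (forall z, ~ N z -> A z <-> B z) -> m A = m B.
Proof.
move=> mA mB mN N0 AB.
have H (C D : set X) : measurable C -> measurable D -> (forall z, ~ N z -> C z -> D z) ->
    (m C <= m D)%E.
  move=> mC mD CD; apply: (@le_trans _ _ (m (D `|` N))).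
    apply: le_measure; rewrite ?inE //; first exact: measurableU.
    by move=> z Cz; have [Nz|nN] := pselect (N z); [right|left; exact: CD].
  by rewrite -[leRHS]adde0 -N0; exact: measureU2.
by apply/eqP; rewrite eq_le !H // => z /AB [].
Qed.

Lemma entropy_rate_ae (T T' : X -> X) (N : set X) (A : finType) (a : X -> A) :
  measurable_fun [set: X] T -> measurable_fun [set: X] T' ->
  preserves T -> measurable N -> m (Om `&` N) = 0%E ->
  (forall z, Om z -> ~ N z -> T z = T' z) -> labelling a ->
  entropy_rate m Om T a = entropy_rate m Om T' a.
Proof.
move=> mT mT' presT mN N0 TT' ma.
(* All preimages of [N] and of the complement of [Om]: off this null set the two orbits agree for
   ever. *)
pose N1 := \bigcup_n (Om `&` iter n T @^-1` (N `|` ~` Om)).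
have mU : measurable (N `|` ~` Om) by apply: measurableU => //; exact: measurableC.
have mN1 : measurable N1.
  by apply: bigcupT_measurable => n; apply: measurableI => //; exact: measurable_iter_preimage.
have N10 : m N1 = 0%E.
  apply: null_bigcup => n; first by apply: measurableI => //; exact: measurable_iter_preimage.
  by rewrite preserve_iter // setIUr setICr setU0.
have it z n : Om z -> ~ N1 z -> iter n T z = iter n T' z.
  move=> Oz nN; elim: n => [//|n IH]; rewrite !iterS -IH; apply: TT'.
    by apply: contrapT => nO; apply: nN; exists n => //; split=> //; right.
  by move=> Nz; apply: nN; exists n => //; split=> //; left.
have pE (C : finType) (c c' : X -> C) : labelling c -> labelling c' ->
    (forall z, Om z -> ~ N1 z -> c z = c' z) -> pmass m Om c = pmass m Om c'.
  move=> mc mc' cc'; apply/funext => i; congr fine.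
  apply: (measure_eq_mod0 _ _ mN1 N10); try exact: measurable_atom.
  by move=> z nN; split=> -[Oz /= ci]; split=> //=; rewrite -ci cc'.
congr (limn _); apply/funext => n; apply: eq_bigr => j _; apply: eq_bigr => i _.
have mw : labelling (word T a n) by exact: labelling_word.
have mw' : labelling (word T' a n) by exact: labelling_word.
have mi : labelling (a \o iter n T) by exact: labelling_iter.
have mi' : labelling (a \o iter n T') by exact: labelling_iter.
have wE z : Om z -> ~ N1 z -> word T a n z = word T' a n z.
  by move=> Oz nN; apply/ffunP => k; rewrite !ffunE it.
congr klog; last by rewrite (pE _ _ _ mw mw' wE).
rewrite (pE _ _ (pair_label (a \o iter n T') (word T' a n))) //; try exact: labelling_pair.
by move=> z Oz nN; rewrite /pair_label /= wE // it.
Qed.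

Lemma total_entropy_ae (T T' : X -> X) (N : set X) :
  measurable_fun [set: X] T -> measurable_fun [set: X] T' ->
  preserves T -> measurable N -> m (Om `&` N) = 0%E ->
  (forall z, Om z -> ~ N z -> T z = T' z) -> total_entropy Om T = total_entropy Om T'.
Proof.
move=> mT mT' presT mN N0 TT'; congr ereal_sup; apply/seteqP; split=> e [k [xi [mxi ->]]].
  by exists k, xi; split=> //; rewrite (entropy_rate_ae mT mT' presT mN N0).
by exists k, xi; split=> //; rewrite -(entropy_rate_ae mT mT' presT mN N0).
Qed.

End TotalEntropy.

(** * Quiltings without exceptional sets *)

Section Recurrence.
Context d (X : measurableType d) (R : realType) (m : {measure set X -> \bar R}).

Lemma measure_sub_eq (A B : set X) : measurable A -> measurable B -> A `<=` B ->
  (m B < +oo)%E -> m A = m B -> m (B `\` A) = 0%E.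
Proof.
move=> mA mB AB fB AeB.
have -> : m (B `\` A) = (m B - m A)%E by rewrite measureD // (setIidr AB).
by rewrite AeB subee // ge0_fin_numE.
Qed.

Section Poincare.
Context (Y : set X) (mY : measurable Y) (fY : (m Y < +oo)%E).
Context (T : X -> X) (mT : measurable_fun [set: X] T).
Context (presT : forall E, measurable E -> m (Y `&` T @^-1` E) = m (Y `&` E)).

(** The sets [En k] of points that visit [E] at some time from [k] on decrease, and each is the
    preimage of the previous one, so that within [Y] they have equal finite measures. The starting
    point may be outside [E]. *)
Lemma poincare_recurrence (E : set X) : measurable E ->
  exists N, [/\ measurable N, m N = 0%E & forall z, Y z -> ~ N z ->
    (exists n, E (iter n T z)) -> forall k, exists n, (k <= n)%N /\ E (iter n T z)].
Proof.
move=> mE; pose En k := \bigcup_(n in [set n | (k <= n)%N]) iter n T @^-1` E.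
have mEn k : measurable (En k).
  by apply: bigcup_measurable => n _; exact: measurable_iter_preimage.
have EnS k : En k.+1 = T @^-1` En k.
  apply/seteqP; split=> z /= [n].
    by case: n => // n /= kn; rewrite /preimage /= -iterS iterSr => En'; exists n.
  by move=> /= kn En'; exists n.+1 => //=; rewrite /preimage /= -iterS iterSr.
have sEn k : En k.+1 `<=` En k by move=> z [n /= kn Ez]; exists n => //=; exact: ltnW.
exists (\bigcup_k ((Y `&` En k) `\` (Y `&` En k.+1))); split.
- by apply: bigcupT_measurable => k; apply: measurableD; exact: measurableI.
- apply: null_bigcup => k; first by apply: measurableD; exact: measurableI.
  apply: measure_sub_eq; try exact: measurableI.
  + by move=> z [Yz /sEn].
  + by apply: le_lt_trans fY; apply: le_measure; rewrite ?inE //; exact: measurableI.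
  + by rewrite EnS presT.
- move=> z Yz nN [n0 En0] k.
  suff [n /= kn Ez] : En k z by exists n.
  elim: k => [|k IH]; first by exists n0.
  apply: contrapT => nE; apply: nN; exists k => //; split=> //; by case.
Qed.

End Poincare.

Lemma image_pieces (N : set X) (P : nat -> set X) (h : nat -> X -> X) (s : X -> X) :
  (forall i, measurable (P i)) -> trivIset setT P -> N = \bigcup_i P i ->
  (forall i z, P i z -> s z = h i z) ->
  (forall i E, measurable E -> E `<=` P i -> measurable (h i @` E) /\ m (h i @` E) = m E) ->
  (forall z z', N z -> N z' -> s z = s z' -> z = z') ->
  forall E, measurable E -> E `<=` N -> measurable (s @` E) /\ m (s @` E) = m E.
Proof.
move=> mP tP NP sh him sinj E mE EN.
have EE : E = \bigcup_i (E `&` P i) by rewrite -setI_bigcupr -NP setIidl.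
have sE : s @` E = \bigcup_i (h i @` (E `&` P i)).
  rewrite {1}EE image_bigcup; apply: eq_bigcup => // i _.
  by apply: eq_imagel => z [_ /sh].
have mi i : measurable (E `&` P i) by exact: measurableI.
have [mh eh] : (forall i, measurable (h i @` (E `&` P i))) /\
    (forall i, m (h i @` (E `&` P i)) = m (E `&` P i)).
  by split=> i; have [] := him i (E `&` P i) (mi i) (@subIsetr _ _ _).
split; first by rewrite sE; exact: bigcupT_measurable.
rewrite sE measure_bigcup //; last first.
  move=> i j _ _ [w [[z [Ez Pz] zw] [z' [Ez' Pz'] zw']]].
  have zz' : z = z' by apply: sinj; [exact: EN|exact: EN|rewrite (sh i) // (sh j) // zw].
  by apply: (tP i j I I); exists z; split=> //; rewrite zz'.
rewrite [in RHS]EE measure_bigcup //; first by apply: eq_eseriesr => i _; rewrite eh.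
move=> i j _ _ [z [[_ Pi] [_ Pj]]]; apply: (tP i j I I); by exists z.
Qed.

(** Images preserving measure give one inequality for [E]; the same inequality for its complement,
    with the finiteness of [m N], gives the other. *)
Lemma preserve_of_image (N : set X) (s : X -> X) : measurable N -> (m N < +oo)%E ->
  measurable_fun [set: X] s -> (forall z, N z -> N (s z)) ->
  (forall E, measurable E -> E `<=` N -> measurable (s @` E) /\ m (s @` E) = m E) ->
  forall E, measurable E -> m (N `&` s @^-1` E) = m (N `&` E).
Proof.
move=> mN fN ms sN im E mE.
have ms' E' : measurable E' -> measurable (s @^-1` E').
  by move=> ?; rewrite -[X in measurable X]setTI; exact: ms.
have H E' : measurable E' -> (m (N `&` s @^-1` E') <= m (N `&` E'))%E.
  move=> mE'; have mi : measurable (N `&` s @^-1` E') by apply: measurableI => //; exact: ms'.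
  have [mim <-] := im _ mi (@subIsetl _ _ _).
  apply: le_measure; rewrite ?inE //; first exact: measurableI.
  by move=> _ [z [Nz Ez] <-]; split=> //; exact: sN.
have fs D : measurable D -> D `<=` N -> (m D < +oo)%E.
  by move=> mD DO; apply: le_lt_trans fN; apply: le_measure; rewrite ?inE.
have split E' : measurable E' -> fine (m N) = fine (m (N `&` E')) + fine (m (N `&` ~` E')).
  move=> mE'; have mC := measurableC mE'.
  rewrite -fine_measureU -?setIUr ?setUv ?setIT //; try exact: measurableI.
  by rewrite setIACA setICr setI0.
have Hr E' : measurable E' -> fine (m (N `&` s @^-1` E')) <= fine (m (N `&` E')).
  move=> mE'; have m1 : measurable (N `&` s @^-1` E') by apply: measurableI => //; exact: ms'.
  have m2 : measurable (N `&` E') by exact: measurableI.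
  by apply: fine_le; rewrite ?ge0_fin_numE ?fs //; exact: H.
have := Hr _ mE; have := Hr _ (measurableC mE); have := split _ mE; have := split _ (ms' _ mE).
rewrite preimage_setC => e1 e2 h1 h2.
have e : fine (m (N `&` s @^-1` E)) = fine (m (N `&` E)) by lra.
have m1 : measurable (N `&` s @^-1` E) by apply: measurableI => //; exact: ms'.
have m2 : measurable (N `&` E) by exact: measurableI.
rewrite -[LHS]fineK; last by rewrite ge0_fin_numE // fs.
by rewrite e fineK // ge0_fin_numE // fs.
Qed.

End Recurrence.

(** * Towers and exact quiltings *)

Section Tower.
Context (X : Type).

Definition in_tower (S : X -> X) (C : nat -> set X) (h : nat -> nat) : set X :=
  [set z | exists i j c, [/\ (0 < j <= h i)%N, C i c & z = iter j S c]].

Definition levels_disjoint (S : X -> X) (C : nat -> set X) (h : nat -> nat) :=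
  forall i i' j j' c c', C i c -> C i' c' -> (0 < j <= h i)%N -> (0 < j' <= h i')%N ->
    iter j S c = iter j' S c' -> i = i' /\ j = j'.

End Tower.

(** Preservation of measure is required only for subsets on which the map is injective: in a
    quilting each map is injective on its own domain but need not be on the union of both. *)
Definition image_preserving d (X : measurableType d) (R : realType)
    (m : {measure set X -> \bar R}) (D : set X) (S : X -> X) :=
  forall E, measurable E -> E `<=` D -> measurable (S @` E) /\
    ((forall z z', E z -> E z' -> S z = S z' -> z = z') -> m (S @` E) = m E).

(* A quilting whose equalities and disjointness relations hold everywhere, as
   they do after removing a suitable null set. *)
Record quilt_model d (X : measurableType d) (R : realType) (m : {measure set X -> \bar R})
    (F G : X -> X) (Of Og : set X) (C : nat -> set X) (dn an : nat -> nat) : Prop := QuiltModel {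
  qm_mF : measurable_fun [set: X] F;
  qm_mG : measurable_fun [set: X] G;
  qm_mOf : measurable Of;
  qm_mOg : measurable Og;
  qm_fOf : (m Of < +oo)%E;
  qm_fOg : (m Og < +oo)%E;
  qm_mC : forall i, measurable (C i);
  qm_F_in : forall z, Of z -> Of (F z);
  qm_F_inj : forall z z', Of z -> Of z' -> F z = F z' -> z = z';
  qm_F_sur : forall w, Of w -> exists2 z, Of z & F z = w;
  qm_G_in : forall z, Og z -> Og (G z);
  qm_G_inj : forall z z', Og z -> Og z' -> G z = G z' -> z = z';
  qm_G_sur : forall w, Og w -> exists2 z, Og z & G z = w;
  qm_F_im : image_preserving m (Of `|` Og) F;
  qm_G_im : image_preserving m (Of `|` Og) G;
  qm_C_sub : forall i, C i `<=` Of;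
  qm_C_triv : forall i j z, C i z -> C j z -> i = j;
  qm_agree : forall z, Of z -> Og z -> (forall i, ~ C i z) -> F z = G z;
  qm_orbit : forall i z, C i z -> iter (dn i).+1 F z = iter (an i).+1 G z;
  qm_F_lev : levels_disjoint F C dn;
  qm_G_lev : levels_disjoint G C an;
  qm_Og : Og = (Of `\` in_tower F C dn) `|` in_tower G C an;
  qm_disj : (Of `\` in_tower F C dn) `&` in_tower G C an = set0
}.

(** * Strands in an exact quilting *)

Section Model.
Context d (X : measurableType d) (R : realType) (m : {measure set X -> \bar R}).
Context (F G : X -> X) (Of Og : set X) (C : nat -> set X) (dn an : nat -> nat).
Context (Q : quilt_model m F G Of Og C dn an).
Local Notation U := (in_tower F C dn).
Local Notation V := (in_tower G C an).

Let mF := qm_mF Q.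
Let mG := qm_mG Q.
Let mOf := qm_mOf Q.
Let mOg := qm_mOg Q.
Let fOf := qm_fOf Q.
Let fOg := qm_fOg Q.
Let mC := qm_mC Q.

Definition common : set X := Of `\` U.
Local Notation Z := common.

Lemma iter_F_in n z : Of z -> Of (iter n F z).
Proof. by move=> Oz; elim: n => //= n; exact: (qm_F_in Q). Qed.

Lemma iter_G_in n z : Og z -> Og (iter n G z).
Proof. by move=> Oz; elim: n => //= n; exact: (qm_G_in Q). Qed.

Lemma iter_F_inj n z z' : Of z -> Of z' -> iter n F z = iter n F z' -> z = z'.
Proof.
move=> Oz Oz'; elim: n => //= n IH e; apply: IH.
by apply: (qm_F_inj Q) e; exact: iter_F_in.
Qed.

Lemma common_Og z : Z z -> Og z. Proof. by rewrite (qm_Og Q); left. Qed.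

Lemma common_notV z : Z z -> ~ V z.
Proof. by move=> Zz Vz; have : (Z `&` V) z by []; rewrite (qm_disj Q). Qed.

Lemma tower_Og z : V z -> Og z. Proof. by rewrite (qm_Og Q); right. Qed.

Lemma Og_cases z : Og z -> Z z \/ V z.
Proof. by rewrite (qm_Og Q). Qed.

Lemma level_F_in i j c : C i c -> (0 < j <= dn i)%N -> U (iter j F c).
Proof. by move=> Cc jd; exists i, j, c. Qed.

Lemma level_G_in i j c : C i c -> (0 < j <= an i)%N -> V (iter j G c).
Proof. by move=> Cc jd; exists i, j, c. Qed.

Lemma F_preserve E : measurable E -> m (Of `&` F @^-1` E) = m (Of `&` E).
Proof.
apply: preserve_of_image => //; first exact: (qm_F_in Q).
move=> E' mE' sE'; have [mim eim] := qm_F_im Q mE' (subset_trans sE' (@subsetUl _ _ _)).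
split=> //; apply: eim => z z' /sE' Oz /sE'; exact: (qm_F_inj Q).
Qed.

Lemma G_preserve E : measurable E -> m (Og `&` G @^-1` E) = m (Og `&` E).
Proof.
apply: preserve_of_image => //; first exact: (qm_G_in Q).
move=> E' mE' sE'; have [mim eim] := qm_G_im Q mE' (subset_trans sE' (@subsetUr _ _ _)).
split=> //; apply: eim => z z' /sE' Oz /sE'; exact: (qm_G_inj Q).
Qed.

Lemma image_iter_F n E : measurable E -> E `<=` Of ->
  measurable (iter n F @` E) /\ m (iter n F @` E) = m E.
Proof.
move=> mE EO; elim: n => [|n [mn en]]; first by rewrite image_id.
have sO : iter n F @` E `<=` Of by move=> _ [z /EO Oz <-]; exact: iter_F_in.
have [mS eS] := qm_F_im Q mn (subset_trans sO (@subsetUl _ _ _)).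
rewrite (_ : iter n.+1 F @` E = F @` (iter n F @` E)); last by rewrite -image_comp.
split=> //; rewrite eS // => z z' /sO Oz /sO; exact: (qm_F_inj Q).
Qed.

Lemma level_G_sub i j : (0 < j <= an i)%N -> iter j G @` C i `<=` Og.
Proof. by move=> ja _ [c Cc <-]; apply: tower_Og; exact: level_G_in Cc ja. Qed.

(** The orbit relation transports injectivity from [F]: points of [C i] with equal [j]-th images
    under [G] have equal images under the iterate of [G] that coincides with an iterate of [F]. *)
Lemma iter_G_inj_C i j z z' : (j <= an i)%N -> C i z -> C i z' ->
  iter j G z = iter j G z' -> z = z'.
Proof.
move=> ja Cz Cz' e; apply: (iter_F_inj (n := (dn i).+1)).
- exact: (qm_C_sub Q Cz).
- exact: (qm_C_sub Q Cz').
- by rewrite (qm_orbit Q Cz) (qm_orbit Q Cz') -(subnK (leqW ja)) !iterD e.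
Qed.

Lemma image_iter_G i j E : (j <= an i)%N -> measurable E -> E `<=` C i ->
  measurable (iter j G @` E) /\ m (iter j G @` E) = m E.
Proof.
move=> + mE EC; elim: j => [|j IH] ja; first by rewrite image_id.
have [mn en] := IH (ltnW ja).
have sO : iter j G @` E `<=` Of `|` Og.
  case: (posnP j) => [->|j0].
    by rewrite image_id => z /EC Cz; left; exact: (qm_C_sub Q) Cz.
  move=> _ [z /EC Cz <-]; right; apply: (@level_G_sub i j); first by rewrite j0 ltnW.
  by exists z.
have [mS eS] := qm_G_im Q mn sO.
rewrite (_ : iter j.+1 G @` E = G @` (iter j G @` E)); last by rewrite -image_comp.
split=> //; rewrite eS // => _ _ [z Ez <-] [z' Ez' <-] e.
by congr (iter j G _); apply: (iter_G_inj_C ja (EC _ Ez) (EC _ Ez')).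
Qed.

Lemma towerE (S : X -> X) (h : nat -> nat) : in_tower S C h =
  \bigcup_i \bigcup_(j in [set j | (0 < j <= h i)%N]) (iter j S @` C i).
Proof.
apply/seteqP; split=> z; first by move=> [i [j [c [jh Cc ->]]]]; exists i => //; exists j => //; exists c.
by move=> [i _ [j /= jh [c Cc <-]]]; exists i, j, c.
Qed.

Lemma measurable_U : measurable U.
Proof.
rewrite towerE; apply: bigcupT_measurable => i; apply: bigcup_measurable => j _.
by have [] := image_iter_F j (mC i) (fun z Cz => qm_C_sub Q Cz).
Qed.

Lemma measurable_V : measurable V.
Proof.
rewrite towerE; apply: bigcupT_measurable => i; apply: bigcup_measurable => j /= /andP[_ ja].
by have [] := image_iter_G ja (mC i) (@subset_refl _ _).
Qed.

Lemma measurable_common : measurable Z.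
Proof. by apply: measurableD => //; exact: measurable_U. Qed.

Definition base : set X := \bigcup_i C i.

Lemma measurable_base : measurable base. Proof. exact: bigcupT_measurable. Qed.

Definition base_index z : nat := xget 0%N [set i | C i z].

Lemma base_indexE i z : C i z -> base_index z = i.
Proof.
by move=> Cz; apply: xget_unique => //= j /= Cj; exact: (qm_C_triv Q) Cj Cz.
Qed.

Definition jump (h : nat -> nat) z : nat := if pselect (base z) then (h (base_index z)).+1 else 1%N.

Lemma jump_base h i z : C i z -> jump h z = (h i).+1.
Proof.
move=> Cz; rewrite /jump; case: pselect => [b|[]]; last by exists i.
by rewrite (base_indexE Cz).
Qed.

Lemma jump_notbase h z : ~ base z -> jump h z = 1%N.
Proof. by rewrite /jump; case: pselect. Qed.

Lemma jump_gt0 h z : (0 < jump h z)%N. Proof. by rewrite /jump; case: pselect. Qed.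

(* Follows the orbits of [F] and of [G] simultaneously. *)
Definition strand z : X := iter (jump dn z) F z.
Local Notation s := strand.

Lemma strand_G z : Of z -> Og z -> s z = iter (jump an z) G z.
Proof.
move=> Oz Oz'; rewrite /s; have [[i _ Cz]|nC] := pselect (base z).
  by rewrite !(jump_base _ Cz) (qm_orbit Q Cz).
rewrite !jump_notbase //=; apply: (qm_agree Q) => // i Ci; apply: nC; by exists i.
Qed.

Lemma strand_Of z : Of z -> Of (s z). Proof. exact: iter_F_in. Qed.

Lemma strand_Og z : Of z -> Og z -> Og (s z).
Proof. by move=> Oz Oz'; rewrite strand_G //; exact: iter_G_in. Qed.

Lemma iter_strand_Of n z : Of z -> Of (iter n s z).
Proof. by move=> Oz; elim: n => //= n; exact: strand_Of. Qed.

Lemma iter_strand_Og n z : Of z -> Og z -> Og (iter n s z).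
Proof.
by move=> Oz Oz'; elim: n => //= n; apply: strand_Og; exact: iter_strand_Of.
Qed.

Definition strand_time h k z : nat := \sum_(i < k) jump h (iter i s z).

Lemma strand_timeS h k z : strand_time h k.+1 z = (strand_time h k z + jump h (iter k s z))%N.
Proof. by rewrite /strand_time big_ord_recr. Qed.

Lemma strand_timeSr h k z : strand_time h k.+1 z = (jump h z + strand_time h k (s z))%N.
Proof.
rewrite /strand_time big_ord_recl /=; congr addn; apply: eq_bigr => i _.
by rewrite -iterSr.
Qed.

Lemma leq_strand_time h k z : (k <= strand_time h k z)%N.
Proof. by elim: k => // k IH; rewrite strand_timeS -addn1 leq_add ?jump_gt0. Qed.

Lemma iter_strand_F k z : iter k s z = iter (strand_time dn k z) F z.
Proof.
elim: k => [|k IH]; first by rewrite /strand_time big_ord0.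
by rewrite iterS strand_timeS addnC iterD -IH.
Qed.

Lemma iter_strand_G k z : Of z -> Og z -> iter k s z = iter (strand_time an k z) G z.
Proof.
move=> Oz Oz'; elim: k => [|k IH]; first by rewrite /strand_time big_ord0.
rewrite iterS strand_timeS addnC iterD -IH strand_G //; first exact: iter_strand_Of.
exact: iter_strand_Og.
Qed.

(** A jump passes only over levels of the removed towers, so a strand cannot skip a visit to the
    common part. *)
Lemma strand_meets_F n z : Of z -> Og z -> Z (iter n F z) -> exists k, strand_time dn k z = n.
Proof.
elim/ltn_ind: n z => n IH z Oz Oz' Zn.
have [->|n0] := posnP n; first by exists 0%N; rewrite /strand_time big_ord0.
have jn : (jump dn z <= n)%N.
  have [[i _ Cz]|/jump_notbase -> //] := pselect (base z).
  rewrite (jump_base _ Cz) ltnNge; apply/negP => nd.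
  by case: Zn => _; apply; apply: level_F_in Cz _; rewrite n0.
have lt : (n - jump dn z < n)%N by rewrite ltn_subrL jump_gt0.
have Zs : Z (iter (n - jump dn z) F (s z)) by rewrite /s -iterD subnK.
have [k ek] := IH _ lt _ (strand_Of Oz) (strand_Og Oz Oz') Zs.
by exists k.+1; rewrite strand_timeSr ek subnKC.
Qed.

Lemma strand_meets_G n z : Of z -> Og z -> Z (iter n G z) -> exists k, strand_time an k z = n.
Proof.
elim/ltn_ind: n z => n IH z Oz Oz' Zn.
have [->|n0] := posnP n; first by exists 0%N; rewrite /strand_time big_ord0.
have jn : (jump an z <= n)%N.
  have [[i _ Cz]|/jump_notbase -> //] := pselect (base z).
  rewrite (jump_base _ Cz) ltnNge; apply/negP => nd.
  by apply: common_notV Zn _; apply: level_G_in Cz _; rewrite n0.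
have lt : (n - jump an z < n)%N by rewrite ltn_subrL jump_gt0.
have Zs : Z (iter (n - jump an z) G (s z)) by rewrite strand_G // -iterD subnK.
have [k ek] := IH _ lt _ (strand_Of Oz) (strand_Og Oz Oz') Zs.
by exists k.+1; rewrite strand_timeSr ek subnKC.
Qed.

(** Past the top of an added tower over [c] comes a point of the [F]-orbit of [c]. *)
Lemma G_reaches_Of v : Og v -> exists q, Of (iter q G v).
Proof.
move=> /Og_cases[[Ov _]|[i [j [c [/andP[j0 ja] Cc ->]]]]]; first by exists 0%N.
exists ((an i).+1 - j)%N; rewrite -iterD subnK; last exact: leqW.
by rewrite -(qm_orbit Q Cc); apply: iter_F_in; exact: (qm_C_sub Q) Cc.
Qed.

(** * Transfer of ergodicity *)

Section Ergodicity.
Hypothesis ergF : forall A, measurable A ->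
  m (Of `&` (F @^-1` A `+` A)) = 0%E -> m (Of `&` A) = 0%E \/ m (Of `\` A) = 0%E.

Let mpre (S : X -> X) A : measurable_fun [set: X] S -> measurable A -> measurable (S @^-1` A).
Proof. by move=> mS mA; rewrite -[X in measurable X]setTI; exact: mS. Qed.

(** Within [Of] such a set contains its preimage, which has the same measure, so it is invariant up
    to a null set. *)
Lemma ergodic_backward_closed A : measurable A -> (forall z, Of z -> A (F z) -> A z) ->
  m (Of `&` A) = 0%E \/ m (Of `\` A) = 0%E.
Proof.
move=> mA FA; apply: ergF => //.
have -> : Of `&` (F @^-1` A `+` A) = (Of `&` A) `\` (Of `&` F @^-1` A).
  apply/seteqP; split=> z.
    move=> [Oz [[Fz nA]|[Az nF]]]; first by case: nA; exact: FA.
    by split=> // -[].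
  by move=> [[Oz Az] nF]; split=> //; right; split=> // Fz; apply: nF.
apply: measure_sub_eq; try by apply: measurableI => //; exact: mpre.
- by move=> z [Oz /FA Az]; split=> //; exact: Az.
- by apply: le_lt_trans fOf; apply: le_measure; rewrite ?inE //; exact: measurableI.
- exact: F_preserve.
Qed.

(** The points whose [F]-orbit meets [E] inside the common part form a backward closed set. On the
    common part it coincides with [E], because visits of an [F]-orbit there are points of the
    strand, hence of the [G]-orbit. *)
Lemma ergodic_common (E : set X) : measurable E -> (forall z, E (G z) <-> E z) ->
  m (Z `&` E) = 0%E \/ m (Z `\` E) = 0%E.
Proof.
move=> mE EG; have mZ := measurable_common.
have EGn n z : E (iter n G z) <-> E z by elim: n => //= n <-; exact: EG.
pose A := \bigcup_n iter n F @^-1` (Z `&` E).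
have mA : measurable A.
  by apply: bigcupT_measurable => n; apply: measurable_iter_preimage => //; exact: measurableI.
have ZO : Z `<=` Of by move=> z [].
have [|A0|A1] := ergodic_backward_closed mA.
- by move=> z _ [n _ An]; exists n.+1 => //; rewrite /preimage /= -iterS iterSr.
- left; apply: null_sub A0; try exact: measurableI.
  by move=> z [Zz Ez]; split; [exact: ZO|exists 0%N].
- right; apply: null_sub A1; try exact: measurableD.
  move=> z [Zz nE]; split; first exact: ZO.
  move=> [n _ [Zn En]]; apply: nE.
  have [k ek] := strand_meets_F (ZO _ Zz) (common_Og Zz) Zn.
  move: En; rewrite /= -ek -iter_strand_F iter_strand_G ?EGn //; first exact: ZO.
  exact: common_Og.
Qed.

Lemma null_G_preimage n N : measurable N -> m (Og `&` N) = 0%E ->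
  m (Og `&` iter n G @^-1` N) = 0%E.
Proof. by move=> mN; rewrite (preserve_iter mG G_preserve). Qed.

Lemma quilt_ergodic (posZ : m Z <> 0%E) E : measurable E ->
  m (Og `&` (G @^-1` E `+` E)) = 0%E -> m (Og `&` E) = 0%E \/ m (Og `\` E) = 0%E.
Proof.
move=> mE E0; have mZ := measurable_common.
have ZO : Z `<=` Of by move=> z [].
have mS : measurable (G @^-1` E `+` E) by apply: measurableU; apply: measurableD => //; exact: mpre.
(* The upper limit of the preimages of [E] is invariant at every point and not merely up to a null
   set. *)
pose E' := \bigcap_k \bigcup_(n in [set n | (k <= n)%N]) iter n G @^-1` E.
have mE' : measurable E'.
  apply: bigcapT_measurable => k; apply: bigcup_measurable => n _.
  exact: measurable_iter_preimage.
have E'G z : E' (G z) <-> E' z.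
  split=> h k _; first by have [n /= kn En] := h k I; exists n.+1; rewrite /= ?leqW // /preimage /= -iterS iterSr.
  have [[//|n] /= kn En] := h k.+1 I; exists n => //.
  by move: En; rewrite /preimage /= -iterS iterSr.
pose N := \bigcup_n (Og `&` iter n G @^-1` (G @^-1` E `+` E)).
have mN : measurable N.
  by apply: bigcupT_measurable => n; apply: measurableI => //; exact: measurable_iter_preimage.
have N0 : m N = 0%E.
  apply: null_bigcup => n; last exact: null_G_preimage.
  by apply: measurableI => //; exact: measurable_iter_preimage.
have EE' z : Og z -> ~ N z -> E z <-> E' z.
  move=> Oz nN; have En n : E (iter n G z) <-> E z.
    elim: n => // n <-; rewrite iterS; have : ~ (G @^-1` E `+` E) (iter n G z).
      by move=> h; apply: nN; exists n.
    rewrite /setY /= => h; split=> h'; apply: contrapT => h''; apply: h; [left|right] => //.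
  split=> [Ez k _|/(_ 0%N I)[n _ /En]//].
  by exists k => //=; exact/En.
suff : m (Og `&` E') = 0%E \/ m (Og `\` E') = 0%E.
  case=> <-; [left|right]; apply: (measure_eq_mod0 _ _ mN N0) => //;
    try (by apply: measurableI); try (by apply: measurableD).
    by move=> z nN; split=> -[Oz] /(EE' _ Oz nN).
  by move=> z nN; split=> -[Oz nE]; split=> // /(EE' _ Oz nN).
(* Almost every point of [Of] reaches the common part: those that do form a backward closed set,
   which is not null. *)
have mUZ : measurable (\bigcup_n iter n F @^-1` Z).
  by apply: bigcupT_measurable => n; exact: measurable_iter_preimage.
have [|H0|H1] := ergodic_backward_closed mUZ.
- by move=> z _ [n _ An]; exists n.+1 => //; rewrite /preimage /= -iterS iterSr.
- case: posZ; apply: null_sub H0 => //.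
    exact: measurableI.
  by move=> z Zz; split; [exact: ZO|exists 0%N].
pose H := Of `\` \bigcup_n iter n F @^-1` Z.
have mH : measurable H.
  by apply: measurableD => //; apply: bigcupT_measurable => n; exact: measurable_iter_preimage.
pose N2 := \bigcup_n (Og `&` iter n G @^-1` H).
have mN2 : measurable N2.
  by apply: bigcupT_measurable => n; apply: measurableI => //; exact: measurable_iter_preimage.
have N20 : m N2 = 0%E.
  apply: null_bigcup => n; first by apply: measurableI => //; exact: measurable_iter_preimage.
  by apply: null_G_preimage => //; apply: null_sub H1 => //; exact: measurableI.
have reach v : Og v -> ~ N2 v -> exists q, Z (iter q G v).
  move=> Ov nN; have [q Oq] := G_reaches_Of Ov.
  have [n Zn] : exists n, Z (iter n F (iter q G v)).
    apply: contrapT => nZ; apply: nN; exists q => //; split=> //; split=> // -[n _ Zn].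
    by apply: nZ; exists n.
  have Oq' : Og (iter q G v) by exact: iter_G_in.
  have [k ek] := strand_meets_F Oq Oq' Zn.
  exists (strand_time an k (iter q G v) + q)%N.
  by rewrite iterD -iter_strand_G // iter_strand_F ek.
(* An invariant set that is null in the common part is null in [Og], since almost every orbit of [G]
   reaches the common part. *)
have sat (D : set X) : measurable D -> (forall z, D (G z) <-> D z) -> m (Z `&` D) = 0%E ->
    m (Og `&` D) = 0%E.
  move=> mD DG Z0; have DGn n z : D (iter n G z) <-> D z by elim: n => //= n <-; exact: DG.
  pose N3 := N2 `|` \bigcup_n (Og `&` iter n G @^-1` (Z `&` D)).
  have m1 n : measurable (Og `&` iter n G @^-1` (Z `&` D)).
    by apply: measurableI => //; apply: measurable_iter_preimage => //; exact: measurableI.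
  have mN3 : measurable N3 by apply: measurableU => //; exact: bigcupT_measurable.
  have N30 : m N3 = 0%E.
    rewrite measureU0 // ?N20 //; first exact: bigcupT_measurable.
    apply: null_bigcup => // n; apply: null_G_preimage; first exact: measurableI.
    apply: null_sub Z0; try exact: measurableI; last by move=> z [].
    by apply: measurableI => //; exact: measurableI.
  apply: null_sub N30 => //; first exact: measurableI.
  move=> z [Oz Dz]; have [Nz|nN] := pselect (N2 z); [by left|right].
  have [q Zq] := reach z Oz nN; exists q => //; split=> //; split=> //=; exact/DGn.
have [e|e] := ergodic_common mE' E'G; [left|right].
  exact: sat.
rewrite setDE; apply: sat; first exact: measurableC.
  by move=> z; split=> nE /E'G.
by rewrite -setDE.
Qed.

End Ergodicity.

(** This set is null when [F] is ergodic and the common part is not null; the entropy formula,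
    stated without ergodicity, has to treat it separately. *)
Definition trapped : set X := Of `&` [set z | forall n, ~ Z (iter n F z)].

Lemma measurable_trapped : measurable trapped.
Proof.
rewrite (_ : trapped = Of `&` \bigcap_n iter n F @^-1` (~` Z)).
  apply: measurableI => //; apply: bigcapT_measurable => n.
  by apply: measurable_iter_preimage => //; apply: measurableC; exact: measurable_common.
by apply/seteqP; split=> z [Oz h]; split=> // n; [move=> _; exact: h|exact: (h n I)].
Qed.

Lemma fin_trapped : (m trapped < +oo)%E.
Proof.
apply: le_lt_trans fOf; apply: le_measure; rewrite ?inE //; first exact: measurable_trapped.
by move=> z [].
Qed.

Lemma trapped_F n z : trapped z -> trapped (iter n F z).
Proof.
move=> [Oz nZ]; split; first exact: iter_F_in.
by move=> k; rewrite -iterD; exact: nZ.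
Qed.

Lemma trapped_U z : trapped z -> U z.
Proof. by move=> [Oz nZ]; apply: contrapT => nU; apply: (nZ 0%N). Qed.

Lemma trapped_strand z : trapped z -> trapped (s z).
Proof. exact: trapped_F. Qed.

(* Two towers can only meet at the top of one and the bottom of the other, so
   that following the strands backwards from [U] is unambiguous. *)
Lemma strand_inj_U z z' : Of z -> Of z' -> U (s z) -> s z = s z' -> z = z'.
Proof.
move=> Oz Oz' Us e; wlog le : z z' Oz Oz' Us e / (jump dn z' <= jump dn z)%N => [H|].
  have [/H|/ltnW /H] := leqP (jump dn z') (jump dn z); first exact.
  by move=> h; apply/esym/h => //; rewrite -e.
have e1 : iter (jump dn z - jump dn z') F z = z'.
  apply: (iter_F_inj (n := jump dn z')) => //; first exact: iter_F_in.
  by rewrite -iterD subnKC // -/(s z) e.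
have [[i _ Ciz]|/jump_notbase jz] := pselect (base z); last first.
  move: e1; rewrite jz; have := jump_gt0 dn z'; move: le; rewrite jz.
  by case: (jump dn z') => [|[]].
rewrite (jump_base _ Ciz) in le e1.
have [je|lt] := eqVneq (jump dn z') (dn i).+1; first by rewrite je subnn in e1.
have [i' [j [c [/andP[j0 jd] Cc ec]]]] := Us.
have ez : s z = F (iter (dn i) F z) by rewrite /s (jump_base _ Ciz).
have nd : (0 < dn i)%N by move: le lt (jump_gt0 dn z'); lia.
have top : c = iter (dn i) F z /\ (0 < dn i')%N.
  case: j j0 jd ec => // j _ jd ec.
  have ej : iter j F c = iter (dn i) F z.
    apply: (qm_F_inj Q); [apply: iter_F_in; exact: (qm_C_sub Q Cc)|exact: iter_F_in|].
    by rewrite -iterS -ec ez.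
  have [j0|jp] := posnP j; first by split; [rewrite -ej j0|exact: leq_trans jd].
  have jd' : (0 < j <= dn i')%N by rewrite jp ltnW.
  have dd : (0 < dn i <= dn i)%N by rewrite nd leqnn.
  have [ii' jj'] := qm_F_lev Q Cc Ciz jd' dd ej.
  by move: jd; rewrite ii' jj' ltnn.
have [[i0 _ Ciz']|nb'] := pselect (base z'); last first.
  move: e1; rewrite jump_notbase // subSS subn0 => e1; case: nb'.
  by exists i'; rewrite // -e1 -top.1.
rewrite (jump_base _ Ciz') in le lt e1.
have [d0|dp] := posnP (dn i0).
  have e2 : z' = c by rewrite -e1 d0 subSS subn0 top.1.
  by have := top.2; rewrite (qm_C_triv Q Cc (_ : C i0 c)) ?d0 // -e2.
have e3 : iter 1 F z' = iter (dn i - dn i0).+1 F z by rewrite /= -e1 subSS.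
have l1 : (0 < 1 <= dn i0)%N by rewrite dp.
have l2 : (0 < (dn i - dn i0).+1 <= dn i)%N by lia.
have [ii jj] := qm_F_lev Q Ciz' Ciz l1 l2 e3.
by move: lt; rewrite ii eqxx.
Qed.

Lemma strand_inj_trapped z z' : trapped z -> trapped z' -> s z = s z' -> z = z'.
Proof.
move=> tz tz'; apply: strand_inj_U; [by case: tz|by case: tz'|].
exact/trapped_U/trapped_strand.
Qed.

Lemma strand_preimage E : s @^-1` E =
  (F @^-1` E `\` base) `|` \bigcup_i (C i `&` iter (dn i).+1 F @^-1` E).
Proof.
apply/seteqP; split=> z /=.
  move=> Ez; have [[i _ Ci]|nb] := pselect (base z).
    by right; exists i => //; split=> //; move: Ez; rewrite /s (jump_base _ Ci).
  by left; split=> //; move: Ez; rewrite /s jump_notbase.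
move=> [[Ez nb]|[i _ [Ci Ez]]]; first by rewrite /s jump_notbase.
by rewrite /s (jump_base _ Ci).
Qed.

Lemma measurable_strand : measurable_fun [set: X] s.
Proof.
move=> _ E mE; rewrite setTI strand_preimage; apply: measurableU.
  by apply: measurableD; [exact: (measurable_iter_preimage mF 1)|exact: measurable_base].
apply: bigcupT_measurable => i; apply: measurableI => //; exact: measurable_iter_preimage.
Qed.

(** Strands may merge when they leave [U], which does not happen here; so the strand is injective on
    trapped points, and on each of countably many pieces it is an iterate of [F]. *)
Lemma strand_preserve E : measurable E -> m (trapped `&` s @^-1` E) = m (trapped `&` E).
Proof.
apply: preserve_of_image; [exact: measurable_trapped|exact: fin_trapped|exact: measurable_strand|
  exact: trapped_strand|].
pose P i := if i is i'.+1 then trapped `&` C i' else trapped `\` base.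
pose h i := if i is i'.+1 then iter (dn i').+1 F else F.
apply: (image_pieces (P := P) (h := h)).
- case=> [|i]; first by apply: measurableD; [exact: measurable_trapped|exact: measurable_base].
  by apply: measurableI => //; exact: measurable_trapped.
- move=> [|i] [|j] _ _ //= [z []].
  + by move=> [_ nb] [_ Cj]; case: nb; exists j.
  + by move=> [_ Ci] [_ nb]; case: nb; exists i.
  + by move=> [_ Ci] [_ Cj]; rewrite (qm_C_triv Q Ci Cj).
- apply/seteqP; split=> z; last by move=> [[|i] _ []].
  move=> tz; have [[i _ Ci]|nb] := pselect (base z); first by exists i.+1.
  by exists 0%N.
- by move=> [|i] z [_ zP]; rewrite /s; [rewrite jump_notbase|rewrite (jump_base _ zP)].
- move=> [|i] E' mE' sE' /=.
    by apply: (image_iter_F 1) => // z /sE' [[]].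
  by apply: image_iter_F => // z /sE' [[]].
- exact: strand_inj_trapped.
Qed.

(** * Rigid points *)

Section Densities.
Context (df dg lf lg : X -> R).
Context (mdf : measurable_fun [set: X] df) (mlf : measurable_fun [set: X] lf).
Context (mdg : measurable_fun [set: X] dg) (mlg : measurable_fun [set: X] lg).
Hypothesis df_gt0 : forall z, Of z -> 0 < df z.
Hypothesis lf_gt0 : forall z, Of z -> 0 < lf z.
Hypothesis lg_gt0 : forall z, Og z -> 0 < lg z.
Hypothesis df_le : forall z, Of z -> df z * lf z <= lf (F z).
Definition cocycle (S : X -> X) (del : X -> R) n z : R := \prod_(i < n) del (iter i S z).
Hypothesis d_agree : forall z, Of z -> Og z -> ~ base z -> df z = dg z.
Hypothesis d_orbit : forall i z, C i z ->
  cocycle F df (dn i).+1 z = cocycle G dg (an i).+1 z.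

(** Here [del] is the slope on the fibres and [l] the fibre length: along the whole orbit the image
    of a fibre has the full length of the next fibre. *)
Definition rigid (S : X -> X) (del l : X -> R) : set X :=
  [set z | forall j, del (iter j S z) * l (iter j S z) = l (iter j.+1 S z)].

Lemma cocycleD (S : X -> X) (del : X -> R) a b z :
  cocycle S del (a + b) z = cocycle S del a z * cocycle S del b (iter a S z).
Proof.
rewrite /cocycle big_split_ord; congr (_ * _); apply: eq_bigr => i _.
by rewrite /= addnC iterD.
Qed.

Lemma cocycle1 (S : X -> X) (del : X -> R) z : cocycle S del 1 z = del z.
Proof. by rewrite /cocycle big_ord1. Qed.

Lemma cocycle_strand k z : Of z -> Og z ->
  cocycle F df (strand_time dn k z) z = cocycle G dg (strand_time an k z) z.
Proof.
move=> Oz Oz'; elim: k => [|k IH]; first by rewrite /strand_time /cocycle !big_ord0.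
rewrite !strand_timeS !cocycleD IH; congr (_ * _).
rewrite -iter_strand_F -iter_strand_G //; set w := iter k s z.
have Ow : Of w by exact: iter_strand_Of.
have Ow' : Og w by exact: iter_strand_Og.
have [[i _ Ci]|nb] := pselect (base w); first by rewrite !(jump_base _ Ci) d_orbit.
by rewrite !jump_notbase // !cocycle1 d_agree.
Qed.

Lemma rigid_cocycle (S : X -> X) (del l : X -> R) n z : rigid S del l z ->
  cocycle S del n z * l z = l (iter n S z).
Proof.
move=> rz; elim: n => [|n IH]; first by rewrite /cocycle big_ord0 mul1r.
have -> : cocycle S del n.+1 z = cocycle S del n z * del (iter n S z).
  by rewrite -addn1 cocycleD cocycle1.
by rewrite mulrAC IH mulrC rz.
Qed.

Lemma measurable_rigid (S : X -> X) (del l : X -> R) : measurable_fun [set: X] S ->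
  measurable_fun [set: X] del -> measurable_fun [set: X] l -> measurable (rigid S del l).
Proof.
move=> mS mdel ml.
rewrite (_ : rigid _ _ _ = \bigcap_j iter j S @^-1` [set z | del z * l z = l (S z)]).
  apply: bigcapT_measurable => j; apply: measurable_iter_preimage => //.
  rewrite (_ : [set z | _] = (fun z => del z * l z - l (S z)) @^-1` [set 0]).
    rewrite -[X in measurable X]setTI.
    have mf : measurable_fun [set: X] (fun z => del z * l z - l (S z)).
      by apply: measurable_funB; [exact: measurable_funM|exact: (measurableT_comp ml mS)].
    exact: mf.
  by apply/seteqP; split=> z /=; [move=> ->; rewrite subrr|move/eqP; rewrite subr_eq0 => /eqP].
apply/seteqP; split=> z h j; first by move=> _; exact: h.
exact: (h j I).
Qed.

(** The proportion of the next fibre that is occupied by the image of the current one; its products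
    along an orbit telescope. *)
Let J z := df z * lf z / lf (F z).

Let J_bounds z : Of z -> 0 <= J z <= 1.
Proof.
move=> Oz; have Fp := lf_gt0 (qm_F_in Q Oz).
have lp := lf_gt0 Oz; have dp := df_gt0 Oz.
apply/andP; split; first by rewrite divr_ge0 ?mulr_ge0 // ltW.
by rewrite ler_pdivrMr // mul1r; exact: df_le.
Qed.

Let prodJ n z : R := \prod_(i < n) J (iter i F z).

Let prodJE n z : Of z -> prodJ n z = cocycle F df n z * lf z / lf (iter n F z).
Proof.
move=> Oz; elim: n => [|n IH].
  by rewrite /prodJ /cocycle !big_ord0 mul1r divff // gt_eqF // lf_gt0.
rewrite /prodJ big_ord_recr /= -/(prodJ n z) IH /cocycle big_ord_recr /= /J.
have h1 := lf_gt0 (iter_F_in n Oz); have h2 := lf_gt0 (iter_F_in n.+1 Oz); rewrite iterS in h2.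
by field; rewrite !gt_eqF.
Qed.

Let prodJ_le k n z : Of z -> (k <= n)%N -> 0 <= prodJ n z <= prodJ k z.
Proof.
move=> Oz /subnK <-; elim: (n - k)%N => [|j IH].
  rewrite add0n lexx andbT; apply: prodr_ge0 => i _.
  by have /andP[] := J_bounds (iter_F_in i Oz).
rewrite addSn /prodJ big_ord_recr /= -/(prodJ _ z); move: IH => /andP[h0 h1].
have /andP[J0 J1] := J_bounds (iter_F_in (j + k) Oz).
rewrite mulr_ge0 //=; apply: le_trans h1; exact: ler_piMr.
Qed.

Lemma measurable_ratio_lt (c : R) (p q : X -> R) : measurable_fun [set: X] p ->
  measurable_fun [set: X] q -> measurable [set z | p z < c * q z].
Proof.
move=> mp mq; rewrite -[X in measurable X]setTI.
have mf : measurable_fun [set: X] (fun z => p z < c * q z).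
  by apply: measurable_fun_ltr => //; apply: measurable_funM.
rewrite (_ : [set z | _] = (fun z => p z < c * q z) @^-1` [set true]); first exact: mf.
by [].
Qed.

(** At a point that is not rigid, [J] is below some [q i < 1] at some time, hence infinitely often
    by recurrence, and its products fall below every power of [q i]. *)
Lemma shrinking (rig0 : m (Of `&` rigid F df lf) = 0%E) :
  exists N, [/\ measurable N, m N = 0%E & forall z, Of z -> ~ N z ->
    forall e, 0 < e -> exists n0, forall n, (n0 <= n)%N ->
      cocycle F df n z * lf z < e * lf (iter n F z)].
Proof.
pose q i : R := 1 - i.+1%:R^-1.
pose E i := [set z | df z * lf z < q i * lf (F z)].
have mE i : measurable (E i).
  apply: measurable_ratio_lt; first exact: measurable_funM.
  exact: (measurableT_comp mlf mF).
have /choice[N HN] : forall i, exists N, [/\ measurable N, m N = 0%E &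
    forall z, Of z -> ~ N z -> (exists n, E i (iter n F z)) ->
    forall k, exists n, (k <= n)%N /\ E i (iter n F z)].
  by move=> i; exact: (poincare_recurrence mOf fOf mF F_preserve (mE i)).
have mr : measurable (Of `&` rigid F df lf) by apply: measurableI => //; exact: measurable_rigid.
have mN : measurable (\bigcup_i N i) by apply: bigcupT_measurable => i; have [] := HN i.
exists ((Of `&` rigid F df lf) `|` \bigcup_i N i); split.
- exact: measurableU.
- rewrite measureU0 //; apply: null_bigcup => i; by have [] := HN i.
move=> z Oz nN e e0.
have [i [n En]] : exists i n, E i (iter n F z).
  apply: contrapT => nE; apply: nN; left; split=> // j.
  have Oj := iter_F_in j Oz.
  apply/eqP; rewrite eq_le df_le //= leNgt; apply/negP => lt.
  have lp := lf_gt0 (qm_F_in Q Oj).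
  set x := df (iter j F z) * _ in lt; set y := lf (F _) in lt lp.
  have r1 : 0 < 1 - x / y by rewrite subr_gt0 ltr_pdivrMr // mul1r.
  have [i hi] : exists i, i.+1%:R^-1 < 1 - x / y.
    have [i _ Hi] := near_infty_natSinv_lt (PosNum r1).
    by exists i; apply: (Hi i) => /=.
  apply: nE; exists i, j; suff : x < (1 - i.+1%:R^-1) * y by [].
  have h : x / y < 1 - i.+1%:R^-1 by rewrite ltrBrDr addrC -ltrBrDr.
  by move: h; rewrite ltr_pdivrMr.
have [_ _ /(_ z Oz)] := HN i.
have nNi : ~ N i z by move=> h; apply: nN; right; exists i.
move=> /(_ nNi (ex_intro _ n En)) inf.
have q0 : 0 <= q i < 1.
  by rewrite /q subr_ge0 invf_le1 ?ltr0n // ler1n /= gtrBl invr_gt0 ltr0n.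
have pow k : exists n, prodJ n z <= q i ^+ k.
  elim: k => [|k [n1 IH]]; first by exists 0%N; rewrite /prodJ big_ord0 expr0.
  have [n2 [n12 En2]] := inf n1; exists n2.+1.
  rewrite /prodJ big_ord_recr /= -/(prodJ n2 z) exprSr.
  have /andP[p0 p1] := prodJ_le Oz n12.
  have /andP[J0 J1] := J_bounds (iter_F_in n2 Oz).
  apply: ler_pM => //; first exact: le_trans p1 IH.
  rewrite /J ler_pdivrMr; first exact: ltW.
  by apply: lf_gt0; exact: (iter_F_in n2.+1 Oz).
have [k hk] : exists k, q i ^+ k < e.
  have : (q i) ^+ n @[n --> \oo] --> (0 : R).
    by apply: cvg_expr; rewrite ger0_norm; case/andP: q0.
  move=> /cvgr_lt /(_ e e0) [k _ Hk]; exists k; exact: (Hk k (leqnn k)).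
have [n0 hn0] := pow k; exists n0 => n' n'n.
have lp := lf_gt0 (iter_F_in n' Oz).
rewrite -ltr_pdivrMr // -prodJE //.
have /andP[_ h] := prodJ_le Oz n'n.
exact: le_lt_trans h (le_lt_trans hn0 hk).
Qed.

Lemma Og_null_preimages N : measurable N -> m (Of `&` N) = 0%E ->
  m (Og `&` \bigcup_q iter q G @^-1` (Of `&` N)) = 0%E.
Proof.
move=> mN N0; rewrite setI_bigcupr; apply: null_bigcup => n.
  by apply: measurableI => //; apply: measurable_iter_preimage => //; exact: measurableI.
rewrite (preserve_iter mG G_preserve); last exact: measurableI.
apply: null_sub N0; last by move=> z [].
  by apply: measurableI => //; exact: measurableI.
exact: measurableI.
Qed.

(** Let a point of both domains be rigid for [G]. At strand times the slopes for [F] and [G] agree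
    while proportions for [F] tend to 0, so [lf / lg] tends to infinity along the strand. This
    contradicts recurrence to a set where [lf / lg] is bounded: recurrence of [F] to the common part
    if the orbit meets it, recurrence of the strand on [trapped] otherwise. *)
Lemma rigid_transfer : m (Of `&` rigid F df lf) = 0%E -> m (Og `&` rigid G dg lg) = 0%E.
Proof.
move=> rig0; have [N0 [mN0 N00 shr]] := shrinking rig0.
have mRG : measurable (rigid G dg lg) by exact: measurable_rigid.
pose big i := [set z | lf z < i.+1%:R * lg z].
have mbig i : measurable (big i) by exact: measurable_ratio_lt.
have bigP z : Of z -> Og z -> exists i, big i z.
  move=> Oz Oz'; have lp := lf_gt0 Oz; have gp := lg_gt0 Oz'.
  have [i hi] : exists i, lf z / lg z < i.+1%:R.
    exists (Num.trunc (lf z / lg z)); have := truncnS_gt (lf z / lg z); by [].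
  by exists i; rewrite /big /= -ltr_pdivrMr.
have mZ := measurable_common; have mtr := measurable_trapped.
have /choice[N1 HN1] : forall i, exists N, [/\ measurable N, m N = 0%E &
    forall z, Of z -> ~ N z -> (exists n, (Z `&` big i) (iter n F z)) ->
    forall k, exists n, (k <= n)%N /\ (Z `&` big i) (iter n F z)].
  move=> i; apply: (poincare_recurrence mOf fOf mF F_preserve); exact: measurableI.
have /choice[N2 HN2] : forall i, exists N, [/\ measurable N, m N = 0%E &
    forall z, trapped z -> ~ N z -> (exists n, big i (iter n s z)) ->
    forall k, exists n, (k <= n)%N /\ big i (iter n s z)].
  move=> i; exact: (poincare_recurrence mtr fin_trapped measurable_strand strand_preserve).
pose N := N0 `|` (\bigcup_i N1 i `|` \bigcup_i N2 i).
have mU1 : measurable (\bigcup_i N1 i) by apply: bigcupT_measurable => i; have [] := HN1 i.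
have mU2 : measurable (\bigcup_i N2 i) by apply: bigcupT_measurable => i; have [] := HN2 i.
have mN : measurable N by apply: measurableU => //; exact: measurableU.
have n1 : m (\bigcup_i N1 i) = 0%E by apply: null_bigcup => i; have [] := HN1 i.
have n2 : m (\bigcup_i N2 i) = 0%E by apply: null_bigcup => i; have [] := HN2 i.
have N0' : m N = 0%E.
  by rewrite measureU0 //; [exact: measurableU|rewrite measureU0].
have sub z : Of z -> Og z -> rigid G dg lg z -> N z.
  move=> Oz Oz' rz; apply: contrapT => nN.
  have lp := lf_gt0 Oz; have gp := lg_gt0 Oz'.
  have rel k : cocycle F df (strand_time dn k z) z * lg z = lg (iter k s z).
    by rewrite cocycle_strand // rigid_cocycle // -iter_strand_G.
  have nobig i : exists k0, forall k, (k0 <= strand_time dn k z)%N -> ~ big i (iter k s z).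
    (* This threshold makes [lf / lg] exceed [i.+1] at the corresponding point of the strand. *)
    have [n0 hn0] := shr z Oz (fun h => nN (or_introl h)) _ (divr_gt0 lp (mulr_gt0 (ltr0Sn R i) gp)).
    exists n0 => k /hn0; rewrite -iter_strand_F /big /= => lt; apply/negP; rewrite -leNgt.
    set a := cocycle _ _ _ _ in lt rel; rewrite -(rel k) -/a.
    have p : 0 < i.+1%:R * lg z by rewrite mulr_gt0 // ltr0n.
    move: lt; rewrite mulrAC ltr_pdivlMr // => lt.
    have : i.+1%:R * (a * lg z) * lf z <= lf (iter k s z) * lf z by nra.
    by rewrite ler_pM2r.
  have [[n Zn]|nZ] := pselect (exists n, Z (iter n F z)).
    have [|i bi] := bigP (iter n F z) (iter_F_in n Oz); first exact: common_Og.
    have [_ _ /(_ z Oz)] := HN1 i.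
    have nNi : ~ N1 i z by move=> h; apply: nN; right; left; exists i.
    move=> /(_ nNi (ex_intro _ n (conj Zn bi))) inf.
    have [k0 hk0] := nobig i; have [n' [kn [Zn' bn']]] := inf k0.
    have [k ek] := strand_meets_F Oz Oz' Zn'.
    by apply: (hk0 k); rewrite ?ek // iter_strand_F ek.
  have tz : trapped z by split=> // n Zn; apply: nZ; exists n.
  have [i bi] := bigP z Oz Oz'.
  have [_ _ /(_ z tz)] := HN2 i.
  have nNi : ~ N2 i z by move=> h; apply: nN; right; right; exists i.
  move=> /(_ nNi (ex_intro _ 0%N bi)) inf.
  have [k0 hk0] := nobig i; have [n' [kn bn']] := inf k0.
  by apply: (hk0 n') => //; apply: leq_trans kn _; exact: leq_strand_time.
have N0'' : m (Of `&` N) = 0%E by apply: null_sub N0' => //; exact: measurableI.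
apply: null_sub (Og_null_preimages mN N0''); first exact: measurableI.
  apply: measurableI => //; apply: bigcupT_measurable => n.
  by apply: measurable_iter_preimage => //; exact: measurableI.
move=> z [Oz rz]; split=> //; have [q Oq] := G_reaches_Of Oz.
exists q => //; split=> //; apply: sub => //; first exact: iter_G_in.
by move=> j; have := rz (j + q)%N; rewrite -addSn !iterD.
Qed.

End Densities.

End Model.

(** * Chains of towers and the square of a map *)

Section HalfModel.
Context d (X : measurableType d) (R : realType) (m : {measure set X -> \bar R}).
Context (S : X -> X) (mS : measurable_fun [set: X] S).
Context (Om : set X) (mOm : measurable Om) (fOm : (m Om < +oo)%E).
Context (presS : forall E, measurable E -> m (Om `&` S @^-1` E) = m (Om `&` E)).
Context (S_inj : forall z z', Om z -> Om z' -> S z = S z' -> z = z').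
Context (Z N : set X) (mZ : measurable Z) (mN : measurable N).
Context (ZO : Z `<=` Om) (NO : N `<=` Om) (ZN : forall z, Z z -> ~ N z).
Context (N_S : forall z, N z -> N (S z)).
Context (C : nat -> set X) (h : nat -> nat) (levd : levels_disjoint S C h).
Context (N_lev : forall z, N z -> exists i j c,
  [/\ (0 < j <= h i)%N, C i c, N c & z = iter j S c]).
Context (shat : X -> X) (mshat : measurable_fun [set: X] shat).
Context (s_off : forall z, N z -> (forall i, ~ C i z) -> shat z = S z).
Context (s_on : forall i z, N z -> C i z -> shat z = iter (h i).+1 S z).
Context (s_Z : forall z, Z z -> shat z = first_return S Z (first_return S Z z)).
Context (pres_shat : forall E, measurable E ->
  m ((Z `|` N) `&` shat @^-1` E) = m ((Z `|` N) `&` E)).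
Context (hit : m (Om `&` [set z | ~ N z /\ forall n, ~ Z (iter n S z)]) = 0%E).

(** First levels and not bases: a base point may be the top level of another tower. *)
Definition tower_bottom : set X :=
  [set z | exists i c, [/\ (0 < h i)%N, C i c, N c & z = S c]].
Context (mbot : measurable tower_bottom).
Let B := Z `|` tower_bottom.

Lemma iter_N n z : N z -> N (iter n S z).
Proof. by move=> Nz; elim: n => //= n; exact: N_S. Qed.

Lemma bottom_N z : tower_bottom z -> N z.
Proof. by move=> [i [c [_ _ Nc ->]]]; exact: N_S. Qed.

Lemma level_not_bottom i j c : C i c -> N c -> (1 < j <= h i)%N -> ~ tower_bottom (iter j S c).
Proof.
move=> Cc Nc /andP[j1 jh] [i' [c' [h' Cc' Nc' e]]].
have l1 : (0 < j <= h i)%N by rewrite jh ltnW.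
have l2 : (0 < 1 <= h i')%N by [].
by have [_ j1'] := levd Cc Cc' l1 l2 e; rewrite j1' in j1.
Qed.

Lemma not_B z : N z -> ~ tower_bottom z -> ~ B z.
Proof. by move=> Nz nb [/ZN|]. Qed.

(** The point after the top is again in [N], hence on a level of some tower. By injectivity of [S]
    and disjointness of the levels it is a first level, so the top itself is the base point of a
    tower of positive height. *)
Lemma tower_top i c : C i c -> N c -> (0 < h i)%N ->
  exists i', C i' (iter (h i) S c) /\ (0 < h i')%N.
Proof.
move=> Cc Nc h0; have [i' [j' [c' [/andP[j0 jh] Cc' Nc' e]]]] := N_lev (iter_N (h i).+1 Nc).
have {}e : iter (h i) S c = iter j'.-1 S c'.
  apply: S_inj; [exact/NO/iter_N|exact/NO/iter_N|].
  by rewrite -!iterS prednK.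
have [j1|j1] := posnP j'.-1.
  by exists i'; rewrite e j1; split=> //; exact: leq_trans j0 jh.
have l1 : (0 < h i <= h i)%N by rewrite h0 leqnn.
have l2 : (0 < j'.-1 <= h i')%N by rewrite j1 (leq_trans (leq_pred _)).
have [ii jj] := levd Cc Cc' l1 l2 e.
by move: jh; rewrite -(prednK j0) -jj ii ltnn.
Qed.

Lemma top_bottom i c : C i c -> N c -> (0 < h i)%N -> tower_bottom (iter (h i).+1 S c).
Proof.
move=> Cc Nc h0; have [i' [Cc' h']] := tower_top Cc Nc h0.
by exists i', (iter (h i) S c); split=> //; exact: iter_N.
Qed.

Lemma return_bottom i c : C i c -> N c -> (0 < h i)%N ->
  first_return S B (S c) = iter (h i).+1 S c.
Proof.
move=> Cc Nc h0; rewrite /first_return (_ : return_time S B (S c) = h i) -?iterSr //.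
rewrite -(prednK h0); apply: return_time_eqS.
  by rewrite prednK // -iterSr; right; exact: top_bottom.
move=> j /andP[j0 jh]; rewrite -iterSr; apply: not_B; first exact: iter_N.
by apply: level_not_bottom Cc Nc _; lia.
Qed.

(** Below the top, [shat] climbs one level at a time: a base point met there has a tower of height
    0, as its image would otherwise be both a first level and a higher level. *)
Lemma hop i j k c : C i c -> N c -> (0 < j)%N -> (j + k <= h i)%N ->
  iter k shat (iter j S c) = iter (j + k) S c.
Proof.
move=> Cc Nc j0; elim: k => [|k IH] jk; first by rewrite addn0.
rewrite iterS IH; last by lia.
set w := iter (j + k) S c; have Nw : N w by exact: iter_N.
rewrite addnS iterS -/w; have [[i' Ci']|nC] := pselect (exists i', C i' w); last first.
  by apply: s_off => // i' Ci'; apply: nC; exists i'.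
rewrite (s_on Nw Ci'); have [->//|h'] := posnP (h i').
have l1 : (0 < 1 <= h i')%N by [].
have l2 : (0 < (j + k).+1 <= h i)%N by lia.
by have [_ jj] := levd Ci' Cc l1 l2 (erefl _ : iter 1 S w = iter (j + k).+1 S c); lia.
Qed.

Lemma shat_top i j c : C i c -> N c -> (0 < j <= h i)%N ->
  exists2 c2, [/\ tower_bottom (S c2), N c2 & c2 = iter (h i) S c] &
    iter (h i - j).+1 shat (iter j S c) = first_return S B (S c2) /\
    tower_bottom (first_return S B (S c2)).
Proof.
move=> Cc Nc /andP[j0 jh]; have h0 : (0 < h i)%N by exact: leq_trans jh.
have [i2 [C2 h2]] := tower_top Cc Nc h0; have N2 := iter_N (h i) Nc.
exists (iter (h i) S c); first by split=> //; exists i2, (iter (h i) S c).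
rewrite (return_bottom C2 N2 h2); split; last exact: top_bottom.
by rewrite iterS (hop Cc) // ?subnKC // (s_on N2 C2).
Qed.

(** From a bottom, [shat] climbs to the top, which is a base point of the next tower, and jumps over
    that tower to the following bottom: one excursion of [shat] and two of [S]. Hence the factor 2
    in [half_model_entropy]. *)
Lemma shat_return_bottom z : tower_bottom z ->
  first_return shat B z = first_return S B (first_return S B z).
Proof.
move=> [i [c [h0 Cc Nc ->]]].
have l1 : (0 < 1 <= h i)%N by [].
have [c2 [_ _ ec2] [e bt]] := shat_top Cc Nc l1.
rewrite (return_bottom Cc Nc h0) iterS -ec2 -e subn1 prednK //.
rewrite /first_return (_ : return_time shat B (S c) = h i) //.
rewrite -(prednK h0); apply: return_time_eqS.
  by right; rewrite -[S c]/(iter 1 S c) -subn1 e.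
move=> k /andP[k0 kh]; rewrite -[S c]/(iter 1 S c) (hop Cc) //; last by lia.
apply: not_B; first exact: iter_N.
by apply: level_not_bottom Cc Nc _; lia.
Qed.

Lemma return_Z z : (exists n, Z (iter n.+1 S z)) ->
  first_return S B z = first_return S Z z /\ Z (first_return S Z z).
Proof.
move=> [n Zn]; have [/andP[r0 rn] Zr nZ] := return_timeP Zn; split=> //.
rewrite /first_return; congr (iter _ S z); rewrite -(prednK r0).
apply: return_time_eqS; first by left; rewrite prednK.
move=> j /andP[j0 jr] [Zj|/bottom_N Nj].
  by apply: (nZ j) => //; rewrite j0 -(prednK r0) ltnS.
apply: ZN Zr _; rewrite /first_return -(@subnK j (return_time S Z z)).
  by rewrite iterD; exact: iter_N.
by apply: leq_trans jr _; exact: leq_pred.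
Qed.

Lemma half_model_entropy : total_entropy m (Z `|` N) shat = (2%:E * total_entropy m Om S)%E.
Proof.
have mB : measurable B by exact: measurableU.
have BO : B `<=` Om by move=> z [/ZO|/bottom_N/NO].
have mP : measurable (Z `|` N) by exact: measurableU.
have PO : Z `|` N `<=` Om by move=> z [/ZO|/NO].
have fP : (m (Z `|` N) < +oo)%E by exact: (fin_sub mOm fOm).
have fB : (m B < +oo)%E by exact: (fin_sub mOm fOm).
have BP : B `<=` Z `|` N by move=> z [Zz|/bottom_N Nz]; [left|right].
have hitS : m (Om `&` [set z | forall n, ~ B (iter n S z)]) = 0%E.
  have mh : measurable [set z | forall n, ~ B (iter n S z)].
    rewrite (_ : [set z | _] = \bigcap_n iter n S @^-1` (~` B)).
      by apply: bigcapT_measurable => n; apply: measurable_iter_preimage => //; exact: measurableC.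
    by apply/seteqP; split=> z H n; [move=> _; exact: H|exact: (H n I)].
  have mhZ : measurable [set z | ~ N z /\ forall n, ~ Z (iter n S z)].
    rewrite (_ : [set z | _] = ~` N `&` \bigcap_n iter n S @^-1` (~` Z)).
      apply: measurableI; first exact: measurableC.
      by apply: bigcapT_measurable => n; apply: measurable_iter_preimage => //; exact: measurableC.
    by apply/seteqP; split=> z [nN H]; split=> // n; [move=> _; exact: H|exact: (H n I)].
  apply: null_sub hit; try exact: measurableI.
  move=> z [Oz nB]; split=> //; split=> [Nz|n Zn]; last by apply: (nB n); left.
  have [i [j [c [/andP[j0 jh] Cc Nc ez]]]] := N_lev Nz.
  apply: (nB ((h i).+1 - j)%N); right; rewrite ez -iterD subnK; last exact: leqW.
  by apply: top_bottom => //; exact: leq_trans j0 jh.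
have mR : measurable_fun [set: X] (first_return S B) by exact: measurable_first_return.
have presR E : measurable E -> m (B `&` first_return S B @^-1` E) = m (B `&` E).
  by apply: (first_return_preserve mOm).
rewrite -(total_entropy_first_return mOm fOm mS presS mB BO hitS).
rewrite -(total_entropy_square mB fB mR presR).
have [N1 [mN1 N10 rec]] := poincare_recurrence mOm fOm mS presS mZ.
have hits : m ((Z `|` N) `&` [set z | forall n, ~ B (iter n shat z)]) = 0%E.
  rewrite (_ : _ `&` _ = set0) ?measure0 // -subset0 => z [[Zz|Nz] nB].
    by apply: (nB 0%N); left.
  have [i [j [c [jh Cc Nc ez]]]] := N_lev Nz.
  have [c2 _ [e bt]] := shat_top Cc Nc jh.
  by apply: (nB (h i - j).+1); right; rewrite ez e.
rewrite -(total_entropy_first_return mP fP mshat pres_shat mB BP hits).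
have mRR : measurable_fun [set: X] (first_return S B \o first_return S B) by exact: measurableT_comp.
have mRs : measurable_fun [set: X] (first_return shat B) by exact: measurable_first_return.
have presRs E : measurable E -> m (B `&` first_return shat B @^-1` E) = m (B `&` E).
  by apply: (first_return_preserve mP).
have BN : m (B `&` N1) = 0%E by apply: null_sub N10 => //; exact: measurableI.
apply: (total_entropy_ae mB mRs mRR presRs mN1 BN).
move=> z [Zz|bz] nN; last exact: shat_return_bottom.
have inf := rec z (ZO Zz) nN (ex_intro _ 0%N Zz).
have [n1 [n10 Zn1]] := inf 1%N.
have ret1 : exists n, Z (iter n.+1 S z) by exists n1.-1; rewrite prednK.
have [e1 Z1] := return_Z ret1.
have ret2 : exists n, Z (iter n.+1 S (first_return S Z z)).
  have [n2 [n20 Zn2]] := inf (return_time S Z z).+1.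
  exists (n2 - (return_time S Z z).+1)%N.
  rewrite /first_return -iterD [X in iter X S z](_ : _ = n2) //; lia.
have [e2 Z2] := return_Z ret2.
(* On [Z] the map [shat] is two returns of [S] by hypothesis, in accordance with its behaviour on
   [N]. *)
rewrite /= e1 e2 -s_Z // /first_return (_ : return_time shat B z = 1%N) //.
by apply: return_time_eqS => [|[]//]; left; rewrite /= s_Z.
Qed.

End HalfModel.

(** * Equality of the unnormalised entropies *)

Section QuiltEntropy.
Context d (X : measurableType d) (R : realType) (m : {measure set X -> \bar R}).
Context (F G : X -> X) (Of Og : set X) (C : nat -> set X) (dn an : nat -> nat).
Context (Q : quilt_model m F G Of Og C dn an).
Local Notation U := (in_tower F C dn).
Local Notation V := (in_tower G C an).
Local Notation Z := (common F Of C dn).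
Local Notation N := (trapped F Of C dn).
Local Notation s := (strand F C dn).
Context (tO : N `<=` Og) (tF : forall z, Of z -> N (F z) -> N z).

Let mF := qm_mF Q.
Let mG := qm_mG Q.
Let mOf := qm_mOf Q.
Let mOg := qm_mOg Q.
Let fOf := qm_fOf Q.
Let fOg := qm_fOg Q.
Let mC := qm_mC Q.
Let mZ := measurable_common Q.
Let mN := measurable_trapped Q.

Lemma trapped_of_iter n z : Of z -> N (iter n F z) -> N z.
Proof.
elim: n z => // n IH z Oz; rewrite iterSr => /(IH _ (qm_F_in Q Oz)); exact: tF.
Qed.

Lemma trapped_of_G z : Of z -> Og z -> (forall n, ~ Z (iter n G z)) -> N z.
Proof.
move=> Oz Oz' nZ; split=> // n Zn; have [k ek] := strand_meets_F Q Oz Oz' Zn.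
apply: (nZ (strand_time F C dn an k z)).
by rewrite -(iter_strand_G Q) // iter_strand_F ek.
Qed.

Lemma trapped_G_avoids z n : N z -> ~ Z (iter n G z).
Proof.
move=> Nz Zn; have Oz : Of z by case: Nz.
have [k ek] := strand_meets_G Q Oz (tO Nz) Zn.
have : Z (iter k s z) by rewrite (iter_strand_G Q) ?ek //; exact: tO.
by rewrite iter_strand_F => Zk; have [_ /(_ (strand_time F C dn dn k z))] := Nz.
Qed.

(** A trapped point cannot be in the common part, so it is on an added tower. The base point is
    trapped too: its image past the tower is a later point of the same [G]-orbit, which avoids the
    common part. *)
Lemma trapped_level_G z : N z -> exists i j c,
  [/\ (0 < j <= an i)%N, C i c, N c & z = iter j G c].
Proof.
move=> Nz; have [Zz|[i [j [c [/andP[j0 ja] Cc ec]]]]] := Og_cases Q (tO Nz).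
  by case: (trapped_G_avoids (n := 0) Nz).
have Oc : Of c by exact: (qm_C_sub Q Cc).
exists i, j, c; split=> //; first by rewrite j0.
apply: (trapped_of_iter (n := (dn i).+1) Oc).
have ew : iter (dn i).+1 F c = iter ((an i).+1 - j) G z.
  by rewrite (qm_orbit Q Cc) ec -iterD subnK // leqW.
apply: trapped_of_G.
- exact: (iter_F_in Q).
- by rewrite ew; apply: (iter_G_in Q); exact: tO.
- by move=> n; rewrite ew -iterD; exact: trapped_G_avoids.
Qed.

Lemma trapped_level_F z : N z -> exists i j c,
  [/\ (0 < j <= dn i)%N, C i c, N c & z = iter j F c].
Proof.
move=> Nz; have [i [j [c [jd Cc ec]]]] := trapped_U Nz.
exists i, j, c; split=> //; apply: (trapped_of_iter (n := j)); last by rewrite -ec.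
exact: (qm_C_sub Q Cc).
Qed.

(** The difficult case is a base point of an added tower of positive height. It is itself on a level
    of an added tower, and disjointness of the levels forces that level to be the top, from where
    [G] leads to a point of a trapped [F]-orbit. *)
Lemma trapped_G z : N z -> N (G z).
Proof.
move=> Nz; have Oz : Of z by case: Nz.
have [[k Ck]|nC] := pselect (exists k, C k z); last first.
  rewrite -(qm_agree Q Oz (tO Nz)); first exact: (trapped_F Q 1 Nz).
  by move=> i Ci; apply: nC; exists i.
have [ak|ak] := posnP (an k).
  have := qm_orbit Q Ck; rewrite ak /= => <-.
  exact: (trapped_F Q (dn k).+1 Nz).
have [i [j [c [/andP[j0 ja] Cc Nc ec]]]] := trapped_level_G Nz.
have [jlt|jge] := ltnP j (an i).
  have l1 : (0 < 1 <= an k)%N by [].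
  have l2 : (0 < j.+1 <= an i)%N by [].
  have e : iter 1 G z = iter j.+1 G c by rewrite /= ec.
  by have [_ [jj]] := qm_G_lev Q Ck Cc l1 l2 e; rewrite -jj in j0.
have ji : j = an i by apply/eqP; rewrite eqn_leq ja.
by rewrite ec ji -iterS -(qm_orbit Q Cc); exact: (trapped_F Q (dn i).+1 Nc).
Qed.

(** Returns of both orbits to [Z] are points of the strand, and the strand times for [F] and for [G]
    increase with the same index. *)
Lemma first_return_common z : Z z -> first_return F Z z = first_return G Z z.
Proof.
move=> Zz; have Oz : Of z by case: Zz.
have Oz' : Og z by exact: (common_Og Q).
have stS h k : (strand_time F C dn h k z < strand_time F C dn h k.+1 z)%N.
  by rewrite strand_timeS -addn1 leq_add2l jump_gt0.
have st_lt k k' : (k < k')%N -> (strand_time F C dn dn k z < strand_time F C dn dn k' z)%N.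
  exact: (homo_ltn ltn_trans (stS dn)).
have st_le k k' : (k <= k')%N -> (strand_time F C dn an k z <= strand_time F C dn an k' z)%N.
  rewrite leq_eqVlt => /predU1P[->//|lt]; apply: ltnW.
  exact: (homo_ltn ltn_trans (stS an)).
have inj k k' : strand_time F C dn dn k z = strand_time F C dn dn k' z -> k = k'.
  by case: (ltngtP k k') => // /st_lt + e; rewrite e ltnn.
have Zk k : Z (iter (strand_time F C dn an k z) G z) <-> Z (iter (strand_time F C dn dn k z) F z).
  by rewrite -(iter_strand_G Q) // -iter_strand_F.
have k0 h k : (0 < strand_time F C dn h k z)%N -> (0 < k)%N.
  by case: k => //; rewrite /strand_time big_ord0.
have [[n Zn]|nF] := pselect (exists n, Z (iter n.+1 F z)); last first.
  have [[n Zn]|nG] := pselect (exists n, Z (iter n.+1 G z)).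
    have [k ek] := strand_meets_G Q Oz Oz' Zn; case: nF.
    have kp : (0 < k)%N by apply: (k0 an); rewrite ek.
    exists (strand_time F C dn dn k z).-1; rewrite prednK; first by apply/Zk; rewrite ek.
    by apply: leq_trans kp _; exact: leq_strand_time.
  rewrite /first_return; have -> : return_time F Z z = 0%N.
    by apply: contrapT => /eqP; rewrite -lt0n => /return_time_gt0.
  suff -> : return_time G Z z = 0%N by [].
  by apply: contrapT => /eqP; rewrite -lt0n => /return_time_gt0.
have [/andP[r0 rn] Zr nZ] := return_timeP Zn.
have [k ek] := strand_meets_F Q Oz Oz' Zr.
have kp : (0 < k)%N by apply: (k0 dn); rewrite ek.
have tp : (0 < strand_time F C dn an k z)%N by apply: leq_trans kp _; exact: leq_strand_time.
have eR : return_time G Z z = strand_time F C dn an k z.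
  rewrite -(prednK tp); apply: return_time_eqS; first by rewrite prednK //; apply/Zk; rewrite ek.
  move=> j /andP[j0 jt] Zj; have [k' ek'] := strand_meets_G Q Oz Oz' Zj.
  have kk' : (k' < k)%N.
    rewrite ltnNge; apply/negP => kk'.
    have := st_le _ _ kk'.
    by rewrite ek'; lia.
  have k'0 : (0 < k')%N by apply: (k0 an); rewrite ek'.
  apply: (nZ (strand_time F C dn dn k' z)); last by apply/Zk; rewrite ek'.
  rewrite -ek st_lt // andbT; apply: leq_trans k'0 _; exact: leq_strand_time.
by rewrite /first_return eR -ek -(iter_strand_G Q) // -iter_strand_F.
Qed.

(** The strand on trapped points already amounts to the square of a return map, for [F] as for [G];
    the return map to [Z] is squared to match. *)
Definition two_step z : X := if z \in Z then first_return F Z (first_return F Z z) else s z.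

Lemma measurable_two_step : measurable_fun [set: X] two_step.
Proof.
have mR : measurable_fun [set: X] (first_return F Z) by exact: measurable_first_return.
move=> _ E mE; rewrite setTI.
rewrite (_ : _ @^-1` _ = (Z `&` (first_return F Z \o first_return F Z) @^-1` E) `|`
    (~` Z `&` s @^-1` E)).
  apply: measurableU; apply: measurableI => //.
  - by rewrite -[X in measurable X]setTI; exact: (measurableT_comp mR mR).
  - exact: measurableC.
  - by rewrite -[X in measurable X]setTI; exact: (measurable_strand Q).
rewrite /two_step; apply/seteqP; split=> z /=.
  by case: ifPn => [/set_mem|/negP nZ]; [left|right; split=> // /mem_set].
by case=> -[zZ Ez]; [rewrite mem_set|rewrite memNset].
Qed.

Let ZN z : Z z -> ~ N z.
Proof. by move=> Zz [_ /(_ 0%N)]. Qed.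

Let ZOf : Z `<=` Of. Proof. by move=> z []. Qed.
Let NOf : N `<=` Of. Proof. by move=> z []. Qed.

Lemma two_step_preserve E : measurable E ->
  m ((Z `|` N) `&` two_step @^-1` E) = m ((Z `|` N) `&` E).
Proof.
have mE' E' : measurable E' -> measurable (two_step @^-1` E').
  by move=> ?; rewrite -[X in measurable X]setTI; exact: measurable_two_step.
have split E' : measurable E' -> m ((Z `|` N) `&` E') = (m (Z `&` E') + m (N `&` E'))%E.
  move=> mE0; rewrite setIUl measureU //; try exact: measurableI.
  by rewrite -subset0 => z [[Zz _] [Nz _]]; exact: ZN Zz Nz.
move=> mE; rewrite !split //; last exact: mE'.
have mR : measurable_fun [set: X] (first_return F Z) by exact: measurable_first_return.
pose H := F @^-1` [set z | exists n, Z (iter n F z)].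
congr (_ + _)%E; last first.
  rewrite -(strand_preserve Q mE); congr (m _); apply/seteqP; split=> z [Nz] /=;
    by rewrite /two_step memNset //; move=> /ZN.
(* Only the part of [Of] visiting [Z] matters for the first return to [Z]. *)
pose O1 := Of `&` [set z | exists n, Z (iter n F z)].
have mO1 : measurable O1.
  rewrite (_ : O1 = Of `&` \bigcup_n iter n F @^-1` Z).
    by apply: measurableI => //; apply: bigcupT_measurable => n; exact: measurable_iter_preimage.
  by apply/seteqP; split=> z [Oz]; [case=> n Zn|case=> n _ Zn]; split=> //; exists n.
have O1E : O1 = Of `\` N.
  apply/seteqP; split=> z [Oz]; first by move=> [n Zn]; split=> // -[_ /(_ n)].
  by move=> nN; split=> //; apply: contrapT => nZ; apply: nN; split=> // n Zn; apply: nZ; exists n.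
have fO1 : (m O1 < +oo)%E by apply: (fin_sub mOf fOf) => // z [].
have presO1 E' : measurable E' -> m (O1 `&` F @^-1` E') = m (O1 `&` E').
  move=> mE0; have mFE : measurable (F @^-1` E') by exact: (measurable_iter_preimage mF 1).
  have mNO : measurable (~` N `&` E') by apply: measurableI => //; exact: measurableC.
  have e1 : O1 `&` E' = Of `&` (~` N `&` E') by rewrite O1E setDE setIA.
  have e2 : O1 `&` F @^-1` E' = Of `&` F @^-1` (~` N `&` E').
    rewrite O1E; apply/seteqP; split=> z; move=> [].
      by move=> [Oz nN] Ez; split=> //; split=> // /(tF Oz).
    move=> Oz [nN Ez]; split=> //; split=> // Nz; apply: nN; exact: (trapped_F Q 1 Nz).
  by rewrite e1 e2 (F_preserve Q).
have ZO1 : Z `<=` O1 by move=> z Zz; split; [exact: ZOf|exists 0%N].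
have hitO1 : m (O1 `&` [set z | forall n, ~ Z (iter n F z)]) = 0%E.
  by rewrite (_ : _ `&` _ = set0) ?measure0 // -subset0 => z [[_ [n Zn]] nZ]; exact: nZ Zn.
have presR E' : measurable E' -> m (Z `&` first_return F Z @^-1` E') = m (Z `&` E').
  exact: (first_return_preserve mO1 fO1 mF presO1 mZ ZO1 hitO1).
have mRE : measurable (first_return F Z @^-1` E).
  by rewrite -[X in measurable X]setTI; exact: mR.
rewrite -(presR E mE) -(presR _ mRE).
congr (m _); apply/seteqP; split=> z [Zz] /=; by rewrite /two_step mem_set.
Qed.

Lemma quilt_entropy : total_entropy m Of F = total_entropy m Og G.
Proof.
have ZOg : Z `<=` Og by move=> z; exact: (common_Og Q).
have bF : measurable (tower_bottom F N C dn).
  rewrite (_ : tower_bottom _ _ _ _ = \bigcup_(i in [set i | (0 < dn i)%N]) F @` (C i `&` N)).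
    apply: bigcup_measurable => i _.
    have [] // := @qm_F_im _ _ _ _ _ _ _ _ _ _ _ Q (C i `&` N); first exact: measurableI.
    by move=> z [_ /NOf]; left.
  apply/seteqP; split=> z; first by move=> [i [c [h0 Cc Nc ->]]]; exists i => //; exists c.
  by move=> [i h0 [c [Cc Nc] <-]]; exists i, c.
have bG : measurable (tower_bottom G N C an).
  rewrite (_ : tower_bottom _ _ _ _ = \bigcup_(i in [set i | (0 < an i)%N]) G @` (C i `&` N)).
    apply: bigcup_measurable => i _.
    have [] // := @qm_G_im _ _ _ _ _ _ _ _ _ _ _ Q (C i `&` N); first exact: measurableI.
    by move=> z [_ /NOf]; left.
  apply/seteqP; split=> z; first by move=> [i [c [h0 Cc Nc ->]]]; exists i => //; exists c.
  by move=> [i h0 [c [Cc Nc] <-]]; exists i, c.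
have hF : m (Of `&` [set z | ~ N z /\ forall n, ~ Z (iter n F z)]) = 0%E.
  by rewrite (_ : _ `&` _ = set0) ?measure0 // -subset0 => z [Oz [nN nZ]]; apply: nN.
have hG : m (Og `&` [set z | ~ N z /\ forall n, ~ Z (iter n G z)]) = 0%E.
  (* The points that enter [N] from outside. An orbit that reaches [N] without starting in it
     crosses [D], which is null. *)
  pose D := (Og `&` G @^-1` N) `\` (Og `&` N).
  have mGN : measurable (G @^-1` N) by exact: (measurable_iter_preimage mG 1).
  have mD : measurable D by apply: measurableD; exact: measurableI.
  have D0 : m D = 0%E.
    apply: measure_sub_eq; try exact: measurableI.
    - by move=> z [Oz Nz]; split=> //; exact: trapped_G.
    - apply: (fin_sub mOg fOg); first exact: measurableI.
      by move=> z [].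
    - by rewrite (G_preserve Q).
  have mH : measurable [set z | ~ N z /\ forall n, ~ Z (iter n G z)].
    rewrite (_ : [set z | _] = ~` N `&` \bigcap_n iter n G @^-1` (~` Z)).
      apply: measurableI; first exact: measurableC.
      by apply: bigcapT_measurable => n; apply: measurable_iter_preimage => //; exact: measurableC.
    by apply/seteqP; split=> z [nN H]; split=> // n; [move=> _; exact: H|exact: (H n I)].
  apply: (@null_sub _ _ _ m _ (\bigcup_n (Og `&` iter n G @^-1` D))).
  - exact: measurableI.
  - by apply: bigcupT_measurable => n; apply: measurableI => //; exact: measurable_iter_preimage.
  - move=> z [Oz [nN nZ]]; have [q Oq] := G_reaches_Of Q Oz.
    have Nq : N (iter q G z).
      by apply: trapped_of_G => // [|n]; [exact: (iter_G_in Q)|rewrite -iterD; exact: nZ].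
    apply: contrapT => nD.
    elim: q Nq {Oq} => // q IH Nq; apply: IH; apply: contrapT => nNq; apply: nD.
    exists q => //; split=> //; split; first by split=> //; exact: (iter_G_in Q).
    by move=> [].
  - apply: null_bigcup => n; first by apply: measurableI => //; exact: measurable_iter_preimage.
    rewrite (preserve_iter mG (G_preserve Q)) //.
    by apply: null_sub D0 => //; exact: measurableI.
have s_base z i : N z -> C i z -> two_step z = iter (dn i).+1 F z.
  by move=> Nz Ci; rewrite /two_step memNset ?/s ?(jump_base Q _ Ci) // => /ZN.
have s_nbase z : N z -> (forall i, ~ C i z) -> two_step z = F z.
  move=> Nz nC; rewrite /two_step memNset; last by move/ZN.
  by rewrite /s jump_notbase // => -[i _ Ci]; exact: nC Ci.
have EF : total_entropy m (Z `|` N) two_step = (2%:E * total_entropy m Of F)%E.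
  apply: (half_model_entropy mF mOf fOf (F_preserve Q) (qm_F_inj Q) mZ mN ZOf NOf ZN
    _ (qm_F_lev Q) trapped_level_F measurable_two_step _ _ _ two_step_preserve hF bF).
  - by move=> z Nz; exact: (trapped_F Q 1 Nz).
  - exact: s_nbase.
  - by move=> i z Nz Ci; exact: s_base.
  - by move=> z Zz; rewrite /two_step mem_set.
have NOg : N `<=` Og by exact: tO.
have EG : total_entropy m (Z `|` N) two_step = (2%:E * total_entropy m Og G)%E.
  apply: (half_model_entropy mG mOg fOg (G_preserve Q) (qm_G_inj Q) mZ mN ZOg NOg ZN
    trapped_G (qm_G_lev Q) trapped_level_G measurable_two_step _ _ _ two_step_preserve hG bG).
  - by move=> z Nz nC; rewrite s_nbase // (qm_agree Q (NOf Nz) (tO Nz)).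
  - by move=> i z Nz Ci; rewrite (s_base _ i) // (qm_orbit Q Ci).
  - move=> z Zz; rewrite /two_step mem_set // -(first_return_common Zz).
    have [[n Zn]|nF] := pselect (exists n, Z (iter n.+1 F z)).
      by apply: first_return_common; have [] := return_timeP Zn.
    have r0 : return_time F Z z = 0%N.
      by apply: contrapT => /eqP; rewrite -lt0n => /return_time_gt0.
    have -> : first_return F Z z = z by rewrite /first_return r0.
    exact: first_return_common.
have EFG : (2%:E * total_entropy m Of F = 2%:E * total_entropy m Og G)%E.
  by rewrite -EF -EG.
have f2 : (2%:E : \bar R)%E \is a fin_num by [].
have p2 : (0 < 2%:E :> \bar R)%E by rewrite lte_fin.
apply/le_anti/andP; split.
  by rewrite -(lee_pmul2l f2 p2) EFG.
by rewrite -(lee_pmul2l f2 p2) EFG.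
Qed.

End QuiltEntropy.

(** * Measures of the towers *)

Section QuiltMeasure.
Context d (X : measurableType d) (R : realType) (m : {measure set X -> \bar R}).

Lemma tower_series (S : X -> X) (C : nat -> set X) (h : nat -> nat) :
  (forall i, measurable (C i)) ->
  (forall i j, (j <= h i)%N -> measurable (iter j S @` C i) /\ m (iter j S @` C i) = m (C i)) ->
  (m (in_tower S C h) < +oo)%E -> levels_disjoint S C h ->
  series (fun i => (h i)%:R * fine (m (C i))) @ \oo --> fine (m (in_tower S C h)).
Proof.
move=> mC im fin dis; pose E i := \bigcup_(j in `I_(h i)) (iter j.+1 S @` C i).
have EE : in_tower S C h = \bigcup_i E i.
  apply/seteqP; split=> z.
    move=> [i [j [c [/andP[j0 jh] Cc ->]]]]; exists i => //; rewrite /E.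
    by case: j j0 jh => // j _ jh; exists j => //; exists c.
  by move=> [i _]; rewrite /E => -[j /= jh [c Cc <-]]; exists i, j.+1, c; split.
have mE i : measurable (E i).
  by apply: bigcup_measurable => j jh; have [] := im i j.+1 jh.
have tE i : m (E i) = ((h i)%:R%:E * m (C i))%E.
  rewrite /E measure_fin_bigcup //; first last.
  - by move=> j /= jh; have [] := im i j.+1 jh.
  - move=> j k /= jh kh [z [[c Cc ec] [c' Cc' ec']]].
    by have [|||_ []//] := dis i i j.+1 k.+1 c c' Cc Cc' => //; rewrite ec.
  rewrite -fsbig_ord /=.
  rewrite (eq_bigr (fun=> m (C i))); last by move=> j _; have [] := im i j.+1 (ltn_ord j).
  elim: (h i) => [|k IH]; first by rewrite big_ord0 mul0e.
  rewrite big_ord_recr /= IH -[in RHS]addn1 natrD EFinD ge0_muleDl ?mul1e //.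
have mEE : measurable (\bigcup_i E i) by exact: bigcupT_measurable.
have fE i : (h i)%:R * fine (m (C i)) = fine (m (E i)).
  (* Without levels, the tower gives no bound for the measure of [C i], but then the coefficient is
     0. *)
  have [hi|hi] := posnP (h i).
    by rewrite tE hi mul0r mul0e.
  have fC : m (C i) \is a fin_num.
    rewrite ge0_fin_numE //; apply: le_lt_trans fin; have [_ <-] := im i 1%N hi.
    apply: le_measure; rewrite ?inE; [by have [] := im i 1%N hi|by rewrite EE|].
    by move=> _ [c Cc <-]; exists i, 1%N, c.
  by rewrite tE fineM.
have tr : trivIset setT E.
  move=> i i' _ _ [z []]; rewrite /E => -[j /= jh [c Cc ec]] [j' /= jh' [c' Cc' ec']].
  have e : iter j.+1 S c = iter j'.+1 S c' by rewrite /= ec ec'.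
  by have [] := dis i i' j.+1 j'.+1 c c' Cc Cc' jh jh' e.
have fEn i : m (E i) \is a fin_num.
  rewrite ge0_fin_numE //; apply: le_lt_trans fin; rewrite EE.
  by apply: le_measure; rewrite ?inE //; exact: bigcup_sup.
have cvE : (fun n => \sum_(0 <= i < n) m (E i))%E @ \oo --> (fine (m (in_tower S C h)))%:E.
  rewrite fineK; last by rewrite ge0_fin_numE.
  by rewrite EE; exact: (@measure_semi_sigma_additive _ _ _ m E mE tr mEE).
have -> : series (fun i => (h i)%:R * fine (m (C i))) =
    fine \o (fun n => \sum_(0 <= i < n) m (E i))%E.
  apply/funext => n /=; rewrite /series /=; under eq_bigr => i _ do rewrite fE.
  by rewrite sum_fine.
exact: fine_cvg cvE.
Qed.

Context (F G : X -> X) (Of Og : set X) (C : nat -> set X) (dn an : nat -> nat).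
Context (Q : quilt_model m F G Of Og C dn an).

(** The series of both towers have nonnegative terms and finite sums, and the common part cancels in
    the difference of the measures. *)
Lemma quilt_measure (w := fun i => ((an i)%:R - (dn i)%:R) * fine (m (C i))) :
  cvgn [normed series w] /\ series w @ \oo --> fine (m Og) - fine (m Of).
Proof.
have mOf := qm_mOf Q; have mOg := qm_mOg Q; have fOf := qm_fOf Q; have fOg := qm_fOg Q.
have mU := measurable_U Q; have mV := measurable_V Q; have mZ := measurable_common Q.
have VO : in_tower G C an `<=` Og by move=> z; exact: (tower_Og Q).
have UO : in_tower F C dn `<=` Of.
  by move=> z [i [j [c [_ /(qm_C_sub Q) Oc ->]]]]; exact: (iter_F_in Q).
have ZO : common F Of C dn `<=` Of by move=> z [].
have fU : (m (in_tower F C dn) < +oo)%E by exact: (fin_sub mOf fOf).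
have fV : (m (in_tower G C an) < +oo)%E by exact: (fin_sub mOg fOg).
have cd : series (fun i => (dn i)%:R * fine (m (C i))) @ \oo --> fine (m (in_tower F C dn)).
  apply: tower_series => //; [exact: (qm_mC Q)| |exact: (qm_F_lev Q)].
  by move=> i j jd; apply: (image_iter_F Q); [exact: (qm_mC Q)|exact: (qm_C_sub Q)].
have ca : series (fun i => (an i)%:R * fine (m (C i))) @ \oo --> fine (m (in_tower G C an)).
  apply: tower_series => //; [exact: (qm_mC Q)| |exact: (qm_G_lev Q)].
  by move=> i j ja; apply: (image_iter_G Q ja); [exact: (qm_mC Q)|exact: subset_refl].
have eOf : fine (m Of) = fine (m (common F Of C dn)) + fine (m (in_tower F C dn)).
  rewrite -fine_measureU //; first by rewrite /common setUC setDUK.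
  - by rewrite /common; apply/seteqP; split=> // z [[_ nU] Uz].
  - by rewrite /common setUC setDUK.
have eOg : fine (m Og) = fine (m (common F Of C dn)) + fine (m (in_tower G C an)).
  rewrite {1}(qm_Og Q) fine_measureU //.
  - exact: (qm_disj Q).
  - by rewrite -(qm_Og Q).
split.
  apply: (@series_le_cvg _ _ (fun i => (an i)%:R * fine (m (C i)) + (dn i)%:R * fine (m (C i)))).
  - by move=> n; exact: normr_ge0.
  - by move=> n; rewrite addr_ge0 // mulr_ge0 // fine_ge0.
  - move=> n; rewrite /= /w normrM (ger0_norm (fine_ge0 _)) // -mulrDl ler_wpM2r ?fine_ge0 //.
    by apply: le_trans (ler_normB _ _) _; rewrite !ger0_norm.
  - exact: (is_cvg_seriesD (cvgP _ ca) (cvgP _ cd)).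
rewrite eOf eOg (_ : _ - _ = fine (m (in_tower G C an)) - fine (m (in_tower F C dn))); last by ring.
rewrite (_ : series w = series (fun i => (an i)%:R * fine (m (C i))) - series (fun i => (dn i)%:R * fine (m (C i)))).
  exact: cvgB.
apply/funext => n; rewrite /series /= -[RHS]/(_ - _) /=. rewrite /series /= -sumrB; apply: eq_bigr => i _.
by rewrite /w mulrBl.
Qed.

End QuiltMeasure.

(** * Moebius maps of the plane *)

Section Homography.
Context (R : realType).
Local Notation leb := (@lebesgue_measure R).

Lemma measurable_inv : measurable_fun [set: R] (fun t : R => t^-1).
Proof.
have -> : [set: R] = [set 0] `|` ~` [set 0] by rewrite setUv.
apply/measurable_funU => //; first exact: measurableC.
split; first exact: measurable_fun_set1.
apply: open_continuous_measurable_fun; first by rewrite openC; exact: closed_eq.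
by move=> x /set_mem x0; apply: inv_continuous; apply/eqP.
Qed.

Lemma measurable_affine (a b : R) : measurable_fun [set: R] (fun x => a * x + b).
Proof. by apply: measurable_funD => //; exact: measurable_funM. Qed.

(** The point [p] will be the image of infinity under a homography, around which preimages of
    intervals are not intervals. Intervals ending at [p] are exhausted from inside, and the others
    are cut at [p]. *)
Lemma lebesgue_unique_punctured (nu : {measure set (measurableTypeR R) -> \bar R}) (p : R) :
  (forall u v, u < v -> v < p \/ p < u -> nu `]u, v]%classic = (v - u)%:E) ->
  nu [set p] = 0%E ->
  forall A : set (measurableTypeR R), measurable A -> leb A = nu A.
Proof.
move=> H H0.
have lebI u v : u < v -> leb (`]u, v]%classic : set R) = (v - u)%:E.
  by move=> uv; rewrite lebesgue_measure_itv /= lte_fin uv.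
have lebO u v : u < v -> leb (`]u, v[%classic : set R) = (v - u)%:E.
  by move=> uv; rewrite lebesgue_measure_itv /= lte_fin uv.
have L u : u < p -> nu (`]u, p[%classic : set (measurableTypeR R)) = (p - u)%:E.
  move=> up; pose e n : R := (p - u) / n.+2%:R.
  have e0 n : 0 < e n by rewrite divr_gt0 ?subr_gt0.
  have e1 n : e n < p - u.
    by rewrite ltr_pdivrMr // -[ltLHS]mulr1 ltr_pM2l ?subr_gt0 // ltr1n.
  pose A n : set (measurableTypeR R) := `]u, p - e n]%classic.
  have AE : `]u, p[%classic = \bigcup_n A n.
    apply/seteqP; split=> x /=; rewrite in_itv /=.
      move=> /andP[ux xp]; pose k := Num.truncn ((p - u) / (p - x)).
      exists k => //; rewrite /A /= in_itv /= ux /= lerBrDr -lerBrDl ler_pdivrMr //.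
      rewrite -ler_pdivrMl ?subr_gt0 // mulrC.
      have := truncnS_gt ((p - u) / (p - x)); rewrite -/k => h.
      by apply: le_trans (ltW h) _; rewrite ler_nat.
    move=> [n _]; rewrite /A /= in_itv /= => /andP[-> xe] /=; apply: le_lt_trans xe _.
    by rewrite ltrBlDr ltrDl.
  have mA n : measurable (A n) by exact: measurable_itv.
  have nd : nondecreasing_seq A.
    move=> m n mn; rewrite subsetEset /A => x /=; rewrite !in_itv /= => /andP[-> xe] /=.
    apply: le_trans xe _; rewrite lerB // /e ler_wpM2l ?subr_ge0 ?(ltW up) //.
    by rewrite lef_pV2 ?posrE // ler_nat.
  have mU : measurable (\bigcup_n A n) by exact: bigcupT_measurable.
  have c1 := nondecreasing_cvg_mu (mu := nu) mA mU nd.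
  have c2 := nondecreasing_cvg_mu (mu := leb) mA mU nd.
  have e12 : nu \o A = leb \o A.
    apply/funext => n /=; have l : u < p - e n by rewrite ltrBrDr addrC -ltrBrDr; exact: e1.
    by rewrite lebI // H //; left; rewrite ltrBlDr ltrDl.
  rewrite e12 in c1; rewrite AE -(cvg_lim _ c1) // (cvg_lim _ c2) // -AE.
  exact: lebO.
have Rr v : p < v -> nu (`]p, v]%classic : set (measurableTypeR R)) = (v - p)%:E.
  move=> pv; pose e n : R := (v - p) / n.+2%:R.
  have e0 n : 0 < e n by rewrite divr_gt0 ?subr_gt0.
  have e1 n : e n < v - p.
    by rewrite ltr_pdivrMr // -[ltLHS]mulr1 ltr_pM2l ?subr_gt0 // ltr1n.
  pose A n : set (measurableTypeR R) := `]p + e n, v]%classic.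
  have AE : `]p, v]%classic = \bigcup_n A n.
    apply/seteqP; split=> x /=; rewrite in_itv /=.
      move=> /andP[ux xp]; pose k := Num.truncn ((v - p) / (x - p)).
      exists k => //; rewrite /A /= in_itv /= xp andbT addrC -ltrBrDr ltr_pdivrMr //.
      rewrite -ltr_pdivrMl ?subr_gt0 // mulrC.
      have := truncnS_gt ((v - p) / (x - p)); rewrite -/k => h.
      by apply: lt_le_trans h _; rewrite ler_nat.
    move=> [n _]; rewrite /A /= in_itv /= => /andP[xe ->]; rewrite andbT.
    by apply: lt_trans xe; rewrite ltrDl.
  have mA n : measurable (A n) by exact: measurable_itv.
  have nd : nondecreasing_seq A.
    move=> m n mn; rewrite subsetEset /A => x /=; rewrite !in_itv /= => /andP[xe ->]; rewrite andbT.
    apply: le_lt_trans xe; rewrite lerD2l /e ler_wpM2l ?subr_ge0 ?(ltW pv) //.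
    by rewrite lef_pV2 ?posrE // ler_nat.
  have mU : measurable (\bigcup_n A n) by exact: bigcupT_measurable.
  have c1 := nondecreasing_cvg_mu (mu := nu) mA mU nd.
  have c2 := nondecreasing_cvg_mu (mu := leb) mA mU nd.
  have e12 : nu \o A = leb \o A.
    apply/funext => n /=; have l : p + e n < v by rewrite addrC -ltrBrDr; exact: e1.
    by rewrite lebI // H //; right; rewrite ltrDl.
  rewrite e12 in c1; rewrite AE -(cvg_lim _ c1) // (cvg_lim _ c2) // -AE.
  exact: lebI.
have L' u : u < p -> nu (`]u, p]%classic : set (measurableTypeR R)) = (p - u)%:E.
  move=> up; have -> : (`]u, p]%classic : set (measurableTypeR R)) = `]u, p[%classic `|` [set p].
    by apply/esym/setUitv1; rewrite bnd_simp.
  transitivity (nu (`]u, p[%classic : set (measurableTypeR R)) + nu [set p])%E; last by rewrite L // H0 adde0.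
  apply: measureU => //.
  by apply/seteqP; split=> // x [] /=; rewrite in_itv /= => /andP[_ xp] xe; move: xp; rewrite xe ltxx.
apply: lebesgue_measure_unique => X [[u v] /= uv <-].
have [vu|{}uv] := leP v u.
  by rewrite set_itv_ge ?bnd_simp -?leNgt // !measure0.
rewrite lebI //.
have [vp|pv|vp] := ltgtP v p; [by rewrite H //; left| |by rewrite vp L' // -vp].
have [up|pu|->] := ltgtP u p; last by rewrite Rr.
  have -> : (`]u, v]%classic : set (measurableTypeR R)) = `]u, p]%classic `|` `]p, v]%classic.
    by rewrite -itv_bndbnd_setU // ?bnd_simp ltW.
  transitivity (nu (`]u, p]%classic : set (measurableTypeR R)) + nu (`]p, v]%classic : set (measurableTypeR R)))%E.
    by rewrite L' // Rr // -EFinD; congr (_%:E); ring.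
  apply/esym/measureU; try exact: measurable_itv.
  apply/seteqP; split=> // x [] /=; rewrite !in_itv /= => /andP[_ xp] /andP[px _].
  by move: (lt_le_trans px xp); rewrite ltxx.
by rewrite H //; right.
Qed.

Lemma integral_inv_sqr (r s u v : R) : u < v ->
  (forall x, u <= x <= v -> r * x + s != 0) ->
  (\int[leb]_(x in `[u, v]) ((r * x + s) ^- 2)%:E = ((v - u) / ((r * u + s) * (r * v + s)))%:E)%E.
Proof.
move=> uv n0; have nu : r * u + s != 0 by apply: n0; rewrite lexx ltW.
(* This primitive makes sense for [r = 0] too, and it vanishes at [u]. *)
pose F (x : R) := (x - u) * ((r * u + s) * (r * x + s))^-1.
have dF x : u <= x <= v -> is_derive x 1 F ((r * x + s) ^- 2).
  move=> /n0 nx.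
  have n2 : (r * u + s) * (r * x + s) != 0 by rewrite mulf_neq0.
  have d1 : is_derive x 1 (fun x : R => x - u) 1.
    by apply: is_derive_eq; rewrite subr0.
  have d2 : is_derive x 1 (fun x : R => (r * u + s) * (r * x + s)) ((r * u + s) * r).
    by apply: is_derive_eq; rewrite /GRing.scale /=; ring.
  have d3 := @is_deriveV _ (fun x : R => (r * u + s) * (r * x + s)) _ _ _ n2 d2.
  have dd := is_deriveM d1 d3; apply: (is_derive_eq dd).
  by rewrite /GRing.scale /=; field; rewrite nx nu.
have cF x : u <= x <= v -> {for x, continuous F}.
  by move=> /dF[d _]; apply/differentiable_continuous/derivable1_diffP.
rewrite (@continuous_FTC2 _ _ F) //.
- rewrite /F subrr mul0r sube0; congr (_%:E); by rewrite mulrC.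
- apply: derivable_within_continuous => x; rewrite in_itv /= => /n0 nx.
  have d2 : is_derive x 1 (fun x : R => (r * x + s) * (r * x + s)) (r * (r * x + s) *+ 2).
    by apply: is_derive_eq; rewrite /GRing.scale /=; ring.
  have n2 : (r * x + s) * (r * x + s) != 0 by rewrite mulf_neq0.
  by have [] := @is_deriveV _ (fun x : R => (r * x + s) * (r * x + s)) _ _ _ n2 d2.
- split.
  + by move=> x; rewrite in_itv /= => /andP[/ltW ux /ltW xv]; have [] := dF x; rewrite ?ux.
  + by apply: cvg_at_right_filter; apply: cF; rewrite lexx ltW.
  + by apply: cvg_at_left_filter; apply: cF; rewrite lexx ltW.
- move=> x; rewrite in_itv /= => /andP[/ltW ux /ltW xv].
  by rewrite derive1E; have [] := dF x; rewrite ?ux.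
Qed.

Lemma affine_same_sign (f0 f1 u v : R) : u <= v ->
  (forall t, u <= t <= v -> f0 + f1 * t != 0) ->
  forall x y, u <= x <= v -> u <= y <= v -> 0 < (f0 + f1 * x) * (f0 + f1 * y).
Proof.
move=> uv n0 x y; wlog xy : x y / x <= y => [H xI yI|xI yI].
  by have [/H|/ltW /H] := leP x y; [exact|rewrite mulrC; exact].
rewrite ltNge; apply/negP => le0.
have [f1_0|f1n] := eqVneq f1 0.
  move: le0 (n0 _ xI); rewrite f1_0 !mul0r !addr0 => le0 f0n.
  by move: le0; apply/negP; rewrite -ltNge -expr2 exprn_even_gt0.
have n1 : f0 + f1 * (- f0 / f1) = 0 by field.
have xf : x <= - f0 / f1 <= y.
  have ex : f0 + f1 * x = f1 * (x - - f0 / f1) by field.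
  have ey : f0 + f1 * y = f1 * (y - - f0 / f1) by field.
  move: le0; rewrite ex ey mulrACA -expr2 pmulr_rle0; last by rewrite exprn_even_gt0.
  set w := - f0 / f1 => h; nra.
have := n0 (- f0 / f1); rewrite n1 eqxx => H; apply/notF/H.
by move: xI yI xf => /andP[ux _] /andP[_ yv] /andP[xw wy]; rewrite (le_trans ux) // (le_trans wy).
Qed.

Lemma affine_between (f0 f1 al be : R) x : 0 < (f0 + f1 * al) * (f0 + f1 * be) -> al <= x <= be ->
  0 < (f0 + f1 * x) * (f0 + f1 * al) /\ 0 < (f0 + f1 * x) * (f0 + f1 * be).
Proof.
move=> h /andP[ax xb].
have [ab|ab] := eqVneq al be.
  have -> : x = al by apply/le_anti; rewrite ax andbT ab.
  by rewrite -ab in h *.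
have {}ab : 0 < be - al by rewrite subr_gt0 lt_neqAle ab (le_trans ax).
set A := f0 + f1 * al in h *; set B := f0 + f1 * be in h *.
have e : (f0 + f1 * x) * (be - al) = A * (be - x) + B * (x - al) by rewrite /A /B; ring.
have An : A != 0 by apply: contraTneq h => ->; rewrite mul0r ltxx.
have Bn : B != 0 by apply: contraTneq h => ->; rewrite mulr0 ltxx.
have A2 : 0 < A ^+ 2 by rewrite exprn_even_gt0.
have B2 : 0 < B ^+ 2 by rewrite exprn_even_gt0.
split; rewrite -(pmulr_lgt0 _ ab).
  rewrite (_ : _ * _ * _ = A ^+ 2 * (be - x) + (A * B) * (x - al)); last by rewrite mulrAC e; ring.
  have [xa|xa] := eqVneq x al; first by rewrite xa subrr mulr0 addr0 mulr_gt0.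
  apply: ltr_wpDl; first by rewrite mulr_ge0 ?(ltW A2) ?subr_ge0.
  by rewrite mulr_gt0 // subr_gt0 lt_neqAle eq_sym xa.
rewrite (_ : _ * _ * _ = (A * B) * (be - x) + B ^+ 2 * (x - al)); last by rewrite mulrAC e; ring.
have [xa|xa] := eqVneq x al; first by rewrite xa subrr mulr0 addr0 mulr_gt0.
apply: ltr_wpDl; first by rewrite mulr_ge0 ?(ltW h) ?subr_ge0.
by rewrite mulr_gt0 // subr_gt0 lt_neqAle eq_sym xa.
Qed.

Section Substitution.
Context (p q r s e : R).
Hypothesis det1 : p * s - q * r = e.
Hypothesis e1 : e ^+ 2 = 1.

Let den x : R := r * x + s.
Let hom x : R := (p * x + q) / den x.

Lemma measurable_homography : measurable_fun [set: R] hom.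
Proof.
apply: measurable_funM; first exact: measurable_affine.
by apply: (measurableT_comp measurable_inv); exact: measurable_affine.
Qed.

Let wt x : \bar R := (den x ^- 2)%:E.

Let mwt : measurable_fun [set: R] wt.
Proof.
apply/measurable_EFinP; apply: (measurableT_comp measurable_inv).
by apply: measurable_funX; exact: measurable_affine.
Qed.

Let wt0 x : (0 <= wt x)%E. Proof. by rewrite lee_fin invr_ge0 sqr_ge0. Qed.

(** The image under [hom] of the Lebesgue measure weighted by the Jacobian; the change of variables
    is the statement that this is again the Lebesgue measure. *)
Let nu (E : set (measurableTypeR R)) : \bar R := (\int[leb]_(x in hom @^-1` E) wt x)%E.

Let nu0 : nu set0 = 0%E. Proof. by rewrite /nu preimage_set0 integral_set0. Qed.

Let nu_ge0 E : (0 <= nu E)%E. Proof. by apply: integral_ge0. Qed.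

Let nu_sa : semi_sigma_additive nu.
Proof.
move=> A mA tA mU.
have mh (B : set R) : measurable B -> measurable (hom @^-1` B).
  by move=> mB; rewrite -[X in measurable X]setTI; exact: measurable_homography.
have := @semi_sigma_additive_nng_induced _ _ _ leb wt mwt wt0 (fun n => hom @^-1` A n).
rewrite /nu preimage_bigcup; apply.
- by move=> n; exact: (mh _ (mA n)).
- move=> i j _ _ [x [Ai Aj]]; apply: (tA i j) => //; by exists (hom x).
- by rewrite -preimage_bigcup; exact: (mh _ mU).
Qed.

HB.instance Definition _ := isMeasure.Build _ _ _ nu nu0 nu_ge0 nu_sa.

(** Away from the image of infinity the inverse is monotone, in the sense given by [e], which
    decides the order of the endpoints [inv u] and [inv v]. The sign of [den] is constant there, so
    denominators can be cleared. *)
Lemma homography_preimage u v : u < v -> (forall t, u <= t <= v -> p - r * t != 0) ->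
  exists al be, [/\ al < be, forall x, al <= x <= be -> den x != 0,
    (be - al) / (den al * den be) = v - u &
    forall x, den x != 0 -> (u <= hom x <= v) = (al <= x <= be)].
Proof.
move=> uv n0; pose inv t : R := (s * t - q) / (p - r * t).
have pos x y : u <= x <= v -> u <= y <= v -> 0 < (p - r * x) * (p - r * y).
  rewrite -!mulNr; apply: affine_same_sign; [exact: ltW|by move=> t /n0; rewrite mulNr].
have uI : u <= u <= v by rewrite lexx ltW.
have vI : u <= v <= v by rewrite lexx ltW.
have nzu := n0 _ uI; have nzv := n0 _ vI.
have dinv t : p - r * t != 0 -> den (inv t) = e / (p - r * t).
  by move=> nt; rewrite /den /inv -det1; field.
have e0 : e != 0 by apply/eqP => E; move: e1; rewrite E expr0n /= => /eqP; rewrite eq_sym oner_eq0.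
have einv : e^-1 = e by apply: (mulfI e0); rewrite divff // -expr2 e1.
have dd t : u <= t <= v -> forall x, den x != 0 -> 0 < den x * den (inv t) ->
    ((t <= hom x) = (0 <= e * (x - inv t))) * ((hom x <= t) = (e * (x - inv t) <= 0)).
  move=> tI x nx dp; have nt := n0 _ tI.
  have nd : den (inv t) != 0 by apply: contraTneq dp => ->; rewrite mulr0 ltxx.
  have -> : e * (x - inv t) = (hom x - t) * (den x * den (inv t)).
    by rewrite (dinv _ nt) /hom /inv -det1 /den; field; rewrite nt.
  by rewrite pmulr_lge0 // pmulr_lle0 // subr_ge0 subr_le0.
have P1 x t : u <= t <= v -> den x != 0 -> u <= hom x <= v -> 0 < den x * den (inv t).
  move=> tI nx hI; have nh := n0 _ hI; have nt := n0 _ tI.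
  have -> : den x = e / (p - r * hom x).
    by apply: (mulIf nh); rewrite divfK // /hom mulrBr mulrA -det1; rewrite /den in nx *; field.
  rewrite dinv // mulrACA -expr2 e1 mul1r -invfM invr_gt0; exact: pos.
have dinv_pos : 0 < den (inv u) * den (inv v).
  by rewrite !dinv // mulrACA -expr2 e1 mul1r -invfM invr_gt0; exact: pos.
have diff : inv v - inv u = e * ((v - u) / ((p - r * u) * (p - r * v))).
  by rewrite /inv -det1; field; rewrite ?nzu ?nzv.
have dP : 0 < (v - u) / ((p - r * u) * (p - r * v)).
  by rewrite divr_gt0 ?subr_gt0 //; exact: pos.
have P2 al be x : 0 < den al * den be -> al <= x <= be -> 0 < den x * den al /\ 0 < den x * den be.
  by rewrite /den ![_ + s]addrC; exact: affine_between.
have n_of x y : 0 < den x * den y -> den x != 0.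
  by move=> h; apply: contraTneq h => ->; rewrite mul0r ltxx.
have : (e - 1) * (e + 1) = 0 by rewrite -subr_sqr e1 expr1n subrr.
move/eqP; rewrite mulf_eq0 subr_eq0 addr_eq0 => /orP[]/eqP ee.
  exists (inv u), (inv v); split.
  - by rewrite -subr_gt0 diff ee mul1r.
  - by move=> x xI; have [/n_of] := P2 _ _ _ dinv_pos xI.
  - by rewrite diff !dinv // ee; field; rewrite ?nzu ?nzv.
  - move=> x nx; apply/idP/idP => [hI|xI].
      move: (hI); rewrite (dd u uI x nx (P1 x u uI nx hI)).1 (dd v vI x nx (P1 x v vI nx hI)).2.
      by rewrite ee !mul1r subr_ge0 subr_le0.
    have [pu pv] := P2 _ _ _ dinv_pos xI.
    by rewrite (dd u uI x nx pu).1 (dd v vI x nx pv).2 ee !mul1r subr_ge0 subr_le0.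
have dinv_pos' : 0 < den (inv v) * den (inv u) by rewrite mulrC.
exists (inv v), (inv u); split.
- by rewrite -subr_lt0 diff ee mulN1r oppr_lt0.
- by move=> x xI; have [/n_of] := P2 _ _ _ dinv_pos' xI.
- by rewrite -opprB diff !dinv // ee; field; rewrite ?nzu ?nzv.
- move=> x nx; apply/idP/idP => [hI|xI].
    move: (hI); rewrite (dd u uI x nx (P1 x u uI nx hI)).1 (dd v vI x nx (P1 x v vI nx hI)).2.
    by rewrite ee !mulN1r oppr_ge0 oppr_le0 subr_ge0 subr_le0 andbC.
  have [pv pu] := P2 _ _ _ dinv_pos' xI.
  by rewrite (dd u uI x nx pu).1 (dd v vI x nx pv).2 ee !mulN1r oppr_ge0 oppr_le0 subr_ge0 subr_le0 andbC.
Qed.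

Lemma homography_null (y : R) : nu [set y] = 0%E.
Proof.
have e0 : e != 0 by apply/eqP => E; move: e1; rewrite E expr0n /= => /eqP; rewrite eq_sym oner_eq0.
(* The pole is added to the algebraic preimage, because [hom] takes the value 0 there by the
   convention for division by zero. *)
pose E1 : set R := [set (s * y - q) / (p - r * y)] `|` [set - s / r].
have fE : finite_set E1 by rewrite /E1 finite_setU.
have sE : hom @^-1` [set y] `<=` E1.
  move=> x /= hx; have [dx|nx] := eqVneq (den x) 0.
    right; have rn : r != 0.
      apply/eqP => r0; move: dx; rewrite /den r0 mul0r add0r => s0.
      by move: e0; rewrite -det1 s0 r0 !mulr0 subr0 eqxx.
    by apply: (mulIf rn); rewrite divfK // mulrC; apply/eqP; rewrite -addr_eq0; exact/eqP.
  left; have eh : (p - r * y) * den x = e.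
    rewrite -hx /hom -det1 /den in nx *; field; exact: nx.
  have ny : p - r * y != 0 by apply: contraNneq e0 => y0; rewrite -eh y0 mul0r.
  have ex : p * x + q = y * den x by rewrite -hx /hom divfK.
  apply: (mulIf ny); rewrite divfK //; move: ex; rewrite /den => ex.
  by rewrite mulrBr (mulrC x p) -[p * x](addrK q) ex; ring.
apply: null_set_integral.
- by rewrite -[X in measurable X]setTI; exact: measurable_homography.
- exact: measurable_funTS.
- by apply: countable_lebesgue_measure0; apply: finite_set_countable; exact: sub_finite_set fE.
Qed.

Lemma lebesgue_homography (E : set R) : measurable E ->
  (\int[leb]_(x in hom @^-1` E) ((den x) ^- 2)%:E = leb E)%E.
Proof.
have ne : p != 0 \/ r != 0.
  case: (eqVneq p 0) => [p0|]; [right|by left]; apply/eqP => r0.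
  by move: e1; rewrite -det1 p0 r0 mul0r mulr0 subr0 expr0n /= => /eqP; rewrite eq_sym oner_eq0.
move=> mE; apply/esym/(@lebesgue_unique_punctured nu (p / r)) => //; last exact: homography_null.
move=> u v uv pI.
have n0 t : u <= t <= v -> p - r * t != 0.
  move=> tI; apply/eqP => pt.
  have [r0|rn] := eqVneq r 0.
    by move: pt; rewrite r0 mul0r subr0 => p0; case: ne; rewrite ?p0 ?r0 eqxx.
  have tp : t = p / r by apply: (mulIf rn); rewrite divfK // mulrC; apply/esym/eqP; rewrite -subr_eq0 pt.
  case: pI; move/andP: tI => [ut tv]; rewrite -tp => h.
    by move: (le_lt_trans tv h); rewrite ltxx.
  by move: (lt_le_trans h ut); rewrite ltxx.
have [al [be [ab nd dd I]]] := homography_preimage uv n0.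
transitivity (nu (`[u, v]%classic : set (measurableTypeR R))).
  have -> : (`[u, v]%classic : set (measurableTypeR R)) = [set u] `|` `]u, v]%classic.
    by apply/esym/setU1itv; rewrite bnd_simp ltW.
  transitivity (nu ([set u]) + nu (`]u, v]%classic : set (measurableTypeR R)))%E.
    by rewrite homography_null add0e.
  apply/esym/measureU => //.
  by apply/seteqP; split=> // x [/= ->]; rewrite in_itv /= ltxx.
rewrite /nu -[v - u]dd -(@integral_inv_sqr r s) //.
rewrite integral_mkcond [RHS]integral_mkcond.
apply: eq_integral => x _; rewrite !patchE.
(* At the pole both integrands are 0, again by the convention for division by zero. *)
have [nx|nx] := eqVneq (den x) 0.
  by rewrite /wt -/(den x) nx expr0n /= invr0; do 2 case: ifP => _.
have -> : (x \in hom @^-1` `[u, v]%classic) = (u <= hom x <= v).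
  by apply/idP/idP; rewrite inE /= in_itv.
by rewrite I // mem_setE in_itv.
Qed.

End Substitution.

End Homography.

(** * Planar Möbius maps in straightened coordinates *)

Section PlanarMobius.
Context (R : realType).
Local Notation leb := (@lebesgue_measure R).
Local Notation leb2 := (@lebesgue_measure R \x @lebesgue_measure R)%E.
Implicit Types (M : 'M[R]_2) (z : R * R).

Lemma det_mx22 M : \det M = M 0 0 * M 1 1 - M 0 1 * M 1 0.
Proof.
rewrite (expand_det_row _ 0) !big_ord_recl big_ord0 addr0 /cofactor !det_mx11 !mxE /=.
rewrite !expr0 !expr1.
rewrite (_ : lift 0 0 = 1); last exact/val_inj.
rewrite (_ : lift 1 0 = 0); last exact/val_inj.
by rewrite mul1r mulN1r mulrN.
Qed.

(** This conjugate of [M] is the transpose of its adjugate. *)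
Lemma rotmx_conj M : let N := rotmx R *m M *m invmx (rotmx R) in
  [/\ N 0 0 = M 1 1, N 0 1 = - M 1 0, N 1 0 = - M 0 1 & N 1 1 = M 0 0].
Proof.
have e : invmx (rotmx R) = - rotmx R.
  have rr : rotmx R *m (- rotmx R) = 1%:M.
    apply/matrixP => i j; rewrite !mxE !big_ord_recl big_ord0 !mxE.
    by case: i => [[|[|//]] ?]; case: j => [[|[|//]] ?] //=;
      rewrite ?(subr0, sub0r, mulr0, mul0r, addr0, add0r, oppr0, mulr1, mul1r, mulN1r, mulrN1, opprK).
  have [u _] := mulmx1_unit rr.
  by rewrite -[RHS](mulKmx u) rr mulmx1.
have l0 : lift 0 0 = 1 :> 'I_2 by exact/val_inj.
rewrite /= e; split; rewrite !(mxE, big_ord_recl, big_ord0) !l0 /=;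
  rewrite ?(subr0, sub0r, mulr0, mul0r, addr0, add0r, oppr0, mulr1, mul1r, mulN1r, mulrN1, opprK) //.
Qed.

(** The adjugate, which induces the inverse Möbius map without any division by the determinant. *)
Definition minv M : 'M[R]_2 := \matrix_(i < 2, j < 2)
  if i == 0 then (if j == 0 then M 1 1 else - M 0 1)
  else (if j == 0 then - M 1 0 else M 0 0).

Lemma minvE M : [/\ minv M 0 0 = M 1 1, minv M 0 1 = - M 0 1, minv M 1 0 = - M 1 0 & minv M 1 1 = M 0 0].
Proof. by rewrite !mxE. Qed.

Lemma planar_mobiusE M z : planar_mobius M z =
  ((M 0 0 * z.1 + M 0 1) / (M 1 0 * z.1 + M 1 1), (M 1 1 * z.2 - M 1 0) / (M 0 0 - M 0 1 * z.2)).
Proof.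
have [e1 e2 e3 e4] := rotmx_conj M.
rewrite /planar_mobius /mobius /mobius_den e1 e2 e3 e4; congr (_, _ / _).
by rewrite mulNr addrC.
Qed.

Definition unimodular M := \det M = 1 \/ \det M = -1.

Lemma unimodular_sqr M : unimodular M -> (\det M) ^+ 2 = 1.
Proof. by case=> ->; rewrite ?sqrrN expr1n. Qed.

Lemma unimodular_neq0 M : unimodular M -> \det M != 0.
Proof. by case=> ->; rewrite ?oppr_eq0 oner_eq0. Qed.

Lemma det_minv M : \det (minv M) = \det M.
Proof. by have [e1 e2 e3 e4] := minvE M; rewrite !det_mx22 e1 e2 e3 e4; ring. Qed.

Lemma minvK M : minv (minv M) = M.
Proof.
by apply/matrixP => -[[|[|//]] i] [[|[|//]] j]; rewrite !mxE /= ?opprK; congr (M _ _); exact/val_inj.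
Qed.

Lemma measurable_mobius M : measurable_fun [set: R] (mobius M).
Proof. exact: measurable_homography. Qed.

Lemma measurable_planar_mobius M : measurable_fun [set: R * R] (planar_mobius M).
Proof.
apply: measurable_fun_pair.
  exact: (measurableT_comp (measurable_mobius M) measurable_fst).
exact: (measurableT_comp (measurable_mobius _) measurable_snd).
Qed.

(* The points at which [planar_mobius M] takes a conventional value. *)
Definition polar M z := (M 1 0 * z.1 + M 1 1 == 0) || (M 0 0 - M 0 1 * z.2 == 0).

Definition hyperbolic z := 1 + z.1 * z.2 == 0.

(* The straightening [(x, y) -> (x, zeta (x, y))] maps [mu] to the Lebesgue
   measure, and the Mobius maps to maps which are affine on vertical lines. *)
Definition zeta z : R := z.2 / (1 + z.1 * z.2).

Definition unstraighten z : R * R := (z.1, z.2 / (1 - z.1 * z.2)).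

(** For determinant 1 or -1, the vertical slope is up to sign the inverse of the horizontal
    derivative [c ^- 2], so area is preserved. *)
Definition planar_skew M z : R * R :=
  let c := M 1 0 * z.1 + M 1 1 in
  (mobius M z.1, \det M * c ^+ 2 * z.2 - \det M * M 1 0 * c).

Lemma mobius_density M z : ~~ polar M z ->
  1 + (planar_mobius M z).1 * (planar_mobius M z).2 =
  \det M * (1 + z.1 * z.2) / ((M 1 0 * z.1 + M 1 1) * (M 0 0 - M 0 1 * z.2)).
Proof.
by rewrite /polar negb_or => /andP[n1 n2]; rewrite planar_mobiusE det_mx22 /=; field; rewrite ?n1 ?n2.
Qed.

Lemma planar_mobius_hyperbolic M z : unimodular M -> ~~ polar M z ->
  hyperbolic (planar_mobius M z) = hyperbolic z.
Proof.
move=> uM pz; have := pz; rewrite /polar negb_or => /andP[n1 n2].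
by rewrite /hyperbolic mobius_density // !mulf_eq0 invr_eq0 mulf_eq0 (negPf n1) (negPf n2)
  (negPf (unimodular_neq0 uM)) /= orbF.
Qed.

Lemma zeta_mobius M z : unimodular M -> ~~ polar M z -> ~~ hyperbolic z ->
  zeta (planar_mobius M z) = (planar_skew M (z.1, zeta z)).2.
Proof.
move=> uM pz hz; rewrite /zeta mobius_density // planar_mobiusE /planar_skew /=.
have := pz; rewrite /polar negb_or => /andP[n1 n2].
have e2 := unimodular_sqr uM; have e0 := unimodular_neq0 uM.
have einv : (\det M)^-1 = \det M by apply: (mulfI e0); rewrite divff // -expr2 e2.
transitivity (\det M * (M 1 1 * z.2 - M 1 0) * (M 1 0 * z.1 + M 1 1) / (1 + z.1 * z.2)).
  by rewrite -[X in _ = X * (M 1 1 * z.2 - _) * _ / _]einv; field; rewrite n1 n2 e0 hz.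
by field.
Qed.

Lemma unstraightenK z : ~~ hyperbolic z -> unstraighten (z.1, zeta z) = z.
Proof.
case: z => x y; rewrite /hyperbolic /unstraighten /zeta /= => h.
have e : 1 - x * (y / (1 + x * y)) = (1 + x * y)^-1 by field.
by rewrite e invrK divfK.
Qed.

Lemma zetaK z : 1 - z.1 * z.2 != 0 -> zeta (unstraighten z) = z.2 /\ ~~ hyperbolic (unstraighten z).
Proof.
case: z => x y; rewrite /hyperbolic /unstraighten /zeta /= => h.
have e : 1 + x * (y / (1 - x * y)) = (1 - x * y)^-1 by field.
by rewrite e invrK divfK // invr_eq0.
Qed.

Lemma minv_planar M z : unimodular M -> ~~ polar M z ->
  ~~ polar (minv M) (planar_mobius M z) /\ planar_mobius (minv M) (planar_mobius M z) = z.
Proof.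
move=> uM; have := unimodular_neq0 uM; rewrite det_mx22 => dn; case: z => x y.
rewrite /polar negb_or [planar_mobius M _]planar_mobiusE /= => /andP[n1 n2].
have [e1 e2 e3 e4] := minvE M; rewrite planar_mobiusE e1 e2 e3 e4 /=.
set a := M 0 0 in dn n1 n2 *; set b := M 0 1 in dn n1 n2 *; set c := M 1 0 in dn n1 n2 *; set d := M 1 1 in dn n1 n2 *.
have E1 : - c * ((a * x + b) / (c * x + d)) + a = (a * d - b * c) / (c * x + d) by field.
have E2 : d - - b * ((d * y - c) / (a - b * y)) = (a * d - b * c) / (a - b * y) by field.
rewrite E1 E2 negb_or !mulf_eq0 !invr_eq0 (negPf n1) (negPf n2) (negPf dn); split=> //.
by congr (_, _); field; rewrite ?n1 ?n2 ?dn.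
Qed.

Lemma finite_affine_zero (f0 f1 : R) : f0 != 0 \/ f1 != 0 -> finite_set [set t | f0 + f1 * t = 0].
Proof.
move=> nz; apply: (@sub_finite_set _ _ [set - f0 / f1]) => // t /= e.
have f1n : f1 != 0.
  by case: nz => // f0n; apply: contraNneq f0n => f10; rewrite -e f10 mul0r addr0.
by apply: (mulIf f1n); rewrite divfK // mulrC; apply/eqP; rewrite -addr_eq0 addrC; exact/eqP.
Qed.

Lemma finite_poles M : unimodular M -> finite_set [set x | M 1 0 * x + M 1 1 = 0].
Proof.
move=> /unimodular_neq0; rewrite det_mx22 => dn.
rewrite (_ : [set _ | _] = [set x | M 1 1 + M 1 0 * x = 0]).
  apply: finite_affine_zero; apply/orP; rewrite -negb_and; apply: contraNN dn => /andP[/eqP -> /eqP ->].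
  by rewrite !mulr0 subr0.
by apply/funext => x; rewrite /= addrC.
Qed.

Lemma leb_eq_off (A B F : set R) : measurable A -> measurable B -> finite_set F ->
  (forall t, ~ F t -> A t <-> B t) -> leb A = leb B.
Proof.
move=> mA mB fF AB; have mF : measurable F by apply: countable_measurable => //; exact: finite_set_countable.
have F0 : leb F = 0%E by apply: countable_lebesgue_measure0; exact: finite_set_countable.
suff le (A' B' : set R) : measurable A' -> measurable B' -> (forall t, ~ F t -> A' t -> B' t) ->
    (leb A' <= leb B')%E.
  by apply/le_anti/andP; split; apply: le => // t /AB [].
move=> mA' mB' H; apply: (@le_trans _ _ (leb (B' `|` F))).
  apply: le_measure; rewrite ?inE //; first exact: measurableU.
  by move=> t At; have [Ft|nF] := pselect (F t); [right|left; exact: H].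
apply: (@le_trans _ _ (leb B' + leb F)%E); first exact: measureU2.
by rewrite F0 adde0.
Qed.

(** Poles and conventional values only concern finitely many vertical lines, and finitely many
    points of every other one. *)
Lemma leb2_eq_off (A B : set (R * R)) (N : set R) : measurable A -> measurable B -> finite_set N ->
  (forall x, ~ N x -> exists2 F, finite_set F & forall t, ~ F t -> A (x, t) <-> B (x, t)) ->
  leb2 A = leb2 B.
Proof.
move=> mA mB fN H.
have N0 : leb N = 0%E by apply: countable_lebesgue_measure0; exact: finite_set_countable.
have mN : measurable N by apply: countable_measurable => //; exact: finite_set_countable.
rewrite /product_measure1; apply: ae_eq_integral => //.
- exact: measurable_fun_xsection.
- exact: measurable_fun_xsection.
exists N; split=> // x /= nx; apply: contrapT => Nx; apply: nx => _.
have [F fF AB] := H x Nx; apply: (leb_eq_off _ _ fF); try exact: measurable_xsection.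
by move=> t Ft; rewrite /xsection /= !inE; exact: AB.
Qed.

Lemma measurable_unstraighten : measurable_fun [set: R * R] unstraighten.
Proof.
apply: measurable_fun_pair; first exact: measurable_fst.
apply: measurable_funM; first exact: measurable_snd.
apply: (@measurableT_comp _ _ _ _ _ _ (fun t : R => t^-1) _ (fun z : R * R => 1 - z.1 * z.2)).
  exact: measurable_inv.
by apply: measurable_funB => //; exact: measurable_funM.
Qed.

Lemma measurable_skew M : measurable_fun [set: R * R] (planar_skew M).
Proof.
have md : measurable_fun [set: R * R] (fun z : R * R => M 1 0 * z.1 + M 1 1).
  by apply: measurable_funD => //; exact: measurable_funM.
apply: measurable_fun_pair.
  exact: (measurableT_comp (measurable_mobius M) measurable_fst).
apply: measurable_funB; last exact: measurable_funM.
by apply: measurable_funM => //; apply: measurable_funM => //; exact: measurable_funX.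
Qed.

Lemma preimage_measurable (S : R * R -> R * R) E : measurable_fun [set: R * R] S -> measurable E ->
  measurable (S @^-1` E).
Proof. by move=> mS mE; rewrite -[X in measurable X]setTI; exact: mS. Qed.

(** For fixed [x], the map from [y] to [zeta (x, y)] is a homography of determinant 1 whose
    derivative is the density of [mu]: this is the change of variables on every vertical line. *)
Lemma mu_unstraighten E : measurable E -> mu E = leb2 (unstraighten @^-1` E).
Proof.
move=> mE; rewrite /mu integral_mkcond fubini_tonelli1 //; first last.
- by move=> z; rewrite patchE; case: ifP => // _; rewrite lee_fin mu_density_ge0.
- apply/(measurable_restrictT _ mE); apply/measurable_EFinP.
  by apply: measurable_funTS; exact: measurable_mu_density.
rewrite /product_measure1; apply: eq_integral => x _.
pose S := xsection (unstraighten @^-1` E) x.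
have mS : measurable S by apply: measurable_xsection; exact: (preimage_measurable measurable_unstraighten).
have d1 : 1 * 1 - 0 * x = 1 :> R by ring.
transitivity (leb S) => //; rewrite /fubini_F -(lebesgue_homography d1 (expr1n _ _) mS) [RHS]integral_mkcond.
apply: eq_integral => y _; rewrite !patchE /mu_density /= addrC.
have [h|h] := eqVneq (x * y + 1) 0.
  by rewrite h expr0n /= invr0; do 2 case: ifP.
rewrite (_ : (y \in _) = ((x, y) \in E)) //.
have e : unstraighten (x, zeta (x, y)) = (x, y).
  by rewrite (unstraightenK (z := (x, y))) // /hyperbolic /= addrC.
rewrite -[in RHS]e /zeta /= [1 + _]addrC; apply/idP/idP; rewrite !inE /S /xsection /= inE /=.
  by rewrite mul1r addr0.
by rewrite mul1r addr0.
Qed.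

Lemma skew_scale M x (B : set R) : unimodular M -> measurable B -> M 1 0 * x + M 1 1 != 0 ->
  leb [set t | B (planar_skew M (x, t)).2] = (((M 1 0 * x + M 1 1) ^- 2)%:E * leb B)%E.
Proof.
move=> uM mB n0; set c := M 1 0 * x + M 1 1.
have e2 := unimodular_sqr uM; have e0 := unimodular_neq0 uM.
(* The affine map of slope [\det M * c ^+ 2] is written as a homography with the constant
   denominator [\det M / c], so as to have determinant [\det M]. *)
have dd : c * (\det M / c) - (- M 1 0) * 0 = \det M by field.
have := lebesgue_homography dd e2 mB.
have -> : (fun t : R => (c * t + - M 1 0) / (0 * t + \det M / c)) = (fun t => (planar_skew M (x, t)).2).
  have einv : (\det M)^-1 = \det M by apply: (mulfI e0); rewrite divff // -expr2 e2.
  apply/funext => t; rewrite /planar_skew /= -/c mul0r add0r invf_div einv; ring.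
rewrite (eq_integral (cst ((c ^+ 2)%:E))); last first.
  by move=> t _ /=; rewrite mul0r add0r expr_div_n e2 invf_div divr1.
have mpre : measurable ((fun t : R => (planar_skew M (x, t)).2) @^-1` B).
  have ms : measurable_fun [set: R] (fun t : R => (planar_skew M (x, t)).2).
    exact: (measurable_affine (\det M * c ^+ 2) (- (\det M * M 1 0 * c))).
  by rewrite -[X in measurable X]setTI; exact: ms.
rewrite integral_cst // => <-; rewrite muleA -EFinM mulVf ?mul1e //.
by rewrite expf_neq0.
Qed.

(** On a product set, the factor [c ^- 2] by which vertical preimages are scaled is exactly the
    Jacobian of the horizontal change of variables; uniqueness of the product measure does the
    rest. *)
Lemma leb2_skew M E : unimodular M -> measurable E -> leb2 (planar_skew M @^-1` E) = leb2 E.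
Proof.
move=> uM mE.
have [nu nuE] : exists nu : {measure set (measurableTypeR R * measurableTypeR R) -> \bar R},
    forall A, nu A = leb2 (planar_skew M @^-1` A).
  have mS : measurable_fun [set: measurableTypeR R * measurableTypeR R]
    (planar_skew M : measurableTypeR R * measurableTypeR R -> measurableTypeR R * measurableTypeR R).
    exact: measurable_skew.
  by exists (measure_function_pushforward__canonical__measure_function_Measure leb2 mS).
rewrite -nuE; apply/esym/product_measure_unique => // A B mA mB; rewrite nuE.
pose w x : \bar R := ((M 1 0 * x + M 1 1) ^- 2)%:E.
have mpre : measurable (mobius M @^-1` A).
  by rewrite -[X in measurable X]setTI; exact: measurable_mobius.
have mw : measurable_fun [set: R] (w \_ (mobius M @^-1` A)).
  apply/(measurable_restrictT _ mpre)/measurable_funTS/measurable_EFinP.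
  apply: (@measurableT_comp _ _ _ _ _ _ (fun t : R => t^-1) _ (fun x : R => (M 1 0 * x + M 1 1) ^+ 2)).
    exact: measurable_inv.
  by apply: measurable_funX; exact: measurable_affine.
have w0 x : (0 <= (w \_ (mobius M @^-1` A)) x)%E.
  by rewrite patchE; case: ifP => // _; rewrite lee_fin invr_ge0 sqr_ge0.
transitivity (\int[leb]_x ((w \_ (mobius M @^-1` A)) x * leb B))%E; last first.
  rewrite ge0_integralZr // -integral_mkcond.
  by rewrite (lebesgue_homography (esym (det_mx22 M)) (unimodular_sqr uM)).
rewrite /product_measure1; apply: ae_eq_integral => //.
- apply: measurable_fun_xsection; apply: preimage_measurable; first exact: measurable_skew.
  exact: measurableX.
- exact: emeasurable_funM.
exists [set x | M 1 0 * x + M 1 1 = 0]; split.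
- by apply: countable_measurable => //; apply: finite_set_countable; exact: finite_poles.
- by apply: countable_lebesgue_measure0; apply: finite_set_countable; exact: finite_poles.
move=> x /= nx; apply: contrapT => /eqP n0; apply: nx => _.
rewrite patchE; case: ifPn => Ax; last first.
  rewrite mul0e (_ : xsection _ _ = set0) ?measure0 //.
  apply/seteqP; split=> // t; rewrite /xsection /= inE /= => -[/= Mx _].
  by move: Ax; rewrite notin_setE.
rewrite /w -(skew_scale uM mB n0); congr (leb _).
apply/seteqP; split=> t; rewrite /xsection /= inE /=; first by case.
by move=> Bt; split=> //=; move: Ax; rewrite inE.
Qed.

Lemma mu_planar_mobius M E : unimodular M -> measurable E -> mu (planar_mobius M @^-1` E) = mu E.
Proof.
move=> uM mE; have mT := measurable_planar_mobius M.
rewrite !mu_unstraighten //; last exact: (preimage_measurable mT).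
rewrite -[RHS](leb2_skew uM); last exact: (preimage_measurable measurable_unstraighten).
set c := M 1 0; set d := M 1 1; set a := M 0 0; set b := M 0 1.
apply: (@leb2_eq_off _ _ [set x | c * x + d = 0]).
- exact: (preimage_measurable measurable_unstraighten (preimage_measurable mT mE)).
- exact: (preimage_measurable (measurable_skew M) (preimage_measurable measurable_unstraighten mE)).
- exact: finite_poles.
(* Heights that the straightening does not attain on this line, and the height at which the second
   coordinate has its pole. *)
move=> x /eqP nx; exists ([set t | 1 - x * t = 0] `|` [set t | a * (1 - x * t) - b * t = 0]).
  rewrite finite_setU; split.
    rewrite (_ : [set _ | _] = [set t | 1 + (- x) * t = 0]); last by apply/funext => t; rewrite /= mulNr.
    by apply: finite_affine_zero; left; exact: oner_neq0.
  rewrite (_ : [set _ | _] = [set t | a + (- (a * x + b)) * t = 0]); last first.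
    by apply/funext => t /=; congr (_ = _); ring.
  apply: finite_affine_zero; have := unimodular_neq0 uM; rewrite det_mx22 -/a -/b -/c -/d => dn.
  have [a0|] := eqVneq a 0; [right|by left].
  by apply: contraNneq dn; rewrite a0 mul0r add0r => /eqP; rewrite oppr_eq0 => /eqP ->; rewrite !mul0r subr0.
move=> t /not_orP[/eqP n1 /eqP n2] /=.
have [zu hu] := zetaK (z := (x, t)) n1.
have pu : ~~ polar M (unstraighten (x, t)).
  rewrite /polar /= negb_or nx /=.
  rewrite (_ : _ - _ = (a * (1 - x * t) - b * t) / (1 - x * t)); last by rewrite /a /b; field.
  by rewrite mulf_neq0 ?invr_eq0.
have := unstraightenK (z := planar_mobius M (unstraighten (x, t))).
rewrite planar_mobius_hyperbolic // => /(_ hu); rewrite zeta_mobius // zu => <- //.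
Qed.

End PlanarMobius.

(** * Saturated null sets *)

Section Saturation.
Context d (X : measurableType d) (R : realType) (m : {measure set X -> \bar R}).

(** Images are required to be negligible as well, since exceptional sets will be made invariant in
    both directions along orbits. *)
Definition nonsingular (S : X -> X) :=
  [/\ measurable_fun [set: X] S,
      forall E, measurable E -> m E = 0%E -> m (S @^-1` E) = 0%E &
      forall E, measurable E -> m E = 0%E -> m.-negligible (S @` E)].

Context (F G : X -> X).

Definition saturated_null (N : set X) :=
  [/\ measurable N, m N = 0%E & forall z, (N z <-> N (F z)) /\ (N z <-> N (G z))].

(** Images and preimages under both maps are adjoined countably many times, within a measurable null
    set at every stage. *)
Lemma saturated_null_exists (K : set X) : nonsingular F -> nonsingular G -> m.-negligible K ->
  exists2 N, saturated_null N & K `<=` N.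
Proof.
move=> [mF pF iF] [mG pG iG] [N0 [mN0 N00 KN0]].
pose null E := measurable E /\ m E = 0%E.
have step (E : {E : set X | null E}) : {E' : set X | null E' /\
    sval E `|` (F @^-1` sval E) `|` (F @` sval E) `|` (G @^-1` sval E) `|` (G @` sval E) `<=` E'}.
  apply: cid; case: E => E [mE E0] /=.
  have pre S : measurable_fun [set: X] S -> m (S @^-1` E) = 0%E -> m.-negligible (S @^-1` E).
    by move=> mS S0; exists (S @^-1` E); split=> //; rewrite -[X in measurable X]setTI; exact: mS.
  have [N [mN N0' sN]] : m.-negligible (E `|` (F @^-1` E) `|` (F @` E) `|` (G @^-1` E) `|` (G @` E)).
    apply: negligibleU; last exact: iG.
    apply: negligibleU; last exact: (pre G mG (pG _ mE E0)).
    apply: negligibleU; last exact: iF.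
    by apply: negligibleU; [by exists E; split|exact: (pre F mF (pF _ mE E0))].
  by exists N.
pose next (E : {E : set X | null E}) : {E : set X | null E} :=
  exist null (sval (step E)) (proj1 (svalP (step E))).
pose E n := sval (iter n next (exist null N0 (conj mN0 N00))).
have nE n : null (E n) by exact: svalP.
have EE n : E n `|` (F @^-1` E n) `|` (F @` E n) `|` (G @^-1` E n) `|` (G @` E n) `<=` E n.+1.
  exact: (proj2 (svalP (step _))).
exists (\bigcup_n E n); last by move=> z /KN0; exists 0%N.
split.
- by apply: bigcupT_measurable => n; have [] := nE n.
- by apply: null_bigcup => n; have [] := nE n.
- move=> z; split; split=> -[n _ En]; exists n.+1 => //; apply: EE.
  + by left; left; right; exists z.
  + by left; left; left; right.
  + by right; exists z.
  + by left; right.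
Qed.

Lemma saturated_nullF N n z : saturated_null N -> N z <-> N (iter n F z).
Proof. by move=> [_ _ s]; elim: n => //= n ->; exact: (s _).1. Qed.

Lemma saturated_nullG N n z : saturated_null N -> N z <-> N (iter n G z).
Proof. by move=> [_ _ s]; elim: n => //= n ->; exact: (s _).2. Qed.

Lemma measurable_piecewise d' (Y : measurableType d') (S : X -> Y) (idx : X -> nat) (h : nat -> X -> Y) :
  (forall n, measurable (idx @^-1` [set n])) -> (forall n, measurable_fun [set: X] (h n)) ->
  (forall z, S z = h (idx z) z) -> measurable_fun [set: X] S.
Proof.
move=> mi mh e _ E mE; rewrite setTI.
rewrite (_ : S @^-1` E = \bigcup_n (idx @^-1` [set n] `&` h n @^-1` E)).
  apply: bigcupT_measurable => n; apply: measurableI => //.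
  by rewrite -[X in measurable X]setTI; exact: mh.
apply/seteqP; split=> z /=; first by rewrite e => Ez; exists (idx z).
by move=> [n _ [/= <-]]; rewrite -e.
Qed.

End Saturation.

(** * Null sets of planar Möbius maps *)

Section PlanarNull.
Context (R : realType).
Implicit Types (M : 'M[R]_2) (z : R * R).
Local Notation mu := (@mu R).
Local Notation leb := (@lebesgue_measure R).
Local Notation leb2 := (@lebesgue_measure R \x @lebesgue_measure R)%E.

Lemma mu_null_fibres (E : set (R * R)) (N : set R) : measurable E -> finite_set N ->
  (forall x, ~ N x -> finite_set [set y | E (x, y)]) -> mu E = 0%E.
Proof.
move=> mE fN H; rewrite /mu; apply: null_set_integral => //.
  apply/measurable_EFinP; apply: measurable_funTS; exact: measurable_mu_density.
transitivity (leb2 (set0 : set (R * R))); last by rewrite measure0.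
apply: (leb2_eq_off (N := N)) => //.
by move=> x /H fE; exists [set y | E (x, y)].
Qed.

Lemma measurable_zero_set (h : R * R -> R) : measurable_fun [set: R * R] h -> measurable [set z | h z == 0].
Proof.
move=> mh; rewrite (_ : [set z | _] = h @^-1` [set 0]); last by apply/seteqP; split=> z /eqP.
by rewrite -[X in measurable X]setTI; exact: mh.
Qed.

Lemma measurable_polar M : measurable (polar M).
Proof.
rewrite (_ : (fun z => polar M z : Prop) = [set z | M 1 0 * z.1 + M 1 1 == 0] `|` [set z | M 0 0 - M 0 1 * z.2 == 0]).
  apply: measurableU; apply: measurable_zero_set.
    by apply: measurable_funD => //; exact: measurable_funM.
  by apply: measurable_funB => //; exact: measurable_funM.
by apply/seteqP; split=> z /=; rewrite /polar => /orP.
Qed.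

Lemma negligible_polar M : unimodular M -> mu.-negligible (polar M).
Proof.
move=> uM.
have mP := measurable_polar M.
exists (polar M); split=> //.
apply: (mu_null_fibres (N := [set x | M 1 0 * x + M 1 1 = 0])) => //; first exact: finite_poles.
move=> x /eqP nx; rewrite (_ : [set y | _] = [set y | M 0 0 + (- M 0 1) * y = 0]).
  apply: finite_affine_zero; apply/orP; rewrite oppr_eq0 -negb_and.
  apply: contraNN (unimodular_neq0 uM) => /andP[/eqP e1 /eqP e2].
  by rewrite det_mx22 e1 e2 !mul0r subrr.
by apply/funext => y; rewrite /polar /= (negPf nx) /= mulNr; apply/propext; split=> /eqP.
Qed.

Lemma negligible_hyperbolic : mu.-negligible (@hyperbolic R).
Proof.
have mP : measurable (@hyperbolic R).
  apply: measurable_zero_set.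
  by apply: measurable_funD => //; exact: measurable_funM.
exists (@hyperbolic R); split=> //; apply: (mu_null_fibres (N := set0)) => // x _.
rewrite (_ : [set y | _] = [set y | 1 + x * y = 0]).
  by apply: finite_affine_zero; left; exact: oner_neq0.
by apply/funext => y; rewrite /hyperbolic /=; apply/propext; split=> /eqP.
Qed.

Lemma negligible_line (P : set R) : finite_set P -> mu.-negligible [set z | P z.1 \/ P z.2].
Proof.
move=> fP; have mP : measurable P by apply: countable_measurable => //; exact: finite_set_countable.
have mL : measurable [set z : R * R | P z.1 \/ P z.2].
  rewrite (_ : [set z | _] = P `*` setT `|` setT `*` P).
    by apply: measurableU; exact: measurableX.
  by apply/seteqP; split=> z [] /=; [left|right|case; left|case; right].
exists [set z | P z.1 \/ P z.2]; split=> //; apply: (mu_null_fibres (N := P)) => // x nx.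
by apply: sub_finite_set fP => y [].
Qed.

(** Off the poles the image is the preimage under the adjugate, up to the null polar set of the
    latter. *)
Lemma planar_mobius_image M E : unimodular M -> measurable E -> (forall z, E z -> ~~ polar M z) ->
  measurable (planar_mobius M @` E) /\ mu (planar_mobius M @` E) = mu E.
Proof.
move=> uM mE nE; have uM' : unimodular (minv M) by rewrite /unimodular det_minv.
have mP' := measurable_polar (minv M).
have e : planar_mobius M @` E = (planar_mobius (minv M) @^-1` E) `\` polar (minv M).
  apply/seteqP; split=> [_ [z Ez <-]|w [Ew /negP nw]].
    by have [n1 e1] := minv_planar uM (nE _ Ez); split; [rewrite /= e1|exact/negP].
  exists (planar_mobius (minv M) w) => //.
  by have [_] := minv_planar uM' nw; rewrite minvK.
have mpre := preimage_measurable (measurable_planar_mobius (minv M)) mE.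
split; first by rewrite e; exact: measurableD.
rewrite -(mu_planar_mobius uM' mE) e; apply/esym.
have [N [mN N0 sN]] := negligible_polar uM'.
have P0 : mu (polar (minv M)) = 0%E by exact: null_sub N0.
have P1 : mu (planar_mobius (minv M) @^-1` E `&` [set z | polar (minv M) z]) = 0%E.
  by apply: null_sub P0 => //; exact: measurableI.
rewrite (measureDI mu mpre mP') -[RHS]adde0; congr (_ + _)%E; exact: P1.
Qed.

Lemma negligible_planar_mobius_image M E : unimodular M -> measurable E -> mu E = 0%E ->
  mu.-negligible (planar_mobius M @` E).
Proof.
move=> uM mE E0.
have mP : measurable (E `\` polar M).
  by apply: measurableD => //; exact: measurable_polar.
have sub : planar_mobius M @` E `<=`
    planar_mobius M @` (E `\` polar M) `|` [set z | [set 0] z.1 \/ [set 0] z.2].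
  move=> _ [z Ez <-]; case: (boolP (polar M z)) => pz; last first.
    by left; exists z => //; split=> //; exact/negP.
  (* At a pole one coordinate of the image is a quotient by 0, hence 0, so the image is on one of
     the axes. *)
  right; move: pz; rewrite planar_mobiusE /polar /= => /orP[]/eqP ->; rewrite invr0 mulr0; [left|right] => //.
apply: (negligibleS sub); apply: negligibleU; last by apply: negligible_line; exact: finite_set1.
have [|m1 e1] := planar_mobius_image uM mP; first by move=> z [_ /negP].
exists (planar_mobius M @` (E `\` polar M)); split=> //; apply: (etrans e1).
by apply: null_sub E0 => // z [].
Qed.

End PlanarNull.

(** * The planar map of a piecewise Möbius map *)

Section PiecewisePlanar.
Context (R : realType) (f : pwMobius R).
Local Notation mu := (@mu R).
Local Notation F := (pw_planar f).

Definition pw_index (x : R) : nat := xget 0%N [set n | pw_cyl f n x].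

Lemma pw_indexE n x : pw_cyl f n x -> pw_index x = n.
Proof.
move=> cx; apply: xget_unique => //= k ck.
by apply: (pw_cyl_triv (p := f)) => //; exists x.
Qed.

Lemma measurable_pw_index n : measurable (pw_index @^-1` [set n]).
Proof.
have mc k : measurable (pw_cyl f k) by apply: is_interval_measurable; exact: pw_cyl_itv.
rewrite (_ : _ @^-1` _ = pw_cyl f n `|` (if n is 0%N then ~` \bigcup_k pw_cyl f k else set0)).
  apply: measurableU => //; case: n => [|//]; apply: measurableC; exact: bigcupT_measurable.
apply/seteqP; split=> x /=.
  have [[k ck]|nc] := pselect (exists k, pw_cyl f k x).
    by rewrite (pw_indexE ck) => <-; left.
  rewrite /pw_index; case: xgetP => [k _ ck|_ <-]; first by case: nc; exists k.
  by right=> -[k _ ck]; apply: nc; exists k.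
move=> [/pw_indexE //|]; case: n => [|//] nc.
by rewrite /pw_index; case: xgetP => // k _ ck; case: nc; exists k.
Qed.

Lemma pw_digitE x : pw_digit f x = pw_mat f (pw_index x). Proof. by []. Qed.

Lemma pw_unimodular x : unimodular (pw_digit f x). Proof. exact: pw_det. Qed.

Lemma measurable_digit_entry i j : measurable_fun [set: R] (fun x => pw_digit f x i j).
Proof.
apply: (measurable_piecewise (idx := pw_index) (h := fun n => cst (pw_mat f n i j))) => //.
exact: measurable_pw_index.
Qed.

Let midx n : measurable ((fun z : R * R => pw_index z.1) @^-1` [set n]).
Proof.
rewrite (_ : _ @^-1` _ = pw_index @^-1` [set n] `*` setT).
  by apply: measurableX => //; exact: measurable_pw_index.
by apply/seteqP; split=> z //= [].
Qed.

Lemma measurable_pw_map : measurable_fun [set: R] (pw_map f).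
Proof.
apply: (measurable_piecewise (idx := pw_index) (h := fun n => mobius (pw_mat f n))) => //.
  exact: measurable_pw_index.
by move=> n; exact: measurable_mobius.
Qed.

Lemma measurable_pw_planar : measurable_fun [set: R * R] F.
Proof.
apply: (measurable_piecewise (idx := fun z : R * R => pw_index z.1) (h := fun n => planar_mobius (pw_mat f n))) => //.
by move=> n; exact: measurable_planar_mobius.
Qed.

Definition pw_polar : set (R * R) := [set z | exists n, polar (pw_mat f n) z].

Lemma pw_polarPn z : ~ pw_polar z -> ~~ polar (pw_digit f z.1) z.
Proof. by move=> np; apply/negP => pz; apply: np; exists (pw_index z.1). Qed.

Lemma negligible_pw_polar : mu.-negligible pw_polar.
Proof.
apply: (@negligibleS _ _ _ _ (\bigcup_n [set z | polar (pw_mat f n) z])).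
  by move=> z [n pz]; exists n.
by apply: negligible_bigcup => n; apply: negligible_polar; exact: pw_det.
Qed.

Lemma pw_planar_image (D : set (R * R)) : (forall z, D z -> ~ pw_polar z) ->
  image_preserving mu D F.
Proof.
move=> nD E mE ED.
have him i E' : measurable E' -> E' `<=` E `&` (fun z : R * R => pw_index z.1) @^-1` [set i] ->
    measurable (planar_mobius (pw_mat f i) @` E') /\ mu (planar_mobius (pw_mat f i) @` E') = mu E'.
  move=> mE' sE'; apply: planar_mobius_image => //; first exact: pw_det.
  by move=> z /sE'[/ED/nD/pw_polarPn + /= zi]; rewrite pw_digitE zi.
have EE : E = \bigcup_i (E `&` (fun z : R * R => pw_index z.1) @^-1` [set i]).
  by apply/seteqP; split=> [z Ez|z [i _ []//]]; exists (pw_index z.1).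
have mP i : measurable (E `&` (fun z : R * R => pw_index z.1) @^-1` [set i]) by exact: measurableI.
split; last first.
  move=> inj; have [||_ //] := image_pieces (N := E) mP _ EE _ him inj mE (@subset_refl _ _).
    by move=> i j _ _ [z [[_ /= <-] [_ /= <-]]].
  by move=> i z [_ /= <-].
rewrite EE image_bigcup; apply: bigcupT_measurable => i.
rewrite (_ : _ @` _ = planar_mobius (pw_mat f i) @` (E `&` (fun z : R * R => pw_index z.1) @^-1` [set i])).
  by have [] := him i _ (mP i) (@subset_refl _ _).
by apply/seteqP; split=> _ [z [Ez /= zi] <-]; exists z => //; rewrite /pw_planar pw_digitE zi.
Qed.

Lemma nonsingular_pw_planar : nonsingular mu F.
Proof.
split; first exact: measurable_pw_planar.
  move=> E mE E0; have mF := preimage_measurable measurable_pw_planar mE.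
  have mB n : measurable (planar_mobius (pw_mat f n) @^-1` E).
    exact: (preimage_measurable (measurable_planar_mobius _) mE).
  apply: (@null_sub _ _ _ mu _ (\bigcup_n (planar_mobius (pw_mat f n) @^-1` E))) => //.
  - exact: bigcupT_measurable.
  - by move=> z Ez; exists (pw_index z.1).
  - by apply: null_bigcup => // n; apply: (etrans (mu_planar_mobius (pw_det f n) mE)).
move=> E mE E0; apply: (@negligibleS _ _ _ _ (\bigcup_n (planar_mobius (pw_mat f n) @` E))).
  by move=> _ [z Ez <-]; exists (pw_index z.1) => //; exists z.
by apply: negligible_bigcup => n; apply: negligible_planar_mobius_image => //; exact: pw_det.
Qed.

(* In the coordinate [zeta], [pw_planar f] is affine on vertical lines. *)
Definition pw_den x := mobius_den (pw_digit f x) x.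
Definition pw_slope x := pw_den x ^+ 2.
Definition pw_offset x := - (\det (pw_digit f x) * pw_digit f x 1 0 * pw_den x).

(** Coefficients [(al, be)] such that the [n]-th iterate acts by [al * zeta + be] on the fibre over
    [x]. *)
Fixpoint zeta_coef n x : R * R :=
  if n is n'.+1 then
    let w := zeta_coef n' x in let y := iter n' (pw_map f) x in
    let s := \det (pw_digit f y) * pw_slope y in
    (s * w.1, s * w.2 + pw_offset y)
  else (1, 0).

Lemma pw_planar_fst n z : (iter n F z).1 = iter n (pw_map f) z.1.
Proof. by elim: n => //= n <-. Qed.

Lemma zeta_pw_planar z : ~ pw_polar z -> ~~ hyperbolic z ->
  zeta (F z) = \det (pw_digit f z.1) * pw_slope z.1 * zeta z + pw_offset z.1.
Proof.
move=> /pw_polarPn nz hz; rewrite zeta_mobius //; exact: pw_unimodular.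
Qed.

Lemma zeta_iter n z : (forall k, ~ pw_polar (iter k F z) /\ ~~ hyperbolic (iter k F z)) ->
  zeta (iter n F z) = (zeta_coef n z.1).1 * zeta z + (zeta_coef n z.1).2.
Proof.
move=> nz; elim: n => [|n IH]; first by rewrite /= mul1r addr0.
have [np nh] := nz n.
by rewrite [in LHS]iterS zeta_pw_planar // IH !pw_planar_fst /=; ring.
Qed.

Lemma zeta_coef_slope n z :
  `|(zeta_coef n z.1).1| = cocycle F (fun z => pw_slope z.1) n z.
Proof.
elim: n => [|n IH]; first by rewrite /cocycle big_ord0 normr1.
rewrite /cocycle big_ord_recr /= normrM IH -/(cocycle _ _ _ _) mulrC pw_planar_fst; congr (_ * _).
rewrite normrM [X in _ * X]ger0_norm ?sqr_ge0 //.
by case: (pw_unimodular (iter n (pw_map f) z.1)) => ->; rewrite ?normrN normr1 mul1r.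
Qed.

Lemma measurable_pw_den : measurable_fun [set: R] pw_den.
Proof.
apply: measurable_funD; last exact: measurable_digit_entry.
by apply: measurable_funM => //; exact: measurable_digit_entry.
Qed.

Lemma measurable_pw_slope : measurable_fun [set: R] pw_slope.
Proof. by apply: measurable_funX; exact: measurable_pw_den. Qed.

Lemma measurable_pw_det : measurable_fun [set: R] (fun x => \det (pw_digit f x)).
Proof.
apply: (measurable_piecewise (idx := pw_index) (h := fun n => cst (\det (pw_mat f n)))) => //.
exact: measurable_pw_index.
Qed.

Lemma measurable_pw_offset : measurable_fun [set: R] pw_offset.
Proof.
apply: measurable_funN; apply: measurable_funM; last exact: measurable_pw_den.
by apply: measurable_funM; [exact: measurable_pw_det|exact: measurable_digit_entry].
Qed.

Lemma measurable_zeta_coef n : measurable_fun [set: R] (fun x => (zeta_coef n x).1) /\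
  measurable_fun [set: R] (fun x => (zeta_coef n x).2).
Proof.
elim: n => [|n [IH1 IH2]] /=; first by split; exact: measurable_cst.
have mi := measurable_fun_iter measurable_pw_map n.
have ms : measurable_fun [set: R] (fun x => \det (pw_digit f (iter n (pw_map f) x)) * pw_slope (iter n (pw_map f) x)).
  apply: measurable_funM.
    exact: (measurableT_comp measurable_pw_det mi).
  exact: (measurableT_comp measurable_pw_slope mi).
split; first exact: measurable_funM.
apply: measurable_funD; first exact: measurable_funM.
exact: (measurableT_comp measurable_pw_offset mi).
Qed.

Lemma measurable_zeta : measurable_fun [set: R * R] (@zeta R).
Proof.
apply: measurable_funM; first exact: measurable_snd.
apply: (@measurableT_comp _ _ _ _ _ _ (fun t : R => t^-1) _ (fun z : R * R => 1 + z.1 * z.2)).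
  exact: measurable_inv.
by apply: measurable_funD => //; exact: measurable_funM.
Qed.

End PiecewisePlanar.

(** * Exceptional null sets *)

Section NegligibleDefects.
Context d (X : measurableType d) (R : realType) (m : {measure set X -> \bar R}).

Lemma negligible_exists (I : countType) (A : I -> set X) :
  (forall i, m.-negligible (A i)) -> m.-negligible [set z | exists i, A i z].
Proof.
move=> nA; apply: (@negligibleS _ _ _ _ (\bigcup_n (if unpickle n is Some i then A i else set0))).
  by move=> z [i Ai]; exists (pickle i) => //; rewrite pickleK.
apply: negligible_bigcup => n; case: (unpickle n) => [i|]; first exact: nA.
exact: negligible_set0.
Qed.

Lemma negligible_trivIset (I : countType) (D : set I) (A : I -> set X) : trivIset_mod0 m D A ->
  m.-negligible [set z | exists p q, [/\ D p, D q, p <> q, A p z & A q z]].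
Proof.
move=> tA; apply: (@negligibleS _ _ _ _ [set z | exists pq : I * I,
    [/\ D pq.1, D pq.2, pq.1 <> pq.2, A pq.1 z & A pq.2 z]]).
  by move=> z [p [q h]]; exists (p, q).
apply: negligible_exists => -[p q] /=.
have [[Dp Dq pq]|n] := pselect [/\ D p, D q & p <> q].
  by apply: negligibleS (tA p q Dp Dq pq) => z [].
by apply: (@negligibleS _ _ _ _ set0); [move=> z [? ? ? _ _]; case: n|exact: negligible_set0].
Qed.

(** The conclusion is stated for every large enough saturated set, so that a single set can meet
    several such requirements. *)
Lemma bijective_clean (S : X -> X) (Om : set X) : bijective_mod0 m S Om ->
  exists2 K, m.-negligible K & forall N, K `<=` N -> (forall z, N z <-> N (S z)) ->
  [/\ forall z, (Om `\` N) z -> (Om `\` N) (S z),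
      forall z z', (Om `\` N) z -> (Om `\` N) z' -> S z = S z' -> z = z' &
      forall w, (Om `\` N) w -> exists2 z, (Om `\` N) z & S z = w].
Proof.
move=> [A [B [AO BO nA nB [fS iS sS]]]]; exists ((Om `\` A) `|` (Om `\` B)); first exact: negligibleU.
move=> N KN SN.
have inA z : (Om `\` N) z -> A z.
  by move=> [Oz Nz]; apply: contrapT => Az; apply: Nz; apply: KN; left.
have inB z : (Om `\` N) z -> B z.
  by move=> [Oz Nz]; apply: contrapT => Az; apply: Nz; apply: KN; right.
split.
- by move=> z Oz; split; [apply: BO; apply: fS; exact: inA|have [_ nz] := Oz; rewrite -SN].
- by move=> z z' Oz Oz' e; apply: iS e; rewrite inE; exact: inA.
- move=> w Ow; have [z Az ez] := sS _ (inB _ Ow); exists z => //; split; first exact: AO.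
  by rewrite SN ez; case: Ow.
Qed.

End NegligibleDefects.

(** * Exact quiltings outside a null set *)

Section CleanModel.
Context (R : realType) (f g : pwMobius R) (Omf Omg : set (R * R)).
Context (mOmf : measurable Omf) (mOmg : measurable Omg).
Context (C : nat -> set (R * R)) (dn an : nat -> nat).
Context (bijf : bijective_mod0 (@mu R) (pw_planar f) Omf).
Context (bijg : bijective_mod0 (@mu R) (pw_planar g) Omg).
Context (domf : Omf `<=` [set z | pw_dom f z.1]) (domg : Omg `<=` [set z | pw_dom g z.1]).
Context (finf : (mu Omf < +oo)%E) (fing : (mu Omg < +oo)%E).
Context (Q : quilting f g Omf Omg C dn an).
Local Notation mu := (@mu R).
Local Notation F := (pw_planar f).
Local Notation G := (pw_planar g).

(** The points where some clause of the quilting fails, with the poles and the hyperbola; the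
    clauses become exact off a saturated set containing them. *)
Definition quilt_defects : set (R * R) :=
  (\bigcup_i C i `+` altered f g Omf) `|`
  [set z | exists i j, [/\ [set: nat] i, [set: nat] j, i <> j, C i z & C j z]] `|`
  [set z | exists i, (C i `&` [set z | iter (dn i).+1 F z <> iter (an i).+1 G z]) z] `|`
  [set z | exists p q, [/\ levels dn p, levels dn q, p <> q, level F C p z & level F C q z]] `|`
  [set z | exists p q, [/\ levels an p, levels an q, p <> q, level G C p z & level G C q z]] `|`
  ((Omf `\` tower F C dn) `&` tower G C an) `|`
  (Omg `+` ((Omf `\` tower F C dn) `|` tower G C an)) `|`
  (pw_polar f `|` pw_polar g `|` [set z | hyperbolic z]).

Lemma negligible_quilt_defects : mu.-negligible quilt_defects.
Proof.
apply: negligibleU; last first.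
  apply: negligibleU; last exact: negligible_hyperbolic.
  by apply: negligibleU; exact: negligible_pw_polar.
apply: negligibleU; last exact: (quilt_eq Q).
apply: negligibleU; last exact: (quilt_disj Q).
apply: negligibleU; last exact: (negligible_trivIset (quilt_added_triv Q)).
apply: negligibleU; last exact: (negligible_trivIset (quilt_removed_triv Q)).
apply: negligibleU; last by apply: negligible_exists => i; exact: (quilt_orbit Q).
apply: negligibleU; last exact: (negligible_trivIset (quilt_triv Q)).
exact: (quilt_cover Q).
Qed.

Lemma eq_mobius_planar (M N : 'M[R]_2) : eq_mobius M N -> planar_mobius M = planar_mobius N.
Proof.
case=> [->//|->]; apply/funext => z; rewrite !planar_mobiusE !mxE /=; congr (_, _).
  by rewrite !mulNr -!opprD invrN mulrNN.
by rewrite !mulNr -!opprD invrN mulrNN.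
Qed.

(** Saturation makes the removal of [N] commute with building towers: a level avoids [N] as soon as
    its base point does, and conversely. *)
Lemma quilt_clean : exists2 K, mu.-negligible K & forall N, K `<=` N -> saturated_null mu F G N ->
  quilt_model mu F G (Omf `\` N) (Omg `\` N) (fun i => C i `\` N) dn an.
Proof.
have [Kf nKf Hf] := bijective_clean bijf; have [Kg nKg Hg] := bijective_clean bijg.
exists (Kf `|` Kg `|` quilt_defects).
  by apply: negligibleU; [exact: negligibleU|exact: negligible_quilt_defects].
move=> N KN sN; have [mN N0 sat] := sN.
have [Fin Finj Fsur] := Hf N (fun z Kz => KN _ (or_introl (or_introl Kz))) (fun z => (sat z).1).
have [Gin Ginj Gsur] := Hg N (fun z Kz => KN _ (or_introl (or_intror Kz))) (fun z => (sat z).2).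
have QN z : quilt_defects z -> N z by move=> h; apply: KN; right.
have mOf : measurable (Omf `\` N) by exact: measurableD.
have mOg : measurable (Omg `\` N) by exact: measurableD.
have CO i z : C i z -> ~ N z -> Omf z.
  move=> Ci Nz; apply: contrapT => Oz; apply: Nz; apply: QN; do 7 left; left.
  by split; [exists i|case].
have np z : ~ N z -> ~ pw_polar f z /\ ~ pw_polar g z.
  by move=> Nz; split=> pz; apply: Nz; apply: QN; right; left; [left|right].
have lev (S : R * R -> R * R) h z : in_tower S (fun i => C i `\` N) h z -> tower S C h z.
  by move=> [i [j [c [jh [Cc _] ->]]]]; exists (i, j) => //; exists c.
have levF z : ~ N z -> tower F C dn z -> in_tower F (fun i => C i `\` N) dn z.
  move=> Nz [[i j] /= jh [c /= Cc e]]; exists i, j, c; split=> //; split=> //.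
  by rewrite (saturated_nullF j _ sN) e.
have levG z : ~ N z -> tower G C an z -> in_tower G (fun i => C i `\` N) an z.
  move=> Nz [[i j] /= jh [c /= Cc e]]; exists i, j, c; split=> //; split=> //.
  by rewrite (saturated_nullG j _ sN) e.
have towF z : in_tower F (fun i => C i `\` N) dn z -> ~ N z.
  by move=> [i [j [c [_ [_ Nc] ->]]]]; rewrite -(saturated_nullF j _ sN).
have towG z : in_tower G (fun i => C i `\` N) an z -> ~ N z.
  by move=> [i [j [c [_ [_ Nc] ->]]]]; rewrite -(saturated_nullG j _ sN).
split.
- exact: measurable_pw_planar.
- exact: measurable_pw_planar.
- exact: mOf.
- exact: mOg.
- by apply: (fin_sub mOmf finf).
- by apply: (fin_sub mOmg fing).
- by move=> i; apply: measurableD => //; exact: (quilt_measurable Q).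
- exact: Fin.
- exact: Finj.
- exact: Fsur.
- exact: Gin.
- exact: Ginj.
- exact: Gsur.
- by apply: pw_planar_image => z [] [_ /np []].
- by apply: pw_planar_image => z [] [_ /np []].
- by move=> i z [Ci Nz]; split=> //; exact: CO Ci Nz.
- move=> i j z [Ci Nz] [Cj _]; apply: contrapT => ij; apply: Nz; apply: QN; do 6 left; right.
  by exists i, j.
- move=> z [Oz Nz] [Oz' _] nC.
  have na : ~ altered f g Omf z.
    move=> az; apply: (Nz); apply: QN; do 7 left; right; split=> // -[i _ Ci].
    by apply: (nC i); split.
  have e : eq_mobius (pw_digit f z.1) (pw_digit g z.1).
    by apply: contrapT => ne; apply: na; split=> //; split=> //; [exact: domf|exact: domg].
  by rewrite /pw_planar (eq_mobius_planar e).
- move=> i z [Ci Nz]; apply: contrapT => ne; apply: Nz; apply: QN; do 5 left; right.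
  by exists i.
- move=> i i' j j' c c' [Cc Nc] [Cc' Nc'] jd jd' e; apply: contrapT => ne.
  have : ~ N (iter j F c) by rewrite -(saturated_nullF j _ sN).
  apply; apply: QN; do 4 left; right; exists (i, j), (i', j'); split=> //.
  + by move=> [e1 e2]; apply: ne.
  + by exists c.
  + by exists c'.
- move=> i i' j j' c c' [Cc Nc] [Cc' Nc'] jd jd' e; apply: contrapT => ne.
  have : ~ N (iter j G c) by rewrite -(saturated_nullG j _ sN).
  apply; apply: QN; do 3 left; right; exists (i, j), (i', j'); split=> //.
  + by move=> [e1 e2]; apply: ne.
  + by exists c.
  + by exists c'.
- apply/seteqP; split=> z.
    move=> [Oz Nz].
    have [[Omz nt]|tz] : ((Omf `\` tower F C dn) `|` tower G C an) z.
    + by apply: contrapT => h; apply: Nz; apply: QN; left; right; left.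
    + by left; split=> // /lev.
    + by right; exact: levG.
  move=> h; have Nz : ~ N z by case: h => [[[]]//|/towG].
  split=> //; apply: contrapT => nO; apply: Nz; apply: QN; left; right; right; split=> //.
  case: h => [[[Oz Nz] nt]|/lev]; [left; split=> // tz|by right].
  by apply: nt; exact: levF.
- apply/seteqP; split=> // z [[[Oz Nz] nt] tz]; apply: (Nz); apply: QN; do 2 left; right.
  by split; [split=> // /(levF _ Nz)|exact: lev tz].
Qed.

End CleanModel.

(** * Fibre lengths *)

Section Fibres.
Context (R : realType).
Implicit Types (E Om : set (R * R)).
Local Notation mu := (@mu R).
Local Notation leb := (@lebesgue_measure R).
Local Notation leb2 := (@lebesgue_measure R \x @lebesgue_measure R)%E.

(* [E] in the coordinates [(x, zeta)]. *)
Definition straightened E : set (R * R) := [set z | 1 - z.1 * z.2 != 0 /\ E (unstraighten z)].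
Definition fibre_length E x : \bar R := leb (xsection (straightened E) x).

Lemma measurable_straightened E : measurable E -> measurable (straightened E).
Proof.
move=> mE; apply: measurableI; last exact: (preimage_measurable (@measurable_unstraighten R) mE).
have -> : (fun z : R * R => is_true (1 - z.1 * z.2 != 0)) = ~` [set z | 1 - z.1 * z.2 == 0].
  by apply/seteqP; split=> z /= /negP.
apply: measurableC; apply: measurable_zero_set.
by apply: measurable_funB => //; exact: measurable_funM.
Qed.

Lemma measurable_fibre_length E : measurable E -> measurable_fun [set: R] (fibre_length E).
Proof. by move=> mE; apply: measurable_fun_xsection; exact: measurable_straightened. Qed.

Lemma mu_fibre E : measurable E -> (mu E = \int[leb]_x fibre_length E x)%E.
Proof.
move=> mE; rewrite mu_unstraighten //.
transitivity (leb2 (straightened E)) => //.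
apply: (leb2_eq_off (N := set0)) => //.
- exact: (preimage_measurable (@measurable_unstraighten R) mE).
- exact: measurable_straightened.
move=> x _; exists [set t | 1 + (- x) * t = 0].
  by apply: finite_affine_zero; left; exact: oner_neq0.
move=> t /= nt; split=> [Et|[]//]; split=> //=.
by apply/eqP => e; apply: nt; rewrite mulNr.
Qed.

Lemma mu_fibre_cylinder E (B : set R) : measurable E -> measurable B ->
  (mu (E `&` (B `*` setT)) = \int[leb]_(x in B) fibre_length E x)%E.
Proof.
move=> mE mB; rewrite mu_fibre; last by apply: measurableI => //; exact: measurableX.
rewrite [RHS]integral_mkcond; apply: eq_integral => x _; rewrite patchE; case: ifPn => Bx.
  congr (leb _); apply/seteqP; split=> t; rewrite /xsection /= !inE /=; first by case=> ? [].
  by case=> ? ?; split=> //; split=> //; split=> //=; move: Bx; rewrite inE.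
rewrite -[RHS](measure0 leb); congr (leb _); apply/seteqP; split=> // t; rewrite /xsection /= inE /=.
by case=> _ [_ [/= Bx' _]]; move: Bx; rewrite notin_setE.
Qed.

Lemma null_fibre_cylinder (B : set R) : measurable B -> leb B = 0%E -> mu.-negligible (B `*` setT).
Proof.
move=> mB B0; exists (B `*` setT); split=> //; first exact: measurableX.
rewrite -[B `*` setT]setTI mu_fibre_cylinder //.
apply: null_set_integral => //; apply: measurable_funTS; exact: measurable_fibre_length.
Qed.

Let mlen E (y : \bar R) : measurable E -> measurable [set x | fibre_length E x = y].
Proof.
move=> mE; have := measurable_fibre_length mE measurableT (emeasurable_set1 y).
by rewrite setTI.
Qed.

Lemma null_fibre_length0 E : measurable E -> mu.-negligible (E `&` [set z | fibre_length E z.1 = 0%E]).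
Proof.
move=> mE; pose B := [set x | fibre_length E x = 0%E].
exists (E `&` (B `*` setT)); split; first by apply: measurableI => //; apply: measurableX => //; exact: mlen.
- rewrite mu_fibre_cylinder //; last exact: mlen.
  by apply: integral0_eq => x.
- by move=> z [].
Qed.

(** If the set of such abscissas had positive length, [E] would have infinite measure. *)
Lemma null_fibre_length_oo E : measurable E -> (mu E < +oo)%E ->
  mu.-negligible [set z | fibre_length E z.1 = +oo%E].
Proof.
move=> mE fE; pose B := [set x | fibre_length E x = +oo%E].
have mB : measurable B by exact: mlen.
apply: (@negligibleS _ _ _ _ (B `*` setT)); first by move=> z.
apply: null_fibre_cylinder => //.
have : (\int[leb]_(x in B) fibre_length E x < +oo)%E.
  rewrite -mu_fibre_cylinder //; apply: le_lt_trans fE; apply: le_measure; rewrite ?inE //.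
  by apply: measurableI => //; exact: measurableX.
rewrite (eq_integral (cst +oo%E)); last by move=> x; rewrite inE.
rewrite integral_cst //; have [->//|n0] := eqVneq (leb B) 0%E.
by rewrite gt0_mulye // lt0e n0 measure_ge0.
Qed.

Lemma measurable_fibre_base E : measurable E -> measurable [set x | fibre_length E x != 0%E].
Proof.
move=> mE; rewrite (_ : [set x | _] = ~` [set x | fibre_length E x = 0%E]).
  by apply: measurableC; exact: mlen.
by apply/seteqP; split=> x /eqP.
Qed.

Lemma null_fibre_base E : measurable E -> mu E = 0%E -> leb [set x | fibre_length E x != 0%E] = 0%E.
Proof.
move=> mE E0; have e : (\int[leb]_x `|fibre_length E x| = 0)%E.
  rewrite -E0 mu_fibre //; apply: eq_integral => x _.
  by rewrite gee0_abs // measure_ge0.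
have [N [mN N0 BN]] := (ae_eq_integral_abs leb measurableT (measurable_fibre_length mE)).1 e.
apply: null_sub N0 => //; first exact: measurable_fibre_base.
by move=> x /eqP nx; apply: BN => /= h; apply: nx; exact: h.
Qed.

Context (f : pwMobius R).
Local Notation F := (pw_planar f).

(** Up to finitely many points and the null part [D], the skew map sends the fibre over [x] into the
    fibre over its image and multiplies lengths by the square of the denominator. *)
Lemma fibre_length_le Om x : measurable Om -> pw_den f x != 0 ->
  fibre_length (Om `&` (~` (F @^-1` Om) `|` [set z | hyperbolic z])) x = 0%E ->
  (fibre_length Om x <= ((pw_den f x) ^- 2)%:E * fibre_length Om (pw_map f x))%E.
Proof.
move=> mOm n0 D0; set M := pw_digit f x in n0 *; set D := Om `&` _ in D0.
have uM : unimodular M by exact: pw_unimodular.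
have mF := preimage_measurable (measurable_pw_planar f) mOm.
have mD : measurable D.
  apply: measurableI => //; apply: measurableU; first exact: measurableC.
  apply: measurable_zero_set.
  by apply: measurable_funD => //; exact: measurable_funM.
have mx E : measurable E -> measurable (xsection (straightened E) x).
  by move=> mE; apply: measurable_xsection; exact: measurable_straightened.
pose P := [set t | M 0 0 + (- (M 0 0 * x + M 0 1)) * t = 0].
have fP : finite_set P.
  apply: finite_affine_zero; have := unimodular_neq0 uM; rewrite det_mx22 => dn.
  have [a0|] := eqVneq (M 0 0) 0; [right|by left].
  by apply: contraNneq dn; rewrite a0 mul0r add0r => /eqP; rewrite oppr_eq0 => /eqP ->; rewrite !mul0r subr0.
have mP : measurable P by apply: countable_measurable => //; exact: finite_set_countable.
have P0 : leb P = 0%E by apply: countable_lebesgue_measure0; exact: finite_set_countable.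
pose S := xsection (straightened Om) (pw_map f x).
have mS : measurable S by apply: measurable_xsection; exact: measurable_straightened.
rewrite -[X in (_ <= X * _)%E]/(((M 1 0 * x + M 1 1) ^- 2)%:E) -(skew_scale uM mS n0).
have mpre : measurable [set t | S (planar_skew M (x, t)).2].
  have ms : measurable_fun [set: R] (fun t : R => (planar_skew M (x, t)).2).
    exact: (measurable_affine (\det M * (M 1 0 * x + M 1 1) ^+ 2) (- (\det M * M 1 0 * (M 1 0 * x + M 1 1)))).
  by rewrite -[X in measurable X]setTI; exact: ms.
apply: (@le_trans _ _ (leb (xsection (straightened D) x `|` P `|` [set t | S (planar_skew M (x, t)).2]))).
  apply: le_measure; rewrite ?inE; [exact: mx|apply: measurableU => //; apply: measurableU => //; exact: mx|].
  move=> t; rewrite /xsection /= inE /= => -[n1 Ot].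
  have [Pt|nP] := pselect (P t); first by left; right.
  have [Dt|nD] := pselect (D (unstraighten (x, t))); first by left; left; rewrite inE.
  right; change ((pw_map f x, (planar_skew M (x, t)).2) \in straightened Om); rewrite inE.
  have [zu hu] := zetaK (z := (x, t)) n1.
  have pu : ~~ polar M (unstraighten (x, t)).
    rewrite /polar /= negb_or n0 /=.
    rewrite (_ : _ - _ = (M 0 0 + (- (M 0 0 * x + M 0 1)) * t) / (1 - x * t)); last by field.
    by rewrite mulf_neq0 ?invr_eq0 //; apply/eqP.
  have OF : Om (F (unstraighten (x, t))).
    by apply: contrapT => nO; apply: nD; split=> //; left.
  have hF : ~~ hyperbolic (F (unstraighten (x, t))) by rewrite planar_mobius_hyperbolic.
  have eF : zeta (F (unstraighten (x, t))) = (planar_skew M (x, t)).2 by rewrite zeta_mobius // zu.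
  have eU := unstraightenK hF; rewrite eF in eU.
  have e1 : (F (unstraighten (x, t))).1 = pw_map f x by [].
  rewrite e1 in eU; split=> /=; last by rewrite eU.
  have ez : 1 - pw_map f x * (planar_skew M (x, t)).2 = (1 + (F (unstraighten (x, t))).1 * (F (unstraighten (x, t))).2)^-1.
    by rewrite -eF /zeta e1; move: hF; rewrite /hyperbolic e1 => hF; field.
  by rewrite ez invr_eq0.
apply: (@le_trans _ _ (leb (xsection (straightened D) x `|` P) + leb [set t | S (planar_skew M (x, t)).2])%E).
  by apply: measureU2 => //; apply: measurableU => //; exact: mx.
have e0 : leb (xsection (straightened D) x `|` P) = 0%E.
  apply/eqP; rewrite eq_le measure_ge0 andbT.
  apply: (@le_trans _ _ (leb (xsection (straightened D) x) + leb P)%E).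
    by apply: measureU2 => //; exact: mx.
  by rewrite -/(fibre_length D x) D0 P0 adde0.
by rewrite e0 add0e.
Qed.

Lemma fibre_clean Om : measurable Om -> (mu Om < +oo)%E -> bijective_mod0 mu F Om ->
  exists2 K, mu.-negligible K & forall N, K `<=` N -> (forall z, N z <-> N (F z)) ->
  forall z, (Om `\` N) z -> [/\ 0 < pw_slope f z.1, 0 < fine (fibre_length Om z.1) &
    pw_slope f z.1 * fine (fibre_length Om z.1) <= fine (fibre_length Om (pw_map f z.1))].
Proof.
move=> mOm fOm bij; have [K1 nK1 H1] := bijective_clean bij.
have mF := preimage_measurable (measurable_pw_planar f) mOm.
pose D := Om `&` (~` (F @^-1` Om) `|` [set z | hyperbolic z]).
have mD : measurable D.
  apply: measurableI => //; apply: measurableU; first exact: measurableC.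
  apply: measurable_zero_set.
  by apply: measurable_funD => //; exact: measurable_funM.
have D0 : mu D = 0%E.
  have [N1 sN1 KN1] := saturated_null_exists (nonsingular_pw_planar f) (nonsingular_pw_planar f)
    (negligibleU nK1 (@negligible_hyperbolic R)).
  have [mN1 N10 sat1] := sN1.
  apply: null_sub N10 => // z [Oz nz]; apply: contrapT => Nz.
  case: nz => [nF|hz]; last by apply: Nz; apply: KN1; right.
  have [FO _ _] := H1 N1 (fun z Kz => KN1 _ (or_introl Kz)) (fun z => (sat1 z).1).
  by apply: nF; have [] := FO z (conj Oz Nz).
pose B := [set x | fibre_length D x != 0%E].
have mB : measurable B by exact: measurable_fibre_base.
have B0 : leb B = 0%E by exact: null_fibre_base.
exists (K1 `|` pw_polar f `|` (B `*` setT) `|` (Om `&` [set z | fibre_length Om z.1 = 0%E]) `|`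
  [set z | fibre_length Om z.1 = +oo%E]).
  apply: negligibleU; last exact: null_fibre_length_oo.
  apply: negligibleU; last exact: null_fibre_length0.
  apply: negligibleU; last exact: null_fibre_cylinder.
  by apply: negligibleU => //; exact: negligible_pw_polar.
move=> N KN sat z [Oz Nz].
have [FO _ _] := H1 N (fun z Kz => KN _ (or_introl (or_introl (or_introl (or_introl Kz))))) sat.
have [OFz NFz] := FO z (conj Oz Nz).
have fin w : ~ N w -> fibre_length Om w.1 \is a fin_num.
  move=> Nw; rewrite ge0_fin_numE ?measure_ge0 // ltey; apply/eqP => e; apply: Nw; apply: KN.
  by right.
have pz : ~~ polar (pw_digit f z.1) z.
  by apply: pw_polarPn => pz; apply: Nz; apply: KN; do 3 left; right.
have n0 : pw_den f z.1 != 0 by move: pz; rewrite /polar negb_or => /andP[].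
have l0 : (0 < fibre_length Om z.1)%E.
  rewrite lt0e measure_ge0 andbT; apply/eqP => e; apply: Nz; apply: KN; left; right.
  by split.
have s0 : 0 < pw_slope f z.1 by rewrite exprn_even_gt0.
split=> //; first by rewrite fine_gt0 // l0 -ge0_fin_numE ?measure_ge0 // fin.
have : (fibre_length Om z.1 <= ((pw_den f z.1) ^- 2)%:E * fibre_length Om (pw_map f z.1))%E.
  apply: fibre_length_le => //; apply: contrapT => /eqP nD; apply: Nz; apply: KN.
  by do 2 left; right; split.
have fF := fin _ NFz.
rewrite -(fineK (fin _ Nz)) -[fibre_length Om (pw_map f z.1)](fineK fF) -EFinM lee_fin => h.
by rewrite mulrC -ler_pdivlMr // mulrC.
Qed.

End Fibres.

(** * Slopes along the two orbits of a piece *)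

Section SlopeAgreement.
Context (R : realType) (f g : pwMobius R).
Local Notation mu := (@mu R).
Local Notation leb := (@lebesgue_measure R).
Local Notation F := (pw_planar f).
Local Notation G := (pw_planar g).

Definition slope_of (h : pwMobius R) (z : R * R) := pw_slope h z.1.

Lemma fibre_two_points (E : set (R * R)) (z : R * R) : fibre_length E z.1 <> 0%E ->
  exists w w', [/\ E w, E w', w.1 = z.1, w'.1 = z.1 & zeta w != zeta w'].
Proof.
move=> n0; apply: contrapT => H; apply: n0.
apply: countable_lebesgue_measure0; apply: finite_set_countable.
have [|n0] := pselect (exists t, xsection (straightened E) z.1 t); last first.
  by rewrite (_ : xsection _ _ = set0) //; apply/seteqP; split=> // t ht; apply: n0; exists t.
move=> [t0]; rewrite /xsection /= inE => -[/= n1 E1].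
apply: (@sub_finite_set _ _ [set t0]); last exact: finite_set1.
move=> t; rewrite /= inE => -[/= n2 E2]; apply: contrapT => /eqP ne.
apply: H; exists (unstraighten (z.1, t)), (unstraighten (z.1, t0)); split=> //.
have [-> _] := zetaK (z := (z.1, t)) n2.
by have [-> _] := zetaK (z := (z.1, t0)) n1.
Qed.

Lemma zeta_iter_clean (h : pwMobius R) N : pw_polar h `|` [set z | hyperbolic z] `<=` N ->
  (forall z, N z <-> N (pw_planar h z)) -> forall n z, ~ N z ->
  zeta (iter n (pw_planar h) z) = (zeta_coef h n z.1).1 * zeta z + (zeta_coef h n z.1).2.
Proof.
move=> KN sat n z Nz; apply: zeta_iter => k.
have Nk : ~ N (iter k (pw_planar h) z) by elim: k => //= k IH; rewrite -sat.
by split; [move=> pz; apply: Nk; apply: KN; left|apply/negP => hz; apply: Nk; apply: KN; right].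
Qed.

(* Both iterates are affine in [zeta] along the fibres; as they agree at two
   points of the same fibre, their slopes agree. *)
Lemma slope_agree_ae (C : nat -> set (R * R)) (dn an : nat -> nat) :
  (forall i, measurable (C i)) ->
  (forall i, mu.-negligible (C i `&` [set z | iter (dn i).+1 F z <> iter (an i).+1 G z])) ->
  exists2 K, mu.-negligible K & forall N, K `<=` N -> forall i z, (C i `\` N) z ->
    cocycle F (slope_of f) (dn i).+1 z = cocycle G (slope_of g) (an i).+1 z.
Proof.
move=> mC orb.
have nK0 : mu.-negligible ([set z | exists i, (C i `&` [set z | iter (dn i).+1 F z <> iter (an i).+1 G z]) z] `|`
    (pw_polar f `|` pw_polar g `|` [set z | hyperbolic z])).
  apply: negligibleU; first exact: negligible_exists.
  apply: negligibleU; last exact: negligible_hyperbolic.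
  by apply: negligibleU; exact: negligible_pw_polar.
have [N1 [mN1 N10 sat1] KN1] := saturated_null_exists (nonsingular_pw_planar f) (nonsingular_pw_planar g) nK0.
have mCN i : measurable (C i `\` N1) by exact: measurableD.
(* Points whose fibre within the piece has length 0 are discarded too, so that two points with
   different [zeta] can be chosen in the fibre. *)
exists (N1 `|` [set z | exists i, ((C i `\` N1) `&` [set z | fibre_length (C i `\` N1) z.1 = 0%E]) z]).
  apply: negligibleU; first by exists N1; split.
  by apply: negligible_exists => i; exact: null_fibre_length0.
move=> N KN i z [Ci Nz].
have N1z : ~ N1 z by move=> h; apply: Nz; apply: KN; left.
have l0 : fibre_length (C i `\` N1) z.1 <> 0%E.
  by move=> e; apply: Nz; apply: KN; right; exists i.
have [w [w' [[Cw Nw] [Cw' Nw'] ew ew' ne]]] := fibre_two_points l0.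
have pf : pw_polar f `|` [set z | hyperbolic z] `<=` N1.
  by move=> y [hy|hy]; apply: KN1; right; [left; left|right].
have pg : pw_polar g `|` [set z | hyperbolic z] `<=` N1.
  by move=> y [hy|hy]; apply: KN1; right; [left; right|right].
have H y : C i y -> ~ N1 y -> y.1 = z.1 ->
  (zeta_coef f (dn i).+1 z.1).1 * zeta y + (zeta_coef f (dn i).+1 z.1).2 =
  (zeta_coef g (an i).+1 z.1).1 * zeta y + (zeta_coef g (an i).+1 z.1).2.
  move=> Cy Ny ey; rewrite -ey -(zeta_iter_clean pf (fun z => (sat1 z).1)) //.
  rewrite -(zeta_iter_clean pg (fun z => (sat1 z).2)) //; congr zeta.
  by apply: contrapT => h; apply: Ny; apply: KN1; left; exists i.
have H1 := H _ Cw Nw ew; have H2 := H _ Cw' Nw' ew'.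
rewrite -!(zeta_coef_slope _ _ z); congr (`| _ |).
have nz : zeta w - zeta w' != 0 by rewrite subr_eq0.
apply: (mulIf nz); rewrite !mulrBr.
move: H1 H2; set a := (zeta_coef f _ _).1; set b := (zeta_coef f _ _).2; set a' := (zeta_coef g _ _).1; set b' := (zeta_coef g _ _).2.
by move=> H1 H2; lra.
Qed.

Lemma slope_agree_digit z : eq_mobius (pw_digit f z.1) (pw_digit g z.1) -> slope_of f z = slope_of g z.
Proof.
rewrite /slope_of /pw_slope /pw_den /mobius_den => -[->//|->]; rewrite !mxE; ring.
Qed.

End SlopeAgreement.

(** * Ergodicity *)

Section PlanarProb.
Context (R : realType) (Om : set (R * R)) (mOm : measurable Om).
Context (posm : (0 < mu Om)%E) (finm : (mu Om < +oo)%E).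
Local Notation mu := (@mu R).
Local Notation P := (planar_prob mOm).

Lemma fine_mu_gt0 : 0 < fine (mu Om). Proof. by rewrite fine_gt0 // posm finm. Qed.

Lemma planar_probE A : P A = (mu (A `&` Om) * ((fine (mu Om))^-1)%:E)%E.
Proof.
rewrite -[LHS]/(mnormalize (mrestr mu mOm) (dirac ((0, 0) : R * R)) A) /mnormalize.
match goal with |- context [if (?v == _) || _ then _ else _] =>
  have e : v = mu Om by rewrite /mrestr; congr mu; apply/seteqP; split=> [z []|z] end.
match goal with |- context [if ?b then _ else _] =>
  have eb : b = (mu Om == 0%E) || (mu Om == +oo%E) by rewrite -e end.
have b0 : (mu Om == 0%E) || (mu Om == +oo%E) = false by rewrite gt_eqF //= lt_eqF.
by rewrite b0 in eb; rewrite eb e.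
Qed.

Lemma planar_prob_eq0 A : P A = 0%E <-> mu (A `&` Om) = 0%E.
Proof.
rewrite planar_probE; split=> [/eqP|->]; last by rewrite mul0e.
by rewrite mule_eq0 => /orP[/eqP//|]; rewrite eqe invr_eq0 gt_eqF // fine_mu_gt0.
Qed.

Lemma mu_fin_sub A : measurable A -> A `<=` Om -> (mu A < +oo)%E.
Proof. by move=> mA AO; exact: (fin_sub mOm finm). Qed.

Lemma planar_prob_eq1 A : measurable A -> P A = 1%E <-> mu (Om `\` A) = 0%E.
Proof.
move=> mA; have mAO : measurable (A `&` Om) by exact: measurableI.
have mOA : measurable (Om `\` A) by exact: measurableD.
have fA : (mu (A `&` Om) < +oo)%E by apply: mu_fin_sub => // z [].
have fO : (mu (Om `\` A) < +oo)%E by apply: mu_fin_sub => // z [].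
have e : mu Om = (mu (Om `\` A) + mu (A `&` Om))%E.
  by rewrite setIC; exact: measureDI.
have p0 := fine_mu_gt0.
rewrite planar_probE -[mu (A `&` Om)]fineK ?ge0_fin_numE // -EFinM.
rewrite -[mu (Om `\` A)]fineK ?ge0_fin_numE //.
have e' : fine (mu Om) = fine (mu (Om `\` A)) + fine (mu (A `&` Om)).
  by rewrite e fineD // ge0_fin_numE.
split=> [[h]|[h]]; congr (_%:E).
  have : fine (mu (A `&` Om)) = fine (mu Om) by rewrite -(divfK (lt0r_neq0 p0) (fine (mu (A `&` Om)))) h mul1r.
  by lra.
have -> : fine (mu (A `&` Om)) = fine (mu Om) by lra.
by rewrite divff // gt_eqF.
Qed.

Lemma null_measure_setD (E N : set (R * R)) : measurable E -> measurable N -> mu N = 0%E ->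
  mu (E `\` N) = mu E.
Proof.
move=> mE mN N0; have EN0 : mu (E `&` N) = 0%E.
  by apply: null_sub N0 => //; exact: measurableI.
by rewrite (measureDI mu mE mN) -[LHS]adde0; congr (_ + _)%E; rewrite -EN0.
Qed.

Lemma planar_prob_negligible (B N : set (R * R)) : measurable B -> measurable N -> mu N = 0%E ->
  mu ((Om `\` N) `&` B) = 0%E -> P B = 0%E.
Proof.
move=> mB mN N0 h; apply/planar_prob_eq0.
have mBO : measurable (B `&` Om) by exact: measurableI.
rewrite -(null_measure_setD mBO mN N0) -h; congr mu; apply/seteqP; split=> z /=; tauto.
Qed.

Lemma planar_preserving (T : R * R -> R * R) N : measurable_fun [set: R * R] T ->
  measurable N -> mu N = 0%E ->
  (forall E, measurable E -> mu ((Om `\` N) `&` T @^-1` E) = mu ((Om `\` N) `&` E)) ->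
  measure_preserving P T.
Proof.
move=> mT mN N0 H; split=> // A mA; rewrite !planar_probE.
have mTA := preimage_measurable mT mA.
have e B : measurable B -> mu (B `&` Om) = mu ((Om `\` N) `&` B).
  move=> mB; have mBO : measurable (B `&` Om) by exact: measurableI.
  rewrite -(null_measure_setD mBO mN N0); congr mu; apply/seteqP; split=> z /=; tauto.
by rewrite !e // H.
Qed.

End PlanarProb.

(** The integral of a nonnegative function over any set is a supremum over simple functions. This
    allows comparison with towers whose measurability has not been established. *)
Lemma mu_le_subset (R : realType) (A B : set (R * R)) : A `<=` B -> (mu A <= mu B)%E.
Proof.
move=> AB; have d0 (z : R * R) : (0 <= (mu_density z)%:E)%E by rewrite lee_fin mu_density_ge0.
rewrite /mu !ge0_integralE //; apply: le_ereal_sup => _ [h hA <-]; exists h => // z.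
apply: le_trans (hA z) _; rewrite !patchE.
case: ifP => [/set_mem Az|_]; first by rewrite mem_set //; exact: AB.
by case: ifP.
Qed.

(** * Clean sets of a quilting *)

Section CleanSet.
Context (R : realType) (f g : pwMobius R) (Omf Omg : set (R * R)).
Context (C : nat -> set (R * R)) (dn an : nat -> nat).
Local Notation mu := (@mu R).
Local Notation F := (pw_planar f).
Local Notation G := (pw_planar g).

Definition fibre_len Om (z : R * R) : R := fine (fibre_length Om z.1).

Record clean_set (N : set (R * R)) : Prop := CleanSet {
  clean_sat : saturated_null mu F G N;
  clean_model : quilt_model mu F G (Omf `\` N) (Omg `\` N) (fun i => C i `\` N) dn an;
  clean_f : forall z, (Omf `\` N) z -> [/\ 0 < slope_of f z, 0 < fibre_len Omf z &
    slope_of f z * fibre_len Omf z <= fibre_len Omf (F z)];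
  clean_g : forall z, (Omg `\` N) z -> [/\ 0 < slope_of g z, 0 < fibre_len Omg z &
    slope_of g z * fibre_len Omg z <= fibre_len Omg (G z)];
  clean_agree : forall z, (Omf `\` N) z -> (Omg `\` N) z -> ~ base (fun i => C i `\` N) z ->
    slope_of f z = slope_of g z;
  clean_orbit : forall i z, (C i `\` N) z ->
    cocycle F (slope_of f) (dn i).+1 z = cocycle G (slope_of g) (an i).+1 z;
  clean_polar_f : pw_polar f `|` [set z | hyperbolic z] `<=` N;
  clean_polar_g : pw_polar g `|` [set z | hyperbolic z] `<=` N
}.

Context (mOmf : measurable Omf) (mOmg : measurable Omg).
Context (bijf : bijectivity_domain f Omf) (bijg : bijectivity_domain g Omg).
Context (finf : (mu Omf < +oo)%E) (fing : (mu Omg < +oo)%E).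
Context (Q : quilting f g Omf Omg C dn an).

Lemma domain_sub (T : pwMobius R) Om : bijectivity_domain T Om -> Om `<=` [set z | pw_dom T z.1].
Proof. by move=> [[<- _] _] z Oz; exists z. Qed.

Lemma clean_set_exists K : mu.-negligible K -> exists2 N, clean_set N & K `<=` N.
Proof.
move=> nK; have domf := domain_sub bijf; have domg := domain_sub bijg.
have [K1 nK1 H1] := quilt_clean mOmf mOmg bijf.2 bijg.2 domf domg finf fing Q.
have [K2 nK2 H2] := fibre_clean mOmf finf bijf.2.
have [K3 nK3 H3] := fibre_clean mOmg fing bijg.2.
have [K4 nK4 H4] := slope_agree_ae (quilt_measurable Q) (quilt_orbit Q).
have nD := negligible_quilt_defects Q.
have nA : mu.-negligible (K `|` K1 `|` K2 `|` K3 `|` K4 `|` quilt_defects f g Omf Omg C dn an).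
  by do 5 (apply: negligibleU => //).
have [N sN KN] := saturated_null_exists (nonsingular_pw_planar f) (nonsingular_pw_planar g) nA.
have sub K' : K' `<=` K `|` K1 `|` K2 `|` K3 `|` K4 `|` quilt_defects f g Omf Omg C dn an -> K' `<=` N.
  by move=> h z /h; exact: KN.
have [mN N0 sat] := sN.
exists N; last by apply: sub => z h; do 5 left.
split=> //.
- by apply: H1 => //; apply: sub => z h; do 4 left; right.
- by apply: H2; [apply: sub => z h; do 3 left; right|move=> z; exact: (sat z).1].
- by apply: H3; [apply: sub => z h; do 2 left; right|move=> z; exact: (sat z).2].
- move=> z [Oz Nz] [Oz' _] nb; apply: slope_agree_digit; apply: contrapT => ne.
  apply: (Nz); apply: KN; right; do 7 left; right.
  split; first by split=> //; split=> //; [exact: domf|exact: domg].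
  by move=> [i _ Ci]; apply: nb; exists i.
- by apply: H4; apply: sub => z h; left; right.
- by apply: sub => z [h|h]; right; right; [left; left|right].
- by apply: sub => z [h|h]; right; right; [left; right|right].
Qed.

(** The strict inequality between the measures of the removed towers and of [Omf] enters here. *)
Lemma common_pos N : clean_set N -> mu (common F (Omf `\` N) (fun i => C i `\` N) dn) <> 0%E.
Proof.
move=> cN Z0; have M := clean_model cN; have [mN N0 sat] := clean_sat cN.
have mU := measurable_U M; have mOf := qm_mOf M.
have : (mu (Omf `\` N) <= mu (in_tower F (fun i => C i `\` N) dn))%E.
  apply: (@le_trans _ _ (mu (common F (Omf `\` N) (fun i => C i `\` N) dn) + mu (in_tower F (fun i => C i `\` N) dn))%E).
    apply: le_trans (measureU2 _ (measurable_common M) mU); apply: mu_le_subset => z Oz.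
    by have [Uz|nU] := pselect (in_tower F (fun i => C i `\` N) dn z); [right|left].
  by rewrite Z0 add0e.
rewrite (null_measure_setD mOmf mN N0) leNgt => /negP; apply.
apply: le_lt_trans (quilt_removed_lt Q); apply: mu_le_subset => z [i [j [c [jd [Cc _] ->]]]].
by exists (i, j) => //; exists c.
Qed.

Context (posf : (0 < mu Omf)%E) (posg : (0 < mu Omg)%E).

Lemma ergodic_quilted :
  ergodic (planar_prob mOmf) F -> ergodic (planar_prob mOmg) G.
Proof.
move=> [_ erg]; have [N cN _] := clean_set_exists (negligible_set0 mu).
have M := clean_model cN; have [mN N0 sat] := clean_sat cN.
split.
  by apply: (planar_preserving mOmg posg fing (N := N)) => //; [exact: (qm_mG M)|exact: (G_preserve M)].
have mpF A : measurable A -> measurable (F @^-1` A) by exact: (preimage_measurable (qm_mF M)).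
have mpG A : measurable A -> measurable (G @^-1` A) by exact: (preimage_measurable (qm_mG M)).
have ergF A : measurable A -> mu ((Omf `\` N) `&` (F @^-1` A `+` A)) = 0%E ->
    mu ((Omf `\` N) `&` A) = 0%E \/ mu ((Omf `\` N) `\` A) = 0%E.
  move=> mA h; have mS : measurable (F @^-1` A `+` A) by apply: measurableU; apply: measurableD => //; exact: mpF.
  have [|e|e] := erg A mA.
  - exists (F @^-1` A `+` A); split=> //.
    by apply: (planar_prob_negligible mOmf posf finf mS mN N0).
  - left; move/(planar_prob_eq0 mOmf posf finf): e; apply: null_sub.
    + by apply: measurableI => //; exact: measurableD.
    + exact: measurableI.
    + by move=> z [[]].
  - right; move/(planar_prob_eq1 mOmf posf finf mA): e; apply: null_sub.
    + by apply: measurableD => //; exact: measurableD.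
    + exact: measurableD.
    + by move=> z [[]].
move=> A mA [B [mB B0 sB]].
have [|h|h] := quilt_ergodic M ergF (common_pos cN) mA.
- move/(planar_prob_eq0 mOmg posg fing): B0; apply: null_sub.
  + apply: measurableI; first exact: measurableD.
    by apply: measurableU; apply: measurableD => //; exact: mpG.
  + exact: measurableI.
  + by move=> z [[Oz _] /sB].
- by left; apply: (planar_prob_negligible mOmg posg fing mA mN N0).
- right; apply/(planar_prob_eq1 mOmg posg fing mA).
  have mOA : measurable (Omg `\` A) by exact: measurableD.
  rewrite -(null_measure_setD mOA mN N0) -h; congr mu; apply/seteqP; split=> z /=; tauto.
Qed.

End CleanSet.

Lemma preimage_mfun d1 d2 (X1 : measurableType d1) (X2 : measurableType d2) (h : X1 -> X2) B :
  measurable_fun [set: X1] h -> measurable B -> measurable (h @^-1` B).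
Proof. by move=> mh mB; rewrite -[X in measurable X]setTI; exact: mh. Qed.

Lemma measurable_setY d (X : measurableType d) (A B : set X) : measurable A -> measurable B -> measurable (A `+` B).
Proof. by move=> mA mB; apply: measurableU; exact: measurableD. Qed.

(** * Natural extensions *)

Section PreimageLimit.
Context (R : realType) d (X : measurableType d) (P : probability X R).
Context d' (Y : measurableType d') (phi : X -> Y) (mphi : measurable_fun [set: X] phi).
Local Notation p A := (fine (P A)).

(** Take [B k] with error below the [k]-th term of a summable series: by Borel-Cantelli almost every
    point sees finitely many errors, so the upper limit of the [B k] serves. *)
Lemma preimage_limit A : measurable A ->
  (forall e : R, 0 < e -> exists2 B, measurable B & p (A `+` phi @^-1` B) < e) ->
  exists2 B, measurable B & P (A `+` phi @^-1` B) = 0%E.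
Proof.
move=> mA near0.
have half k : (0 : R) < 1 / (2 ^ k.+1)%:R by rewrite divr_gt0 // ltr0n expn_gt0.
have /choice[B HB] : forall k, exists B, measurable B /\ p (A `+` phi @^-1` B) < 1 / (2 ^ k.+1)%:R.
  by move=> k; have [B mB hB] := near0 _ (half k); exists B.
have mB k : measurable (B k) by have [] := HB k.
have mD k : measurable (A `+` phi @^-1` B k) by apply: measurable_setY => //; exact: preimage_mfun.
have mL : measurable (lim_sup_set B).
  by apply: bigcap_measurable => // k _; exact: bigcup_measurable.
exists (lim_sup_set B) => //.
apply: (@null_sub _ _ _ P _ (lim_sup_set (fun k => A `+` phi @^-1` B k))).
- by apply: measurable_setY => //; exact: preimage_mfun.
- by apply: bigcap_measurable => // k _; apply: bigcup_measurable => j _.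
- move=> x h k _; apply: contrapT => nk.
  have H j : (k <= j)%N -> (A x <-> B j (phi x)).
    move=> kj; apply: contrapT => ne; apply: nk; exists j => //; rewrite /setY /setD /setU /=.
    by have [] := pselect (A x); have [] := pselect (B j (phi x)); tauto.
  case: h => -[h1 h2]; apply: h2.
    move=> n _; exists (maxn n k); first exact: leq_maxl.
    by apply/H => //; exact: leq_maxr.
  by have [j /= kj Bj] := h1 k I; apply/(H j kj).
- apply: lim_sup_set_cvg0 => //.
  apply: (@le_lt_trans _ _ (\sum_(k <oo) (1 / (2 ^ k.+1)%:R)%:E)%E).
    apply: lee_nneseries => // k _; rewrite -[leLHS]fineK ?fin_num_measure // lee_fin ltW //.
    by have [] := HB k.
  by apply: le_lt_trans (epsilon_trick0 _ _) _; rewrite ?ltey.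
Qed.

End PreimageLimit.

Section Approximation.
Context (R : realType) d (X : measurableType d) (P : probability X R) (T : X -> X).
Context d' (Y : measurableType d') (Q : probability Y R) (S : Y -> Y) (phi : X -> Y).
Hypothesis mT : measurable_fun [set: X] T.
Hypothesis mS : measurable_fun [set: Y] S.
Hypothesis mphi : measurable_fun [set: X] phi.
Hypothesis PT : forall A, measurable A -> P (T @^-1` A) = P A.
Hypothesis phiT : forall x, phi (T x) = S (phi x).
Local Notation p A := (fine (P A)).

Lemma prob_le (A B : set X) : measurable A -> measurable B -> A `<=` B -> p A <= p B.
Proof.
move=> mA mB AB; rewrite fine_le ?fin_num_measure //.
by apply: le_measure; rewrite ?inE.
Qed.

Lemma probU_le (A B : set X) : measurable A -> measurable B -> p (A `|` B) <= p A + p B.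
Proof.
move=> mA mB; rewrite -fineD ?fin_num_measure //.
rewrite fine_le ?fin_num_measure //; first exact: measurableU.
  by rewrite fin_numD !fin_num_measure.
exact: measureU2.
Qed.

Lemma prob_iter n A : measurable A -> P (iter n T @^-1` A) = P A.
Proof.
move=> mA; elim: n A mA => // n IH A mA.
rewrite (_ : iter n.+1 T @^-1` A = iter n T @^-1` (T @^-1` A)); last by apply/funext => x; rewrite /= -iterS.
by rewrite IH ?PT //; exact: preimage_mfun.
Qed.

Lemma phi_iter n x : phi (iter n T x) = iter n S (phi x).
Proof. by elim: n => //= n IH; rewrite phiT IH. Qed.

(** For an invertible [T] this means that [A] is nearly a function of the value of [phi] at a remote
    past time. *)
Definition approximable (A : set X) := measurable A /\ forall e : R, 0 < e ->
  exists n E, measurable E /\ p (iter n T @^-1` A `+` phi @^-1` E) < e.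

Let mTi n A : measurable A -> measurable (iter n T @^-1` A).
Proof. by move=> mA; apply: preimage_mfun => //; exact: measurable_fun_iter. Qed.

Let mSi n A : measurable A -> measurable (iter n S @^-1` A).
Proof. by move=> mA; apply: preimage_mfun => //; exact: measurable_fun_iter. Qed.

Let msd n A E : measurable A -> measurable E -> measurable (iter n T @^-1` A `+` phi @^-1` E).
Proof. by move=> mA mE; apply: measurable_setY; [exact: mTi|exact: preimage_mfun]. Qed.

(** Pulling back both sets changes neither their form nor the error, so that approximations at
    different times can be brought to a common time. *)
Lemma approx_shift n k A E : measurable A -> measurable E ->
  p (iter (n + k) T @^-1` A `+` phi @^-1` (iter k S @^-1` E)) = p (iter n T @^-1` A `+` phi @^-1` E).
Proof.
move=> mA mE; rewrite -(prob_iter k (msd n mA mE)); congr (fine (P _)).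
by apply/funext => x; rewrite /= /setY /= /setD /setU /= iterD phi_iter.
Qed.

Lemma approximable_phi E : measurable E -> approximable (phi @^-1` E).
Proof.
move=> mE; split=> [|e e0]; first exact: preimage_mfun.
exists 0%N, E; split=> //=; rewrite (_ : _ `+` _ = set0) ?measure0 //.
by apply/seteqP; split=> // x [] [].
Qed.

Lemma approximable_T A : approximable A -> approximable (T @^-1` A).
Proof.
move=> [mA aA]; split=> [|e e0]; first exact: preimage_mfun.
have [n [E [mE h]]] := aA e e0; exists n, (S @^-1` E); split; first exact: preimage_mfun.
rewrite -(approx_shift n 1 mA mE) in h; apply: le_lt_trans h.
rewrite (_ : iter n T @^-1` (T @^-1` A) = iter (n + 1) T @^-1` A) //.
by apply/funext => x; rewrite /= addn1.
Qed.

Lemma approximable_setC A : approximable A -> approximable (~` A).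
Proof.
move=> [mA aA]; split=> [|e e0]; first exact: measurableC.
have [n [E [mE h]]] := aA e e0; exists n, (~` E); split; first exact: measurableC.
apply: le_lt_trans h; rewrite (_ : _ `+` _ = iter n T @^-1` A `+` phi @^-1` E) //.
apply/seteqP; split=> x /=; rewrite /setY /setD /setU /=.
  by move=> [[a b]|[a b]]; [right|left]; split=> //; apply: contrapT.
by move=> [[a b]|[a b]]; [right|left]; split=> //; tauto.
Qed.

Lemma approximable_setU A B : approximable A -> approximable B -> approximable (A `|` B).
Proof.
move=> [mA aA] [mB aB]; split=> [|e e0]; first exact: measurableU.
have e2 : 0 < e / 2 by rewrite divr_gt0.
have [n [E [mE hE]]] := aA _ e2; have [k [D [mD hD]]] := aB _ e2.
exists (n + k)%N, (iter k S @^-1` E `|` iter n S @^-1` D).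
have mE' := mSi k mE; have mD' := mSi n mD.
split; first exact: measurableU.
rewrite -(approx_shift n k mA mE) in hE; rewrite -(approx_shift k n mB mD) addnC in hD.
have m1 := msd (n + k) mA mE'; have m2 := msd (n + k) mB mD'.
apply: (@le_lt_trans _ _ (p ((iter (n + k) T @^-1` A `+` phi @^-1` (iter k S @^-1` E)) `|`
    (iter (n + k) T @^-1` B `+` phi @^-1` (iter n S @^-1` D))))).
  apply: prob_le; [by apply: msd; exact: measurableU|exact: measurableU|].
  move=> x /=; rewrite /setY /setD /setU /=.
  by case=> [[[a|a] b]|[[a|a] b]]; [left; left|right; left|left; right|right; right]; split=> //; tauto.
by apply: le_lt_trans (probU_le m1 m2) _; lra.
Qed.

Lemma approximable_bigsetU (A : nat -> set X) n : (forall k, approximable (A k)) ->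
  approximable (\big[setU/set0]_(k < n) A k).
Proof.
move=> aA; elim: n => [|n IH]; last by rewrite big_ord_recr /=; exact: approximable_setU.
by rewrite big_ord0 -(preimage_set0 phi); exact: approximable_phi.
Qed.

Lemma approximable_near A : measurable A ->
  (forall e : R, 0 < e -> exists2 B, approximable B & p (A `+` B) < e) -> approximable A.
Proof.
move=> mA H; split=> // e e0; have e2 : 0 < e / 2 by rewrite divr_gt0.
have [B [mB aB] hB] := H _ e2; have [n [E [mE hE]]] := aB _ e2.
exists n, E; split=> //.
have mAB := measurable_setY mA mB; rewrite -(prob_iter n mAB) in hB.
have m1 := mTi n mAB; have m2 := msd n mB mE.
apply: (@le_lt_trans _ _ (p (iter n T @^-1` (A `+` B) `|` (iter n T @^-1` B `+` phi @^-1` E)))).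
  apply: prob_le; [exact: msd|exact: measurableU|].
  move=> x /=; rewrite /setY /setD /setU /=; have [b|b] := pselect (B (iter n T x)); tauto.
by apply: le_lt_trans (probU_le m1 m2) _; lra.
Qed.

Lemma approximable_bigcup (A : nat -> set X) : (forall k, approximable (A k)) ->
  approximable (\bigcup_k A k).
Proof.
move=> aA; have mA k : measurable (A k) by case: (aA k).
have mU : measurable (\bigcup_k A k) by exact: bigcupT_measurable.
apply: approximable_near => // e e0.
pose B n := \big[setU/set0]_(k < n) A k.
have mB n : measurable (B n) by exact: bigsetU_measurable.
pose D n := (\bigcup_k A k) `\` B n.
have mD n : measurable (D n) by exact: measurableD.
have BU n : B n `<=` \bigcup_k A k.
  by move=> x; rewrite /B -bigcup_mkord => -[k _ Ak]; exists k.
have [|||n hn] := @measure_tail_small _ _ _ P D mD _ _ _ e e0.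
- by rewrite ltey_eq fin_num_measure.
- by move=> n x [Ux nB]; split=> // Bx; apply: nB; rewrite /B big_ord_recr /=; left.
- rewrite (_ : \bigcap_n D n = set0) ?measure0 //; apply/seteqP; split=> // x h.
  have [[k _ Ak] _] := h 0%N I; have [_] := h k.+1 I; apply.
  by rewrite /B big_ord_recr /=; right.
exists (B n); first exact: approximable_bigsetU.
apply: le_lt_trans (hn n (leqnn n)).
apply: prob_le => //; first exact: measurable_setY.
by move=> x [//|[Bx nU]]; case: nU; exact: BU Bx.
Qed.

Lemma approximable_sigma_algebra : sigma_algebra [set: X] approximable.
Proof.
split.
- by rewrite -(preimage_set0 phi); exact: approximable_phi.
- by move=> A aA; rewrite setTD; exact: approximable_setC.
- exact: approximable_bigcup.
Qed.

(** All preimages of an invariant set coincide with it up to null sets, so the approximations are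
    approximations of [A] itself. *)
Lemma approximable_invariant A : approximable A -> P (T @^-1` A `+` A) = 0%E ->
  exists2 E, measurable E & P (A `+` phi @^-1` E) = 0%E.
Proof.
move=> [mA aA] inv; apply: (preimage_limit mphi mA) => e e0.
have [n [E [mE hE]]] := aA e e0; exists E => //.
have mTA := preimage_mfun mT mA.
have p0 : P (iter n T @^-1` A `+` A) = 0%E.
  elim: (n) => [|k IH].
    by rewrite (_ : _ `+` _ = set0) ?measure0 //; apply/seteqP; split=> // x [] [].
  have m1 : measurable (iter k T @^-1` A `+` A) by apply: measurable_setY => //; exact: mTi.
  have m2 : measurable (T @^-1` (iter k T @^-1` A `+` A)) by exact: preimage_mfun.
  have m3 : measurable (T @^-1` A `+` A) by exact: measurable_setY.
  apply: (null_sub (D' := T @^-1` (iter k T @^-1` A `+` A) `|` (T @^-1` A `+` A))).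
  - by apply: measurable_setY => //; exact: mTi.
  - exact: measurableU.
  - move=> x; rewrite /setY /setD /setU /preimage /= -iterS iterSr.
    by have [] := pselect (A (T x)); tauto.
  - by apply: etrans (measureU0 m2 m3 inv) _; apply: etrans (PT m1) IH.
have m1 : measurable (iter n T @^-1` A `+` A) by apply: measurable_setY => //; exact: mTi.
have m2 := msd n mA mE.
apply: le_lt_trans hE; rewrite -[leRHS]add0r (_ : 0 = p (iter n T @^-1` A `+` A)); last by rewrite p0.
apply: le_trans (probU_le m1 m2); apply: prob_le.
- by apply: measurable_setY => //; exact: preimage_mfun.
- exact: measurableU.
- move=> x; rewrite /setY /setD /setU /=.
  by have [] := pselect (A (iter n T x)); tauto.
Qed.

End Approximation.

(** * Natural extensions and approximable sets *)

Section Natural.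
Context (R : realType) d (X : measurableType d) (P : probability X R) (T : X -> X).
Context d' (Y : measurableType d') (Q : probability Y R) (S : Y -> Y) (phi : X -> Y).
Hypothesis phiT : forall x, phi (T x) = S (phi x).
Local Notation p A := (fine (P A)).

(* Minimality is applied to the factor generated by the approximable sets. *)
Lemma natural_approximable : natural_extension P T Q S phi ->
  forall A, measurable A -> approximable P T phi A.
Proof.
move=> [[mS _] [[mT PT] [_ Tiso]] [mphi Pphi _] minimal].
pose AA : set (set X) := approximable P T phi.
have sA : sigma_algebra [set: X] AA by exact: (approximable_sigma_algebra mT mS mphi PT phiT).
pose Z := g_sigma_algebraType AA.
have mZ (A : set Z) : measurable A <-> AA A.
  by rewrite -[X in X A <-> _]/(AA.-sigma.-measurable) measurable_g_measurableTypeE.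
have mal : measurable_fun [set: X] (id : X -> Z).
  by move=> _ B /mZ [mB _]; rewrite setTI.
pose al : {mfun X >-> Z} := HB.pack (id : X -> Z) (isMeasurableFun.Build _ _ _ _ (id : X -> Z) mal).
pose P0 : probability Z R := distribution P al.
have P0E (B : set Z) : P0 B = P B by [].
have negE (B : set Z) : measurable B -> P0 B = 0%E -> P.-negligible B.
  by move=> /mZ [mB _] B0; exists B; split.
have pres0 : measure_preserving P0 (T : Z -> Z).
  split=> [_ B mB|B /mZ [mB _]]; last exact: PT.
  rewrite setTI.
    apply/mZ.
    have aB := (mZ B).1 mB.
    exact: (approximable_T mT mS mphi PT phiT aB).
have mpre A : measurable A -> measurable (T @^-1` A) by exact: preimage_mfun.
have inv0 : invertible_system P0 (T : Z -> Z).
  split=> //; split; first by split=> //; [case: pres0|case: pres0|exact: aeW].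
  (* The factor is invertible: a set [B] with preimage [A] exists in the given system, and it is
     approximable because its preimage is. *)
  move=> A /mZ AAA; have [mA _] := AAA.
  have [B mB [N [mN N0 BN]]] := Tiso A mA.
  have p0 : p (T @^-1` B `+` A) = 0.
    apply/eqP; rewrite eq_le fine_ge0 // andbT.
    have -> : 0 = p N by rewrite N0.
    by apply: prob_le => //; apply: measurable_setY => //; exact: mpre.
  have aTB : AA (T @^-1` B).
    apply: (approximable_near mT mphi PT) => [|e e0]; first exact: mpre.
    by exists A => //; rewrite p0.
  have aB : AA B.
    split=> // e e0; have [_ /(_ e e0) [n [E [mE hE]]]] := aTB.
    exists n.+1, E; split=> //; apply: le_lt_trans hE.
  exists B; first exact/mZ.
  exists (T @^-1` B `+` A); split=> //.
    by apply: (@measurable_setY _ Z); apply/mZ.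
  rewrite P0E; rewrite -[LHS]fineK ?fin_num_measure ?p0 //.
  by apply: measurable_setY => //; exact: mpre.
have fal : factor_map P T P0 (T : Z -> Z) (id : X -> Z) by split=> //; exact: aeW.
have fbe : factor_map P0 (T : Z -> Z) Q S (phi : Z -> Y).
  split; [|exact: Pphi|exact: aeW].
  by move=> _ B mB; rewrite setTI; apply/mZ; exact: approximable_phi.
have := minimal _ Z P0 T id phi inv0 fal fbe (aeW _ (fun x => erefl)).
move=> [_ iso] A mA; have [B /mZ AB [N [mN N0 BN]]] := iso A mA.
apply: (approximable_near mT mphi PT) => // e e0; exists B => //; have [mB _] := AB.
have -> : p (A `+` B) = 0; last exact: e0.
apply/eqP; rewrite eq_le fine_ge0 // andbT.
have -> : 0 = p N by rewrite N0.
apply: prob_le => //; first exact: measurable_setY.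
by rewrite setYC.
Qed.

(** A preimage of [A] is close to a preimage under [phi], which factors through the intermediate
    system. By invertibility there it is an [n]-th preimage of some set modulo null sets; cancelling
    the [n] steps, [A] is close to a preimage under [al]. *)
Lemma approximable_natural : measure_preserving Q S -> invertible_system P T ->
  measurable_fun [set: X] phi -> (forall B, measurable B -> P (phi @^-1` B) = Q B) ->
  (forall A, measurable A -> approximable P T phi A) -> natural_extension P T Q S phi.
Proof.
move=> presS invT mphi Pphi apx; split=> //; first by split=> //; exact: aeW.
have [[mT PT] _] := invT.
move=> d0 Z P0 T0 al be [[mT0 PT0] [_ T0iso]] fal [mbe Pbe be0] albe.
split=> // A mA; have [mal Pal alT] := fal.
have mp d1 d2 (X1 : measurableType d1) (X2 : measurableType d2) (h : X1 -> X2) B :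
  measurable_fun [set: X1] h -> measurable B -> measurable (h @^-1` B) by exact: preimage_mfun.
have invn n (E : set Z) : measurable E -> exists2 B, measurable B & eq_mod0 P0 (iter n T0 @^-1` B) E.
  elim: n E => [|n IH] E mE.
    exists E => //; rewrite /eq_mod0 (_ : _ `+` _ = set0); first exact: negligible_set0.
    by apply/seteqP; split=> // x [] [].
  have [D mD [N [mN N0 DN]]] := T0iso _ mE; have [B mB [N' [mN' N0' BN']]] := IH _ mD.
  exists B => //; exists (N `|` T0 @^-1` N'); split.
  - by apply: measurableU => //; exact: mp.
  - have e2 : P0 (T0 @^-1` N') = 0%E by apply: etrans (PT0 _ mN') N0'.
    by apply: etrans (measureU0 _ _ e2) N0 => //; exact: mp.
  - move=> x /=; rewrite (_ : T0 (iter n T0 x) = iter n T0 (T0 x)); last by rewrite -iterS iterSr.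
    have := BN' (T0 x); have := DN x; rewrite /setY /setD /setU /=.
    by have [] := pselect (D (T0 x)); tauto.
have negP (K : set Z) : P0.-negligible K -> P.-negligible (al @^-1` K).
  move=> [N [mN N0 KN]]; exists (al @^-1` N); split; [exact: mp|by rewrite Pal|by move=> x /KN].
have aliter n : P.-negligible [set x | al (iter n T x) <> iter n T0 (al x)].
  have [N [mN N0 alN]] := alT.
  elim: n => [|n [N' [mN' N0' IH]]].
    by apply: negligibleS (negligible_set0 P) => x.
  exists (N' `|` iter n T @^-1` N); split.
  - by apply: measurableU => //; apply: mp => //; exact: measurable_fun_iter.
  - have mTN : measurable (iter n T @^-1` N) by apply: mp => //; exact: measurable_fun_iter.
    have e2 : P (iter n T @^-1` N) = 0%E by rewrite (prob_iter mT PT).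
    exact: etrans (measureU0 mN' mTN e2) N0'.
  - move=> x /= nx; apply: contrapT => /not_orP[n1 n2]; apply: nx.
    have e1 : al (iter n T x) = iter n T0 (al x) by apply: contrapT => h; apply: n1; exact: IH.
    rewrite -e1; apply: contrapT => h; apply: n2; exact: alN.
have near0 (e : R) : 0 < e -> exists2 B, measurable B & p (A `+` al @^-1` B) < e.
  move=> e0; have [_ /(_ e e0) [n [E [mE hE]]]] := apx A mA.
  have mbE : measurable (be @^-1` E) by exact: mp.
  have [B mB eB] := invn n _ mbE; exists B => //.
  have maB := mp _ _ _ _ _ _ mal mB.
  have mAB := measurable_setY mA maB.
  rewrite -(prob_iter mT PT n mAB); apply: le_lt_trans hE.
  have [N [mN N0 sN]] : P.-negligible (al @^-1` (iter n T0 @^-1` B `+` be @^-1` E) `|`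
      [set x | al (iter n T x) <> iter n T0 (al x)] `|` ~` [set x | be (al x) = phi x]).
    by do 2 (apply: negligibleU => //); exact: negP.
  have miT (D : set X) : measurable D -> measurable (iter n T @^-1` D).
    by move=> mD; apply: mp => //; exact: measurable_fun_iter.
  have mTA : measurable (iter n T @^-1` A `+` phi @^-1` E).
    by apply: measurable_setY; [exact: miT|exact: mp].
  rewrite -[leRHS]addr0 (_ : 0 = p N); last by rewrite N0.
  apply: (le_trans _ (probU_le P mTA mN)); apply: prob_le; [exact: miT|exact: measurableU|].
  move=> x hx; have [Nx|nN] := pselect (N x); [by right|left].
  have e1 : al (iter n T x) = iter n T0 (al x).
    by apply: contrapT => h; apply: nN; apply: sN; left; right.
  have e2 : be (al x) = phi x by apply: contrapT => h; apply: nN; apply: sN; right.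
  have e3 : ~ (iter n T0 @^-1` B `+` be @^-1` E) (al x) by move=> h; apply: nN; apply: sN; left; left.
  move: hx e3; rewrite /setY /setD /setU /= e1 e2.
  by have [] := pselect (B (iter n T0 (al x))); have [] := pselect (E (phi x)); tauto.
have [B mB B0] := preimage_limit mal mA near0; exists B => //.
exists (A `+` al @^-1` B); split=> //; last by rewrite setYC.
by apply: measurable_setY => //; exact: mp.
Qed.

End Natural.

(** * Halving sets of the line *)

Section HalfSets.
Context (R : realType).
Local Notation leb := (@lebesgue_measure R).

Lemma leb_affine (a b : R) (B : set R) : a != 0 -> measurable B ->
  leb [set t | B (a * t + b)] = (`|a|^-1%:E * leb B)%E.
Proof.
(* The affine map is presented as the homography with the constant denominator [e / w], of
   determinant [e]. *)
move=> a0 mB; pose w := Num.sqrt `|a|; pose e := Num.sg a.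
have w0 : 0 < w by rewrite sqrtr_gt0 normr_gt0.
have ww : w ^+ 2 = `|a| by rewrite sqr_sqrtr.
have e2 : e ^+ 2 = 1 by rewrite sqr_sg a0.
have e0 : e != 0 by rewrite sgr_eq0.
have ea : e * `|a| = a by rewrite -numEsg.
have einv : e^-1 = e by apply: (mulfI e0); rewrite divff // -expr2 e2.
have wn : w != 0 by rewrite gt_eqF.
have dd : w * (e / w) - (b * e / w) * 0 = e by field.
have := lebesgue_homography dd e2 mB.
have -> : (fun t : R => (w * t + b * e / w) / (0 * t + e / w)) = (fun t => a * t + b).
  apply/funext => t; rewrite mul0r add0r invf_div einv -[in RHS]ea -ww mulrDl.
  by congr (_ + _); [ring|rewrite -[RHS]mulr1 -e2; field].
rewrite (eq_integral (cst (`|a|%:E))); last first.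
  by move=> t _ /=; rewrite mul0r add0r expr_div_n e2 invf_div divr1 ww.
have mpre : measurable ((fun t => a * t + b) @^-1` B).
  by rewrite -[X in measurable X]setTI; exact: measurable_affine.
rewrite integral_cst // => <-; rewrite muleA -EFinM mulVf ?mul1e //.
by rewrite normr_eq0.
Qed.

(** The distribution function [G] is nondecreasing and 1-Lipschitz, so it takes the value [c] at the
    supremum [t1] of the points where it is at most [c]. *)
Lemma leb_half (S : set R) : measurable S -> (leb S < +oo)%E -> 0 < fine (leb S) ->
  fine (leb (S `&` [set t | fine (leb (S `&` `]-oo, t])) *+ 2 <= fine (leb S)])) = fine (leb S) / 2.
Proof.
move=> mS fS l0; pose G t := fine (leb (S `&` `]-oo, t])).
have lle (A B : set R) : measurable A -> measurable B -> A `<=` B -> (leb A <= leb B)%E.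
  by move=> mA mB AB; apply: le_measure; rewrite ?inE.
have fsub (D : set R) : measurable D -> D `<=` S -> (leb D < +oo)%E.
  by move=> mD DS; apply: le_lt_trans fS; exact: lle.
have mI t : measurable (S `&` `]-oo, t]) by apply: measurableI => //; exact: measurable_itv.
have fI t : leb (S `&` `]-oo, t]) \is a fin_num.
  by rewrite ge0_fin_numE //; apply: fsub => [|x []].
have G0 t : 0 <= G t by rewrite fine_ge0.
have Gle s t : s <= t -> G s <= G t.
  move=> st; rewrite fine_le //; apply: lle => //.
  by move=> x [Sx /=]; rewrite !in_itv /= => xs; split=> //=; rewrite ?in_itv /=; exact: le_trans xs st.
have Glip s t : s < t -> G t <= G s + (t - s).
  move=> st; have mJ : measurable (`]s, t]%classic : set R) by exact: measurable_itv.
  have eJ : leb (`]s, t]%classic : set R) = (t - s)%:E by rewrite lebesgue_measure_itv /= lte_fin st.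
  have : (leb (S `&` `]-oo, t]) <= leb (S `&` `]-oo, s]) + leb (`]s, t]%classic : set R))%E.
    apply: (@le_trans _ _ (leb ((S `&` `]-oo, s]) `|` `]s, t]%classic))); last by apply: measureU2; [exact: mI|exact: mJ].
    apply: lle; [exact: mI|exact: measurableU (mI s) mJ|].
    move=> x [Sx /=]; rewrite in_itv /= => xt; have [xs|sx] := leP x s; [left|right].
      by split=> //=; rewrite ?in_itv.
    by rewrite /= ?in_itv /= sx.
  by rewrite eJ -(fineK (fI t)) -(fineK (fI s)) -EFinD lee_fin.
set c := fine (leb S) / 2; have c0 : 0 < c by rewrite divr_gt0.
have lc : fine (leb S) = c + c by rewrite -splitr.
have small : exists t, G t <= c.
  have [||||n hn] := @measure_tail_small _ _ _ leb (fun n => S `&` `]-oo, (- n%:R)%R]%classic) _ _ _ _ c c0.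
  - by move=> n; exact: mI.
  - by apply: fsub => [|x []].
  - move=> n x [Sx /=]; rewrite !in_itv /= => h; split=> //=; rewrite ?in_itv /=.
    by apply: le_trans h _; rewrite lerN2 ler_nat.
  - rewrite (_ : \bigcap_n _ = set0) ?measure0 //; apply/seteqP; split=> // x h.
    have [_] := h (Num.truncn (- x)).+1 I; rewrite /= ?in_itv /= lerNr leNgt truncnS_gt.
    by [].
  by exists (- n%:R); apply: ltW; exact: (hn n (leqnn n)).
have large : exists t, c < G t.
  have mD n : measurable (S `\` `]-oo, n%:R]%classic) by apply: measurableD => //; exact: measurable_itv.
  have [||||n hn] := @measure_tail_small _ _ _ leb (fun n => S `\` `]-oo, n%:R]%classic) _ _ _ _ c c0.
  - exact: mD.
  - by apply: fsub => [|x []].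
  - move=> n x [Sx /=]; rewrite !in_itv /= => h; split=> // /=; rewrite ?in_itv /= => h'; apply: h.
    by apply: le_trans h' _; rewrite ler_nat.
  - rewrite (_ : \bigcap_n _ = set0) ?measure0 //; apply/seteqP; split=> // x h.
    by have [_] := h (Num.truncn x).+1 I; apply; rewrite /= ?in_itv /= ltW // truncnS_gt.
  exists n%:R; have := hn n (leqnn n).
  have mJ : measurable (`]-oo, n%:R]%classic : set R) by exact: measurable_itv.
  have e : fine (leb S) = fine (leb (S `\` `]-oo, n%:R]%classic)) + G n%:R.
    rewrite /G -fineD //; last by rewrite ge0_fin_numE //; apply: fsub => [|x []].
    by congr fine; exact: measureDI.
  by lra.
pose E := [set t | G t <= c].
have hE : has_sup E.
  split; first by have [t ht] := small; exists t.
  have [t ht] := large; exists t => s /= hs; rewrite leNgt; apply/negP => ts.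
  by have := lt_le_trans ht (le_trans (Gle _ _ (ltW ts)) hs); rewrite ltxx.
set t1 := sup E.
have below t : t < t1 -> G t <= c.
  move=> tt; have t0 : 0 < t1 - t by rewrite subr_gt0.
  have [s Es ts] := sup_adherent t0 hE; rewrite -/t1 opprB addrC subrK in ts.
  exact: le_trans (Gle _ _ (ltW ts)) Es.
have above t : t1 < t -> c < G t.
  move=> tt; rewrite ltNge; apply/negP => h.
  have : t <= t1 by apply: sup_upper_bound.
  by rewrite leNgt tt.
have Gt1 : G t1 = c.
  apply/le_anti/andP; split; apply/ler_addgt0Pr => e e0.
    have := below (t1 - e); rewrite ltrBlDr ltrDl => /(_ e0) h.
    have := Glip (t1 - e) t1; rewrite ltrBlDr ltrDl => /(_ e0); lra.
  have := above (t1 + e); rewrite ltrDl => /(_ e0) h.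
  have := Glip t1 (t1 + e); rewrite ltrDl => /(_ e0); lra.
rewrite -Gt1 /G; congr (fine (leb _)); apply/seteqP; split=> t [St] /=.
  rewrite -/(G t) => h; split=> //=; rewrite ?in_itv /= leNgt; apply/negP => /above.
  by rewrite lc in h; move: h; rewrite mulr2n; lra.
rewrite in_itv /= => h; split=> //=; rewrite -/(G t) lc mulr2n.
by have := Gle _ _ h; rewrite Gt1; lra.
Qed.

End HalfSets.

(** * Rigid points obstruct approximation *)

Section CleanSystem.
Context (R : realType) (f : pwMobius R) (Om : set (R * R)) (mOm : measurable Om).
Context (posm : (0 < mu Om)%E) (finm : (mu Om < +oo)%E).
Local Notation mu := (@mu R).
Local Notation leb := (@lebesgue_measure R).
Local Notation F := (pw_planar f).
Local Notation P := (planar_prob mOm).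

(** The requirements on a single planar map, so that the arguments apply to [f] and to [g] alike. *)
Record clean_system (N : set (R * R)) : Prop := CleanSystem {
  csys_m : measurable N;
  csys_null : mu N = 0%E;
  csys_sat : forall z, N z <-> N (F z);
  csys_polar : pw_polar f `|` [set z | hyperbolic z] `<=` N;
  csys_in : forall z, (Om `\` N) z -> (Om `\` N) (F z);
  csys_sur : forall w, (Om `\` N) w -> exists2 z, (Om `\` N) z & F z = w;
  csys_image : forall E, measurable E -> E `<=` Om `\` N -> measurable (F @` E);
  csys_inj : forall z z', (Om `\` N) z -> (Om `\` N) z' -> F z = F z' -> z = z';
  csys_pres : forall E, measurable E -> mu ((Om `\` N) `&` F @^-1` E) = mu ((Om `\` N) `&` E);
  csys_len : forall z, (Om `\` N) z -> [/\ 0 < slope_of f z, 0 < fibre_len Om z &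
    slope_of f z * fibre_len Om z <= fibre_len Om (F z)]
}.

Lemma fine_fin_num (x : \bar R) : 0 < fine x -> x \is a fin_num.
Proof. by case: x => //=; rewrite ltxx. Qed.

Context (N : set (R * R)) (cN : clean_system N).

Lemma csys_preserving : measure_preserving P F.
Proof.
apply: (planar_preserving mOm posm finm (N := N)); last exact: csys_pres.
- exact: measurable_pw_planar.
- exact: (csys_m cN).
- exact: (csys_null cN).
Qed.

Lemma csys_iter n z : (Om `\` N) z -> (Om `\` N) (iter n F z).
Proof. by move=> Oz; elim: n => //= n; exact: (csys_in cN). Qed.

Definition half_set : set (R * R) := [set z | fine (leb (xsection (straightened Om) z.1 `&` `]-oo, zeta z]))
  *+ 2 <= fine (fibre_length Om z.1)].

Lemma measurable_half_set : measurable half_set.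
Proof.
(* With the threshold as an additional variable, the length below it is the measure of a section,
   hence a measurable function. *)
pose W : set ((R * R) * R) := [set u | u.2 <= u.1.2 /\ straightened Om (u.1.1, u.2)].
have mSt := measurable_straightened mOm.
have mW : measurable W.
  apply: measurableI.
    rewrite -[X in measurable X]setTI.
    have mf : measurable_fun [set: (R * R) * R] (fun u : (R * R) * R => u.2 <= u.1.2).
      by apply: measurable_fun_ler => //; exact: (measurableT_comp measurable_snd measurable_fst).
    rewrite (_ : (fun u => u.2 <= u.1.2 : Prop) = (fun u : (R * R) * R => u.2 <= u.1.2) @^-1` [set true]); first exact: mf.
    by [].
  have mp : measurable_fun [set: (R * R) * R] (fun u : (R * R) * R => (u.1.1, u.2)).
    by apply: measurable_fun_pair => //; exact: (measurableT_comp measurable_fst measurable_fst).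
  exact: (preimage_mfun mp mSt).
have mG : measurable_fun [set: R * R] (fun v : R * R => fine (leb (xsection W v))).
  apply: (measurableT_comp (fine_measurable measurableT)).
  exact: measurable_fun_xsection.
have mz : measurable_fun [set: R * R] (fun z : R * R => (z.1, zeta z)).
  by apply: measurable_fun_pair => //; exact: measurable_zeta.
have ml : measurable_fun [set: R * R] (fun z : R * R => fine (fibre_length Om z.1)).
  apply: (measurableT_comp (fine_measurable measurableT)).
  exact: (measurableT_comp (measurable_fibre_length mOm) measurable_fst).
have mf : measurable_fun [set: R * R] (fun z : R * R => fine (leb (xsection W (z.1, zeta z))) *+ 2 <= fine (fibre_length Om z.1)).
  apply: measurable_fun_ler => //; rewrite (_ : (fun z : R * R => _ *+ 2) = (fun z => 2 * fine (leb (xsection W (z.1, zeta z))))).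
    by apply: measurable_funM => //; exact: (measurableT_comp mG mz).
  by apply/funext => z; rewrite mulr_natl.
rewrite (_ : half_set = (fun z : R * R => fine (leb (xsection W (z.1, zeta z))) *+ 2 <= fine (fibre_length Om z.1)) @^-1` [set true]).
  by rewrite -[X in measurable X]setTI; exact: mf.
have e (z : R * R) : xsection W (z.1, zeta z) = xsection (straightened Om) z.1 `&` `]-oo, zeta z]%classic.
  apply/seteqP; split=> t; rewrite /xsection /= !inE /= ?in_itv /=; by case.
by apply/seteqP; split=> z; rewrite /half_set /= e.
Qed.

Lemma fibre_half x : fibre_length Om x \is a fin_num -> 0 < fine (fibre_length Om x) ->
  fine (fibre_length (Om `&` half_set) x) = fine (fibre_length Om x) / 2.
Proof.
move=> fx px; have mS : measurable (xsection (straightened Om) x).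
  by apply: measurable_xsection; exact: measurable_straightened.
rewrite -(leb_half mS) //; last by rewrite -ge0_fin_numE // measure_ge0.
congr (fine (leb _)); apply/seteqP; split=> t; rewrite /xsection /= !inE /=.
  move=> [n1 [Ot]]; rewrite /half_set /=; have [-> _] := zetaK (z := (x, t)) n1.
  by [].
move=> [[n1 Ot] h]; split=> //; split=> //; rewrite /half_set /=.
by have [-> _] := zetaK (z := (x, t)) n1.
Qed.

Lemma unstraighten_clean x t : (xsection (straightened Om) x `\` xsection (straightened N) x) t ->
  (Om `\` N) (unstraighten (x, t)) /\ zeta (unstraighten (x, t)) = t.
Proof.
rewrite /xsection /= => -[]; rewrite inE => -[/= n1 Ot] nN.
have [zu hu] := zetaK (z := (x, t)) n1; split=> //; split=> // Nt.
by apply: nN; rewrite inE.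
Qed.

Let leb_le_null (A B Z : set R) : measurable A -> measurable B -> measurable Z ->
  leb Z = 0%E -> A `<=` B `|` Z -> (leb A <= leb B)%E.
Proof.
move=> mA mB mZ Z0 AB; apply: (@le_trans _ _ (leb (B `|` Z))).
  by apply: le_measure; rewrite ?inE //; exact: measurableU.
apply: (@le_trans _ _ (leb B + leb Z)%E); first exact: measureU2.
by rewrite Z0 adde0.
Qed.

(** At a rigid point the affine map fills the fibre over [y] up to a null set. The preimage of its
    lower half is then a lower or an upper half, according to the sign of [al]. *)
Lemma fibre_half_iter n z0 : (Om `\` N) z0 -> rigid F (slope_of f) (fibre_len Om) z0 ->
  fibre_length N z0.1 = 0%E ->
  fibre_length (Om `&` iter n F @^-1` half_set) z0.1 = ((fine (fibre_length Om z0.1) / 2)%:E)%E.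
Proof.
move=> Oz0 rz N0; set x := z0.1 in N0 *; pose y := iter n (pw_map f) x.
set al := (zeta_coef f n x).1; set be := (zeta_coef f n x).2.
have Oy := csys_iter n Oz0.
have ey : (iter n F z0).1 = y by rewrite pw_planar_fst.
have [_ lx _] := csys_len cN Oz0; have [_ ly _] := csys_len cN Oy.
have eal : `|al| = cocycle F (slope_of f) n z0 by rewrite /al zeta_coef_slope.
have al0 : 0 < `|al|.
  rewrite eal; apply: prodr_gt0 => i _; by have [] := csys_len cN (csys_iter i Oz0).
have an0 : al != 0 by rewrite -normr_gt0.
have all : `|al| * fine (fibre_length Om x) = fine (fibre_length Om y).
  by have := rigid_cocycle n rz; rewrite -eal /fibre_len ey.
rewrite /fibre_len ey in ly; rewrite /fibre_len -/x in lx.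
have fx := fine_fin_num lx; have fy := fine_fin_num ly.
have mS w : measurable (xsection (straightened Om) w).
  by apply: measurable_xsection; exact: measurable_straightened.
have mNx : measurable (xsection (straightened N) x).
  by apply: measurable_xsection; apply: measurable_straightened; exact: (csys_m cN).
have mH : measurable (Om `&` half_set) by apply: measurableI => //; exact: measurable_half_set.
have mHy : measurable (xsection (straightened (Om `&` half_set)) y).
  by apply: measurable_xsection; exact: measurable_straightened.
have mit : measurable (iter n F @^-1` half_set).
  apply: measurable_iter_preimage => //; [exact: measurable_pw_planar|exact: measurable_half_set].
have mA : measurable (xsection (straightened (Om `&` iter n F @^-1` half_set)) x).
  by apply: measurable_xsection; apply: measurable_straightened; exact: measurableI.
have mg (B : set R) : measurable B -> measurable [set t | B (al * t + be)].
  by move=> mB; exact: (preimage_mfun (measurable_affine al be) mB).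
have key t : xsection (straightened Om) x t -> ~ xsection (straightened N) x t ->
    xsection (straightened Om) y (al * t + be) /\
    (half_set (iter n F (unstraighten (x, t))) <-> xsection (straightened (Om `&` half_set)) y (al * t + be)).
  move=> St Nt; have [Ou zu] := unstraighten_clean (conj St Nt).
  have [Ow Nw] := csys_iter n Ou.
  have hw : ~~ hyperbolic (iter n F (unstraighten (x, t))).
    by apply/negP => h; apply: Nw; apply: (csys_polar cN); right.
  have zw := zeta_iter_clean (csys_polar cN) (csys_sat cN) n Ou.2.
  rewrite zu -/al -/be in zw; have := unstraightenK hw.
  rewrite zw pw_planar_fst -/y => ew.
  have nw : 1 - y * (al * t + be) != 0.
    have -> : 1 - y * (al * t + be) = (1 + (iter n F (unstraighten (x, t))).1 * (iter n F (unstraighten (x, t))).2)^-1.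
      rewrite -zw /zeta pw_planar_fst -/y; move: hw; rewrite /hyperbolic pw_planar_fst -/y => hw.
      by field.
    by rewrite invr_eq0.
  have i1 D : xsection (straightened D) y (al * t + be) <-> D (iter n F (unstraighten (x, t))).
    rewrite /xsection /= inE /straightened /= ew; split=> [[]//|h]; by split.
  by split; [exact/i1|rewrite i1; split=> [h|[]//]; split].
have lg (B : set R) : measurable B -> leb [set t | B (al * t + be)] = (`|al|^-1%:E * leb B)%E by exact: leb_affine.
have eSy : leb [set t | xsection (straightened Om) y (al * t + be)] = fibre_length Om x.
  rewrite lg // -/(fibre_length Om y) -(fineK fy) -all -EFinM mulrA mulVf ?mul1r ?fineK //.
  by rewrite gt_eqF.
pose SY := [set t | xsection (straightened Om) y (al * t + be)].
pose D := SY `\` xsection (straightened Om) x.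
have mD : measurable D by apply: measurableD => //; exact: mg.
(* [SY] has the same length as the fibre over [x] and contains almost all of it, so it exceeds it by
   a null set. *)
have D0 : leb D = 0%E.
  have h : (fibre_length Om x <= leb (SY `&` xsection (straightened Om) x))%E.
    apply: (@leb_le_null _ _ (xsection (straightened N) x)) => //.
      by apply: measurableI => //; exact: mg.
    move=> t St; have [Nt|nN] := pselect (xsection (straightened N) x t); [by right|left].
    by split=> //; have [] := key t St nN.
  have e := @measureDI _ _ _ leb _ _ (mg _ (mS y)) (mS x).
  have fD : leb D \is a fin_num.
    rewrite ge0_fin_numE ?measure_ge0 //; apply: (@le_lt_trans _ _ (fibre_length Om x)).
      by rewrite -eSy; apply: le_measure; rewrite ?inE //; [exact: mg|move=> t []].
    by rewrite -ge0_fin_numE ?measure_ge0.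
  apply/eqP; rewrite eq_le measure_ge0 andbT.
  rewrite -(@leeD2rE _ (fibre_length Om x)) // add0e.
  rewrite -[leRHS]eSy [leRHS]e; exact: leeD2l.
rewrite /fibre_length.
transitivity (leb [set t | xsection (straightened (Om `&` half_set)) y (al * t + be)]).
  apply/le_anti/andP; split.
    apply: (@leb_le_null _ _ (xsection (straightened N) x)) => //; first exact: mg.
    move=> t; have [Nt _|nN] := pselect (xsection (straightened N) x t); first by right.
    rewrite {1}/xsection /= inE => -[/= n1 [Ot Ht]]; left.
    have St : xsection (straightened Om) x t by rewrite /xsection /= inE.
    by have [_ /= h] := key t St nN; apply/h.
  apply: (@leb_le_null _ _ (xsection (straightened N) x `|` D)) => //.
  - exact: mg.
  - exact: measurableU.
  - by rewrite measureU0.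
  move=> t /= Ht; have [Nt|nN] := pselect (xsection (straightened N) x t); first by right; left.
  have Sy : xsection (straightened Om) y (al * t + be).
    by move: Ht; rewrite /xsection /= !inE => -[? []].
  have [St|nS] := pselect (xsection (straightened Om) x t); last by right; right.
  left; have [_ h] := key t St nN; have hh := h.2 Ht.
  by move: St; rewrite /xsection /= !inE => -[n1 Ot]; split.
rewrite lg // -/(fibre_length _ _) -[fibre_length _ y]fineK; last first.
  apply: fine_fin_num; rewrite fibre_half //; exact: divr_gt0.
rewrite fibre_half // -all -EFinM; congr (_%:E).
by field; rewrite gt_eqF.
Qed.

(* Over rigid points the preimages of [half_set] still halve the fibres, hence
   they are far from all sets which are unions of fibres. *)
Lemma approximable_not_rigid : (forall A, measurable A -> approximable P F (@proj_x R) A) ->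
  mu ((Om `\` N) `&` rigid F (slope_of f) (fibre_len Om)) = 0%E.
Proof.
move=> apx; have mN := csys_m cN; have N0 := csys_null cN.
pose len x := fine (fibre_length Om x).
have mlen : measurable_fun [set: R] len.
  by apply: (measurableT_comp (fine_measurable measurableT)); exact: measurable_fibre_length.
pose rset := rigid (pw_map f) (pw_slope f) len.
have mr : measurable rset.
  by apply: measurable_rigid => //; [exact: measurable_pw_map|exact: measurable_pw_slope].
have rE z : rigid F (slope_of f) (fibre_len Om) z <-> rset z.1.
  by split=> h j; have := h j; rewrite /slope_of /fibre_len !pw_planar_fst.
pose B := [set x | [/\ rset x, len x > 0 & fibre_length N x = 0%E]].
have mB : measurable B.
  rewrite (_ : B = rset `&` (fun x => 0 < len x) @^-1` [set true] `\` [set x | fibre_length N x != 0%E]).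
    apply: measurableD; last exact: measurable_fibre_base.
    apply: measurableI => //; rewrite -[X in measurable X]setTI.
    have mf : measurable_fun [set: R] (fun x => 0 < len x) by exact: measurable_fun_ltr.
    exact: mf.
  apply/seteqP; split=> x; first by move=> [r l n]; split; [split|move=> /eqP; apply].
  by move=> [[r l] /= n]; split=> //; apply: contrapT => /eqP.
have mE (E : set R) : measurable E -> measurable (E `*` [set: R]) by move=> mE; exact: measurableX.
have mH := measurable_half_set.
have mit n : measurable (iter n F @^-1` half_set).
  by apply: measurable_iter_preimage => //; exact: measurable_pw_planar.
have half n (E : set R) : measurable E -> E `<=` B ->
    mu ((Om `&` iter n F @^-1` half_set) `&` (E `*` setT)) = ((2^-1)%:E * mu (Om `&` (E `*` setT)))%E.
  move=> mE' EB; rewrite !mu_fibre_cylinder //; last exact: measurableI.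
  rewrite -ge0_integralZl //; last exact: measurable_funTS (measurable_fibre_length mOm).
  apply: eq_integral => x; rewrite inE => /EB[rx lx nx].
  have [t St] : exists t, (xsection (straightened Om) x `\` xsection (straightened N) x) t.
    apply: contrapT => h.
    have : (fibre_length Om x <= fibre_length N x)%E.
      apply: le_measure; rewrite ?inE; try (apply: measurable_xsection; exact: measurable_straightened).
      by move=> t St; apply: contrapT => Nt; apply: h; exists t.
    by rewrite nx => h'; move: lx; rewrite /len ltNge fine_le0.
  have [Oz _] := unstraighten_clean St.
  rewrite (fibre_half_iter (z0 := unstraighten (x, t)) n Oz) //; last by apply/rE.
  by rewrite mulrC EFinM fineK //; exact: fine_fin_num.
pose M := B `*` [set: R].
have mM : measurable M by exact: mE.
have PM0 : fine (P M) = 0.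
  apply/eqP; rewrite eq_le fine_ge0 // andbT leNgt; apply/negP => PM.
  (* An error below half of the mass of [M] is impossible: over [E] the complement of the halving
     set is in error, over the rest of [B] the halving set itself, and each is half of the mass. *)
  have [_ /(_ _ (divr_gt0 PM (ltr0Sn R 1)))] := apx _ mH; move=> [n [E [mE' hE]]].
  have mpE : measurable (@proj_x R @^-1` E) by exact: (preimage_mfun measurable_fst mE').
  have mBE : measurable (B `&` E) by exact: measurableI.
  have mBD : measurable (B `\` E) by exact: measurableD.
  have finP (A : set (R * R)) : measurable A -> P A \is a fin_num by move=> mA; exact: fin_num_measure.
  have Ph (E' : set R) : measurable E' -> E' `<=` B ->
      fine (P (iter n F @^-1` half_set `&` (E' `*` setT))) = fine (P (E' `*` setT)) / 2.
    move=> mE1 E1B; rewrite !(planar_probE mOm posm finm).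
    rewrite (_ : _ `&` Om = (Om `&` iter n F @^-1` half_set) `&` (E' `*` setT)); last by rewrite setIC setIA.
    rewrite half // [_ `&` Om]setIC.
    have fm : mu (Om `&` (E' `*` setT)) \is a fin_num.
      rewrite ge0_fin_numE ?measure_ge0 //; apply: (mu_fin_sub mOm finm); last by move=> z [].
      by apply: measurableI => //; exact: mE.
    by rewrite -(fineK fm) -!EFinM /=; ring.
  have sBE : B `&` E `<=` B by move=> x [].
  have sBD : B `\` E `<=` B by move=> x [].
  have m1 : measurable (iter n F @^-1` half_set `&` ((B `\` E) `*` setT)) by apply: measurableI => //; exact: mE.
  have m2 : measurable (iter n F @^-1` half_set `&` ((B `&` E) `*` setT)) by apply: measurableI => //; exact: mE.
  have m3 : measurable (((B `&` E) `*` setT) `\` iter n F @^-1` half_set).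
    by apply: measurableD => //; exact: mE.
  have e3 : fine (P (((B `&` E) `*` setT) `\` iter n F @^-1` half_set)) = fine (P ((B `&` E) `*` setT)) / 2.
    have := measureDI P (mE _ mBE) (mit n); rewrite [_ `&` iter n F @^-1` _]setIC => h.
    have : fine (P ((B `&` E) `*` setT)) = fine (P (((B `&` E) `*` setT) `\` iter n F @^-1` half_set)) + fine (P (iter n F @^-1` half_set `&` ((B `&` E) `*` setT))).
      by rewrite -fineD ?finP // h.
    by rewrite (Ph _ mBE sBE); lra.
  have eM : fine (P M) = fine (P ((B `\` E) `*` setT)) + fine (P ((B `&` E) `*` setT)).
    rewrite -fineD ?finP //; try exact: mE.
    congr fine; rewrite -measureU //; try exact: mE.
      congr (P _); apply/seteqP; split=> z; rewrite /M /=.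
        by move=> [Bz _]; have [Ez|nE] := pselect (E z.1); [right|left].
      by move=> [[[Bz _] _]|[[Bz _] _]].
    by apply/seteqP; split=> // z [[[_ nE] _] [[_ Ez] _]].
  have : fine (P (iter n F @^-1` half_set `&` ((B `\` E) `*` setT))) + fine (P (((B `&` E) `*` setT) `\` iter n F @^-1` half_set))
      <= fine (P (iter n F @^-1` half_set `+` @proj_x R @^-1` E)).
    rewrite -fineD ?finP //; rewrite -measureU //; last first.
      by apply/seteqP; split=> // z [[_ [[_ nE] _]] [[[_ Ez] _] _]].
    apply: prob_le; [exact: measurableU|exact: measurable_setY|].
    move=> z [[Hz [[_ nE] _]]|[[[_ Ez] _] nH]]; first by left; split.
    by right; split.
  by rewrite e3 (Ph _ mBD sBD); move: hE eM; lra.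
have mu0 : mu (Om `&` M) = 0%E.
  rewrite setIC; apply/(planar_prob_eq0 mOm posm finm).
  by rewrite -[LHS]fineK ?fin_num_measure // PM0.
have mO : measurable (Om `\` N) by exact: measurableD.
have mrig : measurable (rigid F (slope_of f) (fibre_len Om)).
  rewrite (_ : rigid _ _ _ = rset `*` setT); first exact: mE.
  by apply/seteqP; split=> z; [move=> /rE|move=> [/rE]].
have [K [mK K0 NK]] := null_fibre_cylinder (measurable_fibre_base mN) (null_fibre_base mN N0).
apply: (@null_sub _ _ _ mu _ ((Om `&` M) `|` K)).
- exact: measurableI.
- by apply: measurableU => //; exact: measurableI.
- move=> z [[Oz Nz] /rE rz]; have [_ lz _] := csys_len cN (conj Oz Nz).
  have [n0|/eqP n0] := pselect (fibre_length N z.1 = 0%E); first by left.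
  by right; apply: NK; split.
- by rewrite measureU0 //; exact: measurableI.
Qed.

End CleanSystem.

(** * Shrinking fibres give approximation *)

Section Shrinking.
Context (R : realType) (f : pwMobius R) (Om : set (R * R)) (mOm : measurable Om).
Context (posm : (0 < mu Om)%E) (finm : (mu Om < +oo)%E).
Local Notation mu := (@mu R).
Local Notation leb := (@lebesgue_measure R).
Local Notation F := (pw_planar f).
Local Notation P := (planar_prob mOm).
Local Notation p A := (fine (P A)).
Context (N : set (R * R)) (cN : clean_system f Om N).
Local Notation O := (Om `\` N).
Context (N' : set (R * R)) (mN' : measurable N') (N'0 : mu N' = 0%E).
Hypothesis shrink : forall z, O z -> ~ N' z -> forall e, 0 < e -> exists n0, forall n, (n0 <= n)%N ->
  cocycle F (slope_of f) n z * fibre_len Om z < e * fibre_len Om (iter n F z).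

Let mO : measurable O. Proof. by apply: measurableD => //; exact: (csys_m cN). Qed.

Let PnullO (B : set (R * R)) : measurable B -> mu (O `&` B) = 0%E -> P B = 0%E.
Proof. by move=> mB; exact: (planar_prob_negligible mOm posm finm mB (csys_m cN) (csys_null cN)). Qed.

Let PO : P (~` O) = 0%E.
Proof. by apply: PnullO; [exact: measurableC|rewrite setICr measure0]. Qed.

Let finP (A : set (R * R)) : measurable A -> (P A < +oo)%E.
Proof. by move=> mA; rewrite ltey_eq fin_num_measure. Qed.

Let mlen : measurable_fun [set: R * R] (fibre_len Om).
Proof.
apply: (measurableT_comp (fine_measurable measurableT)).
exact: (measurableT_comp (measurable_fibre_length mOm) measurable_fst).
Qed.

Let mslope : measurable_fun [set: R * R] (slope_of f).
Proof. exact: (measurableT_comp (measurable_pw_slope f) measurable_fst). Qed.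

Let mF : measurable_fun [set: R * R] F. Proof. exact: measurable_pw_planar. Qed.

Let mcoc n : measurable_fun [set: R * R] (cocycle F (slope_of f) n).
Proof.
elim: n => [|n IH].
  by rewrite (_ : cocycle _ _ _ = cst 1) //; apply/funext => z; rewrite /cocycle big_ord0.
rewrite (_ : cocycle F (slope_of f) n.+1 = fun z => cocycle F (slope_of f) n z * slope_of f (iter n F z)).
  by apply: measurable_funM => //; exact: (measurableT_comp mslope (measurable_fun_iter mF n)).
by apply/funext => z; rewrite /cocycle big_ord_recr.
Qed.

Let tail (A : nat -> set (R * R)) : (forall n, measurable (A n)) -> (forall n, A n.+1 `<=` A n) ->
  mu (O `&` \bigcap_n A n) = 0%E -> forall e : R, 0 < e ->
  exists n0, forall n, (n0 <= n)%N -> p (A n) < e.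
Proof.
move=> mA dA A0; apply: measure_tail_small => //; first exact: finP.
by apply: PnullO => //; exact: bigcapT_measurable.
Qed.

Let mlt (h1 h2 : R * R -> R) : measurable_fun [set: R * R] h1 -> measurable_fun [set: R * R] h2 ->
  measurable [set z | h1 z < h2 z].
Proof.
move=> m1 m2; rewrite -[X in measurable X]setTI.
have mf : measurable_fun [set: R * R] (fun z => h1 z < h2 z) by exact: measurable_fun_ltr.
exact: mf.
Qed.

Let mle (h1 h2 : R * R -> R) : measurable_fun [set: R * R] h1 -> measurable_fun [set: R * R] h2 ->
  measurable [set z | h1 z <= h2 z].
Proof.
move=> m1 m2; rewrite -[X in measurable X]setTI.
have mf : measurable_fun [set: R * R] (fun z => h1 z <= h2 z) by exact: measurable_fun_ler.
exact: mf.
Qed.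

Let mabs (h : R * R -> R) : measurable_fun [set: R * R] h -> measurable_fun [set: R * R] (fun z => `|h z|).
Proof. by move=> mh; exact: measurableT_comp. Qed.

Lemma zeta_level_null q : mu (O `&` [set z | zeta z = q]) = 0%E.
Proof.
have mz : measurable [set z | zeta z = q].
  by apply: (preimage_mfun (B := [set q]) (@measurable_zeta R)).
have mE : measurable (O `&` [set z | zeta z = q]) by exact: measurableI.
rewrite mu_fibre //; apply: integral0_eq => x _.
apply: countable_lebesgue_measure0; apply: finite_set_countable.
apply: (@sub_finite_set _ _ [set q]); last exact: finite_set1.
move=> t; rewrite /xsection /= inE => -[/= n1 [_ /=]].
by have [-> _] := zetaK (z := (x, t)) n1.
Qed.

(** After [n] steps the coordinate is [al * zeta z + be], where [be] depends on the fibre only and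
    the first term is small as the images of fibres shrink. Comparing [be] with [q] errs near the
    level [q], where [zeta] or a fibre length is large, or where the fibre has not shrunk yet: four
    sets of measure below [e / 4]. *)
Lemma approximable_zeta q : approximable P F (@proj_x R) [set z | q < zeta z].
Proof.
have mz : measurable_fun [set: R * R] (@zeta R) by exact: measurable_zeta.
have mA : measurable [set z : R * R | q < zeta z] by apply: mlt.
split=> // e e0; have e4 : 0 < e / 4 by rewrite divr_gt0.
have [k hk] : exists k, forall n, (k <= n)%N -> p [set z | `|zeta z - q| <= n.+1%:R^-1] < e / 4.
  apply: tail => //.
  - by move=> n; apply: mle => //; apply: mabs; exact: measurable_funB.
  - by move=> n z /= h; apply: le_trans h _; rewrite lef_pV2 ?posrE // ler_nat.
  - rewrite -(zeta_level_null q); congr mu; congr (_ `&` _); apply/seteqP; split=> z.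
      move=> h /=; apply/eqP; rewrite -subr_eq0 -normr_le0; apply/ler_addgt0Pl => d d0; rewrite addr0.
      have [n _ Hn] := near_infty_natSinv_lt (PosNum d0).
      by apply: le_trans (h n I) _; apply: ltW; exact: (Hn n (leqnn n)).
    by move=> /= e1 n _ /=; rewrite e1 subrr normr0 invr_ge0.
have [K1 hK1] : exists k, forall n, (k <= n)%N -> p [set z | n%:R * fibre_len Om z < `|zeta z|] < e / 4.
  apply: tail => //.
  - by move=> n; apply: mlt; [exact: measurable_funM|exact: mabs].
  - move=> n z /= h; have l0 : 0 <= fibre_len Om z by rewrite fine_ge0 // measure_ge0.
    by apply: le_lt_trans h; rewrite ler_wpM2r // ler_nat.
  - rewrite (_ : _ `&` _ = set0) ?measure0 //; apply/seteqP; split=> // z [Oz h].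
    have [_ l0 _] := csys_len cN Oz.
    have := h (Num.truncn (`|zeta z| / fibre_len Om z)).+1 I.
    by rewrite /= -ltr_pdivlMr // ltNge ltW // truncnS_gt.
have [K2 hK2] : exists k, forall n, (k <= n)%N -> p [set z | n%:R < fibre_len Om z] < e / 4.
  apply: tail => //.
  - by move=> n; exact: mlt.
  - by move=> n z /= h; apply: le_lt_trans h; rewrite ler_nat.
  - rewrite (_ : _ `&` _ = set0) ?measure0 //; apply/seteqP; split=> // z [Oz h].
    have := h (Num.truncn (fibre_len Om z)).+1 I.
    by rewrite /= ltNge ltW // truncnS_gt.
pose K : R := (maxn K1 K2).+1%:R.
have K0 : 0 < K by rewrite ltr0n.
pose eta : R := k.+1%:R^-1.
have eta0 : 0 < eta by rewrite invr_gt0 ltr0n.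
(* With [zeta] at most [K] fibre lengths, the image fibre at most [K] and shrinking by [c], the term
   [al * zeta z] is at most [K * c * K = eta]. *)
pose c := eta / (K * K).
have c0 : 0 < c by rewrite divr_gt0 // mulr_gt0.
pose T m := [set z | c * fibre_len Om (iter m F z) <= cocycle F (slope_of f) m z * fibre_len Om z].
have mT m : measurable (T m).
  apply: mle; apply: measurable_funM => //; first exact: (measurableT_comp mlen (measurable_fun_iter mF m)).
(* The union over all later times makes these sets decrease in [n], as [tail] requires. *)
have [n hn] : exists k, forall n, (k <= n)%N -> p (\bigcup_(m in [set m | (n <= m)%N]) T m) < e / 4.
  apply: tail.
  - by move=> n; exact: bigcup_measurable.
  - by move=> n z [m /= nm Tm]; exists m => //=; exact: ltnW.
  - apply: null_sub N'0 => //.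
      by apply: measurableI => //; apply: bigcapT_measurable => n; exact: bigcup_measurable.
    move=> z [Oz h]; apply: contrapT => Nz; have [n0 hn0] := shrink Oz Nz c0.
    by have [m /= nm] := h n0 I; rewrite /T /= leNgt hn0.
  - exact: e4.
pose E := [set x | q < (zeta_coef f n x).2].
have mE : measurable E.
  rewrite -[X in measurable X]setTI.
  have mf : measurable_fun [set: R] (fun x => q < (zeta_coef f n x).2).
    by apply: measurable_fun_ltr => //; have [] := measurable_zeta_coef f n.
  exact: mf.
exists n, E; split=> //.
have [_ PF] := csys_preserving mOm posm finm cN.
pose S1 := [set z | K * fibre_len Om z < `|zeta z|].
pose S2 := [set z | K < fibre_len Om z].
pose S3 := [set z | `|zeta z - q| <= eta].
have mS1 : measurable S1 by apply: mlt; [exact: measurable_funM|exact: mabs].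
have mS2 : measurable S2 by exact: mlt.
have mS3 : measurable S3 by apply: mle => //; apply: mabs; exact: measurable_funB.
have mit (A : set (R * R)) : measurable A -> measurable (iter n F @^-1` A).
  by move=> mA'; exact: measurable_iter_preimage.
have mU : measurable (\bigcup_(m in [set m | (n <= m)%N]) T m) by exact: bigcup_measurable.
have p1 : p S1 < e / 4 by apply: (hK1 (maxn K1 K2).+1); rewrite leqW // leq_maxl.
have p2 : p (iter n F @^-1` S2) < e / 4.
  by rewrite (prob_iter mF PF) //; apply: (hK2 (maxn K1 K2).+1); rewrite leqW // leq_maxr.
have p3 : p (iter n F @^-1` S3) < e / 4 by rewrite (prob_iter mF PF) //; exact: (hk k).
have p4 := hn n (leqnn n).
have mnO : measurable (~` O) by exact: measurableC.
have m2 := mit _ mS2; have m3 := mit _ mS3.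
have mpE : measurable (@proj_x R @^-1` E) by exact: (preimage_mfun measurable_fst mE).
set U := \bigcup_(m in _) T m in mU p4.
apply: (@le_lt_trans _ _ (p (~` O `|` (S1 `|` (iter n F @^-1` S2 `|` (iter n F @^-1` S3 `|` U)))))).
  apply: prob_le; first by apply: measurable_setY => //; exact: mit.
    by do 4 apply: measurableU => //.
  move=> z hz; have [Oz|nO] := pselect (O z); [right|by left].
  apply: contrapT => /not_orP[n1 /not_orP[n2 /not_orP[n3 n4]]]; apply: n3.
  have h1 : `|zeta z| <= K * fibre_len Om z by rewrite leNgt; apply/negP.
  have h2 : fibre_len Om (iter n F z) <= K by rewrite leNgt; apply/negP.
  have h4 : cocycle F (slope_of f) n z * fibre_len Om z < c * fibre_len Om (iter n F z).
    by rewrite ltNge; apply/negP => h; apply: n4; exists n => //=.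
  have ez := zeta_iter_clean (csys_polar cN) (csys_sat cN) n Oz.2.
  have ec := zeta_coef_slope f n z.
  set al := (zeta_coef f n z.1).1 in ez ec; set be := (zeta_coef f n z.1).2 in ez.
  have small : `|al * zeta z| <= eta.
    rewrite normrM ec; have c_ge0 : 0 <= cocycle F (slope_of f) n z by rewrite -ec.
    have s1 : cocycle F (slope_of f) n z * `|zeta z| <= cocycle F (slope_of f) n z * (K * fibre_len Om z).
      exact: ler_wpM2l.
    have s2 : cocycle F (slope_of f) n z * (K * fibre_len Om z) <= K * (c * K).
      rewrite mulrCA ler_wpM2l ?(ltW K0) //; apply: ltW; apply: lt_le_trans h4 _.
      by rewrite ler_wpM2l // ltW.
    apply: le_trans s1 (le_trans s2 _); rewrite /c le_eqVlt; apply/orP; left; apply/eqP.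
    by field; rewrite gt_eqF.
  rewrite /S3 /= ez.
  have e1 : (iter n F @^-1` [set z | q < zeta z]) z <-> q < al * zeta z + be by rewrite /= ez.
  have e2 : (@proj_x R @^-1` E) z <-> q < be by [].
  have [s0 s1] : - eta <= al * zeta z /\ al * zeta z <= eta by move: small; rewrite ler_norml => /andP[].
  case: hz => -[].
    move=> /e1 a1 a2; have : be <= q by rewrite leNgt; apply/negP => /e2.
    by move=> a3; rewrite ler_norml; apply/andP; split; lra.
  move=> /e2 a1 a2; have : al * zeta z + be <= q by rewrite leNgt; apply/negP => /e1.
  by move=> a3; rewrite ler_norml; apply/andP; split; lra.
have mU3 := measurableU _ _ m3 mU; have mU2 := measurableU _ _ m2 mU3; have mU1 := measurableU _ _ mS1 mU2.
have u0 := probU_le P mnO mU1; have u1 := probU_le P mS1 mU2; have u2 := probU_le P m2 mU3.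
have u3 := probU_le P m3 mU; have z0 : p (~` O) = 0 by rewrite PO.
by lra.
Qed.

(** The approximable sets form a sigma-algebra for which the first coordinate and [zeta] are
    measurable, hence also [unstraighten] of this pair, which is the identity off the hyperbola. *)
Lemma shrinking_approximable A : measurable A -> approximable P F (@proj_x R) A.
Proof.
move=> mA; have [_ PF] := csys_preserving mOm posm finm cN.
have sA := approximable_sigma_algebra (P := P) mF (measurable_pw_map f) (measurable_fst : measurable_fun [set: R * R] (@proj_x R)) PF (fun z => erefl).
pose Z := g_sigma_algebraType (approximable P F (@proj_x R)).
have mZ (B : set Z) : measurable B <-> approximable P F (@proj_x R) B.
  by rewrite -[X in X B <-> _]/((approximable P F (@proj_x R)).-sigma.-measurable) measurable_g_measurableTypeE.
have mz : measurable_fun [set: Z] (@zeta R : Z -> R).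
  apply: (measurability _ (RGenOInfty.measurableE R)) => //.
  move=> /= _ [_ [q ->] <-]; rewrite setTI; apply/mZ.
  rewrite (_ : _ @^-1` _ = [set z | q < zeta z]); first exact: approximable_zeta.
  by apply/seteqP; split=> z; rewrite /= in_itv /= andbT.
have mx : measurable_fun [set: Z] ((fun z => z.1) : Z -> R).
  move=> _ B mB; rewrite setTI; apply/mZ.
  have aB : approximable P F (@proj_x R) (@proj_x R @^-1` B).
    by apply: approximable_phi => //; exact: measurable_fst.
  exact: aB.
have mp : measurable_fun [set: Z] ((fun z => (z.1, zeta z)) : Z -> R * R) by exact: measurable_fun_pair.
have mU : measurable (@unstraighten R @^-1` A) by exact: (preimage_mfun (@measurable_unstraighten R) mA).
have aA := (mZ _).1 (preimage_mfun mp mU).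
apply: (approximable_near mF measurable_fst PF mA) => e e0; eexists; first exact: aA.
rewrite (_ : p _ = 0) //; apply/eqP; rewrite eq_le fine_ge0 // andbT.
have [mB _] := aA; rewrite -[X in _ <= X](_ : p (~` O) = 0); last by rewrite PO.
apply: prob_le; [exact: measurable_setY|exact: measurableC|].
move=> z hz [Oz Nz]; have hy : ~~ hyperbolic z.
  by apply/negP => h; apply: Nz; apply: (csys_polar cN); right.
move: hz; rewrite /setY /setD /setU /= (unstraightenK hy); tauto.
Qed.

End Shrinking.

(** The trivial quilting of [G] by itself, by which [shrinking], stated for the first map of a
    model, is applied to [G]. *)
Lemma quilt_model_refl d (X : measurableType d) (R : realType) (m : {measure set X -> \bar R})
    (F G : X -> X) (Of Og : set X) (C : nat -> set X) (dn an : nat -> nat) :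
  quilt_model m F G Of Og C dn an ->
  quilt_model m G G Og Og (fun=> set0) (fun=> 0%N) (fun=> 0%N).
Proof.
move=> Q; have noT S : in_tower S (fun=> set0 : set X) (fun=> 0%N) = set0.
  by apply/seteqP; split=> // z [i [j [c [_ []]]]].
split; try by case: Q.
- by move=> E mE; rewrite setUid => EO; apply: (qm_G_im Q) => //; apply: subset_trans EO _; right.
- by move=> E mE; rewrite setUid => EO; apply: (qm_G_im Q) => //; apply: subset_trans EO _; right.
- by move=> _ z.
- by rewrite !noT setD0 setU0.
- by rewrite !noT setI0.
Qed.

(** * Natural extensions of clean systems *)

Section CleanNatural.
Context (R : realType) (f : pwMobius R) (Om : set (R * R)) (mOm : measurable Om).
Context (posm : (0 < mu Om)%E) (finm : (mu Om < +oo)%E).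
Local Notation mu := (@mu R).
Local Notation F := (pw_planar f).
Local Notation P := (planar_prob mOm).
Context (N : set (R * R)) (cN : clean_system f Om N).
Local Notation O := (Om `\` N).

(** A measurable subset of [O] is the preimage, within [O], of its measurable image. *)
Lemma csys_invertible : invertible_system P F.
Proof.
have pF := csys_preserving mOm posm finm cN; have [mF PF] := pF.
split=> //; split; first by split=> //; exact: aeW.
move=> A mA; have mO : measurable O by apply: measurableD => //; exact: (csys_m cN).
have mAO : measurable (A `&` O) by exact: measurableI.
exists (F @` (A `&` O)); first by apply: (csys_image cN) => // z [].
exists (~` O); split; first exact: measurableC.
  apply: (planar_prob_negligible mOm posm finm _ (csys_m cN) (csys_null cN)); first exact: measurableC.
  by rewrite setICr measure0.
move=> z hz Oz; case: hz => -[].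
  by move=> [w [Aw Ow] /(csys_inj cN Ow Oz) <-].
by move=> Az; apply; exists z.
Qed.

Lemma csys_factor : measure_preserving (marginal_prob mOm) (pw_map f).
Proof.
have [_ PF] := csys_preserving mOm posm finm cN.
split; first exact: measurable_pw_map.
move=> B mB; have := PF (@proj_x R @^-1` B); apply.
exact: (preimage_mfun measurable_fst mB).
Qed.

Lemma csys_natural : (forall A, measurable A -> approximable P F (@proj_x R) A) ->
  natural_extension P F (marginal_prob mOm) (pw_map f) (@proj_x R).
Proof.
move=> apx; apply: approximable_natural => //; [exact: csys_factor|exact: csys_invertible].
Qed.

Lemma natural_csys_approximable :
  natural_extension P F (marginal_prob mOm) (pw_map f) (@proj_x R) ->
  forall A, measurable A -> approximable P F (@proj_x R) A.
Proof. by move=> /natural_approximable; apply. Qed.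

End CleanNatural.

(** * Transfer of natural extensions *)

Section NaturalQuilted.
Context (R : realType) (f g : pwMobius R) (Omf Omg : set (R * R)).
Context (C : nat -> set (R * R)) (dn an : nat -> nat).
Local Notation mu := (@mu R).
Local Notation F := (pw_planar f).
Local Notation G := (pw_planar g).
Context (mOmf : measurable Omf) (mOmg : measurable Omg).
Context (bijf : bijectivity_domain f Omf) (bijg : bijectivity_domain g Omg).
Context (finf : (mu Omf < +oo)%E) (fing : (mu Omg < +oo)%E).
Context (posf : (0 < mu Omf)%E) (posg : (0 < mu Omg)%E).
Context (Q : quilting f g Omf Omg C dn an).

Lemma clean_system_f N : clean_set f g Omf Omg C dn an N -> clean_system f Omf N.
Proof.
move=> cN; have M := clean_model cN; have [mN N0 sat] := clean_sat cN; split=> //.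
- by move=> z; exact: (sat z).1.
- exact: (clean_polar_f cN).
- exact: (qm_F_in M).
- exact: (qm_F_sur M).
- by move=> E mE EO; have [] := qm_F_im M mE (subset_trans EO (@subsetUl _ _ _)).
- exact: (qm_F_inj M).
- exact: (F_preserve M).
- exact: (clean_f cN).
Qed.

Lemma clean_system_g N : clean_set f g Omf Omg C dn an N -> clean_system g Omg N.
Proof.
move=> cN; have M := clean_model cN; have [mN N0 sat] := clean_sat cN; split=> //.
- by move=> z; exact: (sat z).2.
- exact: (clean_polar_g cN).
- exact: (qm_G_in M).
- exact: (qm_G_sur M).
- by move=> E mE EO; have [] := qm_G_im M mE (subset_trans EO (@subsetUr _ _ _)).
- exact: (qm_G_inj M).
- exact: (G_preserve M).
- exact: (clean_g cN).
Qed.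

Let mlen Om : measurable Om -> measurable_fun [set: R * R] (fibre_len Om).
Proof.
move=> mOm; apply: (measurableT_comp (fine_measurable measurableT)).
exact: (measurableT_comp (measurable_fibre_length mOm) measurable_fst).
Qed.

Let mslope h : measurable_fun [set: R * R] (@slope_of R h).
Proof. exact: (measurableT_comp (measurable_pw_slope h) measurable_fst). Qed.

Lemma natural_quilted :
  natural_extension (planar_prob mOmf) F (marginal_prob mOmf) (pw_map f) (@proj_x R) ->
  natural_extension (planar_prob mOmg) G (marginal_prob mOmg) (pw_map g) (@proj_x R).
Proof.
move=> /natural_csys_approximable apx.
have [N cN _] := clean_set_exists mOmf mOmg bijf bijg finf fing Q (negligible_set0 mu).
have M := clean_model cN; have sf := clean_system_f cN; have sg := clean_system_g cN.
have rf := approximable_not_rigid posf finf sf apx.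
have rg := rigid_transfer M (mslope f) (mlen mOmf) (mslope g) (mlen mOmg)
  (fun z Oz => let: And3 a _ _ := clean_f cN Oz in a) (fun z Oz => let: And3 _ a _ := clean_f cN Oz in a)
  (fun z Oz => let: And3 _ a _ := clean_g cN Oz in a) (fun z Oz => let: And3 _ _ a := clean_f cN Oz in a)
  (clean_agree cN) (clean_orbit cN) rf.
have [N' [mN' N'0 shr]] := shrinking (quilt_model_refl M) (mslope g) (mlen mOmg)
  (fun z Oz => let: And3 a _ _ := clean_g cN Oz in a) (fun z Oz => let: And3 _ a _ := clean_g cN Oz in a)
  (fun z Oz => let: And3 _ _ a := clean_g cN Oz in a) rg.
apply: (csys_natural posg fing sg) => A mA.
exact: (shrinking_approximable mOmg posg fing sg mN' N'0 shr mA).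
Qed.

End NaturalQuilted.

(** * The entropy formula *)

Section EntropyComparison.
Context (R : realType).

Lemma klogM (c p q : R) : 0 < c -> 0 <= p -> p <= q -> klog (c * p) (c * q) = c * klog p q.
Proof.
move=> c0; rewrite le_eqVlt => /predU1P[<- _|p0 pq]; first by rewrite mulr0 !klog0 mulr0.
have q0 := lt_le_trans p0 pq.
by rewrite /klog !lnM ?posrE //; ring.
Qed.

Section Pushforward.
Context d (X : measurableType d) (m : {measure set X -> \bar R}).
Context d' (Y : measurableType d') (m' : {measure set Y -> \bar R}).
Context (D : set X) (D' : set Y) (T : X -> X) (S : Y -> Y) (phi : X -> Y) (c : R).
Hypotheses (mD : measurable D) (fD : (m D < +oo)%E) (c0 : 0 < c).
Hypotheses (mT : measurable_fun [set: X] T) (mS : measurable_fun [set: Y] S).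
Hypothesis mphi : measurable_fun [set: X] phi.
Hypothesis presT : forall E, measurable E -> m (D `&` T @^-1` E) = m (D `&` E).
Hypothesis phiT : forall x, phi (T x) = S (phi x).
Hypothesis push : forall E, measurable E -> m' (D' `&` E) = (c%:E * m (D `&` phi @^-1` E))%E.

(** Serves twice: with [c = 1] for the factor map, and with the identity as [phi] for the
    normalisation of the measure. *)
Lemma entropy_rate_push (A : finType) (a : Y -> A) : labelling a ->
  entropy_rate m' D' S a = c * entropy_rate m D T (a \o phi).
Proof.
move=> ma; have map : labelling (a \o phi).
  by move=> i; rewrite comp_preimage -[X in measurable X]setTI; exact: mphi.
have phin n x : phi (iter n T x) = iter n S (phi x) by elim: n => //= n IH; rewrite phiT IH.
have pE (B : finType) (b : Y -> B) (b' : X -> B) i : labelling b -> b' = b \o phi ->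
    pmass m' D' b i = c * pmass m D b' i.
  move=> mb ->; rewrite /pmass push // comp_preimage fineM //.
  rewrite ge0_fin_numE //; apply: (fin_sub mD fD) => [|z []//].
  apply: measurableI => //; rewrite -[X in measurable X]setTI; apply: mphi => //; exact: mb.
have e n : entropy_step m' D' S a n = c * entropy_step m D T (a \o phi) n.
  rewrite /entropy_step /cent mulr_sumr; apply: eq_bigr => j _.
  rewrite mulr_sumr; apply: eq_bigr => i _.
  have mw : labelling (word S a n) by exact: labelling_word.
  have mi : labelling (a \o iter n S) by exact: labelling_iter.
  have mw' : labelling (word T (a \o phi) n) by exact: labelling_word.
  have mi' : labelling ((a \o phi) \o iter n T) by exact: labelling_iter.
  have ew : word T (a \o phi) n = word S a n \o phi.
    by apply/funext => x; apply/ffunP => k; rewrite /= !ffunE /= phin.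
  rewrite (pE _ _ (word T (a \o phi) n)) //.
  rewrite (pE _ _ (pair_label ((a \o phi) \o iter n T) (word T (a \o phi) n))).
  - have /andP[p0 pq] := pmass_pair_le mD fD i j mi' mw'; exact: klogM.
  - exact: labelling_pair.
  - by apply/funext => x; rewrite /pair_label /= ew /= phin.
rewrite /entropy_rate; have -> : entropy_step m' D' S a = (fun n => c * entropy_step m D T (a \o phi) n).
  exact/funext.
apply: cvg_lim => //; apply: cvgMr.
exact: (cvg_entropy_step mD fD mT presT map).
Qed.

End Pushforward.

Section KsEntropy.
Context d (X : measurableType d) (P : probability X R) (T : X -> X).
Hypothesis mT : measurable_fun [set: X] T.
Hypothesis PT : forall A, measurable A -> P (T @^-1` A) = P A.

Let fP : (P setT < +oo)%E. Proof. by rewrite ltey_eq fin_num_measure. Qed.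

Let presT E : measurable E -> P (setT `&` T @^-1` E) = P (setT `&` E).
Proof. by move=> mE; rewrite !setTI PT. Qed.

Lemma ks_entropyE : ks_entropy P T = total_entropy P setT T.
Proof.
congr ereal_sup; apply/seteqP; split=> e [k [xi [mxi ->]]]; exists k, xi; split=> //; congr (_%:E).
  rewrite -(cvg_lim _ (cvg_ent_word measurableT fP mT presT mxi)) //; congr (limn _); apply/funext => n.
  congr (_ / _); apply: eq_bigr => w _; congr (negxlnx (fine (P _))).
  rewrite setTI; apply/seteqP; split=> x /=; last by move=> <- j; rewrite ffunE.
  by move=> h; apply/ffunP => j; rewrite ffunE.
rewrite -(cvg_lim _ (cvg_ent_word measurableT fP mT presT mxi)) //; congr (limn _); apply/funext => n.
congr (_ / _); apply: eq_bigr => w _; congr (negxlnx (fine (P _))).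
rewrite setTI; apply/seteqP; split=> x /=; first by move=> <- j; rewrite ffunE.
by move=> h; apply/ffunP => j; rewrite ffunE.
Qed.

End KsEntropy.

Section FactorEntropy.
Context d (X : measurableType d) (P : probability X R) (T : X -> X).
Context d' (Y : measurableType d') (Q : probability Y R) (S : Y -> Y) (phi : X -> Y).
Hypothesis mT : measurable_fun [set: X] T.
Hypothesis mS : measurable_fun [set: Y] S.
Hypothesis mphi : measurable_fun [set: X] phi.
Hypothesis PT : forall A, measurable A -> P (T @^-1` A) = P A.
Hypothesis QS : forall A, measurable A -> Q (S @^-1` A) = Q A.
Hypothesis Pphi : forall B, measurable B -> P (phi @^-1` B) = Q B.
Hypothesis phiT : forall x, phi (T x) = S (phi x).
Local Notation p A := (fine (P A)).

Let fP : (P setT < +oo)%E. Proof. by rewrite ltey_eq fin_num_measure. Qed.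

Let presT E : measurable E -> P (setT `&` T @^-1` E) = P (setT `&` E).
Proof. by move=> mE; rewrite !setTI PT. Qed.

Let entropy_rate_phi (A : finType) (a : Y -> A) : labelling a ->
  entropy_rate Q setT S a = entropy_rate P setT T (a \o phi).
Proof.
move=> ma; rewrite -[RHS]mul1r.
by apply: (entropy_rate_push measurableT fP ltr01 mT mS mphi presT phiT) => // E mE; rewrite !setTI mul1e; apply/esym; exact: Pphi.
Qed.

Let wT : fine (P setT) = 1. Proof. by rewrite probability_setT. Qed.

(** The inequality [ln x <= x - 1] at the inverse square root of [t] bounds [- t * ln t] by twice
    the square root of [t]. *)
Let negxlnx_le (s t : R) : 0 < s -> 0 <= t -> t <= s ^+ 2 -> klog t 1 <= s *+ 2.
Proof.
move=> s0; rewrite le_eqVlt => /predU1P[<- _|t0 ts]; first by rewrite klog0 mulrn_wge0 // ltW.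
have r0 : 0 < Num.sqrt t by rewrite sqrtr_gt0.
have rs : Num.sqrt t <= s by rewrite -(ger0_norm (ltW s0)) -sqrtr_sqr ler_wsqrtr.
have et : t = Num.sqrt t ^+ 2 by rewrite sqr_sqrtr // ltW.
set r := Num.sqrt t in r0 rs et.
have h : - ln r <= r^-1 - 1.
  have := @le_ln1Dx R (r^-1 - 1); rewrite [1 + _]addrC subrK lnV ?posrE //; apply.
  by rewrite ltrBrDr addNr invr_gt0.
rewrite et /klog ln1 sub0r lnXn // !mulr2n.
have : r ^+ 2 * - (ln r + ln r) <= r ^+ 2 * (2 * (r^-1 - 1)).
  by rewrite ler_wpM2l ?sqr_ge0 //; lra.
have -> : r ^+ 2 * (2 * (r^-1 - 1)) = 2 * r - 2 * r ^+ 2 by field; rewrite gt_eqF.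
by have := sqr_ge0 r; lra.
Qed.

(* Fano's inequality. *)
Let cent_guess (A B : finType) (a : X -> A) (b : X -> B) (h : A -> B) (s : R) :
  labelling a -> labelling b -> injective h -> 0 < s ->
  p [set z | b z != h (a z)] <= s ^+ 2 ->
  cent P setT a b <= s *+ 2 + s ^+ 2 + s ^+ 2 * ln #|A|%:R.
Proof.
move=> ma mb hI s0 small; pose r z := b z != h (a z).
have mr : labelling r.
  exact: (labelling_comp (fun u : A * B => u.2 != h u.1) (labelling_pair ma mb)).
have mbr := labelling_pair mb mr; have mrb := labelling_pair mr mb.
have mar := labelling_pair ma mr.
have mu1 : labelling (fun _ : X => tt).
  move=> []; rewrite (_ : _ @^-1` _ = setT) //; exact/seteqP.
have c1 : cent P setT a b <= cent P setT r b + cent P setT a (pair_label r b).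
  rewrite -(cent_pair measurableT fP mr ma mb).
  apply: (cent_det_left measurableT fP) => //; first exact: labelling_pair.
  by move=> z z' _ _ [].
have eT : r @^-1` [set true] = [set z | b z != h (a z)] by [].
set del := pmass P setT r true.
have del_le : del <= s ^+ 2 by rewrite /del /pmass setTI eT.
have del0 : 0 <= del by exact: pmass_ge0.
have tot : pmass P setT r true + pmass P setT r false = 1.
  by rewrite -wT -(pmass_total mr measurableT fP) big_bool.
have c2 : cent P setT r b <= s *+ 2 + s ^+ 2.
  apply: le_trans (cent_refine measurableT fP mr mb mu1 _) _; first by move=> z z' _ _ _.
  rewrite /cent (big_pred1 tt); last by case.
  have e1 : pmass P setT (fun=> tt) tt = 1.
    by rewrite /pmass setTI -wT; congr (p _); apply/seteqP.
  have e2 i : pmass P setT (pair_label r (fun=> tt)) (i, tt) = pmass P setT r i.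
    rewrite /pmass preimage_pair_label; congr (p _); apply/seteqP; split=> z /=; tauto.
  rewrite big_bool /= e1 !e2; apply: lerD; first exact: negxlnx_le.
  rewrite -/del in tot; set q := pmass _ _ _ false in tot *.
  have q0 : 0 <= q by exact: pmass_ge0.
  have [q0'|q1] := eqVneq q 0; first by rewrite q0' klog0 sqr_ge0.
  have qp : 0 < q by rewrite lt_def q1.
  have q_le1 : q <= 1 by lra.
  have := klog_tangent q0 q_le1 (ltr01 : 0 < (1 : R)) ltr01.
  by rewrite ln1 subrr mulr0 mul1r divr1; lra.
have c3 : cent P setT a (pair_label r b) <= s ^+ 2 * ln #|A|%:R.
  rewrite (cent_eq measurableT fP ma mrb mbr); last 2 first.
  - by move=> z z' _ _; rewrite /pair_label => -[e1 e2]; rewrite e1 e2.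
  - by move=> z z' _ _; rewrite /pair_label => -[e1 e2]; rewrite e1 e2.
  rewrite cent_label big_bool /= !setTI.
  have mB i : measurable (r @^-1` [set i]) by exact: mr.
  have fB i : (P (r @^-1` [set i]) < +oo)%E by rewrite ltey_eq fin_num_measure.
  rewrite [X in _ + X]cent_det //; last first.
    by move=> z z' /= /negbFE/eqP e /negbFE/eqP e' ee; apply: hI; rewrite -e -e'.
  rewrite addr0; apply: le_trans (cent_bound (mB true) (fB true) ma mb) _.
  apply: ler_wpM2r; first by rewrite ln_ge0 // ler1n; apply/card_gt0P; exists (a point).
  by rewrite eT.
lra.
Qed.

(** Shifting [xi] by a large [n] does not change its rate, and the shifted atoms are close to
    preimages of sets [E' i], whose indicators form the labelling [eta] of the factor. Fano's
    inequality bounds what is lost. *)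
Lemma entropy_factor : (forall A, measurable A -> approximable P T phi A) ->
  ks_entropy Q S = ks_entropy P T.
Proof.
move=> apx; rewrite !ks_entropyE //.
have fQ : (Q setT < +oo)%E by rewrite ltey_eq fin_num_measure.
have presS E : measurable E -> Q (setT `&` S @^-1` E) = Q (setT `&` E).
  by move=> mE; rewrite !setTI QS.
apply/eqP; rewrite eq_le; apply/andP; split.
  apply: total_entropy_le => k eta meta; rewrite entropy_rate_phi //.
  apply: entropy_rate_le_total => //.
  by move=> i; rewrite comp_preimage -[X in measurable X]setTI; exact: mphi.
apply: total_entropy_le => k xi mxi; apply/lee_addgt0Pr => e e0.
have lk : 0 <= ln k%:R :> R.
  rewrite ln_ge0 // ler1n; apply: leq_ltn_trans (leq0n _) (ltn_ord (xi point)).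
have [s [s0 hs]] : exists s : R, 0 < s /\ s *+ 2 + s ^+ 2 + s ^+ 2 * ln k%:R <= e.
  (* For [s <= 1] the bound of Fano's inequality is at most [s * (3 + ln k)]. *)
  pose c := 3 + ln k%:R : R; have c0 : 0 < c by rewrite /c; lra.
  exists (Num.min 1 (e / c)); rewrite lt_min ltr01 divr_gt0 //; split=> //.
  set s := Num.min _ _; have s0 : 0 < s by rewrite lt_min ltr01 divr_gt0.
  have s1 : s <= 1 by rewrite ge_min lexx.
  have se : s * c <= e by rewrite -ler_pdivlMr // ge_min lexx orbT.
  have ss : s ^+ 2 <= s by rewrite expr2 ler_piMl // ltW.
  have sk : s ^+ 2 * ln k%:R <= s * ln k%:R by rewrite ler_wpM2r.
  by move: se; rewrite /c mulrDr mulr2n; lra.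
have k0 : (0 < k)%N by apply: leq_ltn_trans (leq0n _) (ltn_ord (xi point)).
have ek : 0 < s ^+ 2 / k%:R by rewrite divr_gt0 ?exprn_gt0 // ltr0n.
have /choice[nn Hn] : forall i : 'I_k, exists n, exists E, measurable E /\
    p (iter n T @^-1` (xi @^-1` [set i]) `+` phi @^-1` E) < s ^+ 2 / k%:R.
  by move=> i; have [_ /(_ _ ek)] := apx _ (mxi i).
have {Hn} /choice[E HE] := Hn.
(* A common time for all labels; the approximations found at earlier times are shifted to it. *)
pose n := (\max_i nn i)%N.
have nnn i : (nn i <= n)%N by exact: leq_bigmax.
pose E' i := iter (n - nn i) S @^-1` E i.
have mE' i : measurable (E' i).
  by have [mE _] := HE i; exact: measurable_iter_preimage.
have hE' i : p (iter n T @^-1` (xi @^-1` [set i]) `+` phi @^-1` (E' i)) < s ^+ 2 / k%:R.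
  have [mE h] := HE i; rewrite -(approx_shift mT mphi PT phiT (nn i) (n - nn i) (mxi i) mE) in h.
  by move: h; rewrite subnKC.
pose eta y : {ffun 'I_k -> bool} := [ffun i => y \in E' i].
have meta : labelling eta.
  move=> w; rewrite (_ : _ @^-1` _ = \bigcap_(i in [set: 'I_k]) (if w i then E' i else ~` E' i)).
    apply: fin_bigcap_measurable => [|i _]; first exact: finite_finset.
    by case: ifP => _ //; exact: measurableC.
  apply/seteqP; split=> y /=.
    move=> <- i _; rewrite ffunE; case: ifP => [/set_mem//|/negP h Ey]; apply: h; exact: mem_set.
  move=> h; apply/ffunP => i; rewrite ffunE; have := h i I; case: (w i); first exact: mem_set.
  by move=> Ey; apply/negP => /set_mem.
have mep : labelling (eta \o phi).
  by move=> i; rewrite comp_preimage -[X in measurable X]setTI; exact: mphi.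
have mxn : labelling (xi \o iter n T) by exact: labelling_iter.
pose guess (i : 'I_k) : {ffun 'I_k -> bool} := [ffun j => j == i].
have gI : injective guess.
  by move=> i j /ffunP/(_ i); rewrite !ffunE eqxx => /esym/eqP.
pose W i := iter n T @^-1` (xi @^-1` [set i]) `+` phi @^-1` (E' i).
have mW i : measurable (W i).
  apply: measurable_setY; first by apply: measurable_iter_preimage => //; exact: mxi.
  exact: preimage_mfun.
have bad : p [set z | (eta \o phi) z != guess ((xi \o iter n T) z)] <= s ^+ 2.
  apply: (@le_trans _ _ (p (\big[setU/set0]_(i : 'I_k) W i))).
    apply: prob_le.
    - exact: (labelling_preimage [set u | u.2 != guess u.1] (labelling_pair mxn mep)).
    - by apply: bigsetU_measurable => i _.
    - move=> z /= /eqP ne; apply: contrapT => nW; apply: ne; apply/ffunP => i; rewrite !ffunE.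
      have nWi : ~ W i z by move=> Wi; apply: nW; rewrite (bigD1 i) //=; left.
      apply/idP/eqP => [/set_mem Ei|ei].
        by apply: contrapT => ne; apply: nWi; right; split=> // /= e1; apply: ne.
      by apply: mem_set; apply: contrapT => nE; apply: nWi; left; split.
  apply: (@le_trans _ _ (\sum_(i : 'I_k) p (W i))).
    suff [_ //] : measurable (\big[setU/set0]_(i : 'I_k) W i) /\
        p (\big[setU/set0]_(i : 'I_k) W i) <= \sum_(i : 'I_k) p (W i).
    elim: (index_enum 'I_k) => [|i r [mr IH]]; first by rewrite !big_nil measure0.
    rewrite !big_cons; split; first exact: measurableU.
    by apply: le_trans (probU_le P (mW i) mr) _; rewrite lerD2l.
  apply: (@le_trans _ _ (\sum_(i : 'I_k) s ^+ 2 / k%:R)).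
    by apply: ler_sum => i _; apply: ltW; exact: hE'.
  by rewrite sumr_const card_ord -[_ *+ _]mulr_natr divfK // pnatr_eq0 -lt0n.
apply: le_trans (_ : ((entropy_rate P setT T (eta \o phi))%:E + e%:E <= _)%E).
  rewrite -EFinD lee_fin -(entropy_rate_shift mT presT n mxi).
  apply: le_trans (entropy_rate_cent measurableT fP mT presT mxn mep) _; rewrite lerD2l.
  apply: le_trans (cent_guess mxn mep gI s0 bad) _; by rewrite card_ord.
rewrite leeD2r // -entropy_rate_phi //; exact: entropy_rate_le_total.
Qed.

End FactorEntropy.
End EntropyComparison.

(** * Trapped points and the domain of the second map *)

Section Confined.
Context (R : realType) (f g : pwMobius R) (Omf Omg : set (R * R)).
Context (C : nat -> set (R * R)) (dn an : nat -> nat).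
Local Notation mu := (@mu R).
Local Notation leb := (@lebesgue_measure R).
Local Notation F := (pw_planar f).
Local Notation G := (pw_planar g).
Context (mOmf : measurable Omf) (mOmg : measurable Omg).
Context (bijf : bijectivity_domain f Omf) (bijg : bijectivity_domain g Omg).
Context (finf : (mu Omf < +oo)%E) (fing : (mu Omg < +oo)%E).
Context (posf : (0 < mu Omf)%E) (posg : (0 < mu Omg)%E).
Context (Q : quilting f g Omf Omg C dn an).
Local Notation clean N := (clean_set f g Omf Omg C dn an N).
Local Notation piece N := (fun i => C i `\` N).
Local Notation s := (strand F C dn).

(** The trapped set without reference to a discarded set [N], which will be enlarged several times:
    the trapped sets of all clean models are traces of this one. Iterates outside [Omf] impose
    nothing. *)
Definition confined : set (R * R) :=
  Omf `&` [set z | forall n, Omf (iter n F z) -> in_tower F C dn (iter n F z)].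

Section Clean.
Context (N : set (R * R)) (cN : clean N).
Let M := clean_model cN.
Let mN : measurable N. Proof. by have [] := clean_sat cN. Qed.
Let N0 : mu N = 0%E. Proof. by have [] := clean_sat cN. Qed.

Lemma clean_iter n z : N z <-> N (iter n F z).
Proof. exact: saturated_nullF (clean_sat cN). Qed.

Lemma trapped_confined : trapped F (Omf `\` N) (piece N) dn = confined `\` N.
Proof.
apply/seteqP; split=> z.
  move=> [[Oz Nz] h]; split=> //; split=> // n On; apply: contrapT => nT; apply: (h n).
  split; first by split=> // /(clean_iter n z).2.
  by move=> [i [j [c [jd [Cc _] e]]]]; apply: nT; exists i, j, c.
move=> [[Oz h] Nz]; split=> // n [[On Nn] nT]; apply: nT.
have [i [j [c [jd Cc e]]]] := h n On; exists i, j, c; split=> //; split=> // Nc.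
by apply: Nn; rewrite e; exact: (clean_iter j c).1.
Qed.

Lemma strand_clean z : ~ N z -> strand F (piece N) dn z = s z.
Proof.
move=> Nz; have e : [set i | (C i `\` N) z] = [set i | C i z].
  by apply/seteqP; split=> i /=; [case|split].
have eb : base (piece N) z = base C z.
  by apply/propext; split=> [[i _ [Ci _]]|[i _ Ci]]; exists i.
by rewrite /strand /jump /base_index /= e eb.
Qed.

Lemma confined_strand z : confined z -> ~ N z -> confined (s z) /\ ~ N (s z).
Proof.
move=> Tz Nz; have : (confined `\` N) z by [].
by rewrite -trapped_confined => /(trapped_strand M); rewrite trapped_confined strand_clean // => -[].
Qed.

Let mO : measurable (Omf `\` N). Proof. exact: measurableD. Qed.
Let mT : measurable (confined `\` N).
Proof. by rewrite -trapped_confined; exact: (measurable_trapped M). Qed.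

(** The set is forward invariant and [F] preserves a finite measure, so its preimage exceeds it by a
    null set. *)
Lemma confined_backward_null : mu (((Omf `\` N) `&` F @^-1` (confined `\` N)) `\` (confined `\` N)) = 0%E.
Proof.
have mpre : measurable (F @^-1` (confined `\` N)) by exact: (preimage_measurable (qm_mF M)).
apply: measure_sub_eq => //.
- exact: measurableI.
- move=> z Tz; split; first by case: Tz => -[].
  by move: Tz; rewrite -trapped_confined => /(trapped_F M 1).
- by apply: (fin_sub mOmf finf) => [|z [[]]//]; exact: measurableI.
- rewrite (F_preserve M) //; congr mu; apply/seteqP; split=> [z Tz|z []//].
  by split=> //; case: Tz => -[].
Qed.

(** The set is invariant and approximable, hence comes from the factor modulo null sets. *)
Lemma confined_fibres_ae : (forall A, measurable A -> approximable (planar_prob mOmf) F (@proj_x R) A) ->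
  exists2 E : set R, measurable E & mu.-negligible (Omf `&` (confined `+` (@proj_x R @^-1` E))).
Proof.
move=> apx; have mF := qm_mF M.
have [_ PF] := csys_preserving mOmf posf finf (clean_system_f cN).
have mpre : measurable (F @^-1` (confined `\` N)) by exact: (preimage_measurable mF).
have [|E mE E0] := approximable_invariant (P := planar_prob mOmf) mF
    (measurable_fst : measurable_fun [set: R * R] (@proj_x R)) PF (apx _ mT).
  apply: (planar_prob_negligible mOmf posf finf _ mN N0); first exact: measurable_setY.
  apply: null_sub confined_backward_null.
  - by apply: measurableI => //; exact: measurable_setY.
  - by apply: measurableD => //; exact: measurableI.
  - move=> z [Oz [[//]|[Tz]]].
    by case; move: Tz; rewrite -trapped_confined => /(trapped_F M 1).
exists E => //; move/(planar_prob_eq0 mOmf posf finf): E0 => E0.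
have mpE : measurable (@proj_x R @^-1` E) by exact: (preimage_mfun measurable_fst).
exists ((((confined `\` N) `+` (@proj_x R @^-1` E)) `&` Omf) `|` N); split.
- by apply: measurableU => //; apply: measurableI => //; exact: measurable_setY.
- by apply: etrans (measureU0 _ mN N0) E0; apply: measurableI => //; exact: measurable_setY.
- move=> z [Oz h]; have [Nz|nN] := pselect (N z); [by right|left; split=> //].
  move: h; rewrite /setY /setD /setU /=; tauto.
Qed.

(** Strands do not leave [Omg] and the strand preserves measure on trapped points, so almost no
    trapped point enters [Omg] along its strand. *)
Lemma confined_strand_null : mu (((confined `\` N) `&` strand F (piece N) dn @^-1` (Omg `\` N)) `\`
  ((confined `\` N) `&` (Omg `\` N))) = 0%E.
Proof.
have mOg : measurable (Omg `\` N) by exact: measurableD.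
have mS : measurable (strand F (piece N) dn @^-1` (Omg `\` N)).
  by apply: (preimage_measurable (measurable_strand M)).
apply: measure_sub_eq.
- exact: measurableI.
- exact: measurableI.
- move=> z [Tz Oz]; split=> //; apply: (strand_Og M) => //.
  by case: Tz => -[].
- by apply: (fin_sub mOmf finf) => [|z [[[]]]//]; exact: measurableI.
- by have := strand_preserve M mOg; rewrite trapped_confined => ->.
Qed.

Hypothesis back : forall z, Omf z -> ~ N z -> confined (F z) -> confined z.
Hypothesis backs : forall z, confined z -> ~ N z -> Omg (s z) -> Omg z.

Lemma confined_back n z : Omf z -> ~ N z -> confined (iter n F z) -> confined z.
Proof.
elim: n z => // n IH z Oz Nz; rewrite iterSr => Tz; apply: back => //; apply: IH => //.
  by have [] := qm_F_in M (conj Oz Nz).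
by move/(clean_iter 1 z).2.
Qed.

Lemma confined_strandC i c : C i c -> ~ N c -> confined c -> (0 < an i)%N -> Omg c.
Proof.
move=> Cc Nc Tc a0; apply: backs => //; rewrite -strand_clean //.
have Cc' : (C i `\` N) c by [].
rewrite /strand (jump_base M dn Cc') (qm_orbit M Cc') iterSr.
have VG : in_tower G (piece N) an (G c) by exists i, 1%N, c.
by have [] := iter_G_in M (an i) (tower_Og M VG).
Qed.

(** Otherwise [G] follows the strand along the whole orbit of [z]. But [z] is on an added tower over
    some [c], and the top of that tower has the same strand successor as [c]. By injectivity the
    strand of [z] meets [c], whose tower has positive height. *)
Lemma confined_Og_meets z : confined z -> ~ N z -> Omg z ->
  exists k i, C i (iter k s z) /\ (0 < an i)%N.
Proof.
move=> Tz Nz Oz'; apply: contrapT => nm.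
have Oz : (Omf `\` N) z by split=> //; case: Tz.
have Oz'' : (Omg `\` N) z by [].
have Tk k : confined (iter k s z) /\ ~ N (iter k s z).
  by elim: k => //= k [T1 N1]; exact: confined_strand.
have sE k : iter k (strand F (piece N) dn) z = iter k s z.
  by elim: k => //= k ->; rewrite strand_clean //; have [] := Tk k.
have nC k i : (C i `\` N) (iter k s z) -> an i = 0%N.
  move=> [Ci _]; apply/eqP; rewrite -leqn0 leqNgt; apply/negP => a0; apply: nm; by exists k, i.
have gk k : iter k G z = iter k s z.
  elim: k => //= k ->; have [[Ok _] Nk] := Tk k.
  have Ogk : (Omg `\` N) (iter k s z) by rewrite -sE; exact: (iter_strand_Og M).
  rewrite -[in RHS]strand_clean // (strand_G M) //.
  have [[i _ Ci]|nb] := pselect (base (piece N) (iter k s z)); last by rewrite jump_notbase.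
  by rewrite (jump_base M an Ci) (nC k i Ci).
have tz : trapped F (Omf `\` N) (piece N) dn z by rewrite trapped_confined.
have [Zz|[i [j [c [/andP[j0 ja] Cc ec]]]]] := Og_cases M Oz''.
  by have [_ /(_ 0%N)] := tz.
have [Cc1 Nc] := Cc; have Oc : (Omf `\` N) c by exact: (qm_C_sub M Cc).
pose k := (an i - j)%N.
have ek : iter (dn i).+1 F c = s (iter k s z).
  rewrite (qm_orbit M Cc) -iterS -gk ec -iterD; congr (iter _ G c).
  by rewrite /k addSn subnK.
have Tc : confined c.
  apply: (confined_back (n := (dn i).+1)) => //; first by case: Oc.
  by rewrite ek; have [] := Tk k.+1.
have [T1 N1] := Tk k.
have eC : c = iter k s z.
  apply: (strand_inj_trapped M); [by rewrite trapped_confined|by rewrite trapped_confined|].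
  by rewrite [RHS]strand_clean // -ek /strand (jump_base M dn Cc).
by apply: nm; exists k, i; rewrite -eC; split=> //; exact: leq_trans ja.
Qed.

Lemma confined_OgP z : confined z -> ~ N z ->
  Omg z <-> exists k i, C i (iter k s z) /\ (0 < an i)%N.
Proof.
move=> Tz Nz; split; first exact: confined_Og_meets.
move=> [k]; elim: k z Tz Nz => [|k IH] z Tz Nz [i [Ci a0]].
  exact: confined_strandC Ci Nz Tz a0.
have [T1 N1] := confined_strand Tz Nz; apply: backs => //.
by apply: IH => //; exists i; rewrite -iterSr.
Qed.

Hypothesis dN : quilt_defects f g Omf Omg C dn an `<=` N.

Lemma clean_altered i z : C i z -> ~ N z -> altered f g Omf z.
Proof.
by move=> Ci Nz; apply: contrapT => na; apply: Nz; apply: dN; do 7 left; left; split=> //; exists i.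
Qed.

Lemma clean_agree_G z : Omf z -> ~ N z -> pw_dom g z.1 -> ~ base C z -> F z = G z.
Proof.
move=> Oz Nz gz nb; rewrite /pw_planar; congr (_ z); apply: eq_mobius_planar.
apply: contrapT => ne; apply: Nz; apply: dN; do 7 left; right; split=> //.
by split=> //; split=> //; exact: (domain_sub bijf).
Qed.

(** A trapped point outside [Omg] has its whole strand outside. The strand meets no piece, since
    pieces lie above the domain of [g], so it is the [F]-orbit. But the point is on a removed tower
    over some [c] in [Omg], and the strand successor of [c] is in [Omg] and on that orbit. *)
Lemma confined_sub_Og : (forall z, confined z -> ~ N z -> pw_dom g z.1 -> Omg z) ->
  trapped F (Omf `\` N) (piece N) dn `<=` Omg `\` N.
Proof.
move=> dom z tz; have := tz; rewrite trapped_confined => -[Tz Nz]; split=> //.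
apply: contrapT => nO.
have Tk k : confined (iter k s z) /\ ~ N (iter k s z).
  by elim: k => //= k [T1 N1]; exact: confined_strand.
have nOk k : ~ Omg (iter k s z).
  elim: k => //= k IH Ok; apply: IH; have [T1 N1] := Tk k; exact: backs.
have COg i c : C i c -> ~ N c -> confined c -> Omg c.
  by move=> Ci Nc Tc; apply: dom => //; have [_ []] := clean_altered Ci Nc.
have nb k : ~ base C (iter k s z).
  by move=> [i _ Ci]; apply: (nOk k); have [T1 N1] := Tk k; exact: COg Ci N1 T1.
have sF k : iter k s z = iter k F z.
  by elim: k => //= k <-; rewrite /strand jump_notbase.
have [i [j [c [/andP[j0 jd] Cc ec]]]] := trapped_U tz.
have [Ci Nc] := Cc; have Oc : (Omf `\` N) c by exact: (qm_C_sub M Cc).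
have Tc : confined c.
  by apply: (confined_back (n := j)) => //; [case: Oc|rewrite -ec].
apply: (nOk ((dn i).+1 - j)%N); rewrite sF ec -iterD subnK; last exact: leqW.
have Ogc : (Omg `\` N) c by split=> //; exact: COg Ci Nc Tc.
by have := strand_Og M Oc Ogc; rewrite /strand (jump_base M dn Cc) => -[].
Qed.

Hypothesis fibT : forall z w, Omf z -> ~ N z -> Omf w -> ~ N w -> z.1 = w.1 -> confined z -> confined w.
Hypothesis fibC : forall i z w, Omf z -> ~ N z -> Omf w -> ~ N w -> z.1 = w.1 -> C i z -> C i w.

Lemma strand_fst z w : Omf z -> ~ N z -> Omf w -> ~ N w -> z.1 = w.1 -> (s z).1 = (s w).1.
Proof.
move=> Oz Nz Ow Nw e; have eC : [set i | C i z] = [set i | C i w].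
  by apply/seteqP; split=> i /=; [apply: fibC|apply: fibC; rewrite // e].
have eb : base C z = base C w.
  by apply/propext; split=> -[i _ Ci]; exists i => //; move: Ci; [apply: fibC|apply: fibC; rewrite // e].
rewrite /strand; have -> : jump C dn z = jump C dn w by rewrite /jump /base_index eC eb.
by rewrite !pw_planar_fst e.
Qed.

(** Strands of two points of a fibre run through common fibres and meet the same pieces, and by
    [confined_OgP] these pieces decide membership in [Omg]. *)
Lemma confined_fibre z w : Omf z -> ~ N z -> z.1 = w.1 -> confined w -> ~ N w -> ~ Omg w ->
  confined z /\ ~ Omg z.
Proof.
move=> Oz Nz e Tw Nw nO; have Ow : Omf w by case: Tw.
have Tz : confined z by apply: (fibT (z := w)).
split=> // /(confined_Og_meets Tz Nz)[k [i [Ci a0]]]; apply: nO; apply/confined_OgP => //.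
exists k, i; split=> //.
have Tk u n : confined u -> ~ N u -> confined (iter n s u) /\ ~ N (iter n s u).
  by move=> Tu Nu; elim: n => //= n [T1 N1]; exact: confined_strand.
have ek n : (iter n s z).1 = (iter n s w).1.
  elim: n => //= n IH; have [[Oz1 _] Nz1] := Tk z n Tz Nz; have [[Ow1 _] Nw1] := Tk w n Tw Nw.
  exact: strand_fst.
have [[Oz1 _] Nz1] := Tk z k Tz Nz; have [[Ow1 _] Nw1] := Tk w k Tw Nw.
exact: (fibC (z := iter k s z)).
Qed.

(** Follow [G] from [z] until it enters [Omf]. Meanwhile the strand of [w], which meets no piece
    with a positive [an i], moves by [G] too, so that both points remain in a common fibre; there
    [confined_fibre] applies. *)
Lemma confined_missed z w : Omg z -> ~ N z -> confined w -> ~ N w -> ~ Omg w -> z.1 = w.1 -> False.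
Proof.
move=> Oz Nz; have [q] := G_reaches_Of M (conj Oz Nz); elim: q z w Oz Nz => [|q IH] z w Oz Nz.
  by move=> [Oz' _] Tw Nw nO e; have [_] := confined_fibre Oz' Nz e Tw Nw nO.
rewrite iterSr => Oq Tw Nw nO e; have [OGz NGz] := qm_G_in M (conj Oz Nz).
have [Ts Ns] := confined_strand Tw Nw.
apply: (IH (G z) (s w)) => //; first by move=> Os; apply: nO; exact: backs.
have -> : s w = G w.
  have [[i _ Ci]|nb] := pselect (base C w).
    have a0 : an i = 0%N.
      by apply/eqP; rewrite -leqn0 leqNgt; apply/negP => a0; apply: nO; exact: confined_strandC Ci Nw Tw a0.
    have Ci' : (C i `\` N) w by [].
    by rewrite -strand_clean // /strand (jump_base M dn Ci') (qm_orbit M Ci') a0.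
  rewrite /strand jump_notbase //=; apply: clean_agree_G => //; first by case: Tw.
  by rewrite -e; exact: (domain_sub bijg).
by rewrite /= -[LHS]/(pw_map g z.1) e.
Qed.

(** Above the base [E] of the missing fibres lies almost nothing of [Omg]; as [Omg] projects onto
    the domain of [g] in the sense of measure, [E] is null. *)
Lemma confined_domain_null : mu.-negligible ((confined `\` Omg) `&` [set z | pw_dom g z.1]).
Proof.
pose A := (confined `\` N) `\` (Omg `\` N).
have mA : measurable A by apply: measurableD => //; exact: measurableD.
pose E := [set x | fibre_length A x != 0%E] `&` pw_dom g.
have mdom : measurable (pw_dom g) by apply: is_interval_measurable; exact: pw_dom_itv.
have mE : measurable E by apply: measurableI => //; exact: measurable_fibre_base.
have hit x : fibre_length A x != 0%E -> exists2 w, A w & w.1 = x.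
  move=> /eqP h; have [[t]|n] := pselect ((xsection (straightened A) x) !=set0).
    by rewrite /xsection /= inE => -[_ At]; exists (unstraighten (x, t)).
  case: h; rewrite /fibre_length (_ : xsection _ _ = set0) ?measure0 //.
  by apply/seteqP; split=> // t ht; apply: n; exists t.
have E0 : leb E = 0%E.
  have [_ onto] := bijg.1; apply: onto => //; first by move=> x [].
  apply/eqP; rewrite eq_le measure_ge0 andbT -N0; apply: mu_le_subset => z [Oz [[/hit[w [Tw nw] ew] _] _]].
  apply: contrapT => Nz; have [Tw1 Nw] := Tw.
  by apply: (confined_missed Oz Nz Tw1 Nw) => // Ow; apply: nw.
apply: (@negligibleS _ _ _ _ (N `|` (A `&` [set z | fibre_length A z.1 = 0%E]) `|` (E `*` setT))).
  move=> z [[Tz nO] gz]; have [Nz|nN] := pselect (N z); first by left; left.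
  have Az : A z by split=> // -[].
  by have [h|h] := eqVneq (fibre_length A z.1) 0%E; [left; right|right].
apply: negligibleU; last exact: null_fibre_cylinder.
apply: negligibleU; last exact: null_fibre_length0.
by exists N; split.
Qed.

End Clean.
End Confined.

(** * Normalised and unnormalised entropy *)

Section PlanarEntropy.
Context (R : realType) (f : pwMobius R) (Om : set (R * R)) (mOm : measurable Om).
Context (posm : (0 < mu Om)%E) (finm : (mu Om < +oo)%E).
Local Notation mu := (@mu R).
Local Notation F := (pw_planar f).
Local Notation P := (planar_prob mOm).
Context (N : set (R * R)) (cN : clean_system f Om N).

Lemma total_entropy_planar :
  total_entropy P setT F = (((fine (mu Om))^-1)%:E * total_entropy mu (Om `\` N) F)%E.
Proof.
have mN := csys_m cN; have N0 := csys_null cN.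
have [mF PF] := csys_preserving mOm posm finm cN.
have mO : measurable (Om `\` N) by exact: measurableD.
have fO : (mu (Om `\` N) < +oo)%E by apply: (fin_sub mOm finm) => // z [].
have fP : (P setT < +oo)%E by rewrite ltey_eq fin_num_measure.
have presP E : measurable E -> P (setT `&` F @^-1` E) = P (setT `&` E).
  by move=> mE; rewrite !setTI PF.
set c := (fine (mu Om))^-1; have c0 : 0 < c by rewrite invr_gt0 fine_mu_gt0.
have push E : measurable E -> P (setT `&` E) = (c%:E * mu ((Om `\` N) `&` id @^-1` E))%E.
  move=> mE; rewrite setTI (planar_probE mOm posm finm) muleC; congr (_ * _)%E.
  have mEO : measurable (E `&` Om) by exact: measurableI.
  by rewrite -(null_measure_setD mEO mN N0); congr mu; apply/seteqP; split=> z /=; tauto.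
have rE k (xi : R * R -> 'I_k) : labelling xi ->
    entropy_rate P setT F xi = c * entropy_rate mu (Om `\` N) F xi.
  move=> mxi; have := entropy_rate_push mO fO c0 mF mF (@measurable_id _ _ _) (csys_pres cN)
    (fun=> erefl) push mxi.
  by [].
apply/eqP; rewrite eq_le; apply/andP; split.
  apply: total_entropy_le => k xi mxi; rewrite rE // EFinM lee_pmul2l //.
  exact: (entropy_rate_le_total mO fO mF (csys_pres cN)).
rewrite -lee_pdivlMl //; apply: total_entropy_le => k xi mxi.
rewrite lee_pdivlMl // -EFinM -rE //; exact: entropy_rate_le_total.
Qed.

Lemma ks_entropy_marginal : (forall A, measurable A -> approximable P F (@proj_x R) A) ->
  ks_entropy (marginal_prob mOm) (pw_map f) =
    (((fine (mu Om))^-1)%:E * total_entropy mu (Om `\` N) F)%E.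
Proof.
move=> apx; have [mF PF] := csys_preserving mOm posm finm cN.
have [mf Pf] := csys_factor mOm posm finm cN.
rewrite -total_entropy_planar -(ks_entropyE mF PF).
by apply: (entropy_factor mF mf (measurable_fst : measurable_fun [set: R * R] (@proj_x R)) PF Pf).
Qed.

End PlanarEntropy.

(** * Comparison of the entropies of the interval maps *)

Section EntropyQuilted.
Context (R : realType) (f g : pwMobius R) (Omf Omg : set (R * R)).
Context (C : nat -> set (R * R)) (dn an : nat -> nat).
Local Notation mu := (@mu R).
Local Notation F := (pw_planar f).
Local Notation G := (pw_planar g).
Context (mOmf : measurable Omf) (mOmg : measurable Omg).
Context (bijf : bijectivity_domain f Omf) (bijg : bijectivity_domain g Omg).
Context (finf : (mu Omf < +oo)%E) (fing : (mu Omg < +oo)%E).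
Context (posf : (0 < mu Omf)%E) (posg : (0 < mu Omg)%E).
Context (Q : quilting f g Omf Omg C dn an).
Local Notation clean N := (clean_set f g Omf Omg C dn an N).
Local Notation piece N := (fun i => C i `\` N).
Local Notation confined := (confined f Omf C dn).
Context (Delta : nat -> set R) (mDelta : forall i, measurable (Delta i)).
Context (CD : forall i, eq_mod0 mu (C i) (Omf `&` (Delta i `*` setT))).

(* The null sets to be discarded depend on a clean set discarded previously,
   hence the successive enlargements. *)
Lemma clean_set_confined :
  (forall A, measurable A -> approximable (planar_prob mOmf) F (@proj_x R) A) ->
  exists2 N, clean N &
    trapped F (Omf `\` N) (piece N) dn `<=` Omg `\` N /\
    forall z, (Omf `\` N) z -> trapped F (Omf `\` N) (piece N) dn (F z) ->
      trapped F (Omf `\` N) (piece N) dn z.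
Proof.
move=> apx; have exN := clean_set_exists mOmf mOmg bijf bijg finf fing Q.
have [N1 cN1 _] := exN _ (negligible_set0 mu).
have [E mE nE] := confined_fibres_ae finf posf cN1 apx.
have [mN1 N10 _] := clean_sat cN1.
pose B1 := ((Omf `\` N1) `&` F @^-1` (confined `\` N1)) `\` (confined `\` N1).
have mT1 : measurable (confined `\` N1).
  by rewrite -(trapped_confined cN1); exact: (measurable_trapped (clean_model cN1)).
have nB1 : mu.-negligible B1.
  exists B1; split=> //; last exact: (confined_backward_null mOmf finf cN1).
  apply: measurableD => //; apply: measurableI; first exact: measurableD.
  exact: (preimage_measurable (qm_mF (clean_model cN1))).
pose D := [set z | exists i, (C i `+` (Omf `&` (Delta i `*` setT))) z].
pose K1 := N1 `|` B1 `|` (Omf `&` (confined `+` (@proj_x R @^-1` E))) `|` D `|`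
  quilt_defects f g Omf Omg C dn an.
have nK1 : mu.-negligible K1.
  apply: negligibleU; last exact: negligible_quilt_defects.
  apply: negligibleU; last exact: negligible_exists.
  by apply: negligibleU => //; apply: negligibleU => //; exists N1; split.
have good N : K1 `<=` N -> [/\ forall z, Omf z -> ~ N z -> confined (F z) -> confined z,
    quilt_defects f g Omf Omg C dn an `<=` N,
    forall z w, Omf z -> ~ N z -> Omf w -> ~ N w -> z.1 = w.1 -> confined z -> confined w &
    forall i z w, Omf z -> ~ N z -> Omf w -> ~ N w -> z.1 = w.1 -> C i z -> C i w].
  move=> KN; split.
  - move=> z Oz Nz Tz; apply: contrapT => nT.
    have N1z : ~ N1 z by move=> h; apply: Nz; apply: KN; do 4 left.
    apply: Nz; apply: KN; do 3 left; right.
    split=> [|[//]]; split; [by split|split=> [|h]; [exact: Tz|]].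
    by apply: N1z; exact: (clean_iter cN1 1 z).2 h.
  - by move=> z h; apply: KN; right.
  - move=> z w Oz Nz Ow Nw e Tz; apply: contrapT => nT.
    have [Ez|nEz] := pselect (E z.1).
      by apply: Nw; apply: KN; do 2 left; right; split=> //; right; split=> //; rewrite /= /proj_x -e.
    by apply: Nz; apply: KN; do 2 left; right; split=> //; left; split.
  - move=> i z w Oz Nz Ow Nw e Ci; apply: contrapT => nC.
    have [Dz|nD] := pselect (Delta i z.1).
      by apply: Nw; apply: KN; left; right; exists i; right; split=> //; split=> //; rewrite /= -e.
    by apply: Nz; apply: KN; left; right; exists i; left; split=> // -[_ []].
have [N2 cN2 KN2] := exN _ nK1; have [mN2 N20 _] := clean_sat cN2.
have M2 := clean_model cN2.
pose B2 := ((confined `\` N2) `&` strand F (piece N2) dn @^-1` (Omg `\` N2)) `\`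
  ((confined `\` N2) `&` (Omg `\` N2)).
have mT2 : measurable (confined `\` N2).
  by rewrite -(trapped_confined cN2); exact: (measurable_trapped M2).
have mOg2 : measurable (Omg `\` N2) by exact: measurableD.
have nB2 : mu.-negligible B2.
  exists B2; split=> //; last exact: (confined_strand_null mOmf mOmg finf cN2).
  apply: measurableD; apply: measurableI => //.
  exact: (preimage_measurable (measurable_strand M2)).
have nK2 : mu.-negligible (N2 `|` B2) by apply: negligibleU => //; exists N2; split.
have good2 N : N2 `|` B2 `<=` N -> forall z, confined z -> ~ N z -> Omg (strand F C dn z) -> Omg z.
  move=> KN z Tz Nz Os; apply: contrapT => nO; have N2z : ~ N2 z by move=> h; apply: Nz; apply: KN; left.
  have [Ts Ns] := confined_strand cN2 Tz N2z.
  apply: Nz; apply: KN; right; split=> [|[_ [//]]]; split; first by split.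
  by rewrite /preimage /= strand_clean //; split.
have [N3 cN3 KN3] := exN _ nK2; have [mN3 N30 _] := clean_sat cN3.
have K13 : K1 `<=` N3 by move=> z /KN2 h; apply: KN3; left.
have [b3 d3 t3 c3] := good N3 K13.
have nB3 := confined_domain_null mOmg bijf bijg cN3 b3 (good2 _ KN3) d3 t3 c3.
have [|N4 cN4 KN4] := exN (N3 `|` ((confined `\` Omg) `&` [set z | pw_dom g z.1])).
  by apply: negligibleU => //; exists N3; split.
have K14 : K1 `<=` N4 by move=> z /K13 h; apply: KN4; left.
have K24 : N2 `|` B2 `<=` N4 by move=> z /KN3 h; apply: KN4; left.
have [b4 d4 t4 c4] := good N4 K14.
exists N4 => //; split.
  apply: (confined_sub_Og cN4 b4 (good2 _ K24) d4) => z Tz Nz gz.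
  by apply: contrapT => nO; apply: Nz; apply: KN4; right.
move=> z [Oz Nz]; rewrite !(trapped_confined cN4) => -[Tz _]; split=> //; exact: b4.
Qed.

Lemma entropy_quilted :
  natural_extension (planar_prob mOmf) F (marginal_prob mOmf) (pw_map f) (@proj_x R) ->
  let u i : R := ((an i)%:R - (dn i)%:R) * fine (marginal_prob mOmf (Delta i)) in
  let c : R := 1 + limn (series u) in
  [/\ cvgn [normed series u], 0 < c
    & ks_entropy (marginal_prob mOmg) (pw_map g) =
      (c^-1%:E * ks_entropy (marginal_prob mOmf) (pw_map f))%E].
Proof.
move=> nat u c; have natg := natural_quilted mOmg bijf bijg finf fing posf posg Q nat.
have apx := natural_csys_approximable nat.
have apxg := natural_csys_approximable natg.
have [N cN [tO tF]] := clean_set_confined apx.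
have M := clean_model cN; have [mN N00 _] := clean_sat cN.
have [nw lw] := quilt_measure M.
have te := quilt_entropy M tO tF.
have [pf epf] : {x | x = fine (mu Omf)} by exists (fine (mu Omf)).
have [pg epg] : {x | x = fine (mu Omg)} by exists (fine (mu Omg)).
have pf0 : 0 < pf by rewrite epf; exact: fine_mu_gt0.
have pg0 : 0 < pg by rewrite epg; exact: fine_mu_gt0.
have pfn : pf != 0 by exact: lt0r_neq0.
have divK : pf / pg / pf = pg^-1 by rewrite mulrAC divff ?mul1r.
have subK : 1 + pf^-1 * (pg - pf) = pg / pf by field.
have ef : fine (mu (Omf `\` N)) = pf by rewrite epf; congr fine; exact: null_measure_setD.
have eg : fine (mu (Omg `\` N)) = pg by rewrite epg; congr fine; exact: null_measure_setD.
rewrite ef eg in lw.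
pose w i : R := ((an i)%:R - (dn i)%:R) * fine (mu (C i `\` N)).
have uE i : u i = pf^-1 * w i.
  rewrite /u /w mulrCA; congr (_ * _).
  have -> : marginal_prob mOmf (Delta i) = planar_prob mOmf (@proj_x R @^-1` Delta i) by [].
  have mp : measurable (@proj_x R @^-1` Delta i) by exact: (preimage_mfun measurable_fst).
  have mC := quilt_measurable Q i.
  have e : mu (@proj_x R @^-1` Delta i `&` Omf) = mu (C i `\` N).
    rewrite (null_measure_setD mC mN N00); have [B [mB B0 sB]] := CD i.
    apply: (measure_eq_mod0 _ mC mB B0) => [|z nB]; first exact: measurableI.
    split=> [[Dz Oz]|Ci]; apply: contrapT => h; apply: nB; apply: sB.
      by right; split=> [|Ci]; [split; [exact: Oz|split; [exact: Dz|]]|exact: h].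
    left; split=> [|[Oz [Dz _]]]; first exact: Ci.
    by apply: h; split; [exact: Dz|exact: Oz].
  have fC : mu (C i `\` N) \is a fin_num.
    rewrite ge0_fin_numE; last exact: measure_ge0.
    by apply: (fin_sub (qm_mOf M) (qm_fOf M) (qm_mC M i)); exact: (qm_C_sub M).
  have -> : fine (planar_prob mOmf (@proj_x R @^-1` Delta i)) = fine (pf^-1%:E * mu (C i `\` N))%E.
    by congr fine; apply: etrans (planar_probE mOmf posf finf _) _; rewrite e muleC epf.
  exact: fineM.
have lu : series u @ \oo --> pf^-1 * (pg - pf).
  rewrite (_ : series u = (fun n => pf^-1 * series w n)); first exact: cvgMr.
  by apply/funext => n; rewrite /series /= mulr_sumr; apply: eq_bigr => i _; exact: uE.
(* The heights weighted by the pieces add up to [pg - pf], so [c] is the ratio of the measures of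
   the two domains. *)
have cE : c = pg / pf.
  have el : limn (series u) = pf^-1 * (pg - pf) by exact: cvg_lim lu.
  by rewrite -subK /c el.
split.
- rewrite (_ : [normed series u] = (fun n => pf^-1 * [normed series w] n)).
    by apply: is_cvgMr.
  apply/funext => n; rewrite /series /= mulr_sumr; apply: eq_bigr => i _.
  have pv : `|pf^-1| = pf^-1 by apply: gtr0_norm; rewrite invr_gt0.
  by rewrite uE normrM pv.
- by rewrite cE divr_gt0.
rewrite (ks_entropy_marginal posf finf (clean_system_f cN) apx).
rewrite (ks_entropy_marginal posg fing (clean_system_g cN) apxg).
rewrite te muleA -EFinM cE invf_div -epf -epg divK.
reflexivity.
Qed.

End EntropyQuilted.

Theorem theorem4p3 (R : realType) (f g : pwMobius R) (Omf Omg : set (R * R))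
    (mOmf : measurable Omf) (mOmg : measurable Omg)
    (C : nat -> set (R * R)) (d a : nat -> nat)
    (bijf : bijectivity_domain f Omf) (bijg : bijectivity_domain g Omg)
    (posf : (0 < mu Omf)%E) (finf : (mu Omf < +oo)%E)
    (posg : (0 < mu Omg)%E) (fing : (mu Omg < +oo)%E)
    (Q : quilting f g Omf Omg C d a) :
  [/\ ergodic (planar_prob mOmf) (pw_planar f) ->
      ergodic (planar_prob mOmg) (pw_planar g),
      natural_extension (planar_prob mOmf) (pw_planar f)
                        (marginal_prob mOmf) (pw_map f) (@proj_x R) ->
      natural_extension (planar_prob mOmg) (pw_planar g)
                        (marginal_prob mOmg) (pw_map g) (@proj_x R)
    & natural_extension (planar_prob mOmf) (pw_planar f)
                        (marginal_prob mOmf) (pw_map f) (@proj_x R) ->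
      forall Delta : nat -> set R,
        (forall i, measurable (Delta i)) ->
        (forall i, Delta i `<=` pw_dom f) ->
        (forall i, eq_mod0 (@mu R) (C i) (Omf `&` (Delta i `*` setT))) ->
        let u i : R :=
          ((a i)%:R - (d i)%:R) * fine (marginal_prob mOmf (Delta i)) in
        let c : R := 1 + limn (series u) in
        [/\ cvgn [normed series u], 0 < c
          & ks_entropy (marginal_prob mOmg) (pw_map g) =
            (c^-1%:E * ks_entropy (marginal_prob mOmf) (pw_map f))%E]].
Proof.
split=> [|nat|nat Delta mDelta _ CD].
- exact: (ergodic_quilted mOmg bijf bijg finf fing Q posf posg).
- exact: (natural_quilted mOmg bijf bijg finf fing posf posg Q nat).
- exact: (entropy_quilted mOmg bijf bijg finf fing posf posg Q mDelta CD nat).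
Qed.
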